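(* Let $f:\mathbb{R}^d\to\mathbb{R}^d$ be a $C^{1+\nu}$ vector field, with $\nu\in(1/2,1]$. Let $S$ be a compact set invariant for the flow $\Phi$ generated by $f$. Suppose that $S\subset M$, where $M$ is a locally invariant submanifold of dimension $d-\delta$, with $\delta\in\{1,\dots,d\}$, and that $\mathbb{R}^d=T_pM\oplus E^u_p$ for all $p\in S$, with: \begin{enumerate} \item[(i)] $p\mapsto E^u_p$ is a continuous mapping from $S$ into the Grassmann manifold $G(\delta,d)$ of $\delta$-dimensional subspaces of $\mathbb{R}^d$; \item[(ii)] $D\Phi_t(p)E^u_p=E^u_{\Phi_t(p)}$; \item[(iii)] there are constants $\lambda>0$ and $C>0$ such that for all $p\in S$, $w\in E^u_p$ and $t\ge0$, $\|D\Phi_t(p)w\|\ge Ce^{\lambda t}\|w\|$. \end{enumerate} Let $(X_n)_{n\in\mathbb{N}}$ be a sequence of random variables in $\mathbb{R}^d$ adapted to a filtration $(\mathcal{F}_n)_{n\in\mathbb{N}}$ such that for all $n\ge0$ $$X_{n+1}-X_n=\gamma_{n+1}G_n+c_{n+1}(\varepsilon_{n+1}+r_{n+1}),$$ with $\gamma,c,G,\varepsilon,r$ as in the context, and suppose that $\gamma_n=c_n$ for all $n$. Let $\Gamma$ be an event. Suppose that there are a compact neighborhood $\mathcal{N}_0(S)$ of $S$, $c>0$, $a>2$ and a finite random variable $T_0$ such that, almost surely on $\Gamma$, \begin{itemize} \item $G_n=f(X_n)$ for all $n\ge T_0$; \item $\sup_n\|\varepsilon_n\|<\infty$ and $\sum_n\|r_n\|^2<\infty$;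 \item $\limsup_{n\to\infty}\mathbb{E}[\|\varepsilon_n\|^a|\mathcal{F}_{n-1}]<\infty$; \item $\mathbb{E}[\langle\varepsilon_{n+1},v\rangle^2|\mathcal{F}_n]\ge c\,1_{X_n\in\mathcal{N}_0(S)}$ for all $n\ge T_0$ and all unit vectors $v\in\mathbb{R}^d$. \end{itemize} Then $\mathbb{P}\big[\Gamma\cap\{\lim_{n\to\infty}d(X_n,S)=0\}\big]=0$.
   Context: $\langle\cdot,\cdot\rangle$ is an inner product on $\mathbb{R}^d$ with norm $\|\cdot\|$, and $d(x,S)$ denotes the distance from $x$ to $S$. $C^{1+\nu}$ means $C^1$ with $\nu$-Hölder differential. $T_pM$ is the tangent space of $M$ at $p$. ''Locally invariant'' has its usual meaning for the flow $\Phi$: there are a neighborhood $U$ of $S$ in $\mathbb{R}^d$ and $t_0>0$ such that $\Phi_t(U\cap M)\subset M$ for all $|t|\le t_0$. $(\gamma_n)_{n\ge0}$ and $(c_n)_{n\ge0}$ are non-negative deterministic sequences with $c_n\ne0$ infinitely often and $\sum_nc_n^2<\infty$. $(\varepsilon_n)_{n\ge0}$, $(r_n)_{n\ge0}$ and $(G_n)_{n\ge0}$ are $\mathbb{R}^d$-valued sequences adapted to $(\mathcal{F}_n)$ such that for all $n\ge0$, $\mathbb{E}[\varepsilon_{n+1}|\mathcal{F}_n]=0$ and $\mathbb{E}[\|\varepsilon_{n+1}\|^2|\mathcal{F}_n]<\infty$. *)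

(* Defs.v *)
(* R^d is 'rV[R]_d with an arbitrary inner product ip.  The topology and the
   Hölder bounds use the library's sup norm `| |: all norms on R^d give the
   same notions.  Metric hypotheses use ip_norm. *)
From HB Require Import structures.
From mathcomp Require Export all_boot all_order all_algebra.
From mathcomp Require Export all_classical all_reals all_analysis.
From mathcomp Require Export measurable_realfun.
Export Order.TTheory GRing.Theory Num.Theory.
Export numFieldNormedType.Exports.

Set Implicit Arguments.
Unset Strict Implicit.
Unset Printing Implicit Defensive.

Local Open Scope classical_set_scope.
Local Open Scope ring_scope.

Section Geometry.
Context {R : realType} {d : nat}.
Local Notation V := 'rV[R]_d.
Implicit Types (ip : {dot V for idfun}) (f : V -> V) (Phi : R -> V -> V).
Implicit Types (S M : set V) (E : V -> {vspace V}).

Definition ip_norm ip (x : V) : R := Num.sqrt (ip x x).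

(* The distance to the empty set is +oo. *)
Definition ip_dist ip (x : V) S : \bar R :=
  ereal_inf [set (ip_norm ip (x - y))%:E | y in S].

(* For 0 < nu and U open: g is C^1 on U and its differential is nu-Hölder,
   uniformly on compact subsets; continuity of the differential follows. *)
Definition C1_holder (k : nat) (nu : R) (U : set V) (g : V -> 'rV[R]_k) :=
  (forall x, U x -> differentiable g x) /\
  forall K, compact K -> K `<=` U -> exists L : R, forall x y v,
    K x -> K y -> `|'d g x v - 'd g y v| <= L * `|x - y| `^ nu * `|v|.

(* u : ]a, b[ -> R^d solves u' = f(u), u(0) = x. *)
Definition solution f (x : V) (a b : R) (u : R -> V) :=
  [/\ a < 0 < b, u 0 = x
    & forall t : R, a < t < b -> is_derive t (1 : R) u (f (u t))].

(* (t, x) belongs to the domain of the maximal flow of f. *)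
Definition flow_dom f (t : R) (x : V) :=
  exists a b u, solution f x a b u /\ a < t < b.

(* Phi is the flow of f.  The vector field is not assumed to be complete:
   Phi t x is the value at time t of the solution issued from x whenever
   (t, x) lies in flow_dom f, and is unconstrained otherwise. *)
Definition is_flow f Phi :=
  forall x a b u, solution f x a b u -> forall t, a < t < b -> Phi t x = u t.

(* As t ranges over all of R, this inclusion gives Phi_t(S) = S. *)
Definition flow_invariant f Phi S :=
  forall t x, S x -> flow_dom f t x /\ S (Phi t x).

Definition locally_invariant f Phi S M :=
  exists (U : set V) (t0 : R), [/\ S `<=` U°, 0 < t0
    & forall t x, `|t| <= t0 -> U x -> M x -> flow_dom f t x -> M (Phi t x)].

(* Embedded C^{1+nu} submanifold of dimension m <= d: locally a regular level
   set of a C^{1+nu} map with values in R^(d - m).  The class C^{1+nu} is that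
   of the vector field; it covers every smoother submanifold. *)
Definition is_submanifold (nu : R) (m : nat) M :=
  forall p, M p -> exists (U : set V) (h : V -> 'rV[R]_(d - m)%N),
    [/\ open U /\ U p, C1_holder nu U h,
        forall x, M x -> U x -> forall w, exists v, 'd h x v = w
      & M `&` U = U `&` [set x | h x = 0]].

(* Velocities at p of the curves drawn on M. *)
Definition tangent_space M (p : V) : set V :=
  [set v | exists c : R -> V, [/\ c 0 = p, \forall t \near (0 : R), M (c t)
                                & is_derive (0 : R) (1 : R) c v]].

Definition direct_sum (A B : set V) :=
  (forall x, exists a b, [/\ A a, B b & x = a + b]) /\
  A `&` B `<=` [set 0].

Definition is_orthproj ip (W : {vspace V}) (Q : 'M[R]_d) :=
  forall x : V, x *m Q \in W /\ forall w, w \in W -> ip (x - x *m Q) w = 0.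

(* The topology of G(k, d) is the one induced by the embedding into matrices
   that sends a subspace to the orthogonal projection onto it. *)
Definition grassmann_continuous ip (k : nat) S E :=
  (forall p, S p -> \dim (E p) = k) /\
  exists Q : V -> 'M[R]_d,
    (forall p, S p -> is_orthproj ip (E p) (Q p)) /\ {within S, continuous Q}.

End Geometry.

Section Stochastic.
Context {R : realType} {disp : measure_display} {T : measurableType disp}.
Implicit Types (P : probability T R) (G : set (set T)).

Definition filtration (F : nat -> set (set T)) :=
  [/\ forall n, sigma_algebra setT (F n),
      forall n, F n `<=` measurable
    & forall m n, (m <= n)%N -> F m `<=` F n].

(* Borel measurability of X_n with respect to F_n. *)
Definition adapted {d : nat} (F : nat -> set (set T))
    (X : nat -> T -> 'rV[R]_d) :=
  forall n, measurable_fun [set: g_sigma_algebraType (F n)]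
    (X n : g_sigma_algebraType (F n) ->
           g_sigma_algebraType (@open 'rV[R]_d)).

(* Y is a version of E[X | G], for X nonnegative, not necessarily
   integrable. *)
Definition is_cond_exp_ge0 P G (X Y : T -> \bar R) :=
  [/\ measurable_fun [set: g_sigma_algebraType G]
        (Y : g_sigma_algebraType G -> \bar R),
      forall w, (0 <= Y w)%E
    & forall A, G A -> (\int[P]_(w in A) Y w = \int[P]_(w in A) X w)%E].

(* Y is a version of E[X | G], for X real-valued with E[|X| | G] < oo a.s.;
   X need not be integrable. *)
Definition is_cond_exp P G (X Y : T -> R) :=
  measurable_fun [set: g_sigma_algebraType G]
    (Y : g_sigma_algebraType G -> R) /\
  exists Yp Ym : T -> \bar R,
    [/\ is_cond_exp_ge0 P G (fun w => (Num.max (X w) 0)%:E) Yp,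
        is_cond_exp_ge0 P G (fun w => (Num.max (- X w) 0)%:E) Ym
      & {ae P, forall w, [/\ (Yp w < +oo)%E, (Ym w < +oo)%E
                           & (Y w)%:E = (Yp w - Ym w)%E]}].

Definition is_cond_exp_vec {d : nat} P G (X Y : T -> 'rV[R]_d) :=
  forall i, is_cond_exp P G (fun w => X w 0 i) (fun w => Y w 0 i).

End Stochastic.

(* Main.v *)
(* Let Q(x) be the integral over [0, T] of |H(Psi_t x)|^2, where H is a global
   C^{1+nu} map vanishing on M near S and injective on E_p in the differential,
   and Psi is the flow of a cut-off of f. A point x near S is the sum of a point
   of M and of a vector w of E_p comparable to H(x), and the expansion along E
   makes |H(Psi_T x)| large compared with |H(x)|; hence the derivative of Q along
   f, which is |H(Psi_T x)|^2 - |H(x)|^2, is at least b Q near S. Expanding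
   Q(X_{n+1}) to second order, the noise contributes a drift kap c_{n+1}^2, and
   the Hölder error sqrt(Q) c^(1+nu) is absorbed by b c Q and o(c^2), because
   2 nu > 1.

   Put s_n = sum_{k > n} c_k^2. From any time n the drift drives Q above a
   multiple of s_n with probability bounded below; once there, 1 / (Q + l), with
   l of order s_n, is almost a supermartingale, so that with probability at least
   1/4 Q never tends to 0 while X stays near S. Hence every event A of F_n keeps a
   fixed proportion of its mass outside the event B that X stays near S and
   Q(X_k) tends to 0. Approximating B by events of F_n gives P(B) = 0. *)

(* Expansion may show only after a long time, since [C] may be smaller than 1, and [H] is merely
   C^{1+nu}. Integrating over [0, T] answers both: the derivative along the flow is a difference of
   two values of |H|^2, and Q still expands to second order because it is quadratic in H. The Taylor
   remainder of H enters either multiplied by H, hence weighted by sqrt Q, or multiplied by a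
   quantity of order |u|. Completing the square in sqrt Q turns the first kind into a loss of order
   c^(1 + 2 nu).

   On the probabilistic side, Gamma and T_0 are not assumed adapted and the noise is not assumed
   integrable. All integrals are therefore taken over events of F_k contained in an event [good k],
   which records at time k the bounds that hold eventually on Gamma near S; the remainder r is cut
   so as to be bounded. The exponent a > 2 controls the overshoot of Q when it leaves the small
   levels: in mean, large jumps use up at most half of the drift. *)
Require Import Defs.
From mathcomp Require Import ring lra.

Set Implicit Arguments.
Unset Strict Implicit.
Unset Printing Implicit Defensive.

Local Open Scope classical_set_scope.
Local Open Scope ring_scope.

(** * Flows of bounded vector fields and their derivative *)

Section Norms.
Context {R : realType}.

Lemma near_dist_lt (V : normedModType R) (t : V) (e : R) :
  0 < e -> \forall x \near t, `|x - t| < e.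
Proof.
move=> e0; have /cvgrPdist_lt /(_ e e0) := @cvg_id _ (nbhs t).
by apply: filterS => x /=; rewrite distrC.
Qed.

Lemma near_dist_ltR (t e : R) : 0 < e -> \forall x \near t, `|x - t| < e.
Proof. exact: (@near_dist_lt R^o). Qed.

Lemma rv_norm_le n (x : 'rV[R]_n) (c : R) :
  0 <= c -> (forall j, `|x 0 j| <= c) -> `|x| <= c.
Proof.
move=> c0 h; rewrite [`|x|]mx_normrE; apply/bigmax_leP; split => // -[i j] _ /=.
by rewrite ord1; exact: h.
Qed.

Lemma rv_coord_le n (x : 'rV[R]_n) j : `|x 0 j| <= `|x|.
Proof.
rewrite [`|x|]mx_normrE.
by apply: (@le_bigmax _ _ _ _ (fun ij : 'I_1 * 'I_n => `|x ij.1 ij.2|) (0, j)).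
Qed.

Lemma rv_is_derive n (u : R -> 'rV[R]_n) (v : 'rV[R]_n) (t : R) :
  is_derive t 1 u v <-> forall j, is_derive t 1 (fun s => u s 0 j) (v 0 j).
Proof.
split=> [h j|h].
  have d : derivable u t 1 by exact: ex_derive.
  apply: DeriveDef; first by move/derivable_mxP : d => /(_ 0 j).
  by rewrite -(@derive_val _ _ _ _ _ _ _ h) derive_mx// mxE.
have d : derivable u t 1.
  by apply/derivable_mxP => i j; rewrite ord1; exact: ex_derive.
apply: DeriveDef => //; rewrite derive_mx//; apply/rowP => j; rewrite mxE.
exact: derive_val.
Qed.

Lemma is_derive_continuous n (u : R -> 'rV[R]_n) (v : 'rV[R]_n) (t : R) :
  is_derive t 1 u v -> {for t, continuous u}.
Proof.
move=> h; apply: differentiable_continuous; apply/derivable1_diffP.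
exact: ex_derive.
Qed.

Lemma is_derive_continuous1 (u : R -> R) (v t : R) :
  is_derive t 1 u v -> {for t, continuous u}.
Proof.
move=> h; apply: differentiable_continuous; apply/derivable1_diffP.
exact: ex_derive.
Qed.

Lemma is_derive_eqval (u : R -> R) (v w t : R) :
  is_derive t 1 u v -> v = w -> is_derive t 1 u w.
Proof. by move=> h <-. Qed.

Lemma derive_nondecr (F f : R -> R) (a b : R) :
  a <= b -> (forall t : R, a <= t <= b -> is_derive t 1 F (f t)) ->
  (forall t, a < t < b -> 0 <= f t) -> F a <= F b.
Proof.
rewrite le_eqVlt => /orP[/eqP->//|ab] dF f0.
have [||c cab E] := @MVT _ F f a b ab.
- by move=> x; rewrite in_itv/= => /andP[? ?]; apply: dF; rewrite !ltW.
- apply/continuous_in_subspaceT => x; rewrite inE/= in_itv/= => xab.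
  exact: is_derive_continuous1 (dF x xab).
rewrite -subr_ge0 E; apply: mulr_ge0; last by lra.
by apply: f0; move: cab; rewrite in_itv.
Qed.

Lemma derive_le (F f G g : R -> R) (a b : R) :
  a <= b -> (forall t : R, a <= t <= b -> is_derive t 1 F (f t)) ->
  (forall t : R, a <= t <= b -> is_derive t 1 G (g t)) ->
  (forall t, a < t < b -> f t <= g t) -> F b - F a <= G b - G a.
Proof.
move=> ab dF dG fg.
suff: G a - F a <= G b - F b by lra.
apply: (@derive_nondecr (fun t => G t - F t) (fun t => g t - f t)) => // t ht.
  by apply: is_deriveB; [exact: dG|exact: dF].
by rewrite subr_ge0; exact: fg.
Qed.

Lemma is_derive_opp_arg (F : R -> R) (f t : R) :
  is_derive (- t) 1 F f -> is_derive t 1 (fun s => F (- s)) (- f).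
Proof.
move=> h; have h2 : is_derive t 1 (fun s : R => - s) (- 1).
  exact: is_deriveN.
apply: is_derive_eqval (is_derive1_comp h h2) _; ring.
Qed.

Lemma is_derive_expRM (k t : R) :
  is_derive t 1 (fun s => expR (k * s)) (k * expR (k * t)).
Proof.
have h : is_derive t 1 ( *%R k) (k * 1).
  have := @is_deriveZ _ _ _ (@id R) k t 1 1 (@is_derive_id _ _ t 1).
  by [].
apply: is_derive_eqval (is_derive1_comp (is_derive_expR (k * t)) h) _; ring.
Qed.

(** The weight [expR (k * |t|)] survives integration at the price of a factor 1 / k. With k large,
    Picard iteration contracts on the whole line at once, and no local solutions have to be
    glued. *)
Lemma exp_deriv_bound (F f : R -> R) (c k t : R) :
  0 < k -> 0 <= c -> (forall s : R, is_derive s 1 F (f s)) ->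
  (forall s, `|s| <= `|t| -> `|f s| <= c * expR (k * `|s|)) ->
  `|F t - F 0| <= c / k * expR (k * `|t|).
Proof.
move=> k0 c0; wlog t0 : F f t / 0 <= t.
  move=> hw dF hf; case: (leP 0 t) => t0; first by apply: hw dF hf.
  have := hw (fun s => F (- s)) (fun s => - f (- s)) (- t).
  rewrite opprK oppr0 normrN; apply; first lra.
    by move=> s; apply: is_derive_opp_arg.
  by move=> s hs; rewrite normrN -(normrN s); apply: hf; rewrite normrN.
move=> dF hf; rewrite (ger0_norm t0) in hf *.
pose G s := c / k * expR (k * s).
have dG (s : R) : is_derive s 1 G (c * expR (k * s)).
  apply: is_derive_eqval (is_deriveZ _ (is_derive_expRM k s)) _.
  by rewrite /GRing.scale/= mulrA -[_ * k]mulrA mulVf ?gt_eqF// mulr1.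
have G0 : 0 <= G 0 by rewrite /G mulr_ge0// ?expR_ge0// divr_ge0// ltW.
have fb s : 0 < s < t -> `|f s| <= c * expR (k * s).
  by move=> /andP[s0 st]; rewrite -[X in k * X](ger0_norm (ltW s0)) hf// ger0_norm ltW.
have h1 : F t - F 0 <= G t - G 0.
  apply: (derive_le t0 (fun s _ => dF s) (fun s _ => dG s)) => s /fb.
  by rewrite ler_norml => /andP[].
have h2 : - F t - - F 0 <= G t - G 0.
  apply: (derive_le (F := fun s => - F s) (f := fun s => - f s) t0 _ (fun s _ => dG s)).
  move=> s /fb; rewrite ler_norml => /andP[]; lra.
by rewrite ler_norml; apply/andP; split; rewrite /G in h1 h2 G0 *; lra.
Qed.

Lemma primitive_exists (v : R -> R) : continuous v ->
  exists F : R -> R, F 0 = 0 /\ forall t : R, is_derive t 1 F (v t).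
Proof.
move=> cv.
have int (a b : R) : lebesgue_measure.-integrable `[a, b] (EFin \o v).
  apply: continuous_compact_integrable; first exact: segment_compact.
  exact/continuous_subspaceT.
(* The fundamental theorem applies to integrals started strictly to the left. By [II], [I a x] does
   not depend on [a] below both [x] and 0, so the base point can move with [x] and one function
   serves both signs of [x]. *)
pose J a x := \int[lebesgue_measure]_(s in `[a, x]) v s.
pose I a x := J a x - J a 0.
have II (a b x : R) : a <= b -> b <= x -> b <= 0 -> I a x = I b x.
  move=> ab bx b0.
  have h y : b <= y -> J a y = J a b + J b y.
    move=> hy.
    have := @Rintegral_itvB _ v (BLeft a) (BRight y) b (int a y).
    rewrite !bnd_simp => /(_ ab hy) E.
    suff e : \int[lebesgue_measure]_(s in `[b, y]) v s = \int[lebesgue_measure]_(s in `]b, y]) v s.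
      by rewrite /J e -E addrC subrK.
    rewrite Rintegral_itv_obnd_cbnd//.
    apply: (integrableS _ _ _ (int b y)) => //; exact: subset_itv_oc_cc.
  by rewrite /I (h x)// (h 0)//; lra.
exists (fun x => I (- (`|x| + 1)) x); split; first by rewrite /I subrr.
move=> t.
pose a := - (`|t| + 2).
have at0 : a < t by rewrite /a; have := ler_norm (- t); rewrite normrN; lra.
have tt : t < t + 1 by lra.
have [dJ EJ] := @continuous_FTC1 R v (BLeft a) t (t + 1) tt (int a (t+1)) at0 (cv t).
have hJ : is_derive t 1 (I a) (v t).
  have hJ : is_derive t 1 (J a) (v t) by rewrite -EJ derive1E; exact: derivableP dJ.
  apply: is_derive_eqval (is_deriveB hJ (is_derive_cst _ _ _)) _.
  by rewrite subr0.
apply: (@near_eq_is_derive _ _ _ (I a)) hJ.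
near=> x.
have xt : `|x - t| < 1 by near: x; exact: (near_dist_ltR t ltr01).
have := ler_norm (- x); have := ler_normD (x - t) t; have := normr_ge0 x; have := normr_ge0 t.
rewrite subrK normrN => ? ? ? ?.
by apply: II; rewrite /a; lra.
Unshelve. all: by end_near. Qed.

Lemma loc_lip_continuous (V W : normedModType R) (f : V -> W) :
  (forall x, exists c r : R, 0 < r /\ forall y, `|y - x| < r -> `|f y - f x| <= c * `|y - x|) ->
  continuous f.
Proof.
move=> h x; have [c [r [r0 hc]]] := h x; apply/cvgrPdist_le => e e0.
have c1 : 0 < `|c| + 1 by have := normr_ge0 c; lra.
near=> y.
have hy : `|y - x| < r by near: y; exact: near_dist_lt.
have hy2 : `|y - x| < e / (`|c| + 1) by near: y; apply: near_dist_lt; rewrite divr_gt0.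
rewrite distrC; apply: le_trans (hc y hy) _.
apply: (@le_trans _ _ ((`|c| + 1) * `|y - x|)).
  by rewrite ler_wpM2r//; have := ler_norm c; lra.
by rewrite mulrC -ler_pdivlMr// ltW.
Unshelve. all: by end_near. Qed.

Lemma geometric_limit n (a : nat -> 'rV[R]_n) (c : R) :
  (forall k, `|a k.+1 - a k| <= c / 2 ^+ k) ->
  exists l, forall k, `|a k - l| <= 2 * c / 2 ^+ k.
Proof.
move=> h.
have p2 k : 0 < (2 ^+ k : R) by exact: exprn_gt0.
have c0 : 0 <= c by have := h 0; rewrite expr0 divr1; exact: le_trans.
have hm k m : `|a (k + m)%N - a k| <= 2 * c / 2 ^+ k - 2 * c / 2 ^+ (k + m).
  elim: m => [|m IH]; first by rewrite addn0 !subrr normr0.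
  rewrite addnS; have := ler_normD (a (k + m).+1 - a (k + m)%N) (a (k + m)%N - a k).
  rewrite addrA subrK => /le_trans; apply.
  have := h (k + m)%N; rewrite exprS.
  have -> : 2 * c / (2 * 2 ^+ (k + m)) = c / 2 ^+ (k + m).
    by field; rewrite gt_eqF.
  by move: IH; rewrite -!mulrA; lra.
have hle k m : `|a k - a m| <= 2 * c / 2 ^+ k + 2 * c / 2 ^+ m.
  have d0 i : 0 <= 2 * c / 2 ^+ i by rewrite divr_ge0 ?mulr_ge0// ltW.
  wlog km : k m / (k <= m)%N.
    move=> hw; case/orP: (leq_total k m) => ?; first exact: hw.
    by rewrite (distrC (a k)) [X in _ <= X]addrC; apply: hw.
  have := hm k (m - k)%N; rewrite subnKC// distrC => /le_trans; apply.
  by have := d0 m; lra.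
(* In each coordinate the intervals of radius 2 c / 2^k around the terms meet pairwise; the supremum
   of their left ends lies in all of them, which gives the limit together with the rate. *)
pose A j := [set a k 0 j - 2 * c / 2 ^+ k | k in [set: nat]].
have ub j m : ubound (A j) (a m 0 j + 2 * c / 2 ^+ m).
  move=> _ [k _ <-].
  have := le_trans (rv_coord_le (a k - a m) j) (hle k m); rewrite !mxE.
  by rewrite ler_norml => /andP[]; lra.
have A0 j : A j !=set0 by exists (a 0 0 j - 2 * c / 2 ^+ 0); exists 0.
exists (\row_j sup (A j)) => k; apply: rv_norm_le => [|j].
  by rewrite divr_ge0 ?mulr_ge0// ltW.
rewrite !mxE ler_norml; apply/andP; split.
  have := ge_sup (A0 j) (ub j k); lra.
have : a k 0 j - 2 * c / 2 ^+ k <= sup (A j).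
  apply: ub_le_sup; last by exists k.
  by exists (a 0 0 j + 2 * c / 2 ^+ 0); exact: ub.
by lra.
Qed.

Lemma le_geometric0 (x c : R) : 0 <= x -> (forall k, x <= c / 2 ^+ k) -> x = 0.
Proof.
move=> x0 h; apply/eqP; rewrite eq_le x0 andbT leNgt; apply/negP => xp.
have p2 k : 0 < (2 ^+ k : R) by exact: exprn_gt0.
have [k hk] : exists k : nat, c / x < k%:R.
  by exists (Num.truncn (c / x)).+1; exact: truncnS_gt.
have := h k; rewrite ler_pdivlMr//.
have : (k%:R : R) <= 2 ^+ k by rewrite -natrX ler_nat ltnW// ltn_expl.
move: hk; rewrite ltr_pdivrMr//; nra.
Qed.

Lemma vec_primitive n (v : R -> 'rV[R]_n) (x : 'rV[R]_n) : continuous v ->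
  exists F : R -> 'rV[R]_n, F 0 = x /\ forall t : R, is_derive t 1 F (v t).
Proof.
move=> cv.
have cvj j : continuous (fun s => v s 0 j).
  move=> s; apply: (@continuous_comp _ _ _ v (fun w : 'rV[R]_n => w 0 j) s (cv s)); exact: coord_continuous.
have [F hF] := choice (fun j => primitive_exists (cvj j)).
exists (fun s => \row_j (x 0 j + F j s)); split.
  by apply/rowP => j; rewrite mxE (hF j).1 addr0.
move=> t; apply/rv_is_derive => j.
under eq_fun do rewrite mxE.
apply: is_derive_eqval (is_deriveD (is_derive_cst _ _ _) ((hF j).2 t)) _.
by rewrite add0r.
Qed.

Lemma vec_exp_deriv_bound n (F f : R -> 'rV[R]_n) (c k t : R) :
  0 < k -> 0 <= c -> (forall s : R, is_derive s 1 F (f s)) ->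
  (forall s, `|s| <= `|t| -> `|f s| <= c * expR (k * `|s|)) ->
  `|F t - F 0| <= c / k * expR (k * `|t|).
Proof.
move=> k0 c0 dF hf; apply: rv_norm_le => [|j].
  by rewrite mulr_ge0 ?expR_ge0// divr_ge0// ltW.
rewrite !mxE; apply: (@exp_deriv_bound (fun s => F s 0 j) (fun s => f s 0 j)) => //.
  by move=> s; exact: (rv_is_derive _ _ _).1 (dF s) j.
by move=> s hs; apply: le_trans (rv_coord_le _ _) (hf s hs).
Qed.

(** * Global solutions of Lipschitz differential equations *)

Section Picard.
Context {n : nat} (g : R -> 'rV[R]_n -> 'rV[R]_n) (L : R).
Hypothesis L0 : 0 <= L.
Hypothesis gL : forall t x y, `|g t x - g t y| <= L * `|x - y|.
Hypothesis gc : forall x, continuous (g^~ x).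

Lemma lip_comp_continuous (u : R -> 'rV[R]_n) :
  continuous u -> continuous (fun t => g t (u t)).
Proof.
move=> cu t; apply/cvgrPdist_le => /= e e0.
have e2 : 0 < e / 2 by rewrite divr_gt0.
have eL : 0 < e / 2 / (L + 1) by have L0' := L0; rewrite divr_gt0//; lra.
near=> s.
have h1 : `|g t (u t) - g s (u t)| <= e / 2.
  by near: s; move/cvgrPdist_le: (@gc (u t) t); apply.
have h2 : `|u t - u s| <= e / 2 / (L + 1).
  by near: s; move/cvgrPdist_le: (cu t); apply.
have h3 : `|g s (u t) - g s (u s)| <= e / 2.
  apply: le_trans (gL _ _ _) _.
  apply: (@le_trans _ _ ((L + 1) * (e / 2 / (L + 1)))).
    by have L0' := L0; apply: ler_pM => //; lra.
  by have L0' := L0; rewrite mulrC divfK//; apply: lt0r_neq0; lra.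
have := ler_normD (g t (u t) - g s (u t)) (g s (u t) - g s (u s)).
by rewrite addrA subrK; lra.
Unshelve. all: by end_near. Qed.

(** The field depends on time so as to cover the variational equation along a trajectory, and
    boundedness is asked only along the constant path [x], since a linear field is unbounded in
    space. The rate 2 L + 1 makes each iteration halve the distance in the weighted norm. *)
Lemma picard (x : 'rV[R]_n) (M : R) : (forall t, `|g t x| <= M) ->
  exists u : R -> 'rV[R]_n, u 0 = x /\ forall t : R, is_derive t 1 u (g t (u t)).
Proof.
move=> gM.
have M0 : 0 <= M by exact: le_trans (normr_ge0 _) (gM 0).
have L0' := L0.
pose CT := {u : R -> 'rV[R]_n | continuous u}.
have step (u : CT) : exists w : CT, sval w 0 = x /\
    forall t : R, is_derive t 1 (sval w) (g t (sval u t)).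
  have [w [w0 dw]] := vec_primitive x (lip_comp_continuous (svalP u)).
  have cw : continuous w by move=> t; exact: is_derive_continuous (dw t).
  by exists (exist _ w cw).
have [P hP] := choice step.
have cx : continuous (fun _ : R => x) by move=> t; exact: cvg_cst.
pose U k := sval (iter k P (exist _ _ cx : CT)).
have U0 k : U k 0 = x by case: k => [//|k]; exact: (hP _).1.
have dU k (t : R) : is_derive t 1 (U k.+1) (g t (U k t)) by exact: (hP _).2.
pose K := 2 * L + 1.
have K0 : 0 < K by rewrite /K; lra.
have p2 k : 0 < (2 ^+ k : R) by exact: exprn_gt0.
have MK : 0 <= M / K by rewrite divr_ge0// ltW.
have LK c : 0 <= c -> L * c / K <= c / 2.
  move=> c0; rewrite ler_pdivrMr// /K; nra.
have step_le k (t : R) : `|U k.+1 t - U k t| <= M / K * expR (K * `|t|) / 2 ^+ k.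
  elim: k t => [|k IH] t.
    rewrite expr0 divr1.
    have := @vec_exp_deriv_bound _ (U 1%N) (fun t => g t (U 0%N t)) M K t K0 M0 (dU 0%N).
    rewrite U0; apply => s _; apply: le_trans (gM s) _.
    rewrite ler_peMr//.
    by rewrite -expR0 ler_expR mulr_ge0// ltW.
  have c0 : 0 <= M / K / 2 ^+ k by rewrite !divr_ge0// ltW.
  have := @vec_exp_deriv_bound _ (U k.+2 - U k.+1) (fun t => g t (U k.+1 t) - g t (U k t)) (L * (M / K / 2 ^+ k)) K t K0.
  rewrite !fctE !U0 subrr subr0.
  move=> /(_ (mulr_ge0 L0 c0)) h.
  apply: le_trans (h _ _) _.
    move=> s _; apply: le_trans (gL _ _ _) _; rewrite -mulrA ler_wpM2l//.
    by apply: le_trans (IH s) _; rewrite mulrAC.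
  rewrite exprS; have := LK _ c0; have := expR_ge0 (K * `|t|).
  set E := expR _; set c := M / K / 2 ^+ k in c0 *.
  have -> : M / K * E / (2 * 2 ^+ k) = c / 2 * E by rewrite /c; field; rewrite ?gt_eqF.
  by move=> E0 h1; apply: ler_wpM2r.
have lim t := @geometric_limit _ (U^~ t) _ (step_le^~ t).
have [u hu] := choice lim.
have cu : continuous u.
  move=> t; apply/cvgrPdist_le => /= e e0.
  pose B := 2 * (M / K * expR (K * (`|t| + 1))).
  have B0 : 0 <= B.
    by rewrite /B; apply: mulr_ge0 => //; apply: mulr_ge0 => //; exact: expR_ge0.
  have e3 : 0 < e / 3 by rewrite divr_gt0.
  have [k hk] : exists k : nat, B / (e / 3) < k%:R.
    by exists (Num.truncn (B / (e / 3))).+1; exact: truncnS_gt.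
  have hB : B / 2 ^+ k <= e / 3.
    rewrite ler_pdivrMr//; move: hk; rewrite ltr_pdivrMr// => hk.
    have : (k%:R : R) <= 2 ^+ k by rewrite -natrX ler_nat ltnW// ltn_expl.
    nra.
  have hus s : `|s| <= `|t| + 1 -> `|U k s - u s| <= e / 3.
    move=> hs; apply: le_trans (hu s k) (le_trans _ hB).
    apply: ler_wpM2r; first by rewrite invr_ge0 ltW.
    by apply: ler_wpM2l => //; apply: ler_wpM2l => //; rewrite ler_expR ler_wpM2l// ltW.
  near=> s.
  have h1 : `|U k t - U k s| <= e / 3.
    by near: s; move/cvgrPdist_le: (svalP (iter k P (exist _ _ cx : CT)) t); apply.
  have h2 : `|s| <= `|t| + 1.
    have : `|t - s| <= 1.
      by rewrite distrC ltW//; near: s; exact: (near_dist_ltR t ltr01).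
    have := ler_normD (s - t) t; rewrite subrK (distrC s); lra.
  have h3 := hus s h2; have h4 : `|U k t - u t| <= e / 3 by apply: hus; lra.
  have := ler_normD (u t - U k t) (U k t - U k s + (U k s - u s)).
  have := ler_normD (U k t - U k s) (U k s - u s).
  rewrite (distrC (u t)) !addrA !subrK; lra.
have [w [w0 dw]] := vec_primitive x (lip_comp_continuous cu).
(* [w] is the Picard image of the limit [u]. The iterate of index k + 1 is within a multiple of
   2^(-k) of both, so the limit is a fixed point and inherits differentiability from [w]. *)
suff uw : u = w by exists w; split=> // t; rewrite -{2}uw; exact: dw.
apply/funext => t.
pose C := 2 * (M / K * expR (K * `|t|)).
have Kge : 1 <= K by rewrite /K; lra.
apply/eqP; rewrite -subr_eq0 -normr_eq0; apply/eqP.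
apply: (@le_geometric0 _ (C + C)) => // k.
have c1 : 0 <= 2 * (M / K) / 2 ^+ k.
  by apply: divr_ge0 (ltW (p2 k)); apply: mulr_ge0.
have c0 : 0 <= L * (2 * (M / K) / 2 ^+ k) by exact: mulr_ge0.
have h := @vec_exp_deriv_bound _ (U k.+1 - w) (fun t => g t (U k t) - g t (u t)) (L * (2 * (M / K) / 2 ^+ k)) K t K0 c0.
have {}h : `|U k.+1 t - w t| <= C / 2 ^+ k.
  have := h _ _; rewrite !fctE U0 w0 subrr subr0 => {}h.
  apply: le_trans (h _ _) _.
    move=> s _; apply: le_trans (gL _ _ _) _; rewrite -mulrA ler_wpM2l//.
    by apply: le_trans (hu s k) _; rewrite !mulrA mulrAC.
  have := LK _ c1; have := expR_ge0 (K * `|t|).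
  rewrite /C; set E := expR _; set c := _ / 2 ^+ k in c1 *.
  have -> : 2 * (M / K * E) / 2 ^+ k = c * E by rewrite /c; field; rewrite ?gt_eqF.
  by move=> E0 h1; apply: ler_wpM2r => //; lra.
have h2 := hu t k.+1.
have h3 : `|U k.+1 t - u t| <= C / 2 ^+ k.
  apply: le_trans h2 _; rewrite exprS ler_wpM2l//.
    by apply: mulr_ge0 => //; apply: mulr_ge0 => //; exact: expR_ge0.
  rewrite lef_pV2 ?posrE ?mulr_gt0//; have := p2 k; lra.
have := ler_normD (u t - U k.+1 t) (U k.+1 t - w t).
by rewrite addrA subrK (distrC (u t) (U k.+1 t)) mulrDl; lra.
Unshelve. all: by end_near. Qed.

End Picard.


Lemma sqr_norm_le_sum n (x : 'rV[R]_n) : `|x| ^+ 2 <= \sum_j x 0 j ^+ 2.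
Proof.
have s0 : 0 <= \sum_j x 0 j ^+ 2 by apply: sumr_ge0 => j _; exact: sqr_ge0.
rewrite -(sqr_sqrtr s0) ler_sqr ?nnegrE ?sqrtr_ge0//.
apply: rv_norm_le => [|j]; first exact: sqrtr_ge0.
rewrite -sqrtr_sqr ler_sqrt// (bigD1 j)//= lerDl.
by apply: sumr_ge0 => i _; exact: sqr_ge0.
Qed.

Lemma sum_sqr_le_norm n (x : 'rV[R]_n) : \sum_j x 0 j ^+ 2 <= n%:R * `|x| ^+ 2.
Proof.
have -> : n%:R * `|x| ^+ 2 = \sum_(j < n) `|x| ^+ 2.
  by rewrite sumr_const card_ord mulr_natl.
apply: ler_sum => j _; rewrite -[X in X <= _]real_normK ?num_real//.
by rewrite ler_sqr ?nnegrE//; exact: rv_coord_le.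
Qed.

(** The sup norm is not differentiable, so the argument runs on the sum of squares [phi], which
    satisfies phi' <= B phi + 2 N m^2, with the integrating factor expR (- B s). The constant
    depends only on the dimension, [A] and [T]. *)
Lemma gronwall_ge0 n (A T : R) : 0 <= A -> 0 <= T ->
  exists2 C : R, 0 <= C & forall (E E' : R -> 'rV[R]_n) (m t : R),
    0 <= m -> 0 <= t <= T ->
    (forall s : R, 0 <= s <= t -> is_derive s 1 E (E' s)) ->
    (forall s, 0 <= s <= t -> `|E' s| <= A * `|E s| + m) ->
    `|E t| <= C * (`|E 0| + m).
Proof.
move=> A0 T0.
pose N : R := n%:R; have N0 : 0 <= N by rewrite /N.
pose B := 1 + 2 * N * A ^+ 2.
have B0 : 0 <= B by rewrite /B; have := sqr_ge0 A; nra.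
pose C2 := expR (B * T) * (N * (1 + 2 * T)).
have C20 : 0 <= C2 by rewrite /C2 mulr_ge0 ?expR_ge0//; nra.
exists (Num.sqrt C2); first exact: sqrtr_ge0.
move=> E E' m t m0 /andP[t0 tT] dE hE.
pose phi s := \sum_j (E s 0 j) ^+ 2.
pose phi' s := \sum_j (2 * E s 0 j * E' s 0 j).
have dphi s : 0 <= s <= t -> is_derive (s : R) (1 : R) phi (phi' s).
  move=> hs.
  have -> : phi = \sum_j (fun s => (E s 0 j) ^+ 2) by apply/funext => r; rewrite fct_sumE.
  apply: is_derive_sum => j; have dj := (rv_is_derive _ _ _).1 (dE s hs) j.
  apply: is_derive_eqval (is_deriveM dj dj) _.
  by rewrite /GRing.scale/=; ring.
have phi'_le s : 0 <= s <= t -> phi' s <= B * phi s + 2 * N * m ^+ 2.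
  move=> hs.
  have h1 : phi' s <= phi s + \sum_j (E' s 0 j) ^+ 2.
    rewrite /phi /phi' -big_split; apply: ler_sum => j _ /=.
    have := sqr_ge0 (E s 0 j - E' s 0 j); nra.
  have h2 := sum_sqr_le_norm (E' s); have h3 := sqr_norm_le_sum (E s).
  have h4 := hE s hs; have h5 := normr_ge0 (E' s); have h6 := normr_ge0 (E s).
  have h7 : `|E' s| ^+ 2 <= 2 * A ^+ 2 * `|E s| ^+ 2 + 2 * m ^+ 2.
    apply: (@le_trans _ _ ((A * `|E s| + m) ^+ 2)).
      by rewrite ler_sqr ?nnegrE// addr_ge0// mulr_ge0.
    have := sqr_ge0 (A * `|E s| - m); nra.
  have h8 : N * `|E' s| ^+ 2 <= N * (2 * A ^+ 2 * `|E s| ^+ 2 + 2 * m ^+ 2).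
    exact: ler_wpM2l.
  have h9 : N * (2 * A ^+ 2 * `|E s| ^+ 2) <= N * (2 * A ^+ 2 * phi s).
    apply: ler_wpM2l => //; apply: ler_wpM2l => //.
    by rewrite mulr_ge0// sqr_ge0.
  rewrite /B; lra.
pose W s := 2 * N * m ^+ 2 * s - expR (- B * s) * phi s.
pose W' s := 2 * N * m ^+ 2 - (expR (- B * s) * phi' s + phi s * (- B * expR (- B * s))).
have dW s : 0 <= s <= t -> is_derive (s : R) (1 : R) W (W' s).
  move=> hs; have d1 := @is_deriveZ _ _ _ (@id R) (2 * N * m ^+ 2) s 1 1 (@is_derive_id _ _ s 1).
  have d2 := is_deriveM (is_derive_expRM (- B) s) (dphi s hs).
  apply: is_derive_eqval (is_deriveB d1 d2) _.
  by rewrite /W' /GRing.scale/= mulr1.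
have W_ge : W 0 <= W t.
  apply: (derive_nondecr t0 dW) => s /andP[s0 st].
  have hs : 0 <= s <= t by rewrite !ltW.
  rewrite /W'; have := phi'_le s hs.
  have e0 := expR_ge0 (- B * s).
  have e1 : expR (- B * s) <= 1 by rewrite -expR0 ler_expR; have := mulr_ge0 B0 (ltW s0); lra.
  have q0 : 0 <= 2 * N * m ^+ 2 by rewrite !mulr_ge0// sqr_ge0.
  set e := expR _ in e0 e1 *; move=> h.
  have h1 : e * phi' s <= e * (B * phi s + 2 * N * m ^+ 2) by exact: ler_wpM2l.
  have h2 : e * (2 * N * m ^+ 2) <= 1 * (2 * N * m ^+ 2) by exact: ler_wpM2r.
  lra.
have key : phi t <= C2 * (`|E 0| + m) ^+ 2.
  have eB := expR_gt0 (B * t).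
  have h1 : phi t <= expR (B * t) * (phi 0 + 2 * N * m ^+ 2 * t).
    move: W_ge; rewrite /W !mulr0 expR0 mul1r sub0r mulNr expRN => h.
    by rewrite -ler_pdivrMl//; lra.
  have h2 := sum_sqr_le_norm (E 0).
  have h3 : expR (B * t) <= expR (B * T) by rewrite ler_expR ler_wpM2l.
  apply: le_trans h1 _; rewrite /C2 -[X in _ <= X]mulrA; apply: ler_pM => //.
    rewrite addr_ge0 ?mulr_ge0 ?sqr_ge0//.
    by apply: sumr_ge0 => j _; exact: sqr_ge0.
  have h4 := normr_ge0 (E 0).
  have h5 : `|E 0| ^+ 2 + m ^+ 2 <= (`|E 0| + m) ^+ 2 by have := mulr_ge0 h4 m0; nra.
  have h6 : m ^+ 2 * t <= m ^+ 2 * T by rewrite ler_wpM2l ?sqr_ge0.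
  have h7 : N * (`|E 0| ^+ 2 + 2 * (m ^+ 2 * T)) <= N * ((1 + 2 * T) * (`|E 0| + m) ^+ 2).
    apply: ler_wpM2l => //.
    have h8 : 2 * T * (`|E 0| ^+ 2 + m ^+ 2) <= 2 * T * (`|E 0| + m) ^+ 2.
      by rewrite ler_wpM2l// mulr_ge0.
    have := mulr_ge0 T0 (sqr_ge0 (`|E 0|)); have := sqr_ge0 m; nra.
  have h9 : N * (m ^+ 2 * t) <= N * (m ^+ 2 * T) by exact: ler_wpM2l.
  rewrite -/N in h2; rewrite /phi; lra.
have s0 : 0 <= `|E 0| + m by rewrite addr_ge0.
rewrite -(@ler_sqr R) ?nnegrE//; last by rewrite mulr_ge0// sqrtr_ge0.
by rewrite exprMn sqr_sqrtr//; apply: le_trans (sqr_norm_le_sum _) key.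
Qed.

Definition btw (t s : R) := (0 <= s <= t) || (t <= s <= 0).

Lemma btwN (t s : R) : btw (- t) (- s) = btw t s.
Proof. by rewrite /btw !oppr_ge0 !lerN2 !oppr_le0 orbC [X in X || _]andbC [X in _ || X]andbC. Qed.

Lemma btw_le (t s : R) : btw t s -> `|s| <= `|t|.
Proof.
case/orP => /andP[h1 h2].
  by rewrite !ger0_norm//; exact: le_trans h2.
by rewrite !ler0_norm ?lerN2//; exact: le_trans h2.
Qed.

Lemma vec_is_derive_opp_arg n (F : R -> 'rV[R]_n) f (t : R) :
  is_derive (- t) 1 F f -> is_derive t 1 (fun s => F (- s)) (- f).
Proof.
move=> /rv_is_derive h; apply/rv_is_derive => j; rewrite mxE.
exact: (@is_derive_opp_arg (fun s => F s 0 j)).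
Qed.

Lemma gronwall n (A T : R) : 0 <= A -> 0 <= T ->
  exists2 C : R, 0 <= C & forall (E E' : R -> 'rV[R]_n) (m t : R),
    0 <= m -> `|t| <= T ->
    (forall s : R, btw t s -> is_derive s 1 E (E' s)) ->
    (forall s, btw t s -> `|E' s| <= A * `|E s| + m) ->
    `|E t| <= C * (`|E 0| + m).
Proof.
move=> A0 T0; have [C C0 hC] := gronwall_ge0 n A0 T0; exists C => // E E' m t m0 tT dE hE.
have [t0|t0] := leP 0 t.
  apply: (hC E E') => //; first by rewrite t0 -(ger0_norm t0).
    by move=> s hs; apply: dE; rewrite /btw hs.
  by move=> s hs; apply: hE; rewrite /btw hs.
have := hC (fun s => E (- s)) (fun s => - E' (- s)) m (- t) m0.
rewrite opprK oppr0; apply.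
- by rewrite oppr_ge0 (ltW t0)/= -(ltr0_norm t0).
- move=> s hs; apply: vec_is_derive_opp_arg; apply: dE.
  by rewrite -btwN opprK /btw hs.
- by move=> s hs; rewrite normrN; apply: hE; rewrite -btwN opprK /btw hs.
Qed.

Lemma ode_unique n (g : R -> 'rV[R]_n -> 'rV[R]_n) (L : R) (u w : R -> 'rV[R]_n) (t : R) :
  0 <= L -> (forall s x y, `|g s x - g s y| <= L * `|x - y|) -> u 0 = w 0 ->
  (forall s : R, btw t s -> is_derive s 1 u (g s (u s))) ->
  (forall s : R, btw t s -> is_derive s 1 w (g s (w s))) -> u t = w t.
Proof.
move=> L0 gL u0 du dw.
have [C C0 hC] := gronwall n L0 (normr_ge0 t).
have := hC (u - w) (fun s => g s (u s) - g s (w s)) 0 t (lexx _) (lexx _).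
rewrite !fctE u0 subrr normr0 addr0 mulr0 => h.
apply/eqP; rewrite -subr_eq0 -normr_le0; apply: h.
  by move=> s hs; have := du s hs; have := dw s hs; move=> ? ?; apply: is_deriveB.
by move=> s hs; rewrite addr0; exact: gL.
Qed.


Lemma flow_exists n (f : 'rV[R]_n -> 'rV[R]_n) (L M : R) :
  0 <= L -> (forall x, `|f x| <= M) -> (forall x y, `|f x - f y| <= L * `|x - y|) ->
  exists Psi : R -> 'rV[R]_n -> 'rV[R]_n, (forall x, Psi 0 x = x) /\
    forall x (t : R), is_derive t 1 (Psi^~ x) (f (Psi t x)).
Proof.
move=> L0 fM fL.
have h x : exists u : R -> 'rV[R]_n, u 0 = x /\ forall t : R, is_derive t 1 u (f (u t)).
  apply: (@picard n (fun _ => f) L L0 _ _ x M) => // z t; exact: cvg_cst.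
have [u hu] := choice h.
by exists (fun t x => u x t); split=> [x|x t]; [exact: (hu x).1|exact: (hu x).2].
Qed.

(** * Uniform C^{1+nu} maps: composition, flows and cutoffs *)

Section Class.
Variables (d : nat) (nu : R).

(* The class C^{1+nu} with bounds uniform over R^d, through first-order Taylor
   expansions; the differential [D x] acts on row vectors from the right. *)
Definition C1h k (K : R) (g : 'rV[R]_d -> 'rV[R]_k) (D : 'rV[R]_d -> 'M[R]_(d, k)) :=
  [/\ 0 <= K, forall x, `|g x| <= K, forall (x u : 'rV_d), `|u *m D x| <= K * `|u|
    & forall (x u : 'rV_d), `|g (x + u) - g x - u *m D x| <= K * `|u| `^ (1 + nu)].

Hypothesis nu01 : 0 < nu <= 1.

Lemma powRnu_mono (x y : R) (p : R) : 0 <= p -> 0 <= x <= y -> x `^ p <= y `^ p.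
Proof.
move=> p0 /andP[x0 xy]; apply: ge0_ler_powR => //; rewrite nnegrE//.
exact: le_trans xy.
Qed.

Lemma powR1nu_le (x : R) : 0 <= x <= 1 -> x `^ (1 + nu) <= x.
Proof.
case/andP: nu01 => n0 n1 /andP[x0 x1].
rewrite powRD ?(gt_eqF (addr_gt0 ltr01 n0))// powRr1// ler_piMr//.
have <- : (1 : R) `^ nu = 1 by rewrite powR1.
by apply: powRnu_mono; [exact: ltW|rewrite x0].
Qed.

Lemma C1h_lip k K (g : 'rV[R]_d -> 'rV[R]_k) D : C1h K g D ->
  forall x y, `|g x - g y| <= 2 * K * `|x - y|.
Proof.
move=> [K0 gK DK gT] x y.
have [h|h] := leP `|x - y| 1; last first.
  have := ler_normB (g x) (g y); have := gK x; have := gK y; nra.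
have := gT y (x - y); rewrite [y + _]addrC subrK.
have := DK y (x - y); have := ler_normD (g x - g y - (x - y) *m D y) ((x - y) *m D y).
rewrite subrK; have := @powR1nu_le `|x - y|; rewrite normr_ge0 h => /(_ isT).
nra.
Qed.

(** Uniform Taylor expansions already force the differential to be Hölder: expand at [x] and at [y]
    the value at the same point y + w with |w| = |y - x|, compare, and rescale [w] to [u] by
    linearity. The three remainders cost 4 + 1 + 1. *)
Lemma taylor_holder k K (g : 'rV[R]_d -> 'rV[R]_k) D : 0 <= K ->
  (forall x u : 'rV_d, `|g (x + u) - g x - u *m D x| <= K * `|u| `^ (1 + nu)) ->
  forall x y u : 'rV_d, `|u *m D x - u *m D y| <= 6 * K * `|x - y| `^ nu * `|u|.
Proof.
move=> K0 gT x y u; case/andP: nu01 => n0 n1.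
have [->|u0] := eqVneq u 0; first by rewrite !mul0mx subrr !normr0 mulr0.
have [->|xy] := eqVneq x y.
  by rewrite !subrr normr0 !mulr_ge0// ?powR_ge0.
have [r rE] : {r : R | r = `|y - x|} by exists `|y - x|.
have r0 : 0 < r by rewrite rE normr_gt0 subr_eq0 eq_sym.
have un : 0 < `|u| by rewrite normr_gt0.
have [s sE] : {s : R | s = r / `|u|} by exists (r / `|u|).
have s0 : 0 < s by rewrite sE divr_gt0.
have [w wE] : {w : 'rV_d | w = s *: u} by exists (s *: u).
have wr : `|w| = r by rewrite wE normrZ gtr0_norm// sE divfK// gt_eqF.
have key : `|w *m D x - w *m D y| <= 6 * K * (r * r `^ nu).
  have h1 := gT x (y - x + w); have h2 := gT x (y - x); have h3 := gT y w.
  rewrite [x + (y - x + w)]addrA [x + (y - x)]addrC subrK in h1 h2.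
  have rn : r `^ (1 + nu) = r * r `^ nu.
    by rewrite powRD ?(gt_eqF (addr_gt0 ltr01 n0))// powRr1// ltW.
  have r2 : `|y - x + w| `^ (1 + nu) <= 4 * (r * r `^ nu).
    rewrite -rn; apply: (@le_trans _ _ ((2 * r) `^ (1 + nu))).
      apply: powRnu_mono; first by rewrite addr_ge0 ?ler01// ltW.
      by rewrite normr_ge0/=; have := ler_normD (y - x) w; rewrite wr -rE mulr_natl.
    rewrite powRM//; last exact: ltW.
    rewrite ler_wpM2r ?powR_ge0//.
    have -> : (4 : R) = 2 `^ 2%:R by rewrite powR_mulrn// expr2; lra.
    by apply: ler_powR; lra.
  rewrite wr rn in h3; rewrite -rE rn in h2.
  set a := r * r `^ nu in r2 h2 h3 *.
  have -> : w *m D x - w *m D y =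
    (g (y + w) - g y - w *m D y) + (g y - g x - (y - x) *m D x)
    - (g (y + w) - g x - (y - x + w) *m D x).
    rewrite (mulmxDl (y - x) w); move: (w *m D x) (w *m D y) ((y - x) *m D x) (g (y + w)) (g y) (g x).
    by move=> ? ? ? ? ? ?; apply/matrixP => i j; rewrite !mxE; ring.
  apply: le_trans (ler_normB _ _) _.
  have := ler_normD (g (y + w) - g y - w *m D y) (g y - g x - (y - x) *m D x).
  have : K * `|y - x + w| `^ (1 + nu) <= K * (4 * a) by rewrite ler_wpM2l.
  move: h1 h2 h3; lra.
rewrite (distrC x y) -rE.
have -> : `|u *m D x - u *m D y| = `|w *m D x - w *m D y| / s.
  by rewrite wE -!scalemxAl -scalerBr normrZ gtr0_norm// mulrC mulKf// gt_eqF.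
rewrite ler_pdivrMr//; apply: le_trans key _.
rewrite sE le_eqVlt; apply/orP; left; apply/eqP; field; exact: lt0r_neq0.
Qed.

(** The inner map only has increments controlled, not values: it will be a flow map, which is
    unbounded and hence not itself in the class. *)
Lemma C1h_comp k K A (g : 'rV[R]_d -> 'rV[R]_k) D (phi : 'rV[R]_d -> 'rV[R]_d) B :
  C1h K g D -> 0 <= A ->
  (forall x u : 'rV_d, `|phi (x + u) - phi x| <= A * `|u|) ->
  (forall x u : 'rV_d, `|u *m B x| <= A * `|u|) ->
  (forall x u : 'rV_d, `|phi (x + u) - phi x - u *m B x| <= A * `|u| `^ (1 + nu)) ->
  C1h (K * (A `^ (1 + nu) + A + 1)) (g \o phi) (fun x => B x *m D (phi x)).
Proof.
move=> [K0 gK DK gT] A0 phiL BA phiT; have p0 := powR_ge0 A (1 + nu).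
split.
- by rewrite mulr_ge0//; lra.
- by move=> x; apply: le_trans (gK _) _; rewrite ler_peMr//; lra.
- move=> x u; rewrite mulmxA; apply: le_trans (DK _ _) _.
  rewrite -mulrA ler_wpM2l//; apply: le_trans (BA _ _) _.
  by rewrite ler_wpM2r//; lra.
move=> x u /=.
pose w := phi (x + u) - phi x.
have -> : g (phi (x + u)) - g (phi x) - u *m (B x *m D (phi x)) =
  (g (phi x + w) - g (phi x) - w *m D (phi x)) + (w - u *m B x) *m D (phi x).
  by rewrite /w [phi x + _]addrC subrK mulmxA [(_ - u *m B x) *m _]mulmxBl addrA subrK.
apply: le_trans (ler_normD _ _) _.
have h1 := gT (phi x) w.
have h2 : `|w| `^ (1 + nu) <= A `^ (1 + nu) * `|u| `^ (1 + nu).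
  rewrite -powRM//; apply: powRnu_mono; first by case/andP: nu01 => n0 _; rewrite addr_ge0 ?ler01// ltW.
  by rewrite normr_ge0 phiL.
have h3 := DK (phi x) (w - u *m B x); have h4 := phiT x u.
have h5 : K * `|w| `^ (1 + nu) <= K * (A `^ (1 + nu) * `|u| `^ (1 + nu)) by exact: ler_wpM2l.
have h6 : K * `|w - u *m B x| <= K * (A * `|u| `^ (1 + nu)) by exact: ler_wpM2l.
have := mulr_ge0 K0 (powR_ge0 `|u| (1 + nu)); lra.
Qed.


(** The rows of [W t x] solve the variational equation started from the basis vectors. The Taylor
    remainder of the flow then solves the same linear equation with a forcing of order |u|^(1+nu),
    and Gronwall concludes. *)
Lemma flow_C1h (f : 'rV[R]_d -> 'rV[R]_d) (Df : 'rV[R]_d -> 'M[R]_d) (K T : R) (Psi : R -> 'rV[R]_d -> 'rV[R]_d) :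
  C1h K f Df -> 0 <= T -> (forall x, Psi 0 x = x) ->
  (forall x (t : R), is_derive t 1 (Psi^~ x) (f (Psi t x))) ->
  exists A (W : R -> 'rV[R]_d -> 'M[R]_d),
  [/\ 0 <= A, forall x, W 0 x = 1%:M,
      forall x (u : 'rV_d) (t : R),
        is_derive t 1 (fun s => u *m W s x) (u *m W t x *m Df (Psi t x)) &
      forall t x u, `|t| <= T -> [/\ `|Psi t (x + u) - Psi t x| <= A * `|u|,
       `|u *m W t x| <= A * `|u| &
       `|Psi t (x + u) - Psi t x - u *m W t x| <= A * `|u| `^ (1 + nu)]].
Proof.
move=> fC T0 Psi0 dPsi; have [K0 fK DK fT] := fC; have fL := C1h_lip fC.
have K20 : 0 <= 2 * K by rewrite mulr_ge0.
have Dh := taylor_holder K0 fT.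
have cPsi x : continuous (Psi^~ x) by move=> t; exact: is_derive_continuous (dPsi x t).
have hW x i : exists w : R -> 'rV[R]_d, w 0 = delta_mx 0 i /\
    forall t : R, is_derive t 1 w (w t *m Df (Psi t x)).
  apply: (@picard d (fun t v => v *m Df (Psi t x)) K K0 _ _ _ (K * `|delta_mx (0 : 'I_1) i : 'rV[R]_d|)) => //.
    by move=> t v w; rewrite -mulmxBl.
  move=> v t; apply/cvgrPdist_le => /= e e0.
  pose c := 6 * K * `|v| + 1; have c0 : 0 < c by rewrite /c; have := mulr_ge0 K0 (normr_ge0 v); lra.
  pose r := (e / c) `^ nu^-1; have r0 : 0 < r by rewrite powR_gt0// divr_gt0.
  near=> s.
  have h : `|Psi t x - Psi s x| <= r.
    by near: s; move/cvgrPdist_le: (cPsi x t); apply.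
  apply: le_trans (Dh _ _ _) _.
  have h2 : `|Psi t x - Psi s x| `^ nu <= e / c.
    case/andP: nu01 => n0 n1.
    have -> : e / c = r `^ nu by rewrite /r -powRrM mulVf ?gt_eqF// powRr1// divr_ge0// ltW.
    by apply: powRnu_mono; [exact: ltW|rewrite normr_ge0].
  apply: (@le_trans _ _ (c * (e / c))); last by rewrite mulrC divfK// gt_eqF.
  have := mulr_ge0 K0 (normr_ge0 v).
  have := powR_ge0 `|Psi t x - Psi s x| nu; rewrite /c.
  set P := _ `^ nu in h2 *; move=> P0 Kv.
  have -> : 6 * K * P * `|v| = 6 * K * `|v| * P by ring.
  apply: ler_pM => //; last by lra.
  by rewrite mulr_ge0// mulr_ge0.
pose wf x := projT1 (choice (hW x)).
have wf0 x i : wf x i 0 = delta_mx 0 i by exact: (projT2 (choice (hW x)) i).1.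
have dwf x i (t : R) : is_derive t 1 (wf x i) (wf x i t *m Df (Psi t x)).
  exact: (projT2 (choice (hW x)) i).2.
pose W t x := \matrix_(i < d) wf x i t.
have uW (u : 'rV_d) t x : u *m W t x = \sum_i u 0 i *: wf x i t.
  by rewrite mulmx_sum_row; apply: eq_bigr => i _; rewrite rowK.
have [C1 C10 hC1] := gronwall d K20 T0; have [C2 C20 hC2] := gronwall d K0 T0.
have PL t x u : `|t| <= T -> `|Psi t (x + u) - Psi t x| <= C1 * `|u|.
  move=> tT; have := hC1 (Psi^~ (x + u) - Psi^~ x) (fun s => f (Psi s (x + u)) - f (Psi s x)) 0 t (lexx _) tT.
  rewrite !fctE !Psi0 [x + u]addrC addrK addr0; apply.
  by move=> s _; rewrite addr0; exact: fL.
have dW x (u : 'rV_d) t : is_derive (t : R) (1 : R) (fun s => u *m W s x) (u *m W t x *m Df (Psi t x)).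
  apply/rv_is_derive => j.
  have -> : (fun s => (u *m W s x) 0 j) = \sum_i (fun s => u 0 i * wf x i s 0 j).
    apply/funext => s; rewrite uW summxE fct_sumE; apply: eq_bigr => i _; by rewrite mxE.
  rewrite uW mulmx_suml summxE; apply: is_derive_sum => i.
  have dj := (rv_is_derive _ _ _).1 (dwf x i t) j.
  apply: is_derive_eqval (is_deriveZ (u 0 i) dj) _.
  by rewrite -scalemxAl [RHS]mxE.
have W0 x : W 0 x = 1%:M.
  by apply/row_matrixP => i; rewrite rowK wf0 rowE mulmx1.
exists (C1 + C2 + C2 * (K * C1 `^ (1 + nu))), W; split => //.
  by rewrite !addr_ge0// !mulr_ge0// powR_ge0.
have p0 := mulr_ge0 C20 (mulr_ge0 K0 (powR_ge0 C1 (1 + nu))).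
move=> t x u tT; split.
- apply: le_trans (PL t x u tT) _; rewrite ler_wpM2r//; lra.
- have := hC2 (fun s => u *m W s x) (fun s => u *m W s x *m Df (Psi s x)) 0 t (lexx _) tT.
  rewrite W0 mulmx1 addr0 => h; apply: le_trans (h _ _) _.
    by move=> s _; rewrite addr0; exact: DK.
  by rewrite ler_wpM2r//; lra.
have := hC2 (fun s => Psi s (x + u) - Psi s x - u *m W s x)
  (fun s => f (Psi s (x + u)) - f (Psi s x) - u *m W s x *m Df (Psi s x))
  (K * (C1 * `|u|) `^ (1 + nu)) t.
rewrite !Psi0 W0 mulmx1 [x + u]addrC addrK subrr normr0 add0r => h.
apply: le_trans (h _ _ _ _) _ => //.
- by rewrite mulr_ge0// powR_ge0.
- move=> s hs; pose w := Psi s (u + x) - Psi s x.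
  have -> : f (Psi s (u + x)) - f (Psi s x) - u *m W s x *m Df (Psi s x) =
     (f (Psi s x + w) - f (Psi s x) - w *m Df (Psi s x)) + (w - u *m W s x) *m Df (Psi s x).
    rewrite /w [Psi s x + _]addrC subrK [(_ - u *m W s x) *m _]mulmxBl addrA subrK//.
  rewrite addrC; apply: le_trans (ler_normD _ _) _; rewrite addrC [X in _ <= X]addrC.
  apply: lerD; last exact: DK.
  apply: le_trans (fT _ _) _; apply: ler_wpM2l => //.
  apply: powRnu_mono; first by case/andP: nu01 => n0 _; rewrite addr_ge0 ?ler01// ltW.
  by have := PL s x u (le_trans (btw_le hs) tT); rewrite normr_ge0 /w [x + u]addrC.
rewrite powRM// mulrA mulrA -[C2 * K * _]mulrA ler_wpM2r ?powR_ge0//; lra.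
Unshelve. all: by end_near. Qed.


Lemma mulmx_bound m k (A : 'M[R]_(m, k)) :
  exists2 c : R, 0 <= c & forall u : 'rV_m, `|u *m A| <= c * `|u|.
Proof.
exists (\sum_i \sum_j `|A i j|).
  by apply: sumr_ge0 => i _; apply: sumr_ge0.
move=> u; apply: rv_norm_le => [|j].
  by apply: mulr_ge0 => //; apply: sumr_ge0 => i _; apply: sumr_ge0.
rewrite mxE mulr_suml; apply: le_trans (ler_norm_sum _ _ _) _; apply: ler_sum => i _.
rewrite normrM mulrC; apply: ler_pM => //; last exact: rv_coord_le.
by rewrite (bigD1 j)//= lerDl; apply: sumr_ge0.
Qed.


(** A piecewise quadratic ramp, C^1 with Lipschitz derivative: enough for the class C^{1+nu}, and
    explicit enough for its Taylor estimates to be settled piece by piece. Applying it twice, as in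
    [plateau], gives a step from 1 down to 0. *)
Definition ramp (t : R) : R := if t <= 0 then 0 else if t <= 1 then t ^+ 2 else 2 * t - 1.
Definition dramp (t : R) : R := if t <= 0 then 0 else if t <= 1 then 2 * t else 2.

Lemma rampP (t : R) : [\/ [/\ t <= 0, ramp t = 0 & dramp t = 0],
  [/\ 0 < t, t <= 1, ramp t = t ^+ 2 & dramp t = 2 * t]
  | [/\ 1 < t, ramp t = 2 * t - 1 & dramp t = 2]].
Proof.
rewrite /ramp /dramp; have [h|h] := leP t 0; first by apply: Or31.
by have [h2|h2] := leP t 1; [apply: Or32|apply: Or33].
Qed.

Lemma ramp_taylor (t v : R) : `|ramp (t + v) - ramp t - dramp t * v| <= v ^+ 2.
Proof.
case: (rampP t) => [[? ? ?]|[? ? ? ?]|[? ? ?]]; case: (rampP (t + v)) => [[? ? ?]|[? ? ? ?]|[? ? ?]];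
  rewrite ler_norml; apply/andP; split; nra.
Qed.

Lemma ramp_lip (t v : R) : `|ramp (t + v) - ramp t| <= 2 * `|v|.
Proof.
case: (leP 0 v) => v0; [rewrite (ger0_norm v0)|rewrite (ltr0_norm v0)];
 case: (rampP t) => [[? ? ?]|[? ? ? ?]|[? ? ?]]; case: (rampP (t + v)) => [[? ? ?]|[? ? ? ?]|[? ? ?]];
  rewrite ler_norml; apply/andP; split; nra.
Qed.

Lemma dramp_bound (t : R) : 0 <= dramp t <= 2.
Proof. by case: (rampP t) => -[? ?]; nra. Qed.

Definition plateau (t : R) : R := ramp (1 - ramp t).
Definition dplateau (t : R) : R := dramp (1 - ramp t) * - dramp t.

Lemma plateau1 (t : R) : t <= 0 -> plateau t = 1.
Proof. by move=> t0; rewrite /plateau {2}/ramp t0 subr0 /ramp lexx expr1n; case: leP => //; lra. Qed.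

Lemma plateau0 (t : R) : 1 <= t -> plateau t = 0 /\ dplateau t = 0.
Proof.
move=> t1; suff h : 1 - ramp t <= 0 by rewrite /plateau /dplateau /ramp /dramp -/(ramp t) h mul0r.
by case: (rampP t) => -[? ?]; nra.
Qed.

Lemma plateau_bound (t : R) : 0 <= plateau t <= 1.
Proof.
have r0 s : 0 <= ramp s by case: (rampP s) => -[? ?]; nra.
rewrite /plateau r0/=; have := r0 t; set s := 1 - _ => h.
have s1 : s <= 1 by rewrite /s; lra.
by case: (rampP s) => -[? ?]; nra.
Qed.

Lemma dplateau_bound (t : R) : `|dplateau t| <= 4.
Proof.
have := dramp_bound t; have := dramp_bound (1 - ramp t); rewrite /dplateau.
move=> /andP[? ?] /andP[? ?]; rewrite ler_norml; nra.
Qed.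

Lemma plateau_taylor (t v : R) :
  `|plateau (t + v) - plateau t - dplateau t * v| <= 6 * v ^+ 2.
Proof.
pose w := (1 - ramp (t + v)) - (1 - ramp t).
have h1 := ramp_taylor (1 - ramp t) w; rewrite [1 - ramp t + w]addrC subrK in h1.
have h2 := ramp_lip t v; have h3 := ramp_taylor t v; have h4 := dramp_bound (1 - ramp t).
rewrite /plateau /dplateau; set c := dramp (1 - ramp t) in h1 h4 *.
have wv : w ^+ 2 <= 4 * v ^+ 2.
  have -> : w = - (ramp (t + v) - ramp t) by rewrite /w; ring.
  rewrite sqrrN -[X in X <= _]real_normK ?num_real// -[v ^+ 2]real_normK ?num_real//.
  have := normr_ge0 (ramp (t + v) - ramp t); nra.
set e := ramp (t + v) - _ - _ in h3.
have we : w = - (dramp t * v) - e by rewrite /w /e; ring.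
have h5 : `|c * e| <= 2 * v ^+ 2.
  by case/andP: h4 => ? ?; rewrite normrM; apply: ler_pM => //; rewrite ger0_norm.
set A := ramp (1 - ramp (t + v)) in h1 *; set B := ramp (1 - ramp t) in h1 *.
have -> : A - B - c * - dramp t * v = (A - B - c * w) - c * e by rewrite we; ring.
apply: le_trans (ler_normB _ _) _; lra.
Qed.

(** The cutoff is a function of the Euclidean distance, whose square is a polynomial; comparing it
    with the sup norm costs the factor d. The parameter [a] sets the size of the region where the
    cutoff is 1. Estimates are given up to distance 4 rho, beyond the support of radius 2 rho, to
    leave room for displacements. *)
Lemma bump_exists (p : 'rV[R]_d) (rho a : R) : 0 < rho -> 0 <= a <= 1 ->
  exists K chi (Dchi : 'rV[R]_d -> 'M[R]_(d, 1)),
  [/\ 0 <= K, forall x, 0 <= chi x <= 1,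
      forall x, `|x - p| <= 4 * rho -> forall u : 'rV_d, `|(u *m Dchi x) 0 0| <= K * `|u|,
      forall x u, `|x - p| <= 4 * rho -> `|u| <= 8 * rho -> `|chi (x + u) - chi x - (u *m Dchi x) 0 0| <= K * `|u| ^+ 2
    & (forall x, d%:R * `|x - p| ^+ 2 <= a * rho ^+ 2 -> chi x = 1) /\
      (forall x, 2 * rho <= `|x - p| -> chi x = 0 /\ Dchi x = 0)].
Proof.
move=> r0 /andP[a0 a1].
pose q (x : 'rV[R]_d) := \sum_j (x 0 j - p 0 j) ^+ 2.
have r2 : 0 < rho ^+ 2 by exact: exprn_gt0.
pose th x := q x / rho ^+ 2 - a.
pose N : R := d%:R; have N0 : 0 <= N by rewrite /N.
pose Dq (x : 'rV[R]_d) : 'M[R]_(d, 1) := \matrix_(i, j) (2 * (x 0 i - p 0 i) / rho ^+ 2).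
have DqE (u x : 'rV[R]_d) : (u *m Dq x) 0 0 = (\sum_i 2 * (x 0 i - p 0 i) * u 0 i) / rho ^+ 2.
  rewrite mxE mulr_suml; apply: eq_bigr => i _; rewrite mxE; ring.
have thT (u x : 'rV[R]_d) : th (x + u) - th x = (u *m Dq x) 0 0 + (\sum_i u 0 i ^+ 2) / rho ^+ 2.
  rewrite DqE /th -mulrDl opprB addrA subrK -mulrBl; congr (_ / _).
  rewrite -sumrB -big_split; apply: eq_bigr => i _ /=; rewrite !mxE; ring.
pose K1 := N * (8 * rho) / rho ^+ 2.
pose K2 := N / rho ^+ 2.
have K10 : 0 <= K1 by rewrite /K1; apply: divr_ge0; [apply: mulr_ge0 => //; lra|exact: ltW].
have K20 : 0 <= K2 by apply: divr_ge0 => //; exact: ltW.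
have Dqb x (u : 'rV[R]_d) : `|x - p| <= 4 * rho -> `|(u *m Dq x) 0 0| <= K1 * `|u|.
  have ri : 0 <= (rho ^+ 2)^-1 by rewrite invr_ge0 ltW.
  move=> hx; rewrite DqE normrM (ger0_norm ri) /K1 [X in _ <= X]mulrAC.
  apply: ler_wpM2r => //.
  have -> : N * (8 * rho) * `|u| = \sum_(i < d) (8 * rho) * `|u|.
    by rewrite sumr_const card_ord -mulrA /N mulr_natl.
  apply: le_trans (ler_norm_sum _ _ _) _; apply: ler_sum => i _.
  rewrite normrM; apply: ler_pM => //; last exact: rv_coord_le.
  have := rv_coord_le (x - p) i; rewrite !mxE normrM [`|2|]ger0_norm//; lra.
have s2b (u : 'rV[R]_d) : 0 <= (\sum_i u 0 i ^+ 2) / rho ^+ 2 <= K2 * `|u| ^+ 2.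
  apply/andP; split.
    by apply: divr_ge0; [apply: sumr_ge0 => i _; exact: sqr_ge0|exact: ltW].
  rewrite /K2 [X in _ <= X]mulrAC; apply: ler_wpM2r; first by rewrite invr_ge0 ltW.
  exact: sum_sqr_le_norm.
pose K3 := K1 + K2 * (8 * rho).
have K30 : 0 <= K3 by rewrite /K3 addr_ge0// mulr_ge0//; lra.
have thb x (u : 'rV[R]_d) : `|x - p| <= 4 * rho -> `|u| <= 8 * rho -> `|th (x + u) - th x| <= K3 * `|u|.
  move=> hx hu; rewrite thT; apply: le_trans (ler_normD _ _) _; rewrite /K3 mulrDl; apply: lerD; first exact: Dqb.
  case/andP: (s2b u) => h1 h2; rewrite ger0_norm//; apply: le_trans h2 _.
  by rewrite expr2 -mulrA; apply: ler_wpM2l => //; apply: ler_wpM2r.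
pose K := 4 * K1 + 6 * K3 ^+ 2 + 4 * K2.
have K32 := sqr_ge0 K3.
exists K, (fun x => plateau (th x)), (fun x => dplateau (th x) *: Dq x); split.
- by rewrite /K; lra.
- by move=> x; exact: plateau_bound.
- move=> x hx u; rewrite -scalemxAr mxE normrM.
  apply: (@le_trans _ _ (4 * (K1 * `|u|))).
    apply: ler_pM => //; [exact: dplateau_bound|exact: Dqb].
  rewrite mulrA ler_wpM2r// /K; lra.
- move=> x u hx hu; rewrite -scalemxAr mxE.
  have := plateau_taylor (th x) (th (x + u) - th x).
  rewrite [th x + _]addrC subrK => h1.
  set A := plateau (th (x + u)) - plateau (th x) in h1 *.
  have -> : A - dplateau (th x) * (u *m Dq x) 0 0 =
    (A - dplateau (th x) * (th (x + u) - th x)) + dplateau (th x) * ((\sum_i u 0 i ^+ 2) / rho ^+ 2).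
    by rewrite thT; ring.
  apply: le_trans (ler_normD _ _) _.
  have h2 : (th (x + u) - th x) ^+ 2 <= K3 ^+ 2 * `|u| ^+ 2.
    rewrite -exprMn -[X in X <= _]real_normK ?num_real// ler_sqr ?nnegrE ?mulr_ge0//.
    exact: thb.
  have h3 : `|dplateau (th x) * ((\sum_i u 0 i ^+ 2) / rho ^+ 2)| <= 4 * (K2 * `|u| ^+ 2).
    case/andP: (s2b u) => s1 s2; rewrite normrM; apply: ler_pM => //; first exact: dplateau_bound.
    by rewrite ger0_norm.
  have := mulr_ge0 K10 (sqr_ge0 `|u|); rewrite /K; lra.
split=> x hx.
  apply: plateau1; rewrite /th subr_le0 ler_pdivrMr//; apply: le_trans hx.
  apply: le_trans (sum_sqr_le_norm (x - p)); apply: ler_sum => j _; by rewrite !mxE.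
have h : 1 <= th x.
  rewrite /th lerBrDr ler_pdivlMr//.
  have := sqr_norm_le_sum (x - p).
  have -> : \sum_j (x - p) 0 j ^+ 2 = q x by apply: eq_bigr => j _; rewrite !mxE.
  have : (2 * rho) ^+ 2 <= `|x - p| ^+ 2 by rewrite ler_sqr ?nnegrE//; lra.
  nra.
by have [-> ->] := plateau0 h; rewrite scale0r.
Qed.

Lemma is_derive_line k (h : 'rV[R]_d -> 'rV[R]_k) (x u : 'rV[R]_d) df (s : R) :
  is_derive (x + s *: u) u h df -> is_derive s 1 (fun s => h (x + s *: u)) df.
Proof.
move=> hd.
have E : (fun t : R => t^-1 *: (h (x + (t *: (1 : R) + s) *: u) - h (x + s *: u))) =
         (fun t : R => t^-1 *: (h (t *: u + (x + s *: u)) - h (x + s *: u))).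
  apply/funext => t; congr (_ *: (h _ - _)).
  have -> : t *: (1 : R) = t by rewrite /GRing.scale/= mulr1.
  by rewrite scalerDl addrCA.
split.
  by have := @ex_derive _ _ _ _ _ _ _ hd; rewrite /derivable /= => hh; rewrite E.
by rewrite -(@derive_val _ _ _ _ _ _ _ hd) /derive /= E.
Qed.

(** Mean value theorem in each coordinate along the segment from x to x + u, which stays in the
    ball; the Hölder bound then compares the differential at the intermediate point with the one at
    x. *)
Lemma C1_holder_taylor k (U : set 'rV[R]_d) (h : 'rV[R]_d -> 'rV[R]_k) (p : 'rV[R]_d) (r : R) :
  0 < r -> C1_holder nu U h -> (forall x, `|x - p| <= r -> U x) ->
  exists2 K : R, 0 <= K & forall x, `|x - p| <= r ->
    [/\ `|h x| <= K, forall u, `|'d h x u| <= K * `|u|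
      & forall u, `|x + u - p| <= r -> `|h (x + u) - h x - 'd h x u| <= K * `|u| `^ (1 + nu)].
Proof.
move=> r0 [dh hh] BU; case/andP: nu01 => n0 n1.
pose B := [set x : 'rV[R]_d | `|x - p| <= r].
have cB : compact B.
  apply: bounded_closed_compact.
    exists (`|p| + r); split; first exact: num_real.
    move=> M hM x /= xB; apply: le_trans (ltW hM).
    by have := ler_normD (x - p) p; rewrite subrK => /le_trans; apply; rewrite addrC lerD2l.
  have -> : B = (fun x => `|x - p|) @^-1` [set t | t <= r] by [].
  apply: preimage_closed; last exact: closed_le.
  move=> x _; apply: loc_lip_continuous => {}x; exists 1, 1; split => // y _; rewrite mul1r.
  apply: le_trans (ler_dist_dist _ _) _.
  by rewrite opprB addrA subrK.
have [L hL] := hh B cB BU.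
have Lnn : 0 <= `|L| by [].
have hL' x y v : B x -> B y -> `|'d h x v - 'd h y v| <= `|L| * `|x - y| `^ nu * `|v|.
  move=> Bx By; apply: le_trans (hL x y v Bx By) _.
  by do 2![apply: ler_wpM2r => //; rewrite ?powR_ge0//]; exact: ler_norm.
have T x u : B x -> B (x + u) -> `|h (x + u) - h x - 'd h x u| <= `|L| * `|u| `^ (1 + nu).
  move=> Bx Bxu.
  have seg (s : R) : 0 <= s <= 1 -> B (x + s *: u).
    move=> /andP[s0 s1]; rewrite /B/=.
    have -> : x + s *: u - p = s *: (x + u - p) + (1 - s) *: (x - p).
      by apply/rowP => j; rewrite !mxE; ring.
    apply: le_trans (ler_normD _ _) _; rewrite !normrZ (ger0_norm s0) ger0_norm ?subr_ge0//.
    have -> : r = s * r + (1 - s) * r by ring.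
    by apply: lerD; apply: ler_wpM2l => //; rewrite subr_ge0.
  apply: rv_norm_le => [|j]; first by rewrite mulr_ge0 ?powR_ge0.
  have dphi (s : R) : 0 <= s <= 1 -> is_derive s 1 (fun s => h (x + s *: u) 0 j) ('d h (x + s *: u) u 0 j).
    move=> hs; apply: (rv_is_derive (fun s => h (x + s *: u)) _ _).1.
    apply: is_derive_line.
    have dh' : differentiable h (x + s *: u) by apply: dh; apply: BU; exact: seg.
    by apply: DeriveDef; [exact: diff_derivable|rewrite deriveE].
  have [||c c01 E] := @MVT _ (fun s => h (x + s *: u) 0 j) (fun s => 'd h (x + s *: u) u 0 j) 0 1 ltr01.
  - by move=> s; rewrite in_itv/= => /andP[? ?]; apply: dphi; rewrite !ltW.
  - apply/continuous_in_subspaceT => s; rewrite inE/= in_itv/= => hs.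
    exact: is_derive_continuous1 (dphi s hs).
  rewrite scale1r scale0r addr0 subr0 mulr1 in E.
  have c01' : 0 <= c <= 1 by move: c01; rewrite in_itv/= => /andP[? ?]; rewrite !ltW.
  rewrite !mxE E.
  have := hL' _ _ u (seg c c01') Bx; have := rv_coord_le ('d h (x + c *: u) u - 'd h x u) j.
  rewrite !mxE [x + _]addrC addrK => /le_trans /[apply] /le_trans; apply.
  rewrite normrZ powRD ?(gt_eqF (addr_gt0 ltr01 n0))// powRr1// [_ * (_ `^ nu)]mulrC mulrA.
  apply: ler_wpM2r => //; apply: ler_wpM2l => //.
  case/andP: c01' => c0 c1; apply: powRnu_mono; first exact: ltW.
  by rewrite mulr_ge0//= ler_piMl// ger0_norm.
have [c c0 hc] := mulmx_bound (lin1_mx ('d h p)).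
have Bp : B p by rewrite /B/= subrr normr0 ltW.
pose K1 := c + `|L| * r `^ nu.
have K10 : 0 <= K1 by rewrite addr_ge0// mulr_ge0// powR_ge0.
have dB x u : B x -> `|'d h x u| <= K1 * `|u|.
  move=> Bx; have := ler_normD ('d h x u - 'd h p u) ('d h p u); rewrite subrK => /le_trans; apply.
  rewrite /K1 mulrDl addrC; apply: lerD; first by have := hc u; rewrite mul_rV_lin1.
  apply: le_trans (hL' x p u Bx Bp) _; apply: ler_wpM2r => //; apply: ler_wpM2l => //.
  by apply: powRnu_mono; [exact: ltW|rewrite normr_ge0].
pose K2 := `|h p| + K1 * r + `|L| * r `^ (1 + nu).
have K20 : 0 <= K2 by rewrite /K2 !addr_ge0 ?mulr_ge0// ?powR_ge0// ltW.
exists (K1 + K2 + `|L|); first by apply: addr_ge0 => //; exact: addr_ge0.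
move=> x Bx; split.
- apply: (@le_trans _ _ K2); last by lra.
  have := T p (x - p) Bp; rewrite [p + _]addrC subrK => /(_ Bx) h1.
  have := ler_normD (h x - h p - 'd h p (x - p)) ('d h p (x - p) + h p).
  rewrite addrA !subrK => /le_trans; apply.
  rewrite /K2 addrC; apply: lerD.
    apply: le_trans (ler_normD _ _) _; rewrite addrC lerD2l.
    apply: le_trans (dB p _ Bp) _; exact: ler_wpM2l.
  apply: le_trans h1 _; apply: ler_wpM2l => //; apply: powRnu_mono; first by rewrite addr_ge0 ?ler01// ltW.
  by rewrite normr_ge0.
- move=> u; apply: le_trans (dB x u Bx) _; rewrite ler_wpM2r//; lra.
- move=> u Bxu; apply: le_trans (T x u Bx Bxu) _; rewrite ler_wpM2r ?powR_ge0//; lra.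
Qed.

(** Where [h] vanishes the derivative of the cutoff drops out, so the differential of the product is
    [chi x] times that of [h]: a regular equation stays regular wherever [chi] is positive. *)
Lemma cutoff_C1h k (U : set 'rV[R]_d) (h : 'rV[R]_d -> 'rV[R]_k) (p : 'rV[R]_d) (rho a : R) :
  0 < rho -> 0 <= a <= 1 -> C1_holder nu U h -> (forall x, `|x - p| <= 4 * rho -> U x) ->
  exists K chi D,
  [/\ C1h K (fun x => chi x *: h x) D, forall x : 'rV[R]_d, 0 <= chi x <= 1,
      continuous chi,
      forall x u, h x = 0 -> U x -> u *m D x = chi x *: 'd h x u
    & (forall x, d%:R * `|x - p| ^+ 2 <= a * rho ^+ 2 -> chi x = 1) /\
      (forall x, 2 * rho <= `|x - p| -> chi x = 0)].
Proof.
move=> r0 a01 hC BU; have [dh _] := hC; case/andP: nu01 => n0 n1.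
have r40 : 0 < 4 * rho by rewrite mulr_gt0.
have [Kh Kh0 hh] := C1_holder_taylor r40 hC BU.
have [Kc [chi [Dchi [Kc0 chi01 Dchib chiT [chi1 chi0]]]]] := bump_exists p r0 a01.
pose g x := chi x *: h x.
pose D x := if `|x - p| <= 4 * rho then chi x *: lin1_mx ('d h x) + Dchi x *m h x else 0.
have DE x (u : 'rV_d) : `|x - p| <= 4 * rho ->
    u *m D x = chi x *: 'd h x u + (u *m Dchi x) 0 0 *: h x.
  move=> hx; rewrite /D hx mulmxDr -scalemxAr mul_rV_lin1 mulmxA; congr (_ + _).
  by rewrite [u *m Dchi x]mx11_scalar mul_scalar_mx !mxE eqxx.
have far x : 2 * rho <= `|x - p| -> g x = 0 /\ D x = 0.
  move=> hx; have [c0 d0] := chi0 _ hx; split; first by rewrite /g c0 scale0r.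
  by rewrite /D c0 d0 mul0mx scale0r addr0; case: ifP.
have [chin chil] : (forall x, `|chi x| <= 1) /\ True.
  by split=> // x; case/andP: (chi01 x) => ? ?; rewrite ger0_norm.
pose K1 := Kh + Kc * Kh.
have K10 : 0 <= K1 by rewrite /K1 addr_ge0// mulr_ge0.
have gb x : `|g x| <= K1.
  have [hx|hx] := leP `|x - p| (4 * rho); last first.
    have hx2 : 2 * rho <= `|x - p| by lra.
    by have [-> _] := far x hx2; rewrite normr0.
  have [h1 _ _] := hh x hx; rewrite /g normrZ.
  apply: (@le_trans _ _ (1 * Kh)); first exact: ler_pM.
  rewrite /K1 mul1r lerDl mulr_ge0//.
have Db x (u : 'rV_d) : `|u *m D x| <= K1 * `|u|.
  have [hx|hx] := leP `|x - p| (4 * rho); last first.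
    have hx2 : 2 * rho <= `|x - p| by lra.
    by have [_ ->] := far x hx2; rewrite mulmx0 normr0 mulr_ge0.
  have [h1 h2 _] := hh x hx; rewrite DE//; apply: le_trans (ler_normD _ _) _.
  rewrite /K1 mulrDl; apply: lerD; rewrite normrZ.
    by apply: (@le_trans _ _ (1 * (Kh * `|u|))); [exact: ler_pM|rewrite mul1r].
  rewrite mulrAC; apply: ler_pM => //; exact: Dchib.
have big (x u : 'rV[R]_d) : rho <= `|u| -> `|g (x + u) - g x - u *m D x| <= (3 * K1 * (rho^-1 + 1) * rho `^ (- nu)) * `|u| `^ (1 + nu).
  move=> hu; have u0 : 0 < `|u| by exact: lt_le_trans hu.
  apply: le_trans (ler_normB _ _) _.
  have h1 := ler_normB (g (x + u)) (g x); have h2 := gb x; have h3 := gb (x + u); have h4 := Db x u.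
  have h5 : 1 <= rho `^ (- nu) * `|u| `^ nu.
    rewrite powRN mulrC ler_pdivlMr ?powR_gt0// mul1r.
    by apply: powRnu_mono; [exact: ltW|rewrite ltW].
  have h6 : 1 <= rho^-1 * `|u| by rewrite mulrC ler_pdivlMr// mul1r.
  have -> : `|u| `^ (1 + nu) = `|u| * `|u| `^ nu.
    by rewrite powRD ?(gt_eqF (addr_gt0 ltr01 n0))// powRr1.
  apply: (@le_trans _ _ (3 * K1 * ((rho^-1 + 1) * `|u|))).
    rewrite mulrDl mul1r; have := mulr_ge0 K10 (ltW u0).
    have := ler_wpM2l K10 h6; rewrite mulr1; lra.
  have -> : 3 * K1 * (rho^-1 + 1) * rho `^ (- nu) * (`|u| * `|u| `^ nu) =
     3 * K1 * ((rho^-1 + 1) * `|u|) * (rho `^ (- nu) * `|u| `^ nu) by ring.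
  by rewrite ler_peMr// !mulr_ge0// addr_ge0// invr_ge0 ltW.
pose K2 := Kh + Kc * (8 * rho) `^ (1 - nu) * Kh + (Kc + Kc * (8 * rho)) * (8 * rho) `^ (1 - nu) * Kh.
have sq (u : 'rV[R]_d) : `|u| <= 8 * rho -> `|u| ^+ 2 <= (8 * rho) `^ (1 - nu) * `|u| `^ (1 + nu).
  move=> hu; have [->|u0] := eqVneq u 0; first by rewrite normr0 expr0n/= mulr_ge0 ?powR_ge0.
  have -> : `|u| ^+ 2 = `|u| `^ (1 - nu) * `|u| `^ (1 + nu).
    rewrite -powRD; last by rewrite normr_eq0 u0 implybT.
    have -> : 1 - nu + (1 + nu) = 2%:R by ring.
    by rewrite powR_mulrn.
  by rewrite ler_wpM2r ?powR_ge0//; apply: powRnu_mono; [rewrite subr_ge0|rewrite normr_ge0].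
have near x u : `|x - p| <= 4 * rho -> `|x + u - p| <= 4 * rho ->
    `|g (x + u) - g x - u *m D x| <= K2 * `|u| `^ (1 + nu).
  move=> hx hxu.
  have hu : `|u| <= 8 * rho.
    have := ler_normB (x + u - p) (x - p).
    have -> : x + u - p - (x - p) = u by apply/rowP => j; rewrite !mxE; ring.
    lra.
  have [h1 h2 /(_ u hxu) h3] := hh x hx; have h4 := chiT x u hx hu; have h5 := Dchib x hx u.
  rewrite DE// /g.
  have -> : chi (x + u) *: h (x + u) - chi x *: h x - (chi x *: 'd h x u + (u *m Dchi x) 0 0 *: h x)
    = chi (x + u) *: (h (x + u) - h x - 'd h x u) + (chi (x + u) - chi x) *: 'd h x u
      + (chi (x + u) - chi x - (u *m Dchi x) 0 0) *: h x.
    by apply/rowP => j; rewrite !mxE; ring.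
  have sqh := sq u hu.
  have h6 : `|chi (x + u) - chi x| <= (Kc + Kc * (8 * rho)) * `|u|.
    have := ler_normD (chi (x + u) - chi x - (u *m Dchi x) 0 0) ((u *m Dchi x) 0 0).
    rewrite subrK => /le_trans; apply.
    have : Kc * `|u| ^+ 2 <= Kc * ((8 * rho) * `|u|) by rewrite expr2 ler_wpM2l// ler_wpM2r.
    by rewrite mulrDl; lra.
  have [P PE] : {P : R | P = `|u| `^ (1 + nu)} by exists (`|u| `^ (1 + nu)).
  have [Z ZE] : {Z : R | Z = (8 * rho) `^ (1 - nu)} by exists ((8 * rho) `^ (1 - nu)).
  have Z0 : 0 <= Z by rewrite ZE powR_ge0.
  have P0 : 0 <= P by rewrite PE powR_ge0.
  have C30 : 0 <= Kc + Kc * (8 * rho) by rewrite addr_ge0// !mulr_ge0// ltW.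
  have e1 : `|chi (x + u) *: (h (x + u) - h x - 'd h x u)| <= Kh * P.
    rewrite normrZ PE; apply: (@le_trans _ _ (1 * (Kh * `|u| `^ (1 + nu)))); first exact: ler_pM.
    by rewrite mul1r.
  have e2 : `|(chi (x + u) - chi x - (u *m Dchi x) 0 0) *: h x| <= Kc * Z * Kh * P.
    rewrite normrZ; apply: (@le_trans _ _ (Kc * `|u| ^+ 2 * Kh)); first exact: ler_pM.
    rewrite [X in _ <= X]mulrAC ler_wpM2r// -mulrA ler_wpM2l// ZE PE//.
  have e3 : `|(chi (x + u) - chi x) *: 'd h x u| <= (Kc + Kc * (8 * rho)) * Z * Kh * P.
    rewrite normrZ.
    apply: (@le_trans _ _ (((Kc + Kc * (8 * rho)) * `|u|) * (Kh * `|u|))); first exact: ler_pM.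
    have -> : (Kc + Kc * (8 * rho)) * `|u| * (Kh * `|u|) = (Kc + Kc * (8 * rho)) * Kh * `|u| ^+ 2 by ring.
    have -> : (Kc + Kc * (8 * rho)) * Z * Kh * P = (Kc + Kc * (8 * rho)) * Kh * (Z * P) by ring.
    by apply: ler_wpM2l; [exact: mulr_ge0|rewrite ZE PE].
  apply: le_trans (ler_normD _ _) _; apply: le_trans (lerD (ler_normD _ _) (lexx _)) _.
  rewrite /K2 -ZE -PE; move: e1 e2 e3; clear; lra.
pose K3 := 3 * K1 * (rho^-1 + 1) * rho `^ (- nu).
have K30 : 0 <= K3.
  by rewrite /K3 !mulr_ge0 ?powR_ge0// addr_ge0// invr_ge0 ltW.
have K20 : 0 <= K2.
  by rewrite /K2 !addr_ge0 ?mulr_ge0 ?powR_ge0 ?addr_ge0 ?mulr_ge0// ltW.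
have K123 : 0 <= K1 + K2 + K3 by apply: addr_ge0 => //; exact: addr_ge0.
have gC : C1h (K1 + K2 + K3) g D.
  split => //.
  - by move=> x; apply: le_trans (gb x) _; lra.
  - by move=> x u; apply: le_trans (Db x u) _; rewrite ler_wpM2r//; lra.
  move=> x u.
  have [hu|hu] := leP rho `|u|.
    apply: le_trans (big x u hu) _; rewrite ler_wpM2r ?powR_ge0// /K3; lra.
  have fin : `|x - p| <= 4 * rho -> `|x + u - p| <= 4 * rho ->
     `|g (x + u) - g x - u *m D x| <= (K1 + K2 + K3) * `|u| `^ (1 + nu).
    move=> a1 a2; apply: le_trans (near x u a1 a2) _; rewrite ler_wpM2r ?powR_ge0//; lra.
  have e1 := ler_normB (x + u - p) u.
  have e2 := ler_normD (x - p) u.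
  have q1 : x + u - p - u = x - p by apply/rowP => j; rewrite !mxE; ring.
  have q2 : x - p + u = x + u - p by apply/rowP => j; rewrite !mxE; ring.
  rewrite q1 in e1; rewrite q2 in e2.
  (* A displacement shorter than rho either keeps both ends within 4 rho, where the local expansions
     hold, or has both ends beyond 2 rho, where [g] and [D] vanish. *)
  have [a1|a1] := leP `|x - p| (2 * rho); first by apply: fin; lra.
  have [a2|a2] := leP `|x + u - p| (2 * rho); first by apply: fin; lra.
  have [-> ->] := far _ (ltW a1); have [-> _] := far _ (ltW a2).
  by rewrite subrr mulmx0 subrr normr0 mulr_ge0 ?powR_ge0.
exists (K1 + K2 + K3), chi, D; split => //.
- apply: loc_lip_continuous => x; exists (Kc + Kc * (8 * rho)), rho; split => // y hy.
  have c0 : 0 <= Kc + Kc * (8 * rho) by have := mulr_ge0 Kc0 (ltW r0); lra.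
  have [hx|hx] := leP `|x - p| (3 * rho); last first.
    have e1 := ler_normD (y - p) (x - y); rewrite [y - p + _]addrC addrA subrK (distrC x y) in e1.
    have hx2 : 2 * rho <= `|x - p| by lra.
    have hy2 : 2 * rho <= `|y - p| by lra.
    by rewrite (chi0 x hx2).1 (chi0 y hy2).1 subrr normr0 mulr_ge0.
  have hx4 : `|x - p| <= 4 * rho by lra.
  have hy8 : `|y - x| <= 8 * rho by lra.
  have := chiT x (y - x) hx4 hy8; have := Dchib x hx4 (y - x).
  rewrite [x + _]addrC subrK => a1 a2.
  have := ler_normD (chi y - chi x - ((y - x) *m Dchi x) 0 0) (((y - x) *m Dchi x) 0 0).
  rewrite subrK => /le_trans; apply.
  have : Kc * `|y - x| ^+ 2 <= Kc * ((8 * rho) * `|y - x|).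
    by rewrite expr2; apply: ler_wpM2l => //; apply: ler_wpM2r.
  by rewrite mulrDl; lra.
- move=> x u hx0 Ux; have [hx|hx] := leP `|x - p| (4 * rho).
    by rewrite DE// hx0 scaler0 addr0.
  have hx' : 2 * rho <= `|x - p| by lra.
  by have [_ ->] := far _ hx'; have [-> _] := chi0 _ hx'; rewrite mulmx0 scale0r.
- by split=> // x hx; have [] := chi0 x hx.
Qed.

End Class.

End Norms.

(** * Geometry near the invariant set *)

Section InnerProduct.
Context {R : realType} {d : nat}.
Variable ip : {dot 'rV[R]_d for idfun}.
Local Notation V := 'rV[R]_d.

Lemma ip_sym (x y : V) : ip x y = ip y x.
Proof. by rewrite hermC expr0 mul1r. Qed.

Lemma ipxx_ge0 (x : V) : 0 <= ip x x.
Proof.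
have [->|/neq0_dnorm_gt0 h] := eqVneq x 0; last exact: ltW.
by rewrite linear0l.
Qed.

Lemma ipxx_eq0 (x : V) : ip x x = 0 -> x = 0.
Proof.
move=> h; apply/eqP/negPn/negP => /(@neq0_dnorm_gt0 _ _ _ ip).
by rewrite h ltxx.
Qed.

Lemma ip_cauchy_schwarz (x y : V) : `|ip x y| <= ip_norm ip x * ip_norm ip y.
Proof.
rewrite /ip_norm -sqrtrM ?ipxx_ge0// -sqrtr_sqr ler_sqrt ?mulr_ge0 ?ipxx_ge0//.
have [->|y0] := eqVneq y 0; first by have e0 (z : V) : ip z 0 = 0 by [rewrite linear0r]; rewrite !e0 expr0n/= mulr0.
have yy := @neq0_dnorm_gt0 _ _ _ ip y y0.
have := ipxx_ge0 (ip y y *: x - ip x y *: y).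
rewrite linearBl !linearBr !linearZl_LR !linearZr_LR /= /GRing.scale/= (ip_sym y x).
set a := ip x y; set b := ip y y in yy *; set c := ip x x => h.
have : 0 <= b * (c * b - a ^+ 2) by lra.
by rewrite pmulr_rge0// subr_ge0.
Qed.

Lemma ip_normZ (a : R) (x : V) : ip_norm ip (a *: x) = `|a| * ip_norm ip x.
Proof.
rewrite /ip_norm linearZl_LR linearZr_LR /= /GRing.scale/= mulrA -expr2.
by rewrite sqrtrM ?sqr_ge0// sqrtr_sqr.
Qed.

(** The Gram matrix of the standard basis is invertible because the form is definite. *)
Lemma riesz (a : 'cV[R]_d) : exists v : V, forall u : V, (u *m a) 0 0 = ip u v.
Proof.
pose G : 'M[R]_d := \matrix_(i, j) ip (delta_mx 0 i) (delta_mx 0 j).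
have Gip (u v : V) : ip u v = (u *m G *m v^T) 0 0.
  rewrite [in LHS](row_sum_delta u) linear_sumlz/= -mulmxA mxE; apply: eq_bigr => i _.
  rewrite linearZl_LR /= /GRing.scale/=; congr (_ * _).
  rewrite [in LHS](row_sum_delta v) linear_sumr/= mxE; apply: eq_bigr => j _.
  by rewrite linearZr_LR /= /GRing.scale/= !mxE mulrC.
have Gf : row_free G.
  rewrite -kermx_eq0; apply/eqP/row_matrixP => i; rewrite row0; apply: ipxx_eq0.
  rewrite Gip; have -> : row i (kermx G) *m G = 0.
    by rewrite -row_mul mulmx_ker row0.
  by rewrite !mul0mx mxE.
have Gu : G \in unitmx by rewrite -row_free_unit.
exists (invmx G *m a)^T => u; by rewrite Gip trmxK mulmxA -[u *m G *m _]mulmxA mulmxV// mulmx1.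
Qed.

Lemma ip_norm_equiv : exists c1 c2 : R, [/\ 0 < c1, 0 < c2,
  forall x, ip_norm ip x <= c2 * `|x| & forall x, `|x| <= c1 * ip_norm ip x].
Proof.
have h1 : exists2 c, 0 <= c & forall x, ip_norm ip x <= c * `|x|.
  pose S2 := \sum_i \sum_j `|ip (delta_mx 0 i : V) (delta_mx 0 j)|.
  have S20 : 0 <= S2 by apply: sumr_ge0 => i _; apply: sumr_ge0.
  exists (Num.sqrt S2) => [|x]; first exact: sqrtr_ge0.
  have -> : Num.sqrt S2 * `|x| = Num.sqrt (S2 * `|x| ^+ 2).
    by rewrite sqrtrM// sqrtr_sqr normr_id.
  rewrite /ip_norm ler_sqrt ?mulr_ge0 ?sqr_ge0//.
  rewrite {1 2}(row_sum_delta x) linear_sumlz/= /S2 mulr_suml; apply: ler_sum => i _.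
  rewrite linear_sumr/= mulr_suml; apply: ler_sum => j _.
  rewrite linearZl_LR linearZr_LR /= /GRing.scale/= mulrA.
  apply: le_trans (ler_norm _) _; rewrite normrM mulrC; apply: ler_wpM2l => //.
  by rewrite normrM expr2; apply: ler_pM => //; exact: rv_coord_le.
have h2 : exists2 c, 0 <= c & forall x, `|x| <= c * ip_norm ip x.
  have [v hv] := choice (fun j : 'I_d => riesz (delta_mx j 0)).
  have vE (x : V) j : x 0 j = ip x (v j).
    by rewrite -hv -colE mxE.
  exists (\sum_j ip_norm ip (v j)) => [|x].
    by apply: sumr_ge0 => j _; exact: sqrtr_ge0.
  have n0 y : 0 <= ip_norm ip y by exact: sqrtr_ge0.
  apply: rv_norm_le => [|j]; first by rewrite mulr_ge0// sumr_ge0.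
  rewrite vE; apply: le_trans (ip_cauchy_schwarz _ _) _; rewrite mulrC ler_wpM2r//.
  by rewrite (bigD1 j)//= lerDl sumr_ge0.
have [c2 c20 hc2] := h1; have [c1 c10 hc1] := h2.
exists (c1 + 1), (c2 + 1); split; [lra|lra| |] => x.
  by apply: le_trans (hc2 x) _; rewrite ler_wpM2r//; lra.
apply: le_trans (hc1 x) _; rewrite ler_wpM2r//; [exact: sqrtr_ge0|lra].
Qed.

Lemma orthproj_id (W : {vspace V}) Q (x : V) : is_orthproj ip W Q -> x \in W -> x *m Q = x.
Proof.
move=> hQ xW; apply/esym/eqP; rewrite -subr_eq0; apply/eqP/ipxx_eq0.
have [h1 h2] := hQ x; apply: h2; exact: memvB.
Qed.

End InnerProduct.

Lemma diff_of_bound (R : realType) (V W : normedModType R) (g : V -> W) (A : {linear V -> W}) (p : V) :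
  continuous A ->
  (forall e : R, 0 < e -> \forall u \near 0, `|g (u + p) - g p - A u| <= e * `|u|) ->
  differentiable g p /\ forall u, 'd g p u = A u.
Proof.
move=> cA h.
have E : g \o shift p = cst (g p) + A +o_ 0 id.
  apply/eqaddoP => e e0; have := h e e0; apply: filterS => u /=.
  by rewrite !fctE/= opprD addrA.
have dE := diff_unique cA E.
split; last by move=> u; rewrite dE.
by apply/diff_locallyP; rewrite dE.
Qed.

Section Local.
Context {R : realType} {d : nat}.
Local Notation V := 'rV[R]_d.
Variable nu : R.
Hypothesis nu01 : 0 < nu <= 1.

Lemma taylor_diff k (g : V -> 'rV[R]_k) (A : 'M[R]_(d, k)) (K r : R) (p : V) :
  0 < r -> (forall u, `|u| < r -> `|g (p + u) - g p - u *m A| <= K * `|u| `^ (1 + nu)) ->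
  differentiable g p /\ forall u, 'd g p u = u *m A.
Proof.
move=> r0 hg; case/andP: nu01 => n0 n1.
apply: (diff_of_bound (A := mulmxr A)).
  have [c c0 hc] := mulmx_bound A.
  apply: loc_lip_continuous => x; exists c, 1; split => // y _ /=.
  by rewrite -mulmxBl.
move=> e e0.
have K1 : 0 < `|K| + 1 by have := normr_ge0 K; lra.
have [s sE] : {s : R | s = (e / (`|K| + 1)) `^ nu^-1} by exists ((e / (`|K| + 1)) `^ nu^-1).
have s0 : 0 < s by rewrite sE powR_gt0// divr_gt0.
near=> u.
have u1 : `|u| < r by near: u; have := @near_dist_lt _ V 0 r r0; apply: filterS => y; rewrite subr0.
have u2 : `|u| < s by near: u; have := @near_dist_lt _ V 0 s s0; apply: filterS => y; rewrite subr0.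
have := hg u u1; rewrite [p + u]addrC => h.
apply: le_trans h _.
have -> : `|u| `^ (1 + nu) = `|u| * `|u| `^ nu.
  by rewrite powRD ?(gt_eqF (addr_gt0 ltr01 n0))// powRr1.
rewrite mulrCA mulrC; apply: ler_wpM2r => //.
have h3 : `|u| `^ nu <= e / (`|K| + 1).
  have -> : e / (`|K| + 1) = s `^ nu by rewrite sE -powRrM mulVf ?gt_eqF// powRr1// divr_ge0// ltW.
  by apply: powRnu_mono; [exact: ltW|rewrite normr_ge0 ltW].
apply: (@le_trans _ _ ((`|K| + 1) * `|u| `^ nu)).
  rewrite ler_wpM2r ?powR_ge0//; have := ler_norm K; lra.
by rewrite mulrC -ler_pdivlMr.
Unshelve. all: by end_near. Qed.

Lemma taylor_chain k (g : V -> 'rV[R]_k) (A : 'M[R]_(d, k)) (K r : R) (c : R -> V) (v : V) (t : R) :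
  0 < r -> (forall u, `|u| < r -> `|g (c t + u) - g (c t) - u *m A| <= K * `|u| `^ (1 + nu)) ->
  is_derive t 1 c v -> is_derive t 1 (g \o c) (v *m A).
Proof.
move=> r0 hg dc; have [dg dgE] := taylor_diff r0 hg.
have dc' : differentiable c t by apply/derivable1_diffP; exact: ex_derive.
apply: DeriveDef; first by apply/derivable1_diffP; exact: differentiable_comp.
rewrite deriveE; last exact: differentiable_comp.
rewrite diff_comp//= dgE; congr (_ *m _).
by rewrite -deriveE//; exact: derive_val.
Qed.

(** Expansion between two arbitrary points with the differential frozen at [p]: the error is a small
    multiple of |v| as soon as both points are close to [p]. This is what Newton's method and the
    comparison of H with its linear part on E_p require. *)
Lemma strict_taylor k K (g : V -> 'rV[R]_k) D : C1h nu K g D ->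
  forall p y v, `|g (y + v) - g y - v *m D p| <= K * (`|v| `^ nu + 6 * `|y - p| `^ nu) * `|v|.
Proof.
move=> [K0 _ _ gT] p y v; case/andP: nu01 => n0 n1.
have h1 := gT y v; have h2 := taylor_holder nu01 K0 gT y p v.
have -> : g (y + v) - g y - v *m D p = (g (y + v) - g y - v *m D y) + (v *m D y - v *m D p).
  by rewrite addrA subrK.
apply: le_trans (ler_normD _ _) _.
have e : `|v| `^ (1 + nu) = `|v| * `|v| `^ nu.
  by rewrite powRD ?(gt_eqF (addr_gt0 ltr01 n0))// powRr1.
rewrite e in h1.
have -> : K * (`|v| `^ nu + 6 * `|y - p| `^ nu) * `|v| = K * (`|v| * `|v| `^ nu) + 6 * K * `|y - p| `^ nu * `|v| by ring.
exact: lerD.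
Qed.

Lemma C1h_row_mx k1 k2 K1 K2 (g1 : V -> 'rV[R]_k1) D1 (g2 : V -> 'rV[R]_k2) D2 :
  C1h nu K1 g1 D1 -> C1h nu K2 g2 D2 ->
  C1h nu (K1 + K2) (fun x => row_mx (g1 x) (g2 x)) (fun x => row_mx (D1 x) (D2 x)).
Proof.
move=> [K10 g1K D1K g1T] [K20 g2K D2K g2T].
have rm (a : 'rV[R]_k1) (b : 'rV[R]_k2) : `|row_mx a b| <= `|a| + `|b|.
  apply: rv_norm_le => [|j]; first by rewrite addr_ge0.
  rewrite mxE; case: splitP => i _.
    by apply: le_trans (rv_coord_le _ _) _; rewrite lerDl.
  by apply: le_trans (rv_coord_le _ _) _; rewrite lerDr.
split; first by rewrite addr_ge0.
- by move=> x; apply: le_trans (rm _ _) _; apply: lerD.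
- by move=> x u; rewrite mul_mx_row mulrDl; apply: le_trans (rm _ _) _; apply: lerD.
- move=> x u; rewrite mul_mx_row !opp_row_mx !add_row_mx mulrDl.
  by apply: le_trans (rm _ _) _; apply: lerD.
Qed.

End Local.

(** Compactness as an induction principle: properties inherited by subsets and by finite unions pass
    from neighbourhoods to [S]. It is used to concatenate finitely many charts and to minimise
    finitely many constants. *)
Lemma compact_induction (T : ptopologicalType) (S : set T) (P : set T -> Prop) :
  compact S -> P set0 -> (forall A B, P A -> P B -> P (A `|` B)) ->
  (forall A B, A `<=` B -> P B -> P A) ->
  (forall p, S p -> exists2 U, open U /\ U p & P U) -> P S.
Proof.
move=> cS P0 PU PS loc.
have h p : exists U, S p -> [/\ open U, U p & P U].
  have [Sp|nSp] := pselect (S p); last by exists set0.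
  by have [U [? ?] ?] := loc p Sp; exists U.
have [U hU] := choice h.
move: cS; rewrite compact_cover => /(_ T S U).
case=> [p /hU[]//|x Sx|D hD cD]; first by exists x => //; have [] := hU x Sx.
apply: (PS _ _ cD).
have : forall s : seq T, {subset s <= S} -> P (cover [set` s] U).
  elim=> [_|x s IH hs].
    by rewrite (_ : cover _ _ = set0)// -subset0 => y [i] /=.
  have [_ _ Px] := hU x (set_mem (hs x (mem_head _ _))).
  have Ps : P (cover [set` s] U) by apply: IH => y ys; apply: hs; rewrite inE ys orbT.
  apply: (PS _ _ _ (PU _ _ Px Ps)) => y [i] /=; rewrite inE => /orP[/eqP->|si] Uy; first by left.
  by right; exists i.
by move=> /(_ (finmap.enum_fset D)); apply => x xD; exact: hD.
Qed.

Lemma compact_uniform (R : realType) (V : normedModType R) (S : set V) (P : R -> V -> Prop) :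
  compact S -> (forall c c' p, 0 < c' -> c' <= c -> P c p -> P c' p) ->
  (forall p, S p -> exists c r : R, [/\ 0 < c, 0 < r &
     forall p', S p' -> `|p' - p| < r -> P c p']) ->
  exists2 c : R, 0 < c & forall p, S p -> P c p.
Proof.
move=> cS mono loc.
suff [c c0 hc] : exists2 c : R, 0 < c & forall p, S p -> S p -> P c p.
  by exists c => // p Sp; exact: hc.
apply: (@compact_induction V S (fun A => exists2 c : R, 0 < c & forall p, S p -> A p -> P c p)) => //.
- by exists 1.
- move=> A B [c c0 hc] [c' c0' hc']; exists (Num.min c c'); first by rewrite lt_min c0.
  move=> p Sp [Ap|Bp].
    by apply: mono (hc p Sp Ap); rewrite ?lt_min ?c0// ge_min lexx.
  by apply: mono (hc' p Sp Bp); rewrite ?lt_min ?c0// ge_min lexx orbT.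
- by move=> A B AB [c c0 hc]; exists c => // p Sp Ap; apply: hc => //; exact: AB.
move=> p Sp; have [c [r [c0 r0 hc]]] := loc p Sp.
exists (ball p r); first by split; [exact: ball_open|exact: ballxx].
by exists c => // p' Sp'; rewrite -ball_normE /= distrC => h; exact: hc.
Qed.

(** * The flow near [S] and its complete replacement *)

Section Flow.
Context {R : realType} {d : nat}.
Local Notation V := 'rV[R]_d.
Variables (nu : R) (f : V -> V) (Phi : R -> V -> V) (S : set V).
Hypothesis nu01 : 0 < nu <= 1.
Hypothesis hf : C1_holder nu setT f.
Hypothesis hPhi : is_flow f Phi.
Hypothesis hS : compact S.
Hypothesis hSinv : flow_invariant f Phi S.

Lemma compact_norm_bound : exists2 r : R, 0 < r & forall x, S x -> `|x| <= r.
Proof.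
have [M [_ hM]] := compact_bounded hS.
exists (`|M| + 1); first by have := normr_ge0 M; lra.
by move=> x Sx; apply: hM => //; have := ler_norm M; lra.
Qed.

(* Multiplying [f] by a cutoff equal to 1 around [S] makes the flow complete. *)
Lemma global_flow : exists K g Dg (Psi : R -> V -> V),
  [/\ C1h nu K g Dg, forall x, Psi 0 x = x,
      forall x (t : R), is_derive t 1 (Psi^~ x) (g (Psi t x)) &
      forall x p, S p -> `|x - p| <= 1 -> g x = f x].
Proof.
have [r r0 hr] := compact_norm_bound.
pose rho := (d%:R + 1) * (r + 1).
have d0 : 0 <= (d%:R : R) by [].
have rho0 : 0 < rho by rewrite /rho mulr_gt0//; lra.
have a01 : 0 <= (1 : R) <= 1 by rewrite ler01 lexx.
have [K [chi [D [hC _ _ _ [chi1 _]]]]] := cutoff_C1h (U := setT) (p := 0) nu01 rho0 a01 hf (fun _ _ => I).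
have [K0 gK DK gT] := hC.
have K20 : 0 <= 2 * K by rewrite mulr_ge0.
have [Psi [P0 dP]] := flow_exists K20 gK (C1h_lip nu01 hC).
exists K, (fun x => chi x *: f x), D, Psi; split => // x p Sp xp.
rewrite chi1 ?scale1r// subr0 mul1r.
have hx : `|x| <= r + 1.
  have := ler_normD (x - p) p; rewrite subrK; have := hr p Sp; lra.
have : `|x| ^+ 2 <= (r + 1) ^+ 2 by rewrite ler_sqr ?nnegrE//; lra.
have := sqr_ge0 `|x|.
rewrite /rho exprMn => h1 h2.
apply: ler_pM => //; have := sqr_ge0 (d%:R : R); nra.
Qed.

Section Psi.
Variables (K : R) (g : V -> V) (Dg : V -> 'M[R]_d) (Psi : R -> V -> V).
Hypothesis gC : C1h nu K g Dg.
Hypothesis Psi0 : forall x, Psi 0 x = x.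
Hypothesis dPsi : forall x (t : R), is_derive t 1 (Psi^~ x) (g (Psi t x)).
Hypothesis gf : forall x p, S p -> `|x - p| <= 1 -> g x = f x.

Lemma Psi_unique (u : R -> V) (t : R) :
  (forall s : R, btw t s -> is_derive s 1 u (g (u s))) -> u t = Psi t (u 0).
Proof.
move=> du; have [K0 _ _ _] := gC.
apply: (@ode_unique _ _ (fun _ => g) (2 * K)) => //; first by rewrite mulr_ge0.
by move=> _; exact: (C1h_lip nu01 gC).
Qed.

Lemma Psi_add (s t : R) x : Psi (s + t) x = Psi s (Psi t x).
Proof.
rewrite -[in RHS](add0r t).
apply: (@Psi_unique (fun s => Psi (s + t) x)) => r _.
have h := dPsi x (r + t).
apply/rv_is_derive => j; have := (rv_is_derive _ _ _).1 h j => hj.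
have sh : is_derive r 1 (fun s : R => s + t) 1.
  by apply: is_derive_eqval (is_deriveD (is_derive_id r 1) (is_derive_cst t r 1)) _; rewrite addr0.
by rewrite -[X in is_derive _ _ _ X]mulr1; exact: (@is_derive1_comp _ (fun s => Psi s x 0 j) (fun s => s + t) r _ 1 hj sh).
Qed.

(** A solution of f issued from [S] stays in [S], where g = f; it therefore solves the equation of
    the Lipschitz field g, and uniqueness identifies it with [Psi]. *)
Lemma Psi_S p (t : R) : S p -> S (Psi t p) /\ Phi t p = Psi t p.
Proof.
move=> Sp; have [[a [b [u [[/andP[a0 b0] u0 du] /andP[atl tb]]]]] SPt] := hSinv t Sp.
have sol : solution f p a b u by split => //; rewrite a0.
have uS s : a < s < b -> S (u s).
  by move=> hs; rewrite -(hPhi sol hs); exact: (hSinv s Sp).2.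
have ut : u t = Psi t p.
  rewrite -u0; apply: Psi_unique => s hs.
  have hs' : a < s < b.
    by case/orP: hs => /andP[h1 h2]; apply/andP; split; lra.
  have -> : g (u s) = f (u s) by apply: (gf (uS s hs')); rewrite subrr normr0.
  exact: du.
have E : Phi t p = u t by apply: (hPhi sol); rewrite atl.
by rewrite -ut -E; split.
Qed.

(** On [-T, T] the flow stretches distances by at most [A], so a point close enough to [S] remains
    within 1 of a trajectory in [S], in the region where g = f. *)
Lemma Psi_near T : 0 <= T -> exists2 r : R, 0 < r &
  forall p x t, S p -> `|x - p| < r -> `|t| < T ->
    flow_dom f t x /\ Phi t x = Psi t x.
Proof.
move=> T0; have [A [W [A0 W0 dW hW]]] := flow_C1h nu01 gC T0 Psi0 dPsi.
exists (A + 1)^-1; first by rewrite invr_gt0; lra.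
move=> p x t Sp xp tT.
have sol : solution f x (- T) T (Psi^~ x).
  split=> //; first by have n0 := normr_ge0 t; apply/andP; split; lra.
  move=> s /andP[s1 s2]; have sT : `|s| <= T by rewrite ler_norml !ltW.
  have [h _ _] := hW s p (x - p) sT; rewrite [p + _]addrC subrK in h.
  rewrite -(gf (Psi_S s Sp).1); first exact: dPsi.
  apply: le_trans h _; apply: (@le_trans _ _ ((A + 1) * (A + 1)^-1)).
    by apply: ler_pM => //; [lra|exact: ltW].
  by rewrite mulfV//; apply: lt0r_neq0; lra.
have tt : - T < t < T by rewrite -ltr_norml.
by split; [exists (- T), T, (Psi^~ x)|apply: (hPhi sol)].
Qed.


Lemma Psi_diff p (t : R) (A : 'M[R]_d) (C : R) : S p ->
  (forall u, `|Psi t (p + u) - Psi t p - u *m A| <= C * `|u| `^ (1 + nu)) ->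
  forall u, 'd (Phi t) p u = u *m A.
Proof.
move=> Sp hA.
have T0 : 0 <= `|t| + 1 by have := normr_ge0 t; lra.
have [r r0 hr] := Psi_near T0.
have tT : `|t| < `|t| + 1 by lra.
have E x : `|x - p| < r -> Phi t x = Psi t x by move=> xp; exact: (hr p x t Sp xp tT).2.
have [|_ h] := @taylor_diff _ _ nu nu01 _ (Phi t) A C r p r0; last exact: h.
move=> u ur.
rewrite !E//; first by rewrite subrr normr0.
by rewrite [p + u]addrC addrK.
Qed.

Variable M : set V.
Hypothesis hSM : S `<=` M.
Hypothesis hMinv : locally_invariant f Phi S M.

(** Local invariance covers only times up to t_0. Longer times are reached by steps of t_0 / 2: the
    trajectory shadows one contained in [S], so each step starts again in the neighbourhood where
    local invariance applies. *)
Lemma Psi_M T : 0 <= T -> exists2 r : R, 0 < r &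
  forall p x t, S p -> M x -> `|x - p| < r -> 0 <= t <= T -> M (Psi t x).
Proof.
move=> T0; have [U [t0 [SU t00 hU]]] := hMinv.
pose t1 := t0 / 2.
have t10 : 0 < t1 by rewrite divr_gt0.
have [A [W [A0 W0 dW hW]]] := flow_C1h nu01 gC T0 Psi0 dPsi.
have [r1 r10 hr1] := Psi_near (ltW t00).
have [rho rho0 hrho] : exists2 rho : R, 0 < rho & forall p, S p -> forall x, `|x - p| < rho -> U x.
  apply: (@compact_uniform _ _ S (fun rho p => forall x, `|x - p| < rho -> U x)) => //.
    by move=> c c' p _ cc' h x xp; apply: h; exact: lt_le_trans cc'.
  move=> p Sp; have : nbhs p U by exact: SU.
  move=> /nbhs_ballP[e /= e0 he].
  have e2 : 0 < e / 2 by rewrite divr_gt0.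
  exists (e / 2), (e / 2); split=> // p' Sp' h x xp; apply: he; rewrite -ball_normE /=.
  have := ler_normD (x - p') (p' - p); rewrite addrA subrK distrC; lra.
have m0 : 0 < Num.min r1 rho by rewrite lt_min r10.
exists (Num.min r1 rho / (A + 1)); first by rewrite divr_gt0//; lra.
move=> p x t Sp Mx xp /andP[t0' tT].
have near s : 0 <= s <= T -> `|Psi s x - Psi s p| < Num.min r1 rho.
  move=> /andP[s0 sT]; have sT' : `|s| <= T by rewrite ger0_norm.
  have [h _ _] := hW s p (x - p) sT'; rewrite [p + _]addrC subrK in h.
  apply: le_lt_trans h _.
  have A1 : 0 < A + 1 by lra.
  move: xp; rewrite ltr_pdivlMr// mulrC; apply: le_lt_trans; apply: ler_wpM2r => //; lra.
have step : forall n : nat, forall s, 0 <= s <= T -> s <= n%:R * t1 -> M (Psi s x).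
  elim=> [|n IH] s /andP[s0 sT] sn.
    by have -> : s = 0 by [apply/eqP; rewrite eq_le s0 andbT; move: sn; rewrite mul0r]; rewrite Psi0.
  have [h|h] := leP s (n%:R * t1); first by apply: IH => //; rewrite s0.
  have [ht|ht] := leP s t1.
    have near0 := near 0; rewrite !Psi0 lexx T0 in near0; have := near0 isT.
    rewrite lt_min => /andP[x1 x2].
    have st : `|s| < t0 by rewrite ger0_norm//; move: ht; rewrite /t1; lra.
    have [fd E] := hr1 p x s Sp x1 st.
    by rewrite -E; apply: hU => //; [exact: ltW|exact: (hrho _ Sp)].
  have s1 : 0 <= s - t1 <= T by apply/andP; split; lra.
  have Ms : M (Psi (s - t1) x).
    by apply: IH => //; move: sn; rewrite -addn1 natrD mulrDl mul1r; lra.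
  have := near _ s1; rewrite lt_min => /andP[x1 x2].
  have st : `|t1| < t0 by rewrite gtr0_norm// /t1; lra.
  have Sp' := (Psi_S (s - t1) Sp).1.
  have [fd E] := hr1 _ _ t1 Sp' x1 st.
  have -> : s = t1 + (s - t1) by ring.
  by rewrite Psi_add -E; apply: hU => //; [exact: ltW|exact: (hrho _ Sp')].
apply: (step (Num.truncn (t / t1)).+1); first by rewrite t0'.
rewrite -ler_pdivrMr//; apply: ltW; exact: truncnS_gt.
Qed.

End Psi.
End Flow.

(** * Defining functions of [M] and projection along E_p *)

Section Chart.
Context {R : realType} {d : nat}.
Local Notation V := 'rV[R]_d.
Variable nu : R.
Hypothesis nu01 : 0 < nu <= 1.
Variables (delta : nat) (M : set V).
Hypothesis hM : is_submanifold nu (d - delta) M.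
Hypothesis hdelta : (delta <= d)%N.

Lemma chart p : M p -> exists k K (H : V -> 'rV[R]_k) D (U : set V),
  [/\ k = delta, C1h nu K H D, open U /\ U p,
      (forall x, M x -> H x = 0) /\ (forall x, U x -> H x = 0 -> M x) &
      forall x, M x -> U x -> forall w, exists v : V, v *m D x = w].
Proof.
move=> Mp; have [U [h [[oU Up] hC hsurj MU]]] := hM Mp.
have : nbhs p U by rewrite nbhsE; exists U.
move=> /nbhs_ballP[e /= e0 he].
pose rho := e / 8.
have rho0 : 0 < rho by rewrite divr_gt0.
have BU x : `|x - p| <= 4 * rho -> U x.
  by move=> xp; apply: he; rewrite -ball_normE /= distrC; move: xp; rewrite /rho; lra.
(* Parameter 0 ensures [chi p = 1] only. That is enough: the chart domain is the open set where
   [chi] is positive, on which chi h and h have the same zeros. *)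
have a01 : 0 <= (0 : R) <= 1 by rewrite ler01 lexx.
have [K [chi [D [HC chi01 cchi hD [chi1 chi0]]]]] := cutoff_C1h nu01 rho0 a01 hC BU.
have chiU x : 0 < chi x -> U x.
  move=> cx; apply: BU; have [h2|h2] := leP (2 * rho) `|x - p|; last by lra.
  by move: cx; rewrite (chi0 x h2) ltxx.
exists (d - (d - delta))%N, K, (fun x => chi x *: h x), D, [set x | 0 < chi x]; split => //.
- by rewrite subKn.
- split; last by rewrite /= chi1 ?ltr01// subrr normr0 expr0n/= mulr0 mul0r.
  have -> : [set x | 0 < chi x] = chi @^-1` [set t | 0 < t] by [].
  by apply: open_comp => //; exact: open_gt.
- split=> x.
    move=> Mx; have [c0|c0] := leP (chi x) 0.
      have -> : chi x = 0 by apply/eqP; rewrite eq_le c0; case/andP: (chi01 x).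
      by rewrite scale0r.
    have : (M `&` U) x by split => //; exact: chiU.
    by rewrite MU => -[_ /= ->]; rewrite scaler0.
  move=> /= cx /eqP; rewrite scaler_eq0 gt_eqF//= => /eqP hx.
  have : (U `&` [set x | h x = 0]) x by split => //; exact: chiU.
  by rewrite -MU => -[].
move=> x Mx /= cx w.
have Ux := chiU x cx.
have hx : h x = 0 by have : (M `&` U) x by []; rewrite MU => -[].
have [v hv] := hsurj x Mx Ux ((chi x)^-1 *: w).
by exists v; rewrite hD// hv scalerA mulfV ?scale1r// gt_eqF.
Qed.

Variable E : V -> {vspace V}.

Lemma tangent_ker k K (H : V -> 'rV[R]_k) D p v : C1h nu K H D ->
  (forall x, M x -> H x = 0) -> tangent_space M p v -> v *m D p = 0.
Proof.
move=> [_ _ _ HT] H0 [c [c0 Mc dc]].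
have h := @taylor_chain _ _ nu nu01 k H (D p) K 1 c v 0 ltr01.
rewrite c0 in h; have {h} h : is_derive (0 : R) 1 (H \o c) (v *m D p) by apply: h.
have h2 : is_derive (0 : R) 1 (H \o c) 0.
  apply: (@near_eq_is_derive _ _ _ (cst 0)).
  by apply: filterS Mc => t Mt /=; rewrite H0.
by rewrite -(@derive_val _ _ _ _ _ _ _ h) (@derive_val _ _ _ _ _ _ _ h2).
Qed.

Section AtPoint.
Variables (k : nat) (K : R) (H : V -> 'rV[R]_k) (D : V -> 'M[R]_(d, k)) (p : V).
Hypothesis kdelta : k = delta.
Hypothesis HC : C1h nu K H D.
Hypothesis H0 : forall x, M x -> H x = 0.
Hypothesis Dsurj : forall w, exists v : V, v *m D p = w.
Hypothesis hsplit : direct_sum (tangent_space M p) [set` E p].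
Hypothesis hdim : \dim (E p) = delta.

Lemma chart_E_surj (w : 'rV[R]_k) : exists2 v, v \in E p & v *m D p = w.
Proof.
have [v hv] := Dsurj w; have [a [b [Ta Eb vE]]] := hsplit.1 v.
exists b => //; rewrite -hv vE mulmxDl (tangent_ker HC H0 Ta) add0r//.
Qed.

(** The differential kills T_pM, so its restriction to E_p is already onto; the dimensions being
    equal, it is injective. *)
Lemma chart_E_inj v : v \in E p -> v *m D p = 0 -> v = 0.
Proof.
move=> vE v0.
pose F : 'Hom(V, 'rV[R]_k) := linfun (mulmxr (D p)).
have FE x : F x = x *m D p by rewrite lfunE.
have full : (F @: E p)%VS = fullv.
  apply/eqP; rewrite eqEsubv subvf/=; apply/subvP => w _.
  have [u uE <-] := chart_E_surj w.
  by rewrite -FE; exact: memv_img.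
have := limg_ker_dim F (E p); rewrite full dimvf hdim /dim /= mul1n -kdelta.
move/eqP; rewrite -[X in _ == X]add0n eqn_add2r dimv_eq0 => /eqP k0.
have : v \in (E p :&: lker F)%VS by rewrite memv_cap vE memv_ker FE v0 eqxx.
by rewrite k0 memv0 => /eqP.
Qed.

Lemma chart_section : exists B : 'M[R]_(k, d), B *m D p = 1%:M /\ forall z : 'rV[R]_k, z *m B \in E p.
Proof.
have [b hb] := choice (fun i : 'I_k => let: ex_intro2 v vE h := chart_E_surj (delta_mx 0 i) in
   ex_intro (fun v => v \in E p /\ v *m D p = delta_mx 0 i) v (conj vE h)).
exists (\matrix_i b i); split.
  by apply/row_matrixP => i; rewrite row_mul rowK (hb i).2 rowE mulmx1.
move=> z; rewrite mulmx_sum_row; apply: memv_suml => i _; rewrite rowK.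
by apply: memvZ; exact: (hb i).1.
Qed.

(* Newton's method along [E p] projects a point near [p] onto [M]. *)
Lemma chart_projection (U : set V) : open U -> U p -> M p ->
  (forall x, U x -> H x = 0 -> M x) ->
  exists C r : R, [/\ 0 <= C, 0 < r & forall x, `|x - p| < r ->
    exists w, [/\ w \in E p, `|w| <= C * `|x - p| & M (x - w)]].
Proof.
move=> oU Up Mp UM; have [B [BD BE]] := chart_section.
have [b b0 hb] := mulmx_bound B; have [K0 HK DK HT] := HC.
have Hlip := C1h_lip nu01 HC; case/andP: nu01 => n0 n1.
have : nbhs p U by rewrite nbhsE; exists U.
move=> /nbhs_ballP[e /= e0 he].
pose c := 1 + 4 * K * b.
have c1 : 1 <= c by rewrite /c lerDl !mulr_ge0.
(* [q] bounds nu-th powers of distances to p: [strict_taylor] will give the Newton map the Lipschitz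
   constant 8 K b q, which is at most 1/2. *)
have [q qE] : {q : R | q = (2 * (K * 8 * b + 1))^-1} by exists (2 * (K * 8 * b + 1))^-1.
have Kb0 : 0 <= K * 8 * b by rewrite !mulr_ge0.
have q0 : 0 < q by rewrite qE invr_gt0; lra.
have [s sE] : {s : R | s = q `^ nu^-1} by exists (q `^ nu^-1).
have s0 : 0 < s by rewrite sE powR_gt0.
have snu : s `^ nu = q by rewrite sE -powRrM mulVf ?gt_eqF// powRr1// ltW.
pose r := Num.min e s / (2 * c).
have r0 : 0 < r by rewrite /r divr_gt0// ?lt_min ?e0//; lra.
exists (b * (4 * K)), r; split=> //; first by rewrite !mulr_ge0.
move=> x xp.
pose rad := 4 * K * `|x - p|.
have rad0 : 0 <= rad by rewrite /rad !mulr_ge0.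
pose Z := [set z : 'rV[R]_k | `|z| <= rad].
have near (z : 'rV[R]_k) : Z z -> `|x - z *m B - p| <= c * `|x - p|.
  move=> /= hz; have := ler_normB (x - p) (z *m B).
  have -> : x - p - z *m B = x - z *m B - p by rewrite addrAC.
  move=> /le_trans; apply; rewrite /c mulrDl mul1r lerD2l.
  apply: le_trans (hb z) _; rewrite mulrC -mulrA [b * _]mulrC mulrA.
  by apply: ler_wpM2r.
have cx : c * `|x - p| <= Num.min e s / 2.
  have c0 : 0 < c by lra.
  have := ltW xp; rewrite /r ler_pdivlMr; last by lra.
  by move=> h; rewrite ler_pdivlMr//; apply: le_trans h; rewrite mulrC mulrA mulrC [2 * c]mulrC mulrA [`|_| * c]mulrC mulrAC lexx.
have mine : Num.min e s <= e by rewrite ge_min lexx.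
have mins : Num.min e s <= s by rewrite ge_min lexx orbT.
(* A fixed point of this map is a zero of H on x + E_p. Since B is a right inverse of the
   differential at p, the linear part cancels and only a small remainder is left, hence a
   contraction. Its value at 0 is at most half the radius of [Z], so [Z] is stable. *)
pose Phi z := z + H (x - z *m B).
have contr z z' : Z z -> Z z' -> `|Phi z - Phi z'| <= 1 / 2 * `|z - z'|.
  move=> Zz Zz'.
  have n1' := near z Zz; have n2 := near z' Zz'.
  have := strict_taylor nu01 HC p (x - z' *m B) ((z' - z) *m B).
  have -> : x - z' *m B + (z' - z) *m B = x - z *m B by rewrite mulmxBl addrA subrK.
  rewrite -[(z' - z) *m B *m D p]mulmxA BD mulmx1 opprB [_ - _ + (z - z')]addrC.
  have -> : z - z' + (H (x - z *m B) - H (x - z' *m B)) = Phi z - Phi z'.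
    by rewrite /Phi opprD addrACA.
  move=> /le_trans; apply.
  have v1 : `|(z' - z) *m B| `^ nu <= 2 * q.
    have hv : `|(z' - z) *m B| <= 2 * s.
      have := ler_normB (x - z *m B - p) (x - z' *m B - p).
      have -> : x - z *m B - p - (x - z' *m B - p) = (z' - z) *m B.
        by rewrite mulmxBl; apply/rowP => j; rewrite !mxE; ring.
      lra.
    rewrite -snu; apply: (@le_trans _ _ ((2 * s) `^ nu)).
      by apply: powRnu_mono; [exact: ltW|rewrite normr_ge0].
    rewrite powRM//; last exact: ltW.
    apply: ler_wpM2r; first exact: powR_ge0.
    by rewrite -[X in _ <= X]powRr1//; apply: ler_powR => //; lra.
  have v2 : `|x - z' *m B - p| `^ nu <= q.
    rewrite -snu; apply: powRnu_mono; first exact: ltW.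
    by rewrite normr_ge0/=; lra.
  have v3 := hb (z' - z); rewrite [`|z' - z|]distrC in v3.
  have v4 : K * (`|(z' - z) *m B| `^ nu + 6 * `|x - z' *m B - p| `^ nu) <= K * (8 * q).
    by apply: ler_wpM2l => //; lra.
  apply: (@le_trans _ _ (K * (8 * q) * (b * `|z - z'|))).
    by apply: ler_pM => //; rewrite mulr_ge0// addr_ge0 ?mulr_ge0 ?powR_ge0.
  rewrite mulrA; apply: ler_wpM2r => //.
  have : 2 * (K * 8 * b + 1) * q = 1 by rewrite qE mulfV//; apply: lt0r_neq0; lra.
  lra.
have stab z : Z z -> Z (Phi z).
  move=> Zz; have Z0 : Z 0 by rewrite /Z/= normr0.
  have h1 := contr z 0 Zz Z0; rewrite subr0 in h1.
  have h2 : `|Phi 0| <= rad / 2.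
    rewrite /Phi add0r mul0mx subr0 -[H x]subr0 -(H0 Mp).
    by apply: le_trans (Hlip x p) _; rewrite /rad; lra.
  have := ler_normD (Phi z - Phi 0) (Phi 0); rewrite subrK.
  by move: Zz; rewrite /Z/=; lra.
have Z0 : Z 0 by rewrite /Z/= normr0.
pose y n := iter n Phi 0.
have yZ n : Z (y n) by elim: n => // n IH; exact: stab.
have step n : `|y n.+1 - y n| <= rad / 2 / 2 ^+ n.
  elim: n => [|n IH].
    rewrite expr0 divr1 /y /= subr0 /Phi add0r mul0mx subr0 -[H x]subr0 -(H0 Mp).
    by apply: le_trans (Hlip x p) _; rewrite /rad; lra.
  apply: le_trans (contr _ _ (yZ n.+1) (yZ n)) _.
  rewrite exprS invfM mulrCA div1r.
  by apply: ler_wpM2l; rewrite ?invr_ge0.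
have [z hz] := geometric_limit step.
have Zz : Z z.
  by have := hz 0; rewrite /y/= sub0r normrN expr0 divr1 mulrC divfK.
have zE : z = Phi z.
  apply/eqP; rewrite -subr_eq0 -normr_eq0; apply/eqP.
  apply: (@le_geometric0 _ _ (2 * (2 * (rad / 2)))) => // n.
  have h1 := hz n; have h2 := hz n.+1; have h3 := contr _ _ (yZ n) Zz.
  have := ler_normD (z - y n.+1) (y n.+1 - Phi z).
  rewrite addrA subrK (_ : y n.+1 = Phi (y n))// (distrC z (Phi (y n))) => /le_trans; apply.
  rewrite exprS (_ : y n.+1 = Phi (y n))// in h2.
  have h4 : 2 * (rad / 2) / (2 * 2 ^+ n) = 2 * (rad / 2) / 2 ^+ n / 2.
    by rewrite invfM mulrCA mulrC.
  have h5 : 0 <= 2 * (rad / 2) / 2 ^+ n by exact: le_trans h1.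
  rewrite h4 in h2; rewrite -[2 * (2 * (rad / 2)) / _]mulrA; lra.
exists (z *m B); split; first exact: BE.
  apply: le_trans (hb z) _; rewrite -mulrA ler_wpM2l//.
apply: UM.
  apply: he; rewrite -ball_normE /= distrC; have := near z Zz; lra.
move: zE; rewrite /Phi => /eqP; rewrite -subr_eq0 opprD addrA subrr add0r oppr_eq0.
by move=> /eqP.
Qed.

End AtPoint.
End Chart.

Lemma mulmx_norm_le (R : realType) m k (A : 'M[R]_(m, k)) (u : 'rV[R]_m) :
  `|u *m A| <= m%:R * `|A| * `|u|.
Proof.
apply: rv_norm_le => [|j]; first by rewrite !mulr_ge0.
rewrite mxE; apply: le_trans (ler_norm_sum _ _ _) _.
have -> : m%:R * `|A| * `|u| = \sum_(i < m) `|u| * `|A|.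
  by rewrite sumr_const card_ord -[RHS]mulr_natl -mulrA [`|A| * _]mulrC.
apply: ler_sum => i _; rewrite normrM; apply: ler_pM => //; first exact: rv_coord_le.
rewrite [`|A|]mx_normrE.
by apply: (@le_bigmax _ _ _ _ (fun ij : 'I_m * 'I_k => `|A ij.1 ij.2|) (i, j)).
Qed.

Section Global.
Context {R : realType} {d : nat}.
Local Notation V := 'rV[R]_d.
Variables (nu : R) (delta : nat) (M S : set V) (E : V -> {vspace V}) (ip : {dot V for idfun}).
Hypothesis nu01 : 0 < nu <= 1.
Hypothesis hM : is_submanifold nu (d - delta) M.
Hypothesis hdelta : (1 <= delta <= d)%N.
Hypothesis hS : compact S.
Hypothesis hSM : S `<=` M.
Hypothesis hsplit : forall p, S p -> direct_sum (tangent_space M p) [set` E p].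
Hypothesis hE : grassmann_continuous ip delta S E.

Let hdim p : S p -> \dim (E p) = delta. Proof. exact: hE.1. Qed.

(** The equations of finitely many charts are put side by side. Each vanishes on all of [M], so they
    need not agree on overlaps; the number of components may exceed delta, and what is kept of
    regularity is injectivity on every E_p. *)
Lemma global_defining : exists m K (H : V -> 'rV[R]_m) D,
  [/\ C1h nu K H D, forall x, M x -> H x = 0 &
      forall p v, S p -> v \in E p -> v *m D p = 0 -> v = 0].
Proof.
pose P (A : set V) := exists m K (H : V -> 'rV[R]_m) D,
  [/\ C1h nu K H D, forall x, M x -> H x = 0 &
      forall p v, S p -> A p -> v \in E p -> v *m D p = 0 -> v = 0].
suff [m [K [H [D [h1 h2 h3]]]]] : P S by exists m, K, H, D; split => // p v Sp; exact: h3.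
have [_ dd] := andP hdelta.
apply: (@compact_induction V S P) => //.
- exists 0%N, 0, (fun _ => 0), (fun _ => 0); split => //; split => // [x|x u|x u].
  + by rewrite normr0.
  + by rewrite mulmx0 normr0 mul0r.
  + by rewrite mulmx0 !subr0 normr0 mul0r.
- move=> A B [m1 [K1 [H1 [D1 [C1 Z1 I1]]]]] [m2 [K2 [H2 [D2 [C2 Z2 I2]]]]].
  exists (m1 + m2)%N, (K1 + K2), (fun x => row_mx (H1 x) (H2 x)), (fun x => row_mx (D1 x) (D2 x)).
  split; first exact: C1h_row_mx.
    by move=> x Mx; rewrite Z1// Z2// row_mx0.
  move=> p v Sp AB vE; rewrite mul_mx_row -row_mx0 => /eq_row_mx[v1 v2].
  by case: AB => ?; [exact: I1 v1|exact: I2 v2].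
- move=> A B AB [m [K [H [D [h1 h2 h3]]]]]; exists m, K, H, D; split => // p v Sp Ap.
  by apply: h3 => //; exact: AB.
move=> p Sp; have [k [K [H [D [U [kd HC [oU Up] [H0 UM] Ds]]]]]] := chart nu01 hM dd (hSM Sp).
exists U; first by split.
exists k, K, H, D; split => // x v Sx Ux.
exact: (chart_E_inj nu01 kd HC H0 (Ds x (hSM Sx) Ux) (hsplit Sx) (hdim Sx)).
Qed.

Lemma local_projection p : S p ->
  exists C r : R, [/\ 0 <= C, 0 < r & forall x, `|x - p| < r ->
    exists w, [/\ w \in E p, `|w| <= C * `|x - p| & M (x - w)]].
Proof.
have [_ dd] := andP hdelta.
move=> Sp; have [k [K [H [D [U [kd HC [oU Up] [H0 UM] Ds]]]]]] := chart nu01 hM dd (hSM Sp).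
exact: (chart_projection nu01 HC H0 (Ds p (hSM Sp) Up) (hsplit Sp) oU Up (hSM Sp) UM).
Qed.

(** At one point an injective linear map is bounded below. The bound passes to nearby points of [S]
    because both the differential and, through the projections, the spaces E_p vary continuously;
    compactness makes it uniform. *)
Lemma lower_bound_on_E m K (H : V -> 'rV[R]_m) D : C1h nu K H D ->
  (forall p v, S p -> v \in E p -> v *m D p = 0 -> v = 0) ->
  exists2 c : R, 0 < c & forall p, S p -> forall w, w \in E p -> c * `|w| <= `|w *m D p|.
Proof.
move=> HC inj; have [K0 HK DK HT] := HC; have [hdimE [Q [hQ cQ]]] := hE.
apply: (@compact_uniform _ _ S (fun c p => forall w, w \in E p -> c * `|w| <= `|w *m D p|)) => //.
  by move=> c c' p _ cc h w /h; apply: le_trans; rewrite ler_wpM2r.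
move=> p Sp.
have [c c0 hc] : exists2 c : R, 0 < c & forall w, w \in E p -> c * `|w| <= `|w *m D p|.
  pose F : 'Hom(subvs_of (E p), 'rV[R]_m) := linfun (mulmxr (D p) \o vsval).
  have FE u : F u = vsval u *m D p by rewrite lfunE.
  have kF : lker F == 0%VS.
    rewrite -subv0; apply/subvP => u; rewrite memv_ker FE memv0 => /eqP u0.
    by apply/eqP/val_inj; exact: (inj p _ Sp (subvsP u) u0).
  pose L : 'M[R]_(m, d) := lin1_mx (vsval \o (F^-1)%VF).
  have [l l0 hl] := mulmx_bound L.
  exists (l + 1)^-1; first by rewrite invr_gt0; lra.
  move=> w wE; rewrite ler_pdivrMl; last by lra.
  have -> : `|w| = `|w *m D p *m L|.
    have := lker0_lfunK kF (vsproj (E p) w); rewrite FE vsprojK// => h.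
    by rewrite /L mul_rV_lin1 /= h vsprojK.
  apply: le_trans (hl _) _; apply: ler_wpM2r => //; lra.
have [r1 r10 hr1] : exists2 r : R, 0 < r & forall p' (u : V), `|p' - p| < r -> `|u *m D p' - u *m D p| <= c / 4 * `|u|.
  have [s sE] : {s : R | s = (c / 4 / (6 * K + 1)) `^ nu^-1} by exists ((c / 4 / (6 * K + 1)) `^ nu^-1).
  case/andP: nu01 => n0 n1.
  have K6 : 0 < 6 * K + 1 by lra.
  have s0 : 0 < s by rewrite sE powR_gt0// !divr_gt0.
  exists s => // p' u hp; apply: le_trans (taylor_holder nu01 K0 HT p' p u) _.
  apply: ler_wpM2r => //.
  have : `|p' - p| `^ nu <= c / 4 / (6 * K + 1).
    have -> : c / 4 / (6 * K + 1) = s `^ nu by rewrite sE -powRrM mulVf ?gt_eqF// powRr1// !divr_ge0// ltW.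
    by apply: powRnu_mono; [exact: ltW|rewrite normr_ge0 ltW].
  rewrite ler_pdivlMr// => h; apply: le_trans h; rewrite mulrC; apply: ler_wpM2l; rewrite ?powR_ge0//; lra.
have e10 : 0 < Num.min 1 c / (2 * (2 * K + 1)).
  by rewrite divr_gt0// ?lt_min ?c0 ?ltr01//; lra.
have [r2 r20 hr2] : exists2 r : R, 0 < r & forall p' (u : V), S p' -> `|p' - p| < r ->
    `|u *m Q p' - u *m Q p| <= Num.min 1 c / (4 * (2 * K + 1)) * `|u|.
  have e30 : 0 < Num.min 1 c / (4 * (2 * K + 1)) / (d%:R + 1).
    have d0 : 0 <= (d%:R : R) by [].
    by rewrite !divr_gt0// ?lt_min ?c0 ?ltr01//; lra.
  have := cQ p; rewrite /continuous_at => /cvgrPdist_lt /(_ _ e30).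
  rewrite /nbhs /= -nbhs_subspace_in// near_withinE => /nbhs_ballP[r /= r0 hr].
  exists r => // p' u Sp' pp'; have := hr p'; rewrite -ball_normE /= distrC => /(_ pp' Sp') h.
  rewrite -mulmxBr; apply: le_trans (mulmx_norm_le _ _) _; apply: ler_wpM2r => //.
  rewrite distrC in h; have d0 : 0 <= (d%:R : R) by [].
  have d1 : 0 < (d%:R : R) + 1 by lra.
  move: h; rewrite ltr_pdivlMr// => /ltW; apply: le_trans.
  by rewrite mulrC; apply: ler_wpM2l => //; lra.
pose r := Num.min r1 r2.
exists (c / 8), r; split; rewrite ?divr_gt0// ?lt_min ?r10//.
move=> p' Sp'; rewrite lt_min => /andP[p1 p2] w' wE'.
(* The vector of E_{p'} is replaced by its orthogonal projection onto E_p. It moves little, being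
   fixed by [Q p'], which is close to [Q p]. *)
pose w := w' *m Q p.
have wE : w \in E p by exact: (hQ p Sp w').1.
have w'Q : w' *m Q p' = w' := orthproj_id (hQ p' Sp') wE'.
have h1 : `|w' - w| <= Num.min 1 c / (4 * (2 * K + 1)) * `|w'|.
  by have := hr2 p' w' Sp' p2; rewrite w'Q.
have m1 : Num.min 1 c <= 1 by rewrite ge_min lexx.
have m2 : Num.min 1 c <= c by rewrite ge_min lexx orbT.
have K4 : 0 < 4 * (2 * K + 1) by lra.
have m0 : 0 <= Num.min 1 c by rewrite le_min ler01 ltW.
have e1 : Num.min 1 c / (4 * (2 * K + 1)) <= 1 / 4.
  by rewrite ler_pdivrMr//; lra.
have e2 : K * (Num.min 1 c / (4 * (2 * K + 1))) <= c / 8.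
  rewrite mulrA ler_pdivrMr//.
  have : K * Num.min 1 c <= K * c by exact: ler_wpM2l.
  lra.
set ee := Num.min 1 c / _ in h1 e1 e2.
have h2 : `|w' - w| <= 1 / 4 * `|w'| by apply: le_trans h1 _; exact: ler_wpM2r.
have h3 := ler_normD w (w' - w); rewrite addrC subrK in h3.
have h4 := hc w wE; have h5 := hr1 p' w' p1.
have h6 : `|(w' - w) *m D p| <= c / 8 * `|w'|.
  apply: le_trans (DK _ _) _; apply: le_trans (ler_wpM2l K0 h1) _.
  by rewrite mulrA; exact: ler_wpM2r.
have h7 : `|w *m D p| <= `|w' *m D p'| + `|w' *m D p' - w' *m D p| + `|(w' - w) *m D p|.
  have -> : w *m D p = w' *m D p' - (w' *m D p' - w' *m D p) - (w' - w) *m D p.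
    rewrite mulmxBl; move: (w *m D p) (w' *m D p) (w' *m D p') => a b c'.
    by apply/rowP => j; rewrite !mxE; ring.
  by apply: le_trans (ler_normB _ _) _; rewrite lerD2r; exact: ler_normB.
have h8 : c * (3 / 4 * `|w'|) <= c * `|w| by apply: ler_wpM2l; lra.
have h9 : 0 <= c * `|w'| by rewrite mulr_ge0// ltW.
lra.
Qed.

End Global.

Lemma holder_continuous (R : realType) (V W : normedModType R) (f : V -> W) (C nu : R) :
  0 < nu -> (forall x y, `|f x - f y| <= C * `|x - y| `^ nu) -> continuous f.
Proof.
move=> n0 h x; apply/cvgrPdist_le => e e0.
have C1 : 0 < `|C| + 1 by have := normr_ge0 C; lra.
have [s sE] : {s : R | s = (e / (`|C| + 1)) `^ nu^-1} by exists ((e / (`|C| + 1)) `^ nu^-1).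
have s0 : 0 < s by rewrite sE powR_gt0// divr_gt0.
near=> y.
have hy : `|y - x| < s by near: y; exact: near_dist_lt.
apply: le_trans (h x y) _.
have h3 : `|x - y| `^ nu <= e / (`|C| + 1).
  have -> : e / (`|C| + 1) = s `^ nu by rewrite sE -powRrM mulVf ?gt_eqF// powRr1// divr_ge0// ltW.
  by apply: ge0_ler_powR; rewrite ?nnegrE// ?(ltW n0) ?(ltW s0)// distrC ltW.
apply: (@le_trans _ _ ((`|C| + 1) * `|x - y| `^ nu)).
  by rewrite ler_wpM2r ?powR_ge0//; have := ler_norm C; lra.
by rewrite mulrC -ler_pdivlMr.
Unshelve. all: by end_near. Qed.

Lemma continuous_sum (R : realType) (T : topologicalType) n (f : 'I_n -> T -> R) :
  (forall i, continuous (f i)) -> continuous (fun t => \sum_i f i t).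
Proof.
elim: n f => [|n IH] f cf t.
  by under eq_fun do rewrite big_ord0; exact: cvg_cst.
under eq_fun do rewrite big_ord_recr /=.
apply: cvgD; last exact: cf.
exact: (IH (fun i => f (widen_ord (leqnSn n) i))).
Qed.

Lemma mulD_continuous (R : realType) d k nu K (H : 'rV[R]_d -> 'rV[R]_k) D (a y : R -> 'rV[R]_d) j :
  0 < nu <= 1 -> C1h nu K H D -> continuous a -> continuous y ->
  continuous (fun t => (a t *m D (y t)) 0 j).
Proof.
move=> nu01 [K0 _ _ HT] ca cy.
have -> : (fun t => (a t *m D (y t)) 0 j) = (fun t => \sum_i a t 0 i * D (y t) i j).
  by apply/funext => t; rewrite mxE.
have cD i : continuous (fun x => D x i j).
  apply: (@holder_continuous _ _ _ _ (6 * K) nu); first by case/andP: nu01.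
  move=> x z; have := taylor_holder nu01 K0 HT x z (delta_mx 0 i).
  have d1 : `|delta_mx 0 i : 'rV[R]_d| <= 1.
    apply: rv_norm_le => // l; rewrite mxE; case: (_ && _); rewrite ?normr1 ?normr0//.
  have := rv_coord_le (delta_mx 0 i *m D x - delta_mx 0 i *m D z) j.
  rewrite -!rowE !mxE => /le_trans /[apply] /le_trans; apply.
  by rewrite ler_piMr// !mulr_ge0// powR_ge0.
apply: continuous_sum => i t; apply: cvgM.
  exact: (@continuous_comp _ _ _ a (fun w : 'rV[R]_d => w 0 i) t (ca t) (@coord_continuous _ _ _ 0 i _)).
exact: (@continuous_comp _ _ _ y (fun x => D x i j) t (cy t) (cD i _)).
Qed.

(** * Growth of H along the flow near [S] *)

Section Growth.
Context {R : realType} {d : nat}.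
Local Notation V := 'rV[R]_d.
Variables (nu : R) (S M : set V) (E : V -> {vspace V}).
Hypothesis nu01 : 0 < nu <= 1.
Variables (m : nat) (K : R) (H : V -> 'rV[R]_m) (D : V -> 'M[R]_(d, m)).
Hypothesis HC : C1h nu K H D.
Hypothesis H0 : forall x, M x -> H x = 0.
Variable (c1 : R).
Hypothesis c10 : 0 < c1.
Hypothesis hc1 : forall p, S p -> forall w, w \in E p -> c1 * `|w| <= `|w *m D p|.
Hypothesis hproj : forall p, S p -> exists C r : R, [/\ 0 <= C, 0 < r & forall x, `|x - p| < r ->
    exists w, [/\ w \in E p, `|w| <= C * `|x - p| & M (x - w)]].
Variables (T : R) (Psi : R -> V -> V) (W : R -> V -> 'M[R]_d) (KT : R).
Hypothesis T0 : 0 <= T.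
Hypothesis HT : forall t, 0 <= t <= T -> C1h nu KT (H \o Psi t) (fun x => W t x *m D (Psi t x)).
Variable (r2 : R).
Hypothesis r20 : 0 < r2.
Hypothesis hPsiM : forall p x t, S p -> M x -> `|x - p| < r2 -> 0 <= t <= T -> M (Psi t x).
Hypothesis hgrow : forall p, S p -> forall w, w \in E p ->
  8 * (m%:R + 1) * (K + 1) * `|w| <= `|w *m (W T p *m D (Psi T p))|.

(** Squared Euclidean norm, smooth unlike the square of the sup norm; passing from one to the other
    costs a factor m, visible in the constants. *)
Definition sqn k (z : 'rV[R]_k) : R := \sum_j z 0 j ^+ 2.

(** Write x = y + w with y in [M] and w in E_p. H and H composed with Psi_t vanish at y, so both are
    linear in w up to a small relative error. This gives |H(x)| between c_1 |w| / 2 and 2 K |w|,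
    while |H(Psi_T x)| >= 4 (m + 1) (K + 1) |w|: the factor m + 1 pays for the change of norm and
    leaves the ratio 4. *)
Lemma local_growth p : S p -> exists2 r : R, 0 < r & forall x, `|x - p| < r ->
  4 * sqn (H x) <= sqn (H (Psi T x)) /\
  forall t, 0 <= t <= T -> sqn (H (Psi t x)) <= 16 * m%:R * KT ^+ 2 / c1 ^+ 2 * sqn (H x).
Proof.
move=> Sp; have [C [r1 [C0 r10 hw]]] := hproj Sp.
have [K0 _ _ _] := HC; case/andP: nu01 => n0 n1; have c1p := c10.
have TT : 0 <= T <= T by rewrite T0 lexx.
have [KT0 _ _ _] := HT TT.
pose A := 8 * (m%:R + 1) * (K + 1).
have m0 : 0 <= (m%:R : R) by [].
have A0 : 0 < A by rewrite /A !mulr_gt0//; lra.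
pose KK := K + KT + 1.
have KK0 : 0 < KK by rewrite /KK; lra.
have [q qE] : {q : R | q = Num.min c1 A / 2 / (7 * KK)} by exists (Num.min c1 A / 2 / (7 * KK)).
have min0 : 0 < Num.min c1 A by rewrite lt_min c1p.
have q0 : 0 < q by rewrite qE !divr_gt0// mulr_gt0.
have [s sE] : {s : R | s = q `^ nu^-1} by exists (q `^ nu^-1).
have s0 : 0 < s by rewrite sE powR_gt0.
have snu : s `^ nu = q by rewrite sE -powRrM mulVf ?gt_eqF// powRr1// ltW.
have qK : KK * (7 * q) <= Num.min c1 A / 2.
  have -> : KK * (7 * q) = Num.min c1 A / 2; last by [].
  rewrite qE; field; exact: lt0r_neq0.
exists (Num.min r1 (Num.min r2 s / (1 + C))).
  by rewrite lt_min r10/= divr_gt0// ?lt_min ?r20//; lra.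
move=> x; rewrite lt_min => /andP[xp1 xp2].
have [w [wE wx Mw]] := hw x xp1.
have C1 : 0 < 1 + C by lra.
have xs : (1 + C) * `|x - p| < Num.min r2 s by rewrite mulrC -ltr_pdivlMr.
have yp : `|x - w - p| <= (1 + C) * `|x - p|.
  have := ler_normB (x - p) w; have -> : x - p - w = x - w - p by rewrite addrAC.
  lra.
have ws : `|w| <= s.
  have : Num.min r2 s <= s by rewrite ge_min lexx orbT.
  have := normr_ge0 (x - p); lra.
have ys : `|x - w - p| <= s by have : Num.min r2 s <= s by [rewrite ge_min lexx orbT]; lra.
have yr : `|x - w - p| < r2.
  have h : Num.min r2 s <= r2 by rewrite ge_min lexx.
  exact: le_lt_trans yp (lt_le_trans xs h).
have pow z : `|z : V| <= s -> `|z| `^ nu <= q.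
  by move=> hz; rewrite -snu; apply: powRnu_mono; [exact: ltW|rewrite normr_ge0].
have small KX : 0 <= KX -> KX <= KK ->
    KX * (`|w| `^ nu + 6 * `|x - w - p| `^ nu) <= Num.min c1 A / 2.
  move=> KX0 KXK; apply: le_trans qK; apply: ler_pM => //.
  have := pow _ ws; have := pow _ ys; lra.
have e1 : `|H x - w *m D p| <= c1 / 2 * `|w|.
  have := strict_taylor nu01 HC p (x - w) w; rewrite subrK (H0 Mw) subr0 => /le_trans; apply.
  apply: ler_wpM2r => //; apply: le_trans (small K K0 _) _; first by rewrite /KK; lra.
  by rewrite ler_pM2r ?invr_gt0// ge_min lexx.
have MT t : 0 <= t <= T -> H (Psi t (x - w)) = 0.
  by move=> tT; apply: H0; exact: (hPsiM Sp).
have e2 : `|H (Psi T x) - w *m (W T p *m D (Psi T p))| <= A / 2 * `|w|.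
  have := strict_taylor nu01 (HT TT) p (x - w) w; rewrite /= subrK (MT T TT) subr0 => /le_trans; apply.
  apply: ler_wpM2r => //; apply: le_trans (small KT KT0 _) _; first by rewrite /KK; lra.
  by rewrite ler_pM2r ?invr_gt0// ge_min lexx orbT.
have low : c1 / 2 * `|w| <= `|H x|.
  have := hc1 Sp wE; have := ler_normB (H x) (H x - w *m D p).
  by rewrite opprB addrC subrK; lra.
have lowT : A / 2 * `|w| <= `|H (Psi T x)|.
  have := hgrow Sp wE; rewrite -/A.
  have := ler_normB (H (Psi T x)) (H (Psi T x) - w *m (W T p *m D (Psi T p))).
  by rewrite opprB addrC subrK; lra.
have up : `|H x| <= 2 * K * `|w|.
  have := C1h_lip nu01 HC x (x - w); rewrite (H0 Mw) subr0.
  by have -> : x - (x - w) = w by rewrite opprB addrCA subrr addr0.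
have ratio : 2 * (m%:R + 1) * `|H x| <= `|H (Psi T x)|.
  apply: le_trans lowT; apply: le_trans (ler_wpM2l _ up) _; first by lra.
  rewrite mulrA; apply: ler_wpM2r => //.
  rewrite /A; have := mulr_ge0 m0 K0; lra.
have H1 := sum_sqr_le_norm (H x); have H2 := sqr_norm_le_sum (H x).
have nH := normr_ge0 (H x).
split.
  apply: le_trans (sqr_norm_le_sum _).
  apply: (@le_trans _ _ ((2 * (m%:R + 1) * `|H x|) ^+ 2)); last first.
    by rewrite ler_sqr ?nnegrE// !mulr_ge0//; lra.
  rewrite exprMn; apply: le_trans (ler_wpM2l _ H1) _ => //.
  rewrite mulrA; apply: ler_wpM2r; first exact: sqr_ge0.
  have := sqr_ge0 (m%:R : R); lra.
move=> t tT; apply: le_trans (sum_sqr_le_norm _) _.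
have up2 : `|H (Psi t x)| <= 2 * KT * `|w|.
  have := C1h_lip nu01 (HT tT) x (x - w); rewrite /= (MT t tT) subr0.
  by have -> : x - (x - w) = w by rewrite opprB addrCA subrr addr0.
have up3 : `|H (Psi t x)| ^+ 2 <= (2 * KT * `|w|) ^+ 2.
  by rewrite ler_sqr ?nnegrE// !mulr_ge0.
have low2 : (c1 / 2 * `|w|) ^+ 2 <= `|H x| ^+ 2.
  rewrite ler_sqr ?nnegrE//; apply: mulr_ge0 => //; apply: divr_ge0 => //; exact: ltW.
have w2 : `|w| ^+ 2 <= 4 / c1 ^+ 2 * `|H x| ^+ 2.
  rewrite mulrAC ler_pdivlMr; last exact: exprn_gt0.
  move: low2; rewrite !exprMn exprVn; lra.
apply: (@le_trans _ _ (m%:R * ((2 * KT) ^+ 2 * (4 / c1 ^+ 2 * sqn (H x))))).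
  apply: ler_wpM2l => //; apply: le_trans up3 _; rewrite exprMn; apply: ler_wpM2l; first exact: sqr_ge0.
  apply: le_trans w2 _; apply: ler_wpM2l => //.
  by rewrite divr_ge0// sqr_ge0.
rewrite le_eqVlt; apply/orP; left; apply/eqP; rewrite exprMn; ring.
Qed.

End Growth.

(** * The Lyapunov function *)

Section ContinuousIntegral.
Context {R : realType}.
Implicit Types u v : R -> R.

(* The integral of a continuous function over [0, T], as the value at T of a
   primitive; [0] when [v] is not continuous. *)
Definition cint v (T : R) : R :=
  if pselect (continuous v) is left cv then projT1 (cid (primitive_exists cv)) T else 0.

Lemma cintP v : continuous v -> cint v 0 = 0 /\ forall t : R, is_derive t 1 (cint v) (v t).
Proof. by move=> cv; rewrite /cint; case: pselect => // {}cv; case: cid. Qed.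

Lemma cint_le u v T : continuous u -> continuous v -> 0 <= T ->
  (forall t, 0 <= t <= T -> u t <= v t) -> cint u T <= cint v T.
Proof.
move=> /cintP[u0 du] /cintP[v0 dv] T0 uv.
have := derive_le T0 (fun t _ => du t) (fun t _ => dv t).
rewrite u0 v0 !subr0; apply => t /andP[t0 tT]; apply: uv; by rewrite !ltW.
Qed.

Lemma cint_unique (F : R -> R) v T : continuous v -> 0 <= T -> F 0 = 0 ->
  (forall t : R, is_derive t 1 F (v t)) -> F T = cint v T.
Proof.
move=> /cintP[v0 dv] T0 F0 dF; apply/eqP; rewrite eq_le; apply/andP; split.
  by have := derive_le T0 (fun t _ => dF t) (fun t _ => dv t) (fun t _ => lexx _); rewrite F0 v0 !subr0.
by have := derive_le T0 (fun t _ => dv t) (fun t _ => dF t) (fun t _ => lexx _); rewrite F0 v0 !subr0.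
Qed.

Lemma cintD u v T : continuous u -> continuous v -> 0 <= T ->
  cint (fun t => u t + v t) T = cint u T + cint v T.
Proof.
move=> cu cv T0; have [u0 du] := cintP cu; have [v0 dv] := cintP cv.
rewrite -(@cint_unique (cint u + cint v))// => [t|]; first by apply: cvgD; [exact: cu|exact: cv].
by rewrite !fctE u0 v0 addr0.
Qed.

Lemma cintZ (c : R) v T : continuous v -> 0 <= T -> cint (fun t => c * v t) T = c * cint v T.
Proof.
move=> cv T0; have [v0 dv] := cintP cv.
have cw : continuous (fun t => c * v t) by move=> t; apply: cvgM; [exact: cvg_cst|exact: cv].
apply/esym; apply: (cint_unique (F := fun t => c * cint v t) cw T0).
by rewrite v0 mulr0.
Qed.

Lemma cint_cst (c T : R) : 0 <= T -> cint (fun _ => c) T = c * T.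
Proof.
move=> T0; apply/esym.
apply: (cint_unique (F := fun t => c * t) (v := fun _ => c) _ T0); rewrite ?mulr0//.
  by move=> t; exact: cvg_cst.
move=> t; have := @is_deriveZ _ _ _ (@id R) c t 1 1 (@is_derive_id _ _ t 1).
by rewrite /GRing.scale/= mulr1.
Qed.

Lemma cint_ge0 v T : continuous v -> 0 <= T -> (forall t, 0 <= t <= T -> 0 <= v t) -> 0 <= cint v T.
Proof.
move=> cv T0 h; rewrite -(mul0r T) -cint_cst//; apply: cint_le => // t; exact: cvg_cst.
Qed.

Lemma cint_sum n (f : 'I_n -> R -> R) T : (forall i, continuous (f i)) -> 0 <= T ->
  cint (fun t => \sum_i f i t) T = \sum_i cint (f i) T.
Proof.
move=> cf T0; apply/esym; apply: (cint_unique (F := fun t => \sum_i cint (f i) t) _ T0).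
- exact: continuous_sum.
- by apply: big1 => i _; exact: (cintP (cf i)).1.
move=> t; have -> : (fun t => \sum_i cint (f i) t) = \sum_i cint (f i).
  by apply/funext => s; rewrite fct_sumE.
apply: is_derive_sum => i; exact: (cintP (cf i)).2.
Qed.

Lemma cint_subinterval v tau T : continuous v -> 0 <= tau -> tau <= T ->
  (forall t, 0 <= t <= T -> 0 <= v t) -> cint v tau <= cint v T.
Proof.
move=> cv t0 tT h; apply: (derive_nondecr tT (fun t _ => (cintP cv).2 t)) => t /andP[t1 t2].
by apply: h; rewrite (ltW t2) (le_trans t0 (ltW t1)).
Qed.

End ContinuousIntegral.

Section Square.
Context {R : realType} {m : nat}.
Implicit Types a b : 'rV[R]_m.

Definition dotp a b : R := \sum_j a 0 j * b 0 j.

Lemma sqn_ge0 a : 0 <= sqn a. Proof. by apply: sumr_ge0 => j _; exact: sqr_ge0. Qed.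

Lemma sqnD a b : sqn (a + b) = sqn a + 2 * dotp a b + sqn b.
Proof.
rewrite /sqn /dotp mulr_sumr -!big_split; apply: eq_bigr => j _ /=; rewrite !mxE; ring.
Qed.

Lemma dotp_young (th : R) a b : 0 < th -> `|2 * dotp a b| <= th * sqn a + th^-1 * sqn b.
Proof.
move=> t0; rewrite /dotp mulr_sumr /sqn !mulr_sumr -big_split /=.
apply: le_trans (ler_norm_sum _ _ _) _; apply: ler_sum => j _.
set x := a 0 j; set y := b 0 j.
have e : th * th^-1 = 1 by rewrite mulfV// gt_eqF.
have i0 : 0 < th^-1 by rewrite invr_gt0.
have h1 : 0 <= th^-1 * (th * x - y) ^+ 2 by rewrite mulr_ge0 ?sqr_ge0// ltW.
have h2 : 0 <= th^-1 * (th * x + y) ^+ 2 by rewrite mulr_ge0 ?sqr_ge0// ltW.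
have e1 : th^-1 * (th * x - y) ^+ 2 = th * x ^+ 2 - 2 * (x * y) + th^-1 * y ^+ 2.
  by field; exact: lt0r_neq0.
have e2 : th^-1 * (th * x + y) ^+ 2 = th * x ^+ 2 + 2 * (x * y) + th^-1 * y ^+ 2.
  by field; exact: lt0r_neq0.
by rewrite ler_norml; apply/andP; split; lra.
Qed.

Lemma dotp_norm a b : `|dotp a b| <= m%:R * (`|a| * `|b|).
Proof.
have -> : m%:R * (`|a| * `|b|) = \sum_(j < m) `|a| * `|b|.
  by rewrite sumr_const card_ord mulr_natl.
apply: le_trans (ler_norm_sum _ _ _) _; apply: ler_sum => j _.
by rewrite normrM; apply: ler_pM => //; exact: rv_coord_le.
Qed.

End Square.

(** The best parameter is B / sqrt A; when A or B is 0 a large or a small one contradicts the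
    converse. Integrating Young's inequality and then optimising gives a Cauchy-Schwarz bound for
    the integral. *)
Lemma young_optimum (R : realType) (X A B : R) : 0 <= A -> 0 <= B ->
  (forall th : R, 0 < th -> X <= th * A + th^-1 * B ^+ 2) -> X <= 2 * Num.sqrt A * B.
Proof.
move=> A0 B0 h.
have [A00|Apos] := eqVneq A 0.
  rewrite A00 sqrtr0 mulr0 mul0r leNgt; apply/negP => X0.
  have q0 : 0 < 2 * (B ^+ 2 + 1) / X by rewrite divr_gt0// mulr_gt0//; have := sqr_ge0 B; lra.
  have := h _ q0; rewrite A00 mulr0 add0r invf_div => hX.
  have B1 : 0 < 2 * (B ^+ 2 + 1) by have := sqr_ge0 B; lra.
  move: hX; rewrite mulrAC ler_pdivlMr//; have := sqr_ge0 B; nra.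
have Ap : 0 < A by rewrite lt_def Apos.
have s0 : 0 < Num.sqrt A by rewrite sqrtr_gt0.
have sA : Num.sqrt A ^+ 2 = A by rewrite sqr_sqrtr.
have [B00|Bpos] := eqVneq B 0.
  rewrite B00 mulr0 leNgt; apply/negP => X0.
  have q0 : 0 < X / (2 * A) by rewrite divr_gt0// mulr_gt0.
  have := h _ q0; rewrite B00 expr0n/= mulr0 addr0.
  have -> : X / (2 * A) * A = X / 2 by field; exact: lt0r_neq0.
  lra.
have Bp : 0 < B by rewrite lt_def Bpos.
have q0 : 0 < B / Num.sqrt A by rewrite divr_gt0.
have := h _ q0; rewrite invf_div.
have -> : B / Num.sqrt A * A = Num.sqrt A * B.
  by rewrite -[X in _ * X = _]sA; field; exact: lt0r_neq0.
have -> : Num.sqrt A / B * B ^+ 2 = Num.sqrt A * B by field; exact: lt0r_neq0.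
lra.
Qed.

(** * The integrated square and its second-order expansion *)

Section Potential.
Context {R : realType} {d m : nat}.
Local Notation V := 'rV[R]_d.
Variables (nu T K : R) (G : R -> V -> 'rV[R]_m) (DG : R -> V -> 'M[R]_(d, m)).
Hypothesis nu01 : 0 < nu <= 1.
Hypothesis T0 : 0 < T.
Hypothesis GC : forall t, 0 <= t <= T -> C1h nu K (G t) (DG t).
Hypothesis cG : forall x j, continuous (fun t => G t x 0 j).
Hypothesis cDG : forall x (u : V) j, continuous (fun t => (u *m DG t x) 0 j).

Definition pot x := cint (fun t => sqn (G t x)) T.
Definition dpot x : 'cV[R]_d :=
  \col_i cint (fun t => 2 * dotp (G t x) (delta_mx 0 i *m DG t x)) T.
Definition quad x (u : V) := cint (fun t => sqn (u *m DG t x)) T.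

Let T00 : 0 <= T. Proof. exact: ltW. Qed.
Let K0 : 0 <= K.
Proof. by have [] := GC (t := 0) _; rewrite ?lexx//. Qed.

Let c_sqn x : continuous (fun t => sqn (G t x)).
Proof.
apply: continuous_sum => j t.
have -> : (fun t => G t x 0 j ^+ 2) = (fun t => G t x 0 j * G t x 0 j) by [].
by apply: cvgM; exact: cG.
Qed.

Let c_quad x u : continuous (fun t => sqn (u *m DG t x)).
Proof.
apply: continuous_sum => j t.
have -> : (fun t => (u *m DG t x) 0 j ^+ 2) = (fun t => (u *m DG t x) 0 j * (u *m DG t x) 0 j) by [].
by apply: cvgM; exact: cDG.
Qed.

Let c_dot x u : continuous (fun t => 2 * dotp (G t x) (u *m DG t x)).
Proof.
move=> t; apply: cvgM; first exact: cvg_cst.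
apply: continuous_sum => j {}t; apply: cvgM; [exact: cG|exact: cDG].
Qed.

Lemma dpotE x (u : V) : (u *m dpot x) 0 0 = cint (fun t => 2 * dotp (G t x) (u *m DG t x)) T.
Proof.
rewrite mxE.
have -> : (fun t => 2 * dotp (G t x) (u *m DG t x)) =
  (fun t => \sum_i u 0 i * (2 * dotp (G t x) (delta_mx 0 i *m DG t x))).
  apply/funext => t.
  have -> : u *m DG t x = \sum_i u 0 i *: (delta_mx 0 i *m DG t x).
    by rewrite {1}(row_sum_delta u) mulmx_suml; apply: eq_bigr => i _; rewrite -scalemxAl.
  rewrite /dotp.
  under eq_bigr do rewrite summxE mulr_sumr.
  rewrite exchange_big mulr_sumr; apply: eq_bigr => i _ /=.
  rewrite mulrCA; congr (_ * _); rewrite mulr_sumr; apply: eq_bigr => j _; rewrite mxE; ring.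
rewrite cint_sum//; last first.
  by move=> i t; apply: cvgM; [exact: cvg_cst|exact: c_dot].
by apply: eq_bigr => i _; rewrite (cintZ (u 0 i) _ T00) ?[dpot x _ _]mxE//; exact: c_dot.
Qed.

Lemma pot_ge0 x : 0 <= pot x.
Proof. by apply: cint_ge0 => // t _; exact: sqn_ge0. Qed.

Lemma quad_ge0 x (u : V) : 0 <= quad x u.
Proof. by apply: cint_ge0 => // t _; exact: sqn_ge0. Qed.

Let Bm : R := m%:R * K ^+ 2.

Lemma pot_le x : pot x <= T * Bm.
Proof.
rewrite mulrC -cint_cst//; apply: cint_le => // [t|t tT]; first exact: cvg_cst.
have [_ GK _ _] := GC tT; apply: le_trans (sum_sqr_le_norm _) _; apply: ler_wpM2l => //.
by rewrite ler_sqr ?nnegrE.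
Qed.

Lemma quad_le x (u : V) : quad x u <= T * Bm * `|u| ^+ 2.
Proof.
have -> : T * Bm * `|u| ^+ 2 = Bm * `|u| ^+ 2 * T by ring.
rewrite -cint_cst//; apply: cint_le => // [t|t tT]; first exact: cvg_cst.
have [_ _ DK _] := GC tT; apply: le_trans (sum_sqr_le_norm _) _; rewrite /Bm -mulrA.
apply: ler_wpM2l => //; rewrite -exprMn ler_sqr ?nnegrE ?mulr_ge0//.
Qed.

(* Integrates a pointwise bound with a Young parameter, then optimises it. *)
Lemma pot_young x (v : R -> R) (B c : R) : continuous v -> 0 <= B ->
  (forall t th, 0 <= t <= T -> 0 < th -> v t <= th * sqn (G t x) + th^-1 * B ^+ 2 + c) ->
  cint v T <= 2 * Num.sqrt (pot x) * (Num.sqrt T * B) + c * T.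
Proof.
move=> cv B0 h; rewrite -lerBlDr; apply: young_optimum => [||th th0].
- exact: pot_ge0.
- by rewrite mulr_ge0// sqrtr_ge0.
rewrite exprMn sqr_sqrtr// lerBlDr.
have -> : th * pot x + th^-1 * (T * B ^+ 2) + c * T =
  cint (fun t => th * sqn (G t x) + (th^-1 * B ^+ 2 + c)) T.
  rewrite cintD// ?cintZ// ?cint_cst//.
  - by rewrite /pot; ring.
  - by move=> t; apply: cvgM; [exact: cvg_cst|exact: c_sqn].
  - by move=> t; exact: cvg_cst.
apply: cint_le => // [t|t tT]; last by rewrite addrA; exact: h.
apply: cvgD; last exact: cvg_cst.
by apply: cvgM; [exact: cvg_cst|exact: c_sqn].
Qed.

Let r := Num.sqrt T * Num.sqrt m%:R * K.

Let sqn_norm (z : 'rV[R]_m) (B : R) : 0 <= B -> `|z| <= B -> sqn z <= (Num.sqrt m%:R * B) ^+ 2.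
Proof.
move=> B0 zB; rewrite exprMn sqr_sqrtr//; apply: le_trans (sum_sqr_le_norm _) _.
by apply: ler_wpM2l => //; rewrite ler_sqr ?nnegrE.
Qed.

Lemma dpot_le x (u : V) : `|(u *m dpot x) 0 0| <= 2 * r * (Num.sqrt (pot x) * `|u|).
Proof.
have aux (w : V) : `|w| = `|u| -> (w *m dpot x) 0 0 <= 2 * r * (Num.sqrt (pot x) * `|u|).
  move=> wu; rewrite dpotE.
  have -> : 2 * r * (Num.sqrt (pot x) * `|u|) = 2 * Num.sqrt (pot x) * (Num.sqrt T * (Num.sqrt m%:R * (K * `|u|))) + 0 * T.
    by rewrite /r; ring.
  apply: pot_young => //; first by rewrite mulr_ge0 ?sqrtr_ge0// mulr_ge0.
  move=> t th tT th0; rewrite addr0; have [_ _ DK _] := GC tT.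
  apply: le_trans (ler_norm _) _; apply: le_trans (dotp_young _ _ th0) _.
  rewrite lerD2l; apply: ler_wpM2l; first by rewrite invr_ge0 ltW.
  by apply: sqn_norm; [rewrite mulr_ge0|rewrite -wu; exact: DK].
rewrite ler_norml; apply/andP; split; last exact: aux.
have := aux (- u) (normrN _); rewrite mulNmx mxE; lra.
Qed.

(** Expand |G + u DG + e|^2, where e is the Taylor remainder. The product of G and e yields the term
    in sqrt(pot) |u|^(1+nu), and the products of u DG and e with e yield the last one. The minimum
    appears because e is of order |u|^(1+nu) for small u but also grows at most linearly, so that no
    moment above 2 is forced for large u. *)
Lemma pot_expand x (u : V) :
  `|pot (x + u) - pot x - (u *m dpot x) 0 0 - quad x u| <=
  2 * r * (Num.sqrt (pot x) * `|u| `^ (1 + nu)) +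
  15 * T * Bm * (`|u| * Num.min (`|u| `^ (1 + nu)) `|u|).
Proof.
pose e t := G t (x + u) - G t x - u *m DG t x.
pose v t := sqn (G t (x + u)) - sqn (G t x) - 2 * dotp (G t x) (u *m DG t x) - sqn (u *m DG t x).
have cv : continuous v.
  move=> t; apply: cvgB; last exact: c_quad.
  apply: cvgB; last exact: c_dot.
  by apply: cvgB; exact: c_sqn.
have vE t : v t = 2 * dotp (G t x) (e t) + (2 * dotp (u *m DG t x) (e t) + sqn (e t)).
  have -> : v t = sqn (G t x + (u *m DG t x + e t)) - sqn (G t x) - 2 * dotp (G t x) (u *m DG t x) - sqn (u *m DG t x).
    rewrite /v /e; set a1 := G t x; set b1 := u *m DG t x; set c1 := G t (x + u).
    have -> : a1 + (b1 + (c1 - a1 - b1)) = c1 by apply/rowP => j; rewrite !mxE; ring.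
    by [].
  rewrite !sqnD.
  have -> : dotp (G t x) (u *m DG t x + e t) = dotp (G t x) (u *m DG t x) + dotp (G t x) (e t).
    by rewrite /dotp -big_split; apply: eq_bigr => j _ /=; rewrite !mxE mulrDr.
  ring.
have iv : pot (x + u) - pot x - (u *m dpot x) 0 0 - quad x u = cint v T.
  rewrite dpotE /pot /quad /v.
  have E (a b : R -> R) : continuous a -> continuous b -> cint (fun t => a t - b t) T = cint a T - cint b T.
    move=> ca cb; have -> : (fun t => a t - b t) = (fun t => a t + (-1) * b t).
      by apply/funext => t; rewrite mulN1r.
    rewrite cintD// ?cintZ// ?mulN1r// => t; apply: cvgM; [exact: cvg_cst|exact: cb].
  rewrite !E// => t; rewrite /=.
  - by apply: cvgB; exact: c_sqn.
  - apply: cvgB; last exact: c_dot.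
    by apply: cvgB; exact: c_sqn.
pose mi := Num.min (`|u| `^ (1 + nu)) `|u|.
have e1 t : 0 <= t <= T -> `|e t| <= K * `|u| `^ (1 + nu) by move=> tT; have [_ _ _ h] := GC tT; exact: h.
have e2 t : 0 <= t <= T -> `|e t| <= 3 * K * mi.
  move=> tT; rewrite /mi /Num.min; case: ltP => _.
    apply: le_trans (e1 t tT) _; apply: ler_wpM2r; rewrite ?powR_ge0//; have := K0; lra.
  have [_ _ DK _] := GC tT; have h1 := C1h_lip nu01 (GC tT) (x + u) x.
  rewrite [x + u]addrC addrK in h1.
  apply: le_trans (ler_normB _ _) _; have := DK x u; rewrite [x + u]addrC; lra.
have rest t : 0 <= t <= T -> `|2 * dotp (u *m DG t x) (e t) + sqn (e t)| <= 15 * Bm * (`|u| * mi).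
  move=> tT; have [_ _ DK _] := GC tT.
  have -> : 2 * dotp (u *m DG t x) (e t) + sqn (e t) = dotp (u *m DG t x + (G t (x + u) - G t x)) (e t).
    have -> : u *m DG t x + (G t (x + u) - G t x) = 2 *: (u *m DG t x) + e t.
      by rewrite /e; apply/rowP => j; rewrite !mxE; ring.
    rewrite /dotp /sqn mulr_sumr -big_split; apply: eq_bigr => j _ /=; rewrite !mxE; ring.
  apply: le_trans (dotp_norm _ _) _.
  have -> : 15 * Bm * (`|u| * mi) = m%:R * ((5 * K * `|u|) * (3 * K * mi)) by rewrite /Bm; ring.
  apply: ler_wpM2l => //; apply: ler_pM => //; last exact: e2.
  have h1 := C1h_lip nu01 (GC tT) (x + u) x; rewrite [x + u]addrC addrK in h1.
  have Ku := mulr_ge0 K0 (normr_ge0 u).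
  apply: (@le_trans _ _ (K * `|u| + 2 * K * `|u|)) => [|]; last by lra.
  apply: le_trans (ler_normD _ _) _; apply: lerD; first exact: DK.
  by rewrite [x + u]addrC.
have bd t th : 0 <= t <= T -> 0 < th -> `|v t| <= th * sqn (G t x) + th^-1 * (Num.sqrt m%:R * (K * `|u| `^ (1 + nu))) ^+ 2 + 15 * Bm * (`|u| * mi).
  move=> tT th0; rewrite vE; apply: le_trans (ler_normD _ _) _; apply: lerD; last exact: rest.
  apply: le_trans (dotp_young _ _ th0) _; rewrite lerD2l; apply: ler_wpM2l; first by rewrite invr_ge0 ltW.
  apply: sqn_norm; last exact: e1.
  by rewrite mulr_ge0 ?powR_ge0.
have fin (w : R -> R) : continuous w -> (forall t, w t <= `|v t|) -> cint w T <=
    2 * r * (Num.sqrt (pot x) * `|u| `^ (1 + nu)) + 15 * T * Bm * (`|u| * mi).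
  move=> cw wv.
  have -> : 2 * r * (Num.sqrt (pot x) * `|u| `^ (1 + nu)) + 15 * T * Bm * (`|u| * mi) =
    2 * Num.sqrt (pot x) * (Num.sqrt T * (Num.sqrt m%:R * (K * `|u| `^ (1 + nu)))) + 15 * Bm * (`|u| * mi) * T.
    by rewrite /r; ring.
  apply: pot_young => //; first by rewrite !mulr_ge0 ?sqrtr_ge0 ?powR_ge0.
  by move=> t th tT th0; apply: le_trans (wv t) _; exact: bd.
rewrite iv ler_norml; apply/andP; split; last by apply: fin => // t; exact: ler_norm.
rewrite lerNl.
have -> : - cint v T = cint (fun t => (-1) * v t) T by rewrite cintZ// mulN1r.
apply: fin => [t|t]; first by apply: cvgM; [exact: cvg_cst|exact: cv].
by rewrite mulN1r -normrN; exact: ler_norm.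
Qed.

(** Integral form of |a|^2 - |b|^2 <= 2 a . (a - b). It makes sqrt(pot) Lipschitz, which bounds
    jumps of Q by square roots of its values. *)
Lemma pot_diff_le x y : pot y - pot x <= 4 * r * (Num.sqrt (pot y) * `|y - x|).
Proof.
have -> : 4 * r * (Num.sqrt (pot y) * `|y - x|) =
    2 * Num.sqrt (pot y) * (Num.sqrt T * (Num.sqrt m%:R * (2 * K * `|y - x|))) + 0 * T.
  by rewrite /r; ring.
have -> : pot y - pot x = cint (fun t => sqn (G t y) + (-1) * sqn (G t x)) T.
  rewrite cintD// ?cintZ// ?mulN1r// => t; apply: cvgM; [exact: cvg_cst|exact: c_sqn].
apply: pot_young.
- move=> t; apply: cvgD; first exact: c_sqn.
  by apply: cvgM; [exact: cvg_cst|exact: c_sqn].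
- by rewrite !mulr_ge0 ?sqrtr_ge0.
move=> t th tT th0; rewrite addr0 mulN1r.
have h1 := C1h_lip nu01 (GC tT) y x.
have -> : sqn (G t x) = sqn (G t y + (G t x - G t y)) by congr sqn; apply/rowP => j; rewrite !mxE; ring.
rewrite sqnD.
have dE : dotp (G t y) (G t x - G t y) = - dotp (G t y) (G t y - G t x).
  by rewrite /dotp -sumrN; apply: eq_bigr => j _; rewrite !mxE; ring.
have := dotp_young (G t y) (G t y - G t x) th0.
have h2 : sqn (G t y - G t x) <= (Num.sqrt m%:R * (2 * K * `|y - x|)) ^+ 2.
  by apply: sqn_norm; rewrite ?mulr_ge0.
have h3 : th^-1 * sqn (G t y - G t x) <= th^-1 * (Num.sqrt m%:R * (2 * K * `|y - x|)) ^+ 2.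
  by apply: ler_wpM2l => //; rewrite invr_ge0 ltW.
have := ler_norm (2 * dotp (G t y) (G t y - G t x)).
have := sqn_ge0 (G t x - G t y).
rewrite dE; lra.
Qed.

(** The unweighted first-order form, obtained from boundedness of the potential; it feeds
    [taylor_holder], for continuity of the gradient, and the chain rule along the flow. *)
Lemma pot_taylor : exists2 C : R, 0 <= C & forall x (u : V),
  `|pot (x + u) - pot x - (u *m dpot x) 0 0| <= C * `|u| `^ (1 + nu).
Proof.
have nn := nu01; case/andP: (nn) => n0 n1.
have Bm0 : 0 <= T * Bm by rewrite /Bm !mulr_ge0// sqr_ge0.
have r0 : 0 <= r by rewrite /r !mulr_ge0 ?sqrtr_ge0.
have s0 := sqrtr_ge0 (T * Bm).
have C0 : 0 <= 2 * (r * Num.sqrt (T * Bm)) by rewrite !mulr_ge0.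
have sP x : Num.sqrt (pot x) <= Num.sqrt (T * Bm) by apply: ler_wsqrtr; exact: pot_le.
exists (2 * (r * Num.sqrt (T * Bm)) + 16 * (T * Bm)); first by lra.
move=> x u; have P0 := powR_ge0 `|u| (1 + nu).
have [u1|u1] := leP `|u| 1.
  have h := pot_expand x u; have q := quad_le x u; have q0 := quad_ge0 x u.
  have i1 : `|u| * Num.min (`|u| `^ (1 + nu)) `|u| <= `|u| `^ (1 + nu).
    apply: (@le_trans _ _ (1 * `|u| `^ (1 + nu))); last by rewrite mul1r.
    have m0 : 0 <= Num.min (`|u| `^ (1 + nu)) `|u| by rewrite le_min P0 normr_ge0.
    by apply: ler_pM => //; rewrite ge_min lexx.
  have i2 : `|u| ^+ 2 <= `|u| `^ (1 + nu).
    have [->|un] := eqVneq `|u| 0; first by rewrite expr0n powR0 ?gt_eqF//; lra.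
    by rewrite -powR_mulrn//; apply: ger_powR; [rewrite lt_def un normr_ge0|lra].
  have i3 : 2 * r * (Num.sqrt (pot x) * `|u| `^ (1 + nu)) <= 2 * (r * Num.sqrt (T * Bm)) * `|u| `^ (1 + nu).
    have e := ler_wpM2l (mulr_ge0 (mulr_ge0 (ler0n R 2) r0) P0) (sP x).
    have E1 : 2 * r * (Num.sqrt (pot x) * `|u| `^ (1 + nu)) = 2 * r * `|u| `^ (1 + nu) * Num.sqrt (pot x) by ring.
    have E2 : 2 * (r * Num.sqrt (T * Bm)) * `|u| `^ (1 + nu) = 2 * r * `|u| `^ (1 + nu) * Num.sqrt (T * Bm) by ring.
    by rewrite E1 E2.
  have j1 := ler_wpM2l Bm0 i1; have j2 := ler_wpM2l Bm0 i2.
  have := ler_normD (pot (x + u) - pot x - (u *m dpot x) 0 0 - quad x u) (quad x u).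
  rewrite subrK (ger0_norm q0).
  lra.
have i1 : `|u| <= `|u| `^ (1 + nu).
  by rewrite -[X in X <= _]powRr1//; apply: ler_powR; [exact: ltW|lra].
have i2 : 1 <= `|u| `^ (1 + nu) by apply: le_trans (ltW u1) i1.
have a1 := pot_le x; have a2 := pot_le (x + u); have b1 := pot_ge0 x; have b2 := pot_ge0 (x + u).
have h : `|(u *m dpot x) 0 0| <= 2 * (r * Num.sqrt (T * Bm)) * `|u| `^ (1 + nu).
  have e : Num.sqrt (pot x) * `|u| <= Num.sqrt (T * Bm) * `|u| `^ (1 + nu) by exact: ler_pM.
  have E2 : 2 * (r * Num.sqrt (T * Bm)) * `|u| `^ (1 + nu) = 2 * r * (Num.sqrt (T * Bm) * `|u| `^ (1 + nu)) by ring.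
  rewrite E2; apply: le_trans (dpot_le x u) (ler_wpM2l _ e); exact: mulr_ge0.
have j := ler_wpM2l Bm0 i2; rewrite mulr1 in j.
apply: le_trans (ler_normB _ _) _.
have : `|pot (x + u) - pot x| <= T * Bm by rewrite ler_norml; apply/andP; split; lra.
lra.
Qed.

Lemma pot_continuous : continuous pot.
Proof.
apply: (@holder_continuous R V R^o _ (4 * r * Num.sqrt (T * Bm)) 1) => // x y.
rewrite powRr1//.
have r0 : 0 <= r by rewrite /r !mulr_ge0 ?sqrtr_ge0.
have h a b : pot b - pot a <= 4 * r * Num.sqrt (T * Bm) * `|x - y| \/ `|b - a| != `|x - y|.
  have [e|] := eqVneq `|b - a| `|x - y|; [left|by right].
  apply: le_trans (pot_diff_le a b) _; rewrite e mulrA; apply: ler_wpM2r => //.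
  apply: ler_wpM2l; first exact: mulr_ge0.
  by apply: ler_wsqrtr; exact: pot_le.
rewrite ler_norml; apply/andP; split.
  by have [|] := h x y; [lra|rewrite distrC eqxx].
by have [|] := h y x; [lra|rewrite eqxx].
Qed.

Lemma dpot_continuous i : continuous (fun x => dpot x i 0).
Proof.
have [C C0 hC] := pot_taylor; have nn := nu01; case/andP: (nn) => n0 n1.
have hC' (x u : V) : `|(pot (x + u))%:M - (pot x)%:M - u *m dpot x| <= C * `|u| `^ (1 + nu).
  apply: rv_norm_le => [|j]; first by rewrite mulr_ge0 ?powR_ge0.
  by rewrite ord1 !mxE; have := hC x u; rewrite !mxE.
have hL := @taylor_holder R d nu nn 1 C (fun x => (pot x)%:M) dpot C0 hC'.
apply: (@holder_continuous R V R^o _ (6 * C * `|delta_mx 0 i : V|) nu) => // x y.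
have := hL x y (delta_mx 0 i); rewrite -!rowE => /(le_trans (rv_coord_le _ 0)).
by rewrite !mxE mulrAC.
Qed.

(** Some column of DG at time 0 and point p is nonzero; by Riesz it is the inner product with a
    vector, normalised to [v]. For short times and x near p this coordinate of u DG moves little,
    and y^2 >= z^2 / 2 - (y - z)^2 bounds the integrand below. The direction [v] is fixed before the
    tolerance [b], which will later be chosen against the moments of the noise. *)
Lemma quad_lower (ip : {dot V for idfun}) p (w : V) : w *m DG 0 p != 0 ->
  exists2 v : V, ip_norm ip v = 1 & forall b : R, 0 < b -> exists2 kap : R, 0 < kap &
    exists2 rad : R, 0 < rad & forall x, `|x - p| < rad -> forall u : V,
      kap * (ip u v ^+ 2 - b * `|u| ^+ 2) <= quad x u.
Proof.
have key (a y e : R) : (y - a) ^+ 2 <= e -> a ^+ 2 / 2 - e <= y ^+ 2.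
  by have := sqr_ge0 (2 * y - a); lra.
have nn := nu01; case/andP: (nn) => n0 n1; move=> wD.
have /rV0Pn[j wj] := wD.
have [v0 hv0] := riesz ip (col j (DG 0 p)).
have E u : (u *m DG 0 p) 0 j = ip u v0 by rewrite -hv0 [LHS]mxE [RHS]mxE; apply: eq_bigr => i _; rewrite [col _ _ _ _]mxE.
have v0n : v0 != 0 by apply: contraNneq wj => v00; rewrite E v00 linear0r.
pose nv := ip_norm ip v0.
have nv0 : 0 < nv by rewrite /nv sqrtr_gt0; apply: neq0_dnorm_gt0.
exists (nv^-1 *: v0); first by rewrite ip_normZ gtr0_norm ?invr_gt0// mulVf// gt_eqF.
have E' u : (u *m DG 0 p) 0 j = nv * ip u (nv^-1 *: v0).
  by rewrite linearZr_LR /= /GRing.scale/= mulrA mulfV ?mul1r ?gt_eqF.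
move=> b b0.
pose ep := nv * Num.sqrt (b / 2).
have ep0 : 0 < ep by rewrite mulr_gt0// sqrtr_gt0 divr_gt0.
pose F (t : R) : R := \sum_i `|((delta_mx 0 i : V) *m DG t p) 0 j - ((delta_mx 0 i : V) *m DG 0 p) 0 j|.
have cF : continuous F.
  apply: continuous_sum => i t; apply: (@continuous_comp _ _ _ (fun t => ((delta_mx 0 i : V) *m DG t p) 0 j - ((delta_mx 0 i : V) *m DG 0 p) 0 j) (fun z : R => `|z|)).
    by apply: cvgB; [exact: cDG|exact: cvg_cst].
  exact: norm_continuous.
have F0 : F 0 = 0 by apply: big1 => i _; rewrite subrr normr0.
have [tau [tau0 tauT htau]] : exists tau : R, [/\ 0 < tau, tau <= T & forall t, 0 <= t <= tau -> F t <= ep / 2].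
  have : \forall t \near (0 : R), `|F 0 - F t| <= ep / 2.
    by move/cvgrPdist_le : (cF 0); apply; rewrite divr_gt0.
  move=> /nbhs_ballP[e /= e0 he]; exists (Num.min (e / 2) T); split.
  - by rewrite lt_min T0 divr_gt0.
  - by rewrite ge_min lexx orbT.
  move=> t /andP[t0]; rewrite le_min => /andP[te _].
  have := he t; rewrite /ball/= F0 !sub0r !normrN (ger0_norm t0) => h.
  have {}h := h (le_lt_trans te _); apply: le_trans (ler_norm _) (h _); lra.
pose rad := (ep / 2 / (6 * K + 1)) `^ nu^-1.
have K60 : 0 < 6 * K + 1 by have := K0; lra.
have q0 : 0 < ep / 2 / (6 * K + 1) by rewrite !divr_gt0.
exists (tau * nv ^+ 2 / 2); first by rewrite divr_gt0// mulr_gt0// exprn_gt0.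
exists rad; first exact: powR_gt0.
move=> x xp u.
have xn : 6 * K * `|x - p| `^ nu <= ep / 2.
  have h : `|x - p| `^ nu <= ep / 2 / (6 * K + 1).
    have -> : ep / 2 / (6 * K + 1) = rad `^ nu by rewrite -powRrM mulVf ?gt_eqF// powRr1// ltW.
    by apply: powRnu_mono; [exact: ltW|rewrite normr_ge0 ltW].
  apply: (@le_trans _ _ ((6 * K + 1) * (ep / 2 / (6 * K + 1)))).
    by apply: ler_pM => //; [have := K0; lra|lra].
  by rewrite mulrC divfK ?gt_eqF.
have close t : 0 <= t <= tau -> `|(u *m DG t x) 0 j - (u *m DG 0 p) 0 j| <= ep * `|u|.
  move=> /andP[t0 tt].
  have tT : 0 <= t <= T by rewrite t0 (le_trans tt).
  have [_ _ _ hT] := GC tT.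
  have h1 := taylor_holder nn K0 hT x p u.
  have h2 : `|(u *m DG t p) 0 j - (u *m DG 0 p) 0 j| <= ep / 2 * `|u|.
    have -> : (u *m DG t p) 0 j - (u *m DG 0 p) 0 j =
       \sum_i u 0 i * (((delta_mx 0 i : V) *m DG t p) 0 j - ((delta_mx 0 i : V) *m DG 0 p) 0 j).
      rewrite !mxE -sumrB; apply: eq_bigr => i _; rewrite -!rowE !mxE; ring.
    apply: le_trans (ler_norm_sum _ _ _) _; rewrite mulrC.
    apply: le_trans (ler_wpM2l (normr_ge0 u) (htau t _)); last by rewrite t0.
    rewrite mulr_sumr; apply: ler_sum => i _; rewrite normrM; apply: ler_wpM2r => //.
    exact: rv_coord_le.
  have h3 : `|(u *m DG t x) 0 j - (u *m DG t p) 0 j| <= ep / 2 * `|u|.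
    have -> : (u *m DG t x) 0 j - (u *m DG t p) 0 j = (u *m DG t x - u *m DG t p) 0 j by rewrite !mxE.
    apply: le_trans (rv_coord_le _ _) _; apply: le_trans h1 _; exact: ler_wpM2r.
  have := ler_normD ((u *m DG t x) 0 j - (u *m DG t p) 0 j) ((u *m DG t p) 0 j - (u *m DG 0 p) 0 j).
  rewrite addrA subrK; lra.
have ep2 : ep ^+ 2 = nv ^+ 2 * (b / 2) by rewrite exprMn (@sqr_sqrtr _ (b / 2))//; apply: divr_ge0 => //; exact: ltW.
have sub : cint (fun t => sqn (u *m DG t x)) tau <= quad x u.
  by apply: cint_subinterval => // [|t _]; [exact: ltW|exact: sqn_ge0].
apply: le_trans sub.
have -> : tau * nv ^+ 2 / 2 * (ip u (nv^-1 *: v0) ^+ 2 - b * `|u| ^+ 2) =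
  (nv ^+ 2 / 2 * ip u (nv^-1 *: v0) ^+ 2 - ep ^+ 2 * `|u| ^+ 2) * tau by rewrite ep2; field.
set A := _ - _; apply: (@le_trans _ _ (cint (fun _ => A) tau)); first by rewrite cint_cst// ltW.
have cA : continuous (fun _ : R => A) by move=> t; exact: cvg_cst.
apply: (cint_le cA (@c_quad x u) (ltW tau0)) => t tt; rewrite /A.
apply: (@le_trans _ _ ((u *m DG t x) 0 j ^+ 2)); last first.
  by rewrite /sqn (bigD1 j)//= lerDl; apply: sumr_ge0 => i _; exact: sqr_ge0.
have := close t tt; rewrite E'; set y := (u *m DG t x) 0 j; set z := ip _ _ => h.
have : (y - nv * z) ^+ 2 <= (ep * `|u|) ^+ 2.
  by rewrite -real_normK ?num_real// ler_sqr ?nnegrE// mulr_ge0// ltW.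
by move=> /key; rewrite [(ep * _) ^+ 2]exprMn [(nv * z) ^+ 2]exprMn [nv ^+ 2 / 2 * _]mulrAC.
Qed.

End Potential.

(* [Q] behaves like the squared distance to [M]; [L x] is its gradient at [x]
   and [qd x] the quadratic part of its expansion, nondegenerate in some
   direction at every point of [S]. Errors are weighted by [Num.sqrt (Q x)]
   where the Hölder exponent alone would be too weak. *)
Record lyapunov (R : realType) (d : nat) (nu : R) (ip : {dot 'rV[R]_d for idfun})
    (f : 'rV[R]_d -> 'rV[R]_d) (S Nb : set 'rV[R]_d) (Q : 'rV[R]_d -> R)
    (L : 'rV[R]_d -> 'cV[R]_d) (qd : 'rV[R]_d -> 'rV[R]_d -> R) (K b : R) : Prop := Lyapunov {
  lyK0 : 0 <= K;
  lyb0 : 0 < b;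
  lyN_open : open Nb;
  lyS_sub : S `<=` Nb;
  lyQ_ge0 : forall x, 0 <= Q x;
  lyQ_le : forall x, Q x <= K;
  lyQ_S : forall p, S p -> Q p = 0;
  lyQ_continuous : continuous Q;
  lyL_continuous : forall i, continuous (fun x => L x i 0);
  lyL_le : forall x (u : 'rV[R]_d), `|(u *m L x) 0 0| <= K * (Num.sqrt (Q x) * `|u|);
  lyf_ge : forall x, Nb x -> b * Q x <= (f x *m L x) 0 0;
  lyQ_expand : forall x (u : 'rV[R]_d),
    Q x + (u *m L x) 0 0 + qd x u - K * (Num.sqrt (Q x) * `|u| `^ (1 + nu))
      - K * (`|u| * Num.min (`|u| `^ (1 + nu)) `|u|) <= Q (x + u);
  lyQ_diff : forall x y, Q y - Q x <= K * (Num.sqrt (Q y) * `|y - x|);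
  lyqd_ge0 : forall x u, 0 <= qd x u;
  lyqd_lower : forall p, S p -> exists2 v : 'rV[R]_d, ip_norm ip v = 1 &
    forall e : R, 0 < e -> exists2 kap : R, 0 < kap & exists2 rad : R, 0 < rad &
      forall x, `|x - p| < rad -> forall u : 'rV[R]_d,
        kap * (ip u v ^+ 2 - e * `|u| ^+ 2) <= qd x u }.

Section FlowPotential.
Context {R : realType} {d m : nat}.
Local Notation V := 'rV[R]_d.
Variables (nu T K : R) (H : V -> 'rV[R]_m) (Psi : R -> V -> V) (g : V -> V).
Variable DG : R -> V -> 'M[R]_(d, m).
Hypothesis nu01 : 0 < nu <= 1.
Hypothesis T0 : 0 < T.
Hypothesis GC : forall t, 0 <= t <= T -> C1h nu K (H \o Psi t) (DG t).
Hypothesis cG : forall x j, continuous (fun t => H (Psi t x) 0 j).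
Hypothesis cDG : forall x (u : V) j, continuous (fun t => (u *m DG t x) 0 j).
Hypothesis Psi0 : forall x, Psi 0 x = x.
Hypothesis PsiD : forall s t x, Psi (s + t) x = Psi s (Psi t x).
Hypothesis dPsi : forall x (t : R), is_derive t 1 (Psi^~ x) (g (Psi t x)).

Let G t := H \o Psi t.

(* Along the flow [pot (Psi s x)] is the integral of [sqn (H (Psi t x))] over
   [s, s + T]; differentiate at [s = 0]. *)
Lemma pot_generator x : (g x *m dpot T G DG x) 0 0 = sqn (H (Psi T x)) - sqn (H x).
Proof.
pose v t := sqn (H (Psi t x)).
have cv : continuous v.
  apply: continuous_sum => j t.
  have -> : (fun t => H (Psi t x) 0 j ^+ 2) = (fun t => H (Psi t x) 0 j * H (Psi t x) 0 j) by [].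
  by apply: cvgM; exact: cG.
have [v0 dv] := cintP cv.
have shift (s t : R) : is_derive t 1 (fun t => cint v (t + s)) (v (t + s)).
  have d1 : is_derive t 1 (fun t => t + s) (1 + 0).
    by apply: is_deriveD.
  have := @is_derive1_comp _ (cint v) (fun t => t + s) t _ _ (dv (t + s)) d1.
  by rewrite addr0 mulr1.
have E s : pot T G (Psi s x) = cint v (T + s) - cint v s.
  rewrite /pot; apply/esym.
  have -> : (fun t => sqn (G t (Psi s x))) = (fun t => v (t + s)).
    by apply/funext => t; rewrite /G /v /= -PsiD.
  apply: (cint_unique (F := fun t => cint v (t + s) - cint v s)).
  - move=> t; apply: (@continuous_comp _ _ _ (fun t => t + s) v); last exact: cv.
    by apply: cvgD; [exact: cvg_id|exact: cvg_cst].
  - exact: ltW.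
  - by rewrite add0r subrr.
  move=> t; have h := is_deriveB (shift s t) (is_derive_cst (cint v s) t 1).
  by rewrite subr0 in h; exact: h.
have d1 : is_derive (0 : R) (1 : R) (fun s => pot T G (Psi s x)) (v T - v 0).
  have -> : (fun s => pot T G (Psi s x)) = (fun s => cint v (s + T) - cint v s).
    by apply/funext => s; rewrite E (addrC T).
  have h := is_deriveB (shift T 0) (dv 0); rewrite add0r in h; exact: h.
have [C C0 hC] := pot_taylor nu01 T0 GC cG cDG.
have d2 : is_derive (0 : R) (1 : R) ((fun y => (pot T G y)%:M : 'rV[R]_1) \o (Psi^~ x)) (g x *m dpot T G DG x).
  have := dPsi x 0; rewrite Psi0; apply: (taylor_chain (K := C) nu01 ltr01) => u _; rewrite Psi0.
  apply: rv_norm_le => [|j]; first by rewrite mulr_ge0 ?powR_ge0.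
  by rewrite ord1 !mxE; have := hC x u; rewrite !mxE; apply.
have := (rv_is_derive _ _ _).1 d2 0.
have -> : (fun s => ((fun y => (pot T G y)%:M : 'rV[R]_1) \o (Psi^~ x)) s 0 0) = (fun s => pot T G (Psi s x)).
  by apply/funext => s /=; rewrite mxE.
move=> d3; have e3 := @derive_val _ _ _ _ _ _ _ d3; have e1 := @derive_val _ _ _ _ _ _ _ d1.
by rewrite -e3 e1 /v Psi0.
Qed.

End FlowPotential.

Section LyapunovExists.
Context {R : realType} {d : nat}.
Local Notation V := 'rV[R]_d.
Variables (delta : nat) (ip : {dot V for idfun}) (nu : R) (f : V -> V) (Phi : R -> V -> V).
Variables (S M : set V) (E : V -> {vspace V}) (lambda C : R).
Hypothesis nu01 : 0 < nu <= 1.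
Hypothesis hf : C1_holder nu setT f.
Hypothesis hPhi : is_flow f Phi.
Hypothesis hScompact : compact S.
Hypothesis hSinv : flow_invariant f Phi S.
Hypothesis hSM : S `<=` M.
Hypothesis hdelta : (1 <= delta <= d)%N.
Hypothesis hM : is_submanifold nu (d - delta) M.
Hypothesis hMinv : locally_invariant f Phi S M.
Hypothesis hsplit : forall p, S p -> direct_sum (tangent_space M p) [set` E p].
Hypothesis hEcont : grassmann_continuous ip delta S E.
Hypothesis hEinv : forall (t : R) p, S p -> 'd (Phi t) p @` [set` E p] = [set` E (Phi t p)].
Hypothesis hlambda : 0 < lambda.
Hypothesis hC : 0 < C.
Hypothesis hexp : forall p w (t : R), S p -> w \in E p -> 0 <= t ->
  C * expR (lambda * t) * ip_norm ip w <= ip_norm ip ('d (Phi t) p w).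

(** The constant [C] and the equivalence of norms may spoil any fixed factor; a long enough time
    makes up for it, and the linear bound expR x >= 1 + x suffices. *)
Lemma expansion_time (A c1 : R) : 0 < c1 -> exists2 T : R, 0 < T &
  forall p w, S p -> w \in E p -> A * `|w| <= c1 * `|'d (Phi T) p w|.
Proof.
move=> c10; have [i1 [i2 [i10 i20 hi2 hi1]]] := ip_norm_equiv ip.
pose B := c1 * C * lambda / (i1 * i2).
have Cp := hC; have lp := hlambda.
have i12 : 0 < i1 * i2 by exact: mulr_gt0.
have B0 : 0 < B by rewrite divr_gt0// !mulr_gt0.
exists (`|A| / B + 1); first by rewrite ltr_wpDl// divr_ge0// ltW.
set T := _ + 1.
have T0 : 0 <= T by rewrite addr_ge0// divr_ge0// ltW.
have AT : A <= B * T.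
  rewrite /T mulrDr mulrC divfK ?gt_eqF// mulr1.
  by have := ler_norm A; have := B0; lra.
move=> p w Sp wE; have := hexp Sp wE T0.
set e := expR _; have eT : lambda * T <= e by have := @expR_ge1Dx R (lambda * T); rewrite -/e; lra.
set z := 'd (Phi T) p w => h.
have zn : ip_norm ip z <= i2 * `|z| by exact: hi2.
have wn : `|w| <= i1 * ip_norm ip w by exact: hi1.
have h1 : C * (lambda * T) * ip_norm ip w <= i2 * `|z|.
  apply: le_trans zn; apply: le_trans h; apply: ler_wpM2r; first exact: sqrtr_ge0.
  by apply: ler_wpM2l => //; exact: ltW.
apply: (@le_trans _ _ (B * T * `|w|)); first exact: ler_wpM2r.
apply: (@le_trans _ _ (B * T * (i1 * ip_norm ip w))).
  by apply: ler_wpM2l => //; apply: mulr_ge0 => //; exact: ltW.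
have -> : B * T * (i1 * ip_norm ip w) = c1 / i2 * (C * (lambda * T) * ip_norm ip w).
  by rewrite /B; field; rewrite !lt0r_neq0.
have -> : c1 * `|z| = c1 / i2 * (i2 * `|z|) by field; exact: lt0r_neq0.
by apply: ler_wpM2l => //; apply: divr_ge0; exact: ltW.
Qed.

Theorem lyapunov_exists (U : set V) : S `<=` U° -> exists Nb Q L qd K b,
  lyapunov nu ip f S Nb Q L qd K b /\ Nb `<=` U.
Proof.
move=> SU; have nn := nu01.
have [Kg [g [Dg [Psi [gC Psi0 dPsi gf]]]]] := global_flow nn hf hScompact.
have [m [K [H [D [HC H0 inj]]]]] := global_defining nn hM hdelta hScompact hSM hsplit hEcont.
have [c1 c10 hc1] := lower_bound_on_E nn hScompact hEcont HC inj.
have [T T0 hT] := expansion_time (8 * (m%:R + 1) * (K + 1)) c10.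
have T00 := ltW T0.
have [AW [W [AW0 W0 dW hW]]] := flow_C1h nn gC T00 Psi0 dPsi.
have hPS := Psi_S nn hPhi hSinv gC Psi0 dPsi gf.
have abs t : 0 <= t <= T -> `|t| <= T by case/andP => t0 tT; rewrite ger0_norm.
have [KT GC] : exists KT, forall t, 0 <= t <= T -> C1h nu KT (H \o Psi t) (fun x => W t x *m D (Psi t x)).
  exists (K * (AW `^ (1 + nu) + AW + 1)) => t /abs tT.
  by apply: (C1h_comp nn HC AW0) => x u; have [] := hW t x u tT.
have [r2 r20 hPM] := Psi_M nn hPhi hScompact hSinv gC Psi0 dPsi gf hMinv T00.
have hgrow p : S p -> forall w, w \in E p ->
    8 * (m%:R + 1) * (K + 1) * `|w| <= `|w *m (W T p *m D (Psi T p))|.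
  move=> Sp w wE; apply: le_trans (hT p w Sp wE) _.
  have [SP PE] := hPS p T Sp.
  have TT : `|T| <= T by rewrite ger0_norm.
  have dE := Psi_diff nn hPhi hSinv gC Psi0 dPsi gf Sp (fun u => (let: And3 _ _ h := hW T p u TT in h)).
  rewrite dE mulmxA; apply: hc1 => //.
  have : [set` E (Phi T p)] (w *m W T p) by rewrite -hEinv//; exists w => //; exact: dE.
  by rewrite PE.
have LG p Sp := local_growth nn HC H0 c10 hc1 (local_projection nn hM hdelta hSM hsplit) T00 GC r20 hPM hgrow (p := p) Sp.
have cPsi x : continuous (Psi^~ x) by move=> t; exact: is_derive_continuous (dPsi x t).
have cG x j : continuous (fun t => H (Psi t x) 0 j).
  have cH : continuous (fun y => H y 0 j).
    apply: (@holder_continuous R V R^o _ (2 * K) 1) => // y z; rewrite powRr1//.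
    apply: le_trans (C1h_lip nn HC y z).
    by have := rv_coord_le (H y - H z) j; rewrite !mxE.
  by move=> t; apply: (@continuous_comp _ _ _ (Psi^~ x) (fun y => H y 0 j)); [exact: cPsi|exact: cH].
have cDG x (u : V) j : continuous (fun t => (u *m (W t x *m D (Psi t x))) 0 j).
  have -> : (fun t => (u *m (W t x *m D (Psi t x))) 0 j) = (fun t => ((u *m W t x) *m D (Psi t x)) 0 j).
    by apply/funext => t; rewrite mulmxA.
  apply: (mulD_continuous nn HC) => // t; exact: is_derive_continuous (dW x u t).
have PsiD := Psi_add nn gC Psi0 dPsi.
have gen := pot_generator nn T0 GC cG cDG Psi0 PsiD dPsi.
pose G t := H \o Psi t; pose DG t x := W t x *m D (Psi t x).
pose Q := pot T G; pose L := dpot T G DG.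
pose Cq := 16 * m%:R * KT ^+ 2 / c1 ^+ 2.
have Cq0 : 0 <= Cq by apply: divr_ge0; [apply: mulr_ge0; [exact: mulr_ge0|exact: sqr_ge0]|exact: sqr_ge0].
have b0 : 0 < (Cq * T + 1)^-1 by rewrite invr_gt0 ltr_wpDl// mulr_ge0.
have [KT0 _ _ _] := GC 0 (introT andP (conj (lexx 0) T00)).
pose rr := Num.sqrt T * Num.sqrt m%:R * KT.
have rr0 : 0 <= rr by rewrite /rr !mulr_ge0 ?sqrtr_ge0.
pose Bm := T * (m%:R * KT ^+ 2).
have Bm0 : 0 <= Bm by rewrite /Bm !mulr_ge0// sqr_ge0.
pose KK := 4 * rr + 15 * Bm.
have KK0 : 0 <= KK by rewrite /KK; lra.
(* The inequality has to hold on an open set: it is proved at every point near [S], and the interior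
   is taken. The rate comes from two bounds of [local_growth]: the derivative of Q along f is at
   least 3 |H(x)|^2, while Q is at most Cq T |H(x)|^2. *)
pose good x := U x /\ (Cq * T + 1)^-1 * Q x <= (f x *m L x) 0 0.
exists (good°), Q, L, (quad T DG), KK, (Cq * T + 1)^-1; split; last first.
  by move=> x /interior_subset [].
split => //.
- exact: open_interior.
- move=> p Sp; have [r r0 hr] := LG p Sp.
  have : \forall x \near p, U x by exact: SU.
  have n1 := @near_dist_lt R V p r r0; have n2 := @near_dist_lt R V p 1 ltr01.
  rewrite /interior/=; move: n1 n2; apply: filterS3 => x xr x1 Ux; split => //.
  have [g1 g2] := hr x xr.
  rewrite -(gf x p Sp (ltW x1)) gen.
  have QT : Q x <= Cq * sqn (H x) * T.
    have cs : continuous (fun t => sqn (G t x)).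
      apply: continuous_sum => j t.
      have -> : (fun t => G t x 0 j ^+ 2) = (fun t => H (Psi t x) 0 j * H (Psi t x) 0 j) by [].
      by apply: cvgM; exact: cG.
    have cc : continuous (fun _ : R => Cq * sqn (H x)) by move=> t; exact: cvg_cst.
    by rewrite -(cint_cst _ T00); exact: (cint_le cs cc T00 g2).
  have s0 := sqn_ge0 (H x).
  rewrite mulrC ler_pdivrMr; last by rewrite -invr_gt0.
  have e0 : 0 <= Cq * T * sqn (H x) by apply: mulr_ge0 => //; exact: mulr_ge0.
  have e1 : sqn (H x) * (Cq * T + 1) <= (sqn (H (Psi T x)) - sqn (H x)) * (Cq * T + 1).
    apply: ler_wpM2r; last by lra.
    by rewrite -invr_ge0 ltW.
  apply: le_trans QT _; apply: le_trans e1; lra.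
- by move=> x; exact: (pot_ge0 T0 cG).
- move=> x; apply: le_trans (pot_le T0 GC cG x) _; rewrite -/Bm /KK; lra.
- move=> p Sp; rewrite /Q /pot.
  have -> : (fun t => sqn (G t p)) = (fun _ => 0).
    apply/funext => t; rewrite /G /=; have [SP _] := hPS p t Sp; rewrite H0; last exact: hSM.
    by rewrite /sqn big1// => j _; rewrite mxE expr0n.
  by rewrite cint_cst// mul0r.
- exact: pot_continuous nn T0 GC cG.
- exact: dpot_continuous nn T0 GC cG cDG.
- move=> x u; apply: le_trans (dpot_le T0 GC cG cDG x u) _.
  apply: ler_wpM2r; first by rewrite mulr_ge0// sqrtr_ge0.
  rewrite -/rr /KK; lra.
- by move=> x /interior_subset [].
- move=> x u; have := pot_expand nn T0 GC cG cDG x u; rewrite -/rr -/Bm -/Q -/L => /ler_normlP[h _].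
  set P1 := Num.sqrt _ * _; set P2 := `|u| * _.
  have p1 : 0 <= P1 by rewrite mulr_ge0 ?sqrtr_ge0 ?powR_ge0.
  have p2 : 0 <= P2 by rewrite mulr_ge0// le_min powR_ge0/=.
  have q1 : 2 * rr * P1 <= KK * P1 by apply: ler_wpM2r => //; rewrite /KK; lra.
  have q2 : 15 * Bm * P2 <= KK * P2 by apply: ler_wpM2r => //; rewrite /KK; lra.
  move: h; rewrite -/P1 -/P2; have -> : 15 * T * (m%:R * KT ^+ 2) * P2 = 15 * Bm * P2 by rewrite /Bm; ring.
  lra.
- move=> x y; apply: le_trans (pot_diff_le nn T0 GC cG x y) _.
  apply: ler_wpM2r; first by rewrite mulr_ge0// sqrtr_ge0.
  rewrite -/rr /KK; lra.
- by move=> x u; exact: (quad_ge0 T0 cDG).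
- move=> p Sp; have [hdim _] := hEcont.
  (* Since delta >= 1, E_p contains a nonzero vector, which the differential of H does not kill:
     this provides the direction in which noise makes Q grow. *)
  have wn : vpick (E p) != 0.
    by rewrite vpick0 -dimv_eq0 hdim// -lt0n; case/andP: hdelta.
  apply: (quad_lower nn T0 GC cDG ip (w := vpick (E p))).
  rewrite W0 Psi0 mul1mx; apply: contra_neq wn => e; apply: inj e => //; exact: memv_pick.
Qed.

End LyapunovExists.

Ltac nonneg := by repeat first [done | exact: sqr_ge0 | exact: ltW | exact: sqrtr_ge0
  | exact: powR_ge0 | apply: addr_ge0 | apply: mulr_ge0 | rewrite invr_ge0].

(** * Escape of an almost repelled process *)

Section Expectation.
Context {R : realType} {disp : measure_display} {T : measurableType disp}.
Variable P : probability T R.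
Implicit Types (A B : set T) (f g h : T -> R).

Definition pr A : R := fine (P A).
(** In the escape argument an inequality E[Z | F_k] >= 0 is always expressed as nonnegativity of the
    integral of Z over the events A of F_k in the good region, so that integrability is required
    only there. *)
Definition ev A f : R := \int[P]_(w in A) f w.
Definition itg A f := measurable A /\ P.-integrable A (EFin \o f).

Lemma prE A : measurable A -> P A = (pr A)%:E.
Proof. by move=> mA; rewrite /pr fineK// fin_num_measure. Qed.

Lemma pr_ge0 A : 0 <= pr A.
Proof. by rewrite /pr fine_ge0. Qed.

Lemma pr_le A B : measurable A -> measurable B -> A `<=` B -> pr A <= pr B.
Proof. by move=> mA mB AB; rewrite -lee_fin -!prE// le_measure ?inE. Qed.

Lemma pr_split A B : measurable A -> measurable B -> pr A = pr (A `&` B) + pr (A `\` B).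
Proof.
move=> mA mB; apply: EFin_inj; rewrite EFinD -!prE//; last 2 first.
  exact: measurableD.
  exact: measurableI.
rewrite addeC -measureU//; first by rewrite setUC setUIDK.
- exact: measurableD.
- exact: measurableI.
- by rewrite setDE setIACA setICl setI0.
Qed.

Lemma itg_bd A f M : measurable A -> measurable_fun setT f ->
  (forall w, A w -> `|f w| <= M) -> itg A f.
Proof.
move=> mA mf fM; split=> //; apply: measurable_bounded_integrable => //.
- by rewrite (le_lt_trans (probability_le1 P mA))// ltry.
- exact: measurable_funS mf.
exists M; split; first exact: num_real.
by move=> y My w Aw; exact: le_trans (fM w Aw) (ltW My).
Qed.

Lemma itgD A f g : itg A f -> itg A g -> itg A (fun w => f w + g w).
Proof. by move=> [mA If] [_ Ig]; split=> //; exact: (integrableD mA If Ig). Qed.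

Lemma itgB A f g : itg A f -> itg A g -> itg A (fun w => f w - g w).
Proof. by move=> [mA If] [_ Ig]; split=> //; exact: (integrableB mA If Ig). Qed.

Lemma itgZ A (c : R) f : itg A f -> itg A (fun w => c * f w).
Proof. by move=> [mA If]; split=> //; exact: (integrableZl mA c If). Qed.

Lemma itgS A B f : measurable B -> B `<=` A -> itg A f -> itg B f.
Proof. by move=> mB BA [mA If]; split=> //; exact: integrableS If. Qed.

Lemma itg_cst A (c : R) : measurable A -> itg A (fun _ => c).
Proof. by move=> mA; split=> //; exact: finite_measure_integrable_cst. Qed.

Lemma itg_le A f g : measurable_fun setT f -> itg A g ->
  (forall w, A w -> `|f w| <= g w) -> itg A f.
Proof.
move=> mf [mA Ig] fg; split=> //; apply: (le_integrable mA _ _ Ig).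
  by apply/measurable_EFinP; exact: measurable_funS mf.
by move=> w Aw; rewrite /= lee_fin (le_trans (fg w Aw))// ler_norm.
Qed.

Lemma itgM A f h M : measurable_fun setT f -> measurable_fun setT h -> itg A f ->
  (forall w, A w -> `|h w| <= M) -> itg A (fun w => h w * f w).
Proof.
move=> mf mh [mA If] hM.
apply: (@itg_le _ _ (fun w => M * `|f w|)).
- exact: measurable_funM.
- by apply: itgZ; split=> //; exact: integrable_norm.
by move=> w Aw; rewrite normrM ler_wpM2r// hM.
Qed.

Lemma itg_norm A f : itg A f -> itg A (fun w => `|f w|).
Proof. by move=> [mA If]; split=> //; exact: integrable_norm. Qed.

Lemma evD A f g : itg A f -> itg A g -> ev A (fun w => f w + g w) = ev A f + ev A g.
Proof. by move=> [mA If] [_ Ig]; exact: RintegralD. Qed.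

Lemma evB A f g : itg A f -> itg A g -> ev A (fun w => f w - g w) = ev A f - ev A g.
Proof. by move=> [mA If] [_ Ig]; exact: RintegralB. Qed.

Lemma evZ A (c : R) f : itg A f -> ev A (fun w => c * f w) = c * ev A f.
Proof. by move=> [mA If]; exact: RintegralZl. Qed.

Lemma ev_cst A (c : R) : measurable A -> ev A (fun _ => c) = c * pr A.
Proof. by move=> mA; exact: Rintegral_cst. Qed.

Lemma ev_le A f g : itg A f -> itg A g -> (forall w, A w -> f w <= g w) -> ev A f <= ev A g.
Proof. by move=> [mA If] [_ Ig]; exact: le_Rintegral. Qed.

Lemma ev_ge0 A f : (forall w, A w -> 0 <= f w) -> 0 <= ev A f.
Proof. exact: Rintegral_ge0. Qed.

Lemma ev_le_cst A f (c : R) : itg A f -> (forall w, A w -> f w <= c) -> ev A f <= c * pr A.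
Proof. by move=> If fc; rewrite -ev_cst; [apply: ev_le => //; apply: itg_cst; case: If|case: If]. Qed.

Lemma eq_ev A f g : (forall w, A w -> f w = g w) -> ev A f = ev A g.
Proof. by move=> h; apply: eq_Rintegral => w /set_mem; exact: h. Qed.

Lemma ev_split A B f : itg A f -> measurable B -> ev A f = ev (A `&` B) f + ev (A `\` B) f.
Proof.
move=> [mA If] mB; rewrite -{1}(setUIDK A B) setUC.
have mI : measurable (A `&` B) by exact: measurableI.
have mD : measurable (A `\` B) by exact: measurableD.
rewrite setUC /ev Rintegral_setU//; first by rewrite setUIDK.
by apply/disj_setPS; rewrite setDE setIACA setICr setI0.
Qed.

Lemma ev_sub A B f : measurable A -> A `<=` B -> itg B f -> (forall w, B w -> 0 <= f w) ->
  ev A f <= ev B f.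
Proof.
move=> mA AB If f0; rewrite (ev_split If mA) setIidr// lerDl.
by apply: ev_ge0 => w [Bw _]; exact: f0.
Qed.

Lemma ev_ind A B f : ev (A `&` B) f = ev A (fun w => \1_B w * f w).
Proof.
rewrite /ev Rintegral_mkcondr; apply: eq_Rintegral => w _.
by rewrite patchE indicE; case: ifP => _; rewrite ?mul1r ?mul0r.
Qed.

(* Counting the thresholds [1, ..., m] below [x] computes [floor x]. *)
Lemma count_thresholds (m : nat) (x : R) : 0 <= x ->
  0 <= x - \sum_(j < m) ((j.+1%:R : R) <= x)%R%:R /\
  (x - \sum_(j < m) ((j.+1%:R : R) <= x)%R%:R <= 1 \/ m%:R <= x).
Proof.
move=> x0; elim: m => [|m [h0 h]]; first by rewrite big_ord0 subr0; split => //; right.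
rewrite big_ord_recr /=; have [le|lt] := leP m.+1%:R x.
  have sm : \sum_(j < m) ((j.+1%:R : R) <= x)%R%:R <= m%:R :> R.
    have -> : m%:R = \sum_(j < m) 1 :> R by rewrite sumr_const card_ord.
    by apply: ler_sum => j _; case: ((j.+1%:R : R) <= x); rewrite ?ler01.
  split; last by right.
  have -> : (true%:R : R) = 1 by [].
  by move: le; rewrite -[m.+1%:R]natr1; lra.
rewrite addr0; split => //; left; case: h => // mx.
have -> : \sum_(j < m) ((j.+1%:R : R) <= x)%R%:R = m%:R :> R.
  rewrite -[RHS](_ : \sum_(j < m) 1 = _); last by rewrite sumr_const card_ord.
  apply: eq_bigr => j _; suff -> : j.+1%:R <= x by [].
  by apply: le_trans mx; rewrite ler_nat.
by move: lt; rewrite -natr1; lra.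
Qed.

(* A nonnegative weight [h] is a uniform limit of positive combinations of
   indicators of its upper level sets. *)
Lemma ev_weight A h f M : itg A f -> measurable_fun setT f -> measurable_fun setT h ->
  (forall w, 0 <= h w <= M) ->
  (forall t : R, 0 <= ev (A `&` [set w | t <= h w]) f) -> 0 <= ev A (fun w => h w * f w).
Proof.
move=> If mf mh hM hf.
have mI (t : R) : measurable [set w | t <= h w].
  have -> : [set w | t <= h w] = setT `&` (h @^-1` `[t, +oo[).
    by rewrite setTI; apply/seteqP; split=> w /=; rewrite in_itv/= andbT.
  exact: mh.
have Ihf : itg A (fun w => h w * f w).
  by apply: (itgM (M := M)) => // w _; have /andP[h0 h1] := hM w; rewrite ger0_norm.
have close (x y z e : R) : 0 <= x - y <= e -> y * z <= x * z + e * `|z|.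
  move=> /andP[xy0 xye].
  have h1 : (x - y) * `|z| <= e * `|z| by exact: ler_wpM2r.
  have h2 : (x - y) * - z <= (x - y) * `|z| by apply: ler_wpM2l => //; rewrite -normrN ler_norm.
  lra.
pose c := ev A (fun w => `|f w|).
have key (n : nat) : - (n.+1%:R^-1 * c) <= ev A (fun w => h w * f w).
  have n0 : 0 < n.+1%:R :> R by [].
  (* Enough thresholds to exceed (n + 1) h everywhere, so that [S] lies between h - 1 / (n + 1) and
     h. *)
  pose m := (Num.truncn (n.+1%:R * M)).+1.
  pose S (w : T) : R := n.+1%:R^-1 * \sum_(j < m) ((j.+1%:R : R) <= n.+1%:R * h w)%R%:R.
  have ind (k : nat) : itg A (fun w => (\sum_(j < k) ((j.+1%:R : R) <= n.+1%:R * h w)%R%:R) * f w) /\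
     0 <= ev A (fun w => (\sum_(j < k) ((j.+1%:R : R) <= n.+1%:R * h w)%R%:R) * f w).
    elim: k => [|k [Ik ek]].
      have -> : (fun w => (\sum_(j < 0) ((j.+1%:R : R) <= n.+1%:R * h w)%R%:R) * f w) = (fun _ => 0).
        by apply/funext => w; rewrite big_ord0 mul0r.
      case: If => mA _.
      by split; [exact: itg_cst|rewrite ev_cst// mul0r].
    pose t : R := k.+1%:R / n.+1%:R.
    have E : (fun w => (\sum_(j < k.+1) ((j.+1%:R : R) <= n.+1%:R * h w)%R%:R) * f w) =
      (fun w => (\sum_(j < k) ((j.+1%:R : R) <= n.+1%:R * h w)%R%:R) * f w + \1_[set w | t <= h w] w * f w).
      apply/funext => w; rewrite big_ord_recr/= mulrDl; congr (_ + _ * _).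
      have tE : (w \in [set w | t <= h w]) = (t <= h w) by apply/idP/idP; rewrite inE.
      by rewrite indicE tE /t ler_pdivrMr// [h w * _]mulrC.
    have I1 : itg A (fun w => \1_[set w | t <= h w] w * f w).
      apply: (itgM (M := 1)) => // w _.
      by rewrite indicE; case: (_ \in _); rewrite ?normr1 ?normr0.
    rewrite E; split; first exact: itgD.
    by rewrite evD// -ev_ind addr_ge0.
  have [Im em] := ind m.
  have IS : itg A (fun w => S w * f w).
    have -> : (fun w => S w * f w) = (fun w => n.+1%:R^-1 * ((\sum_(j < m) ((j.+1%:R : R) <= n.+1%:R * h w)%R%:R) * f w)).
      by apply/funext => w; rewrite mulrA.
    exact: itgZ.
  have eS : 0 <= ev A (fun w => S w * f w).
    have -> : (fun w => S w * f w) = (fun w => n.+1%:R^-1 * ((\sum_(j < m) ((j.+1%:R : R) <= n.+1%:R * h w)%R%:R) * f w)).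
      by apply/funext => w; rewrite mulrA.
    by rewrite evZ// mulr_ge0.
  have In : itg A (fun w => n.+1%:R^-1 * `|f w|) by apply: itgZ; exact: itg_norm.
  have -> : - (n.+1%:R^-1 * c) = - ev A (fun w => n.+1%:R^-1 * `|f w|) by rewrite evZ//; exact: itg_norm.
  suff : ev A (fun w => S w * f w) <= ev A (fun w => h w * f w) + ev A (fun w => n.+1%:R^-1 * `|f w|) by lra.
  rewrite -evD//; apply: ev_le => //; first exact: itgD.
  move=> w _; have /andP[h0 h1] := hM w.
  have nh0 : 0 <= n.+1%:R * h w by rewrite mulr_ge0.
  have [d0 d1] := count_thresholds m nh0.
  have {}d1 : n.+1%:R * h w - \sum_(j < m) ((j.+1%:R : R) <= n.+1%:R * h w)%R%:R <= 1.
    case: d1 => // mh'.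
    have : n.+1%:R * h w < m%:R.
      apply: le_lt_trans (truncnS_gt _); exact: ler_wpM2l.
    by rewrite ltNge mh'.
  have e1 : 0 <= h w - S w <= n.+1%:R^-1.
    have -> : h w - S w = n.+1%:R^-1 * (n.+1%:R * h w - \sum_(j < m) ((j.+1%:R : R) <= n.+1%:R * h w)%R%:R).
      by rewrite mulrBr mulKf// gt_eqF.
    by rewrite mulr_ge0//= ler_piMr.
  exact: close.
have c0 : 0 <= c by apply: ev_ge0.
rewrite leNgt; apply/negP => e0.
pose n := Num.truncn (c / - ev A (fun w => h w * f w)).
have := key n; have n0 : 0 < n.+1%:R :> R by [].
have : c / - ev A (fun w => h w * f w) < n.+1%:R by exact: truncnS_gt.
rewrite ltr_pdivrMr ?oppr_gt0// => h1.
rewrite lerNl mulrC ler_pdivlMr// => h2.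
by rewrite mulrC in h2; have := lt_le_trans h1 h2; rewrite ltxx.
Qed.

Lemma ev_bigsum (I : eqType) (r : seq I) (f : I -> T -> R) A : (forall j, j \in r -> itg A (f j)) -> measurable A ->
  itg A (fun w => \sum_(j <- r) f j w) /\
  ev A (fun w => \sum_(j <- r) f j w) = \sum_(j <- r) ev A (f j).
Proof.
move=> If mA; elim: r If => [|j r ih] If.
  have -> : (fun w => \sum_(j <- [::]) f j w) = (fun _ => 0) by apply/funext => w; rewrite big_nil.
  by rewrite big_nil ev_cst// mul0r; split=> //; exact: itg_cst.
have [|Ir er] := ih; first by move=> i ir; apply: If; rewrite in_cons ir orbT.
have Ij : itg A (f j) by apply: If; rewrite in_cons eqxx.
have -> : (fun w => \sum_(j <- j :: r) f j w) = (fun w => f j w + \sum_(j <- r) f j w).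
  by apply/funext => w; rewrite big_cons.
by rewrite big_cons -er evD//; split=> //; exact: itgD.
Qed.

End Expectation.

Section Filtration.
Context {R : realType} {disp : measure_display} {T : measurableType disp}.
Variables (P : probability T R) (F : nat -> set (set T)).
Hypothesis hF : filtration F.

Definition fmeas k (f : T -> R) := measurable_fun setT (f : g_sigma_algebraType (F k) -> R).

Lemma F_measurable k (A : set T) : F k A = @measurable _ (g_sigma_algebraType (F k)) A.
Proof. by case: hF => h _ _; rewrite [RHS]/measurable/= sigma_algebra_id. Qed.

Lemma FT k : F k setT.
Proof. by rewrite F_measurable; exact: measurableT. Qed.

Lemma FI k A B : F k A -> F k B -> F k (A `&` B).
Proof. by rewrite !F_measurable; exact: measurableI. Qed.

Lemma FD k A B : F k A -> F k B -> F k (A `\` B).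
Proof. by rewrite !F_measurable; exact: measurableD. Qed.

Lemma Fle m n A : (m <= n)%N -> F m A -> F n A.
Proof. by case: hF => _ _ h mn; exact: h. Qed.

Lemma Fsub k A : F k A -> measurable A.
Proof. by case: hF => _ h _; exact: h. Qed.

Lemma F_ge k (f : T -> R) (t : R) : fmeas k f -> F k [set w | t <= f w].
Proof.
move=> mf; rewrite F_measurable.
have -> : [set w | t <= f w] = setT `&` (f @^-1` `[t, +oo[).
  by rewrite setTI; apply/seteqP; split=> w /=; rewrite in_itv/= andbT.
exact: mf.
Qed.

Lemma F_le k (f : T -> R) (t : R) : fmeas k f -> F k [set w | f w <= t].
Proof.
move=> mf; rewrite F_measurable.
have -> : [set w | f w <= t] = setT `&` (f @^-1` `]-oo, t]).
  by rewrite setTI; apply/seteqP; split=> w /=; rewrite in_itv.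
exact: mf.
Qed.

Lemma fmeas_sub k (f : T -> R) : fmeas k f -> measurable_fun setT f.
Proof. by move=> mf _ B mB; apply: (@Fsub k); rewrite F_measurable; exact: mf. Qed.

Lemma fmeas_comp k (f : T -> R) (phi : R -> R) : measurable_fun setT phi -> fmeas k f -> fmeas k (phi \o f).
Proof. by move=> mp mf; exact: measurableT_comp. Qed.

Definition trk (H : nat -> set T) (n m : nat) : set T := [set w | forall i, (n <= i < m)%N -> H i w].

Lemma trk_recr H n m : (n <= m)%N -> trk H n m.+1 = trk H n m `&` H m.
Proof.
move=> nm; apply/seteqP; split=> [w h|w [h1 h2] i /andP[ni]].
  by split=> [i /andP[ni im]|]; apply: h; rewrite ?ni ?nm ?ltnS ?(ltnW im)//=.
by rewrite ltnS leq_eqVlt => /orP[/eqP->//|im]; apply: h1; rewrite ni.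
Qed.

Lemma trkn H n : trk H n n = setT.
Proof. by apply/seteqP; split=> // w _ i; rewrite ltnNge => /andP[->]. Qed.

Lemma F_trk H n m : (forall i, F i (H i)) -> (n <= m)%N -> F m (trk H n m.+1).
Proof.
move=> HF; elim: m => [|m ih nm].
  by rewrite leqn0 => /eqP->; rewrite trk_recr// trkn setTI.
rewrite trk_recr//; apply: FI => //.
have [nm'|mn] := leqP n m; first by apply: (Fle (leqnSn m)); exact: ih.
by have -> : n = m.+1 by [apply/eqP; rewrite eqn_leq nm mn]; rewrite trkn; exact: FT.
Qed.

Lemma F_trk' H n m : (forall i, F i (H i)) -> (n <= m)%N -> F m (trk H n m).
Proof.
move=> HF; rewrite leq_eqVlt => /orP[/eqP->|]; first by rewrite trkn; exact: FT.
by case: m => // m nm; apply: (Fle (leqnSn m)); exact: F_trk.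
Qed.

Lemma prD (A B : set T) : measurable A -> measurable B -> B `<=` A -> pr P (A `\` B) = pr P A - pr P B.
Proof. by move=> mA mB BA; rewrite (pr_split P mA mB) setIidr// addrAC subrr add0r. Qed.

Lemma pr_le_split (X A B : set T) : measurable X -> measurable A -> measurable B ->
  X `<=` A `|` B -> pr P X <= pr P A + pr P B.
Proof.
move=> mX mA mB XAB; rewrite (pr_split P mX mA); apply: lerD; apply: pr_le => //.
- exact: measurableI.
- exact: measurableD.
- by move=> w [/XAB[]].
Qed.

(** The events approximable by some F_n form a lambda-system containing the pi-system of the union
    of the F_k. The index can be taken beyond [N], where the escape estimates begin. *)
Lemma filtration_approx N (X : set T) : <<s \bigcup_k F k >> X -> measurable X /\
  forall e : R, 0 < e -> exists n A,
    [/\ (N <= n)%N, F n A, pr P (A `\` X) <= e & pr P (X `\` A) <= e].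
Proof.
pose H (X : set T) := measurable X /\ forall e : R, 0 < e -> exists n A,
    [/\ (N <= n)%N, F n A, pr P (A `\` X) <= e & pr P (X `\` A) <= e].
apply: (@lambda_system_subset _ (\bigcup_k F k) _ setT H).
- move=> A B [m _ mA] [n _ nB]; exists (maxn m n) => //.
  by apply: FI; [apply: Fle mA; exact: leq_maxl|apply: Fle nB; exact: leq_maxr].
- split.
  + by [].
  + split=> // e e0; exists N, setT; split => //; first exact: FT.
      by rewrite setDv /pr measure0 ltW.
    by rewrite setDv /pr measure0 ltW.
  + move=> A B BA [mA hA] [mB hB]; split; first exact: measurableD.
    move=> e e0; have e2 : 0 < e / 2 by rewrite divr_gt0.
    have [n1 [A1 [N1 FA a1 a2]]] := hA _ e2.
    have [n2 [B1 [N2 FB b1 b2]]] := hB _ e2.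
    have FA' : F (maxn n1 n2) A1 by apply: Fle FA; exact: leq_maxl.
    have FB' : F (maxn n1 n2) B1 by apply: Fle FB; exact: leq_maxr.
    have mA1 := Fsub FA'; have mB1 := Fsub FB'.
    exists (maxn n1 n2), (A1 `\` B1); split.
    * by rewrite (leq_trans N1)// leq_maxl.
    * exact: FD.
    * apply: (le_trans (pr_le_split (A := A1 `\` A) (B := B `\` B1) _ _ _ _)); last lra.
      - by apply: measurableD; apply: measurableD.
      - exact: measurableD.
      - exact: measurableD.
      - move=> w [[A1w B1w] h]; have [Aw|Aw] := pselect (A w); last by left.
        by right; split => //; apply: contrapT => Bw; exact: h.
    * apply: (le_trans (pr_le_split (A := A `\` A1) (B := B1 `\` B) _ _ _ _)); last lra.
      - by apply: measurableD; apply: measurableD.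
      - exact: measurableD.
      - exact: measurableD.
      - move=> w [[Aw Bw] h]; have [A1w|A1w] := pselect (A1 w); last by left.
        by right; split => //; apply: contrapT => B1w; exact: h.
  + move=> X0 ndX hX; have mX i : measurable (X0 i) by case: (hX i).
    have mU : measurable (\bigcup_i X0 i) by exact: bigcupT_measurable.
    split => // e e0; have e2 : 0 < e / 2 by rewrite divr_gt0.
    have cv := nondecreasing_cvg_mu (mu := P) mX mU ndX.
    have [i hi] : exists i, pr P (\bigcup_i X0 i) - pr P (X0 i) <= e / 2.
      have cv' : pr P (X0 i) @[i --> \oo] --> pr P (\bigcup_i X0 i).
        by apply: fine_cvg; rewrite -prE.
      move/cvgrPdist_le : cv' => /(_ _ e2) [i _ hi]; exists i.
      by apply: le_trans (hi i _); [exact: ler_norm|rewrite /=].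
    have [_ hXi] := hX i; have [n [A [Nn FA a1 a2]]] := hXi _ e2.
    have mA := Fsub FA.
    exists n, A; split => //.
    * apply: le_trans (_ : e / 2 <= e); last lra.
      apply: le_trans a1; apply: pr_le; [exact: measurableD|exact: measurableD|].
      by move=> w [Aw h]; split => // Xw; apply: h; exists i.
    * apply: (le_trans (pr_le_split (A := (\bigcup_i X0 i) `\` X0 i) (B := X0 i `\` A) _ _ _ _)).
      - exact: measurableD.
      - exact: measurableD.
      - exact: measurableD.
      - move=> w [Uw Aw]; have [Xw|Xw] := pselect (X0 i w); [right|left]; by split.
      - rewrite prD//; [lra|exact: bigcup_sup].
- move=> A [n _ FA]; split; first exact: Fsub FA.
  move=> e e0; exists (maxn N n), A; split.
  + exact: leq_maxl.
  + by apply: Fle FA; exact: leq_maxr.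
  + by rewrite setDv /pr measure0 ltW.
  + by rewrite setDv /pr measure0 ltW.
- by [].
Qed.

End Filtration.

(** 1 / (z + l) equals the first-order part plus (z - y)^2 / ((y + l)^2 (z + l)). The square roots
    in the hypothesis are what tames this term: (z - y)^2 <= 2 V^2 (y + z), so it is bounded by V^2
    / l^2 up to a constant, however large y and z are. *)
Lemma inverse_descent (R : realType) (y z l V : R) : 0 <= y -> 0 <= z -> 0 < l -> 0 <= V ->
  `|z - y| <= V * (Num.sqrt y + Num.sqrt z) ->
  (z + l)^-1 <= (y + l)^-1 - (z - y) / (y + l) ^+ 2 + 4 * V ^+ 2 / l ^+ 2.
Proof.
move=> y0 z0 l0 V0 h.
have a0 : 0 < y + l by lra.
have b0 : 0 < z + l by lra.
have -> : (z + l)^-1 = (y + l)^-1 - (z - y) / (y + l) ^+ 2 + (z - y) ^+ 2 / ((y + l) ^+ 2 * (z + l)).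
  by field; rewrite !lt0r_neq0.
rewrite lerD2l.
have sq : (z - y) ^+ 2 <= 2 * V ^+ 2 * (y + z).
  have h2 : (z - y) ^+ 2 <= (V * (Num.sqrt y + Num.sqrt z)) ^+ 2.
    by rewrite -[X in X <= _]real_normK ?num_real// ler_sqr ?nnegrE// mulr_ge0// addr_ge0 ?sqrtr_ge0.
  apply: le_trans h2 _; rewrite exprMn.
  have -> : 2 * V ^+ 2 * (y + z) = V ^+ 2 * (2 * (y + z)) by ring.
  apply: ler_wpM2l; first exact: sqr_ge0.
  have := sqr_sqrtr y0; have := sqr_sqrtr z0; have := sqr_ge0 (Num.sqrt y - Num.sqrt z).
  set u := Num.sqrt y; set v := Num.sqrt z; lra.
have a2 : 0 < (y + l) ^+ 2 * (z + l) by rewrite mulr_gt0// exprn_gt0.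
rewrite ler_pdivrMr//; apply: le_trans sq _.
have V2 : 0 <= 2 * V ^+ 2 by rewrite mulr_ge0// sqr_ge0.
have -> : 4 * V ^+ 2 / l ^+ 2 * ((y + l) ^+ 2 * (z + l)) =
    2 * V ^+ 2 * (2 * ((y + l) ^+ 2 * (z + l)) / l ^+ 2).
  by field; exact: lt0r_neq0.
apply: ler_wpM2l => //; rewrite ler_pdivlMr ?exprn_gt0//.
have la : l <= y + l by lra.
have lb : l <= z + l by lra.
have yz : y + z <= (y + l) + (z + l) by lra.
move: (y + l) (z + l) a0 b0 la lb yz => a b a0 b0 la lb yz.
have l2 : l ^+ 2 <= a ^+ 2 by have l00 := ltW l0; have a00 := ltW a0; rewrite ler_sqr ?nnegrE.
have lab : l ^+ 2 <= a * b by rewrite expr2; apply: ler_pM => //; exact: ltW.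
have h1 : (y + z) * l ^+ 2 <= (a + b) * l ^+ 2 by apply: ler_wpM2r => //; exact: sqr_ge0.
have h2 : a * l ^+ 2 <= a * (a * b) by apply: ler_wpM2l => //; exact: ltW.
have h3 : b * l ^+ 2 <= b * a ^+ 2 by apply: ler_wpM2l => //; exact: ltW.
have : a * (a * b) = a ^+ 2 * b by ring.
have : b * a ^+ 2 = a ^+ 2 * b by ring.
lra.
Qed.

(** * The escape estimate *)

Section Escape.
Context {R : realType} {disp : measure_display} {T : measurableType disp}.
Variables (P : probability T R) (F : nat -> set (set T)).
Hypothesis hF : filtration F.
(** [q k] stands for Q(X_k), [q' k] for its value when the last step uses the cut remainder of norm
    [rho k], and [U k] for the norm of the corresponding increment. Drift and moments are controlled
    for the cut step only; [EQ] returns to [q] on events where nothing was cut. *)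
Variables (N : nat) (q q' rho U : nat -> T -> R) (Gd : nat -> set T) (c s : nat -> R).
Variables (Kq kap Cc K K1 B2 Ba a ep : R).
Hypothesis s_step : forall k, s k = c k.+1 ^+ 2 + s k.+1.
Hypothesis s_gt0 : forall k, 0 < s k.
Hypothesis s_lim : forall e : R, 0 < e -> exists m, forall k, (m <= k)%N -> s k <= e.
Hypothesis c_ge0 : forall k, 0 <= c k.
Hypothesis qF : forall k, fmeas F k (q k).
Hypothesis q01 : forall k w, 0 <= q k w <= Kq.
Hypothesis q'm : forall k, measurable_fun setT (q' k).
Hypothesis q'01 : forall k w, 0 <= q' k w <= Kq.
Hypothesis rhom : forall k, measurable_fun setT (rho k).
Hypothesis rho0 : forall k w, 0 <= rho k w.
Hypothesis rhosum : forall n m w, (N <= n)%N -> \sum_(n <= j < m) rho j.+1 w ^+ 2 <= ep ^+ 2.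
Hypothesis Um : forall k, measurable_fun setT (U k).
Hypothesis U0 : forall k w, 0 <= U k w.
Hypothesis Ua : forall k A, (N <= k)%N -> F k A -> A `<=` Gd k ->
  itg P A (fun w => U k.+1 w `^ a) /\ ev P A (fun w => U k.+1 w `^ a) <= Ba * pr P A.
Hypothesis U2 : forall k A, (N <= k)%N -> F k A -> A `<=` Gd k ->
  itg P A (fun w => U k.+1 w ^+ 2) /\ ev P A (fun w => U k.+1 w ^+ 2) <= B2 * pr P A.
Hypothesis GdF : forall k, F k (Gd k).
Hypothesis LIP : forall k w, (N <= k)%N -> Gd k w ->
  `|q' k.+1 w - q k w| <= K * c k.+1 * U k.+1 w * (Num.sqrt (q k w) + Num.sqrt (q' k.+1 w)).
Hypothesis EQ : forall k D (phi : R -> R), (N <= k)%N -> measurable D -> D `<=` Gd k `&` Gd k.+1 ->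
  measurable_fun setT phi -> ev P D (fun w => phi (q' k.+1 w)) = ev P D (fun w => phi (q k.+1 w)).
Hypothesis OS : forall k A, (N <= k)%N -> F k A -> A `<=` Gd k ->
  0 <= ev P A (fun w => q' k.+1 w - q k w - kap * c k.+1 ^+ 2
                       + Cc * c k.+1 * (Num.sqrt (q k w) * rho k.+1 w)).
Hypothesis kap0 : 0 < kap.
Hypothesis Cc0 : 0 <= Cc.
Hypothesis K0 : 0 <= K.
Hypothesis B20 : 0 <= B2.
Hypothesis Ba0 : 0 <= Ba.
Hypothesis a2 : 2 < a.
Hypothesis ep0 : 0 < ep.
Hypothesis K11 : 1 <= K1.
Hypothesis K1B : 32 * K ^+ 2 * B2 <= K1 ^+ 2.
Hypothesis K1C : 8 * Cc * ep <= K1.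
Hypothesis epC : 8 * Cc * K1 * ep <= kap.

Definition bad := [set w | (forall k, (N <= k)%N -> Gd k w) /\ q^~ w @ \oo --> (0 : R)].

Let qm k : measurable_fun setT (q k).
Proof. exact: (fmeas_sub hF (@qF k)). Qed.

Let q0 k w : 0 <= q k w. Proof. by case/andP: (q01 k w). Qed.
Let q'0 k w : 0 <= q' k w. Proof. by case/andP: (q'01 k w). Qed.

Let s_le k m : (k <= m)%N -> s m <= s k.
Proof.
elim: m => [|m ih]; first by rewrite leqn0 => /eqP->.
rewrite leq_eqVlt => /orP[/eqP->//|km]; apply: le_trans (ih km).
by rewrite (s_step m) lerDr sqr_ge0.
Qed.

Let rho_le k w : (N <= k)%N -> rho k.+1 w <= ep.
Proof.
move=> Nk; have := rhosum k.+1 w Nk; rewrite big_nat1 ler_sqr ?nnegrE//; exact: ltW.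
Qed.

Let itg_q A k : measurable A -> itg P A (q k).
Proof. by move=> mA; apply: (itg_bd P (M := Kq)) => // w _; rewrite ger0_norm// (andP (q01 k w)).2. Qed.

Let itg_q' A k : measurable A -> itg P A (q' k).
Proof. by move=> mA; apply: (itg_bd P (M := Kq)) => // w _; rewrite ger0_norm// (andP (q'01 k w)).2. Qed.

Let itg_rho A k : (N <= k)%N -> measurable A -> itg P A (rho k.+1).
Proof. by move=> Nk mA; apply: (itg_bd P (M := ep)) => // w _; rewrite ger0_norm// rho_le. Qed.

Let sqrtm k : measurable_fun setT (fun w => Num.sqrt (q k w)).
Proof.
apply: (@measurableT_comp _ _ _ _ _ _ (@Num.sqrt R)) => //.
by apply: continuous_measurable_fun; exact: sqrt_continuous.
Qed.

Let sqrt_le k w : Num.sqrt (q k w) <= Num.sqrt Kq.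
Proof. by apply: ler_wsqrtr; case/andP: (q01 k w). Qed.

Let itg_sr A k : (N <= k)%N -> measurable A -> itg P A (fun w => Num.sqrt (q k w) * rho k.+1 w).
Proof.
move=> Nk mA; apply: (itgM (M := Num.sqrt Kq) _ _ (itg_rho Nk mA)) => //.
by move=> w _; rewrite ger0_norm ?sqrtr_ge0.
Qed.

(* Cauchy-Schwarz for the sequences [c] and [rho]. *)
Lemma rho_sum n m A : (N <= n)%N -> measurable A ->
  \sum_(n <= j < m) c j.+1 * ev P A (rho j.+1) <= ep * Num.sqrt (s n) * pr P A.
Proof.
move=> Nn mA; have ep0' := ep0.
have s0 : 0 < Num.sqrt (s n) by rewrite sqrtr_gt0.
have ss : Num.sqrt (s n) ^+ 2 = s n by rewrite sqr_sqrtr// ltW.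
have Ij j : j \in index_iota n m -> itg P A (fun w => c j.+1 * rho j.+1 w).
  by rewrite mem_index_iota => /andP[nj _]; apply: itgZ; apply: itg_rho => //; exact: leq_trans nj.
have [Is es] := ev_bigsum (P := P) Ij mA.
have -> : \sum_(n <= j < m) c j.+1 * ev P A (rho j.+1) = \sum_(n <= j < m) ev P A (fun w => c j.+1 * rho j.+1 w).
  apply: eq_big_seq => j; rewrite mem_index_iota => /andP[nj _]; rewrite evZ//.
  by apply: itg_rho => //; exact: leq_trans nj.
rewrite -es; apply: ev_le_cst => // w _.
have cs : \sum_(n <= j < m) c j.+1 ^+ 2 <= s n.
  have [nm|mn] := leqP n m; last by rewrite big_geq ?(ltnW mn)// ltW.
  have -> : \sum_(n <= j < m) c j.+1 ^+ 2 = s n - s m.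
    have -> : \sum_(n <= j < m) c j.+1 ^+ 2 = - \sum_(n <= j < m) (s j.+1 - s j).
      rewrite -sumrN; apply: eq_bigr => j _; rewrite (s_step j); ring.
    by rewrite telescope_sumr// opprB.
  by rewrite gerBl ltW.
have rs := rhosum m w Nn.
set y := Num.sqrt (s n) in s0 ss *.
apply: (@le_trans _ _ (ep / y / 2 * (\sum_(n <= j < m) c j.+1 ^+ 2) + y / ep / 2 * (\sum_(n <= j < m) rho j.+1 w ^+ 2))).
  rewrite !mulr_sumr -big_split; apply: ler_sum => j _ /=.
  have := sqr_ge0 (ep * c j.+1 - y * rho j.+1 w) => h.
  have : 0 <= (ep * c j.+1 - y * rho j.+1 w) ^+ 2 / (2 * ep * y).
    by rewrite divr_ge0// !mulr_ge0// ltW.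
  have -> : (ep * c j.+1 - y * rho j.+1 w) ^+ 2 / (2 * ep * y) =
     ep / y / 2 * c j.+1 ^+ 2 + y / ep / 2 * rho j.+1 w ^+ 2 - c j.+1 * rho j.+1 w.
    by field; rewrite !lt0r_neq0.
  by rewrite subr_ge0.
have h1 : ep / y / 2 * (\sum_(n <= j < m) c j.+1 ^+ 2) <= ep / y / 2 * y ^+ 2.
  by rewrite ss; apply: ler_wpM2l => //; rewrite !divr_ge0// ltW.
have h2 : y / ep / 2 * (\sum_(n <= j < m) rho j.+1 w ^+ 2) <= y / ep / 2 * ep ^+ 2.
  by apply: ler_wpM2l => //; rewrite !divr_ge0// ltW.
have e1 : ep / y / 2 * y ^+ 2 = ep * y / 2 by field; exact: lt0r_neq0.
have e2 : y / ep / 2 * ep ^+ 2 = ep * y / 2 by field; exact: lt0r_neq0.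
apply: le_trans (lerD h1 h2) _; rewrite e1 e2; lra.
Qed.

Lemma bad_sigma : <<s \bigcup_k F k >> bad.
Proof.
have sub k A : F k A -> <<s \bigcup_k F k >> A by move=> FA; apply: sub_sigma_algebra; exists k.
pose TT := g_sigma_algebraType (\bigcup_k F k).
suff : @measurable _ TT bad by [].
have -> : bad = (\bigcap_(k in [set k | (N <= k)%N]) Gd k) `&`
    (\bigcap_j \bigcup_m \bigcap_(k in [set k | (m <= k)%N]) [set w | q k w <= j.+1%:R^-1]).
  apply/seteqP; split=> [w [h1 h2]|w [h1 h2]].
    split; first by move=> k /= Nk; exact: h1.
    move=> j _; move/cvgrPdist_le : h2 => /(_ j.+1%:R^-1); rewrite invr_gt0 ltr0n => /(_ isT)[m _ hm].
    by exists m => // k /= mk; have := hm k mk; rewrite /= sub0r normrN ger0_norm.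
  split; first by move=> k Nk; exact: h1.
  apply/cvgrPdist_le => e e0.
  have [m _ hm] := h2 (Num.truncn e^-1) I.
  exists m => // k /= mk; rewrite sub0r normrN ger0_norm//.
  apply: le_trans (hm k mk) _; rewrite /= invf_ple ?posrE//.
  by apply: ltW; exact: truncnS_gt.
apply: measurableI.
  by apply: bigcap_measurableType => k _; exact: sub (GdF k).
apply: bigcap_measurableType => j _; apply: bigcup_measurable => m _.
by apply: bigcap_measurableType => k _; apply: (sub k); exact: F_le.
Qed.

Lemma bad_measurable : measurable bad.
Proof. by case: (filtration_approx P hF 0 bad_sigma). Qed.

Lemma bad_lim (e : R) : 0 < e -> exists m, forall k, (m <= k)%N -> ev P bad (q k) <= e.
Proof.
move=> e0; have mb := bad_measurable.
have mq n : measurable_fun bad (fun w => (q n w)%:E).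
  by apply/measurable_EFinP; exact: measurable_funS (@qm n).
have cq : {ae P, forall w, bad w -> (q n w)%:E @[n --> \oo] --> cst 0%E w}.
  by apply: aeW => w [_ h]; apply: cvg_EFin => //; exact: nearW.
have bq : {ae P, forall w n, bad w -> (`|(q n w)%:E| <= cst Kq%:E w)%E}.
  by apply: aeW => w n _; rewrite /= lee_fin ger0_norm//; case/andP: (q01 n w).
have [_ _] := dominated_convergence mb mq (measurable_cst 0%E) cq (finite_measure_integrable_cst P Kq mb) bq.
rewrite integral0 => cv.
have cv' : ev P bad (q n) @[n --> \oo] --> 0.
  by apply: fine_cvg; exact: cv.
move/cvgrPdist_le : cv' => /(_ e e0)[m _ hm]; exists m => k mk.
have := hm k mk; rewrite /= sub0r normrN; apply: le_trans; exact: ler_norm.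
Qed.

Let Z k w := q' k.+1 w - q k w - kap * c k.+1 ^+ 2 + Cc * c k.+1 * (Num.sqrt (q k w) * rho k.+1 w).

Let Zm k : measurable_fun setT (Z k).
Proof.
apply: measurable_funD.
  by apply: measurable_funB => //; apply: measurable_funB => //; exact: qm.
by apply: measurable_funM => //; apply: measurable_funM => //; exact: sqrtm.
Qed.

Let itg_Z A k : (N <= k)%N -> measurable A -> itg P A (Z k).
Proof.
move=> Nk mA; apply: itgD; last by apply: itgZ; exact: itg_sr.
by apply: itgB; [apply: itgB; [exact: itg_q'|exact: itg_q]|exact: itg_cst].
Qed.

(** The absolute value makes the inverse continuous on the whole line; it is applied to nonnegative
    values. *)
Lemma invl_measurable (l : R) : 0 < l -> measurable_fun setT (fun x : R => (`|x| + l)^-1).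
Proof.
move=> l0; apply: continuous_measurable_fun => x; apply: cvgV.
  by rewrite gt_eqF// ltr_wpDl.
by apply: cvgD; [exact: norm_continuous|exact: cvg_cst].
Qed.

(** [inverse_descent] integrated: its first-order part carries the weight (q + l)^-2, which is
    F_k-measurable, so [ev_weight] applies the drift inequality to it. Errors are charged to a
    larger event [B] independent of k, so that they can be summed by [rho_sum]. *)
Lemma invl_step (l : R) k A D B : 0 < l -> (N <= k)%N -> F k A -> A `<=` Gd k ->
  measurable D -> D `<=` A `&` Gd k.+1 -> measurable B -> A `<=` B ->
  ev P D (fun w => (`|q k.+1 w| + l)^-1) <= ev P A (fun w => (`|q k w| + l)^-1)
    + Cc / (l * Num.sqrt l) * (c k.+1 * ev P B (rho k.+1))
    + 4 * K ^+ 2 * B2 / l ^+ 2 * (c k.+1 ^+ 2 * pr P B).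
Proof.
move=> l0 Nk FA AG mD DA mB AB.
have mA := Fsub hF FA; have l00 := ltW l0.
have mi := invl_measurable l0.
have sl0 : 0 < Num.sqrt l by rewrite sqrtr_gt0.
have DG : D `<=` Gd k `&` Gd k.+1 by move=> w /DA[/AG ? ?].
rewrite -(EQ Nk mD DG mi).
have inv0 (x : R) : 0 <= (`|x| + l)^-1 <= l^-1.
  by rewrite invr_ge0 addr_ge0//= lef_pV2 ?posrE// ?lerDr// ltr_wpDl.
have mq' : measurable_fun setT (fun w => (`|q' k.+1 w| + l)^-1) by exact: (measurableT_comp mi).
have mq : measurable_fun setT (fun w => (`|q k w| + l)^-1) by exact: (measurableT_comp mi (@qm k)).
have Iq' : itg P A (fun w => (`|q' k.+1 w| + l)^-1).
  by apply: (@itg_bd _ _ _ P A _ l^-1) => // w _; rewrite ger0_norm; case/andP: (inv0 (q' k.+1 w)).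
have Iq : itg P A (fun w => (`|q k w| + l)^-1).
  by apply: (@itg_bd _ _ _ P A _ l^-1) => // w _; rewrite ger0_norm; case/andP: (inv0 (q k w)).
have le1 : ev P D (fun w => (`|q' k.+1 w| + l)^-1) <= ev P A (fun w => (`|q' k.+1 w| + l)^-1).
  apply: ev_sub => //; first by move=> w /DA[].
  by move=> w _; case/andP: (inv0 (q' k.+1 w)).
apply: le_trans le1 _.
pose g w := (`|q k w| + l)^-1 ^+ 2.
have g0 w : 0 <= g w <= l^-1 ^+ 2.
  case/andP: (inv0 (q k w)) => h1 h2.
  by rewrite /g sqr_ge0/= ler_sqr ?nnegrE// invr_ge0.
have mg : measurable_fun setT g by exact: measurable_funX.
have gF : fmeas F k g.
  by apply: measurable_funX; apply: (measurableT_comp mi); exact: qF.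
have IZ := itg_Z Nk mA.
have gZ : 0 <= ev P A (fun w => g w * Z k w).
  apply: (ev_weight (M := l^-1 ^+ 2)) => // t.
  apply: OS => //; last by move=> w [/AG].
  by apply: FI => //; exact: F_ge.
have [IU eU] := U2 Nk FA AG.
have IgZ : itg P A (fun w => g w * Z k w).
  apply: (itgM (M := l^-1 ^+ 2)) => // w _; case/andP: (g0 w) => h1 h2; by rewrite ger0_norm.
set e1 := Cc / (l * Num.sqrt l).
have e10 : 0 <= e1 by rewrite divr_ge0// mulr_ge0// ltW.
pose e2 := 4 * K ^+ 2 / l ^+ 2.
have e20 : 0 <= e2 by rewrite divr_ge0 ?sqr_ge0// mulr_ge0// sqr_ge0.
have Ir := itg_rho Nk mA.
have c0 := c_ge0 k.+1.
have I1 : itg P A (fun w => e1 * c k.+1 * rho k.+1 w) by exact: itgZ.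
have I2 : itg P A (fun w => e2 * c k.+1 ^+ 2 * U k.+1 w ^+ 2) by exact: itgZ.
have le2 : ev P A (fun w => (`|q' k.+1 w| + l)^-1) <=
    ev P A (fun w => (`|q k w| + l)^-1 + (e1 * c k.+1 * rho k.+1 w + e2 * c k.+1 ^+ 2 * U k.+1 w ^+ 2) - g w * Z k w).
  apply: ev_le => //; first by apply: itgB => //; apply: itgD => //; exact: itgD.
  move=> w Aw; rewrite !ger0_norm//.
  have V0 : 0 <= K * c k.+1 * U k.+1 w by rewrite !mulr_ge0.
  have := inverse_descent (q0 k w) (q'0 k.+1 w) l0 V0 (LIP Nk (AG w Aw)).
  rewrite /Z /g ger0_norm//.
  have x0 : 0 < q k w + l by rewrite ltr_wpDl.
  have -> : 4 * (K * c k.+1 * U k.+1 w) ^+ 2 / l ^+ 2 = e2 * c k.+1 ^+ 2 * U k.+1 w ^+ 2 by rewrite /e2; ring.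
  have gs : (q k w + l)^-1 ^+ 2 * Num.sqrt (q k w) <= (l * Num.sqrt l)^-1.
    rewrite exprVn mulrC ler_pdivrMr ?exprn_gt0// mulrC ler_pdivlMr ?mulr_gt0//.
    have h1 : Num.sqrt (q k w) <= Num.sqrt (q k w + l) by apply: ler_wsqrtr; rewrite lerDl.
    have h2 : Num.sqrt l <= Num.sqrt (q k w + l) by apply: ler_wsqrtr; rewrite lerDr.
    rewrite mulrCA expr2; apply: ler_pM; rewrite ?mulr_ge0 ?sqrtr_ge0 ?lerDr//.
    rewrite -[X in _ <= X](sqr_sqrtr (ltW x0)) expr2.
    by apply: ler_pM; rewrite ?sqrtr_ge0.
  have gk : 0 <= (q k w + l)^-1 ^+ 2 * (kap * c k.+1 ^+ 2).
    by rewrite mulr_ge0 ?sqr_ge0// mulr_ge0 ?sqr_ge0// ltW.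
  have gr : (q k w + l)^-1 ^+ 2 * Num.sqrt (q k w) * (Cc * c k.+1 * rho k.+1 w) <= e1 * c k.+1 * rho k.+1 w.
    apply: le_trans (ler_wpM2r _ gs) _; first by rewrite !mulr_ge0.
    by rewrite /e1 le_eqVlt; apply/orP; left; apply/eqP; ring.
  have -> : (q' k.+1 w - q k w) / (q k w + l) ^+ 2 = (q k w + l)^-1 ^+ 2 * (q' k.+1 w - q k w) by rewrite exprVn mulrC.
  move: ((q k w + l)^-1 ^+ 2) gs gk gr => G gs gk gr; lra.
apply: le_trans le2 _.
rewrite evB//; last by apply: itgD => //; exact: itgD.
rewrite evD//; last exact: itgD.
rewrite evD// !evZ//.
have r1 : e1 * c k.+1 * ev P A (rho k.+1) <= e1 * (c k.+1 * ev P B (rho k.+1)).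
  rewrite mulrA; apply: ler_wpM2l; first exact: mulr_ge0.
  by apply: ev_sub => //; exact: itg_rho.
have r2 : e2 * c k.+1 ^+ 2 * ev P A (fun w => U k.+1 w ^+ 2) <= 4 * K ^+ 2 * B2 / l ^+ 2 * (c k.+1 ^+ 2 * pr P B).
  have -> : 4 * K ^+ 2 * B2 / l ^+ 2 * (c k.+1 ^+ 2 * pr P B) = e2 * c k.+1 ^+ 2 * (B2 * pr P B) by rewrite /e2; ring.
  apply: ler_wpM2l; first by rewrite mulr_ge0// sqr_ge0.
  by apply: le_trans eU _; apply: ler_wpM2l => //; exact: pr_le.
lra.
Qed.

(* Once [q] is above the level [K1 ^+ 2 * s k], the process [(q + l)^-1] is
   almost a supermartingale and stays, with positive probability, away from its
   maximal value [l^-1], which is attained at [q = 0]. *)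
Lemma escape_above k B : (N <= k)%N -> F k B -> B `<=` Gd k ->
  (forall w, B w -> K1 ^+ 2 * s k <= q k w) -> pr P (B `&` bad) <= 3 / 4 * pr P B.
Proof.
move=> Nk FB BG Bq; have mB := Fsub hF FB; have mb := bad_measurable.
have [l lE] : {l | l = K1 ^+ 2 * s k} by exists (K1 ^+ 2 * s k).
have K10 : 0 < K1 by apply: lt_le_trans K11.
have l0 : 0 < l by rewrite lE mulr_gt0// exprn_gt0.
have sk := s_gt0 k.
have sqk : 0 < Num.sqrt (s k) by rewrite sqrtr_gt0.
have sql : Num.sqrt l = K1 * Num.sqrt (s k).
  by rewrite lE sqrtrM ?sqr_ge0// sqrtr_sqr ger0_norm// ltW.
pose Bj j := B `&` trk Gd k j.+1.
have FBj j : (k <= j)%N -> F j (Bj j).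
  by move=> kj; apply: FI => //; [exact: Fle FB|exact: F_trk].
have BjB j : Bj j `<=` B by move=> w [].
have claim i : ev P (Bj (k + i)%N) (fun w => (`|q (k + i)%N w| + l)^-1) <=
    ev P B (fun w => (`|q k w| + l)^-1)
    + Cc / (l * Num.sqrt l) * (\sum_(k <= j < k + i) c j.+1 * ev P B (rho j.+1))
    + 4 * K ^+ 2 * B2 / l ^+ 2 * ((s k - s (k + i)%N) * pr P B).
  elim: i => [|i ih].
    rewrite addn0 big_geq// subrr mul0r !mulr0 !addr0.
    have -> : Bj k = B; last by [].
    apply/seteqP; split=> [w []//|w Bw]; split => // i /andP[ki]; rewrite ltnS => ik.
    by have -> : i = k by [apply/eqP; rewrite eqn_leq ki ik]; exact: BG.
  rewrite addnS; have kk : (k <= k + i)%N by exact: leq_addr.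
  have := @invl_step l (k + i) (Bj (k + i)%N) (Bj (k + i).+1) B l0 (leq_trans Nk kk) (FBj _ kk).
  move=> /(_ _ _ _ mB (BjB _)) h.
  have {}h := h (fun w h' => h'.2 (k + i)%N (introT andP (conj kk (ltnSn _)))).
  have {}h := h (Fsub hF (FBj _ (leq_trans kk (leqnSn _)))).
  have sub : Bj (k + i).+1 `<=` Bj (k + i)%N `&` Gd (k + i).+1.
    by move=> w; rewrite /Bj trk_recr ?(leq_trans kk)// => -[? [? ?]].
  apply: (le_trans (h sub)).
  rewrite big_nat_recr//= mulrDr.
  have -> : s k - s (k + i).+1 = (s k - s (k + i)%N) + c (k + i).+1 ^+ 2 by rewrite (s_step (k + i)); ring.
  rewrite [(_ + c _ ^+ 2) * pr P B]mulrDl [4 * _ * _ / _ * (_ + _)]mulrDr; move: ih; set x1 := _ * (\sum_(_ <= _ < _) _); set x2 := _ * (c _ * _); lra.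
have mi := invl_measurable l0.
have inv0 (x : R) : 0 <= (`|x| + l)^-1 <= l^-1.
  by have l00 := ltW l0; rewrite invr_ge0 addr_ge0//= lef_pV2 ?posrE// ?lerDr// ltr_wpDl.
have Iq A j : measurable A -> itg P A (fun w => (`|q j w| + l)^-1).
  move=> mA; apply: (@itg_bd _ _ _ P A _ l^-1) => //; first exact: (measurableT_comp mi (@qm j)).
  by move=> w _; rewrite ger0_norm; case/andP: (inv0 (q j w)).
have start : ev P B (fun w => (`|q k w| + l)^-1) <= (2 * l)^-1 * pr P B.
  apply: ev_le_cst; first exact: Iq.
  move=> w Bw; rewrite ger0_norm// lef_pV2 ?posrE ?mulr_gt0 ?ltr_wpDl//.
  by have := Bq w Bw; rewrite -lE; lra.
have p0 := pr_ge0 P B.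
(* 1/2 comes from the start, where q + l >= 2 l, 1/8 from the remainder by [K1C], and 1/8 from the
   noise by [K1B]. *)
have upper i : ev P (Bj (k + i)%N) (fun w => (`|q (k + i)%N w| + l)^-1) <= 3 / 4 * pr P B / l.
  apply: le_trans (claim i) _.
  have t1 : Cc / (l * Num.sqrt l) * (\sum_(k <= j < k + i) c j.+1 * ev P B (rho j.+1)) <= 1 / 8 * pr P B / l.
    apply: (@le_trans _ _ (Cc / (l * Num.sqrt l) * (ep * Num.sqrt (s k) * pr P B))).
      apply: ler_wpM2l; last exact: rho_sum.
      by rewrite divr_ge0// mulr_ge0 ?sqrtr_ge0// ltW.
    rewrite sql.
    have -> : Cc / (l * (K1 * Num.sqrt (s k))) * (ep * Num.sqrt (s k) * pr P B) = (Cc * ep / K1) * (pr P B / l).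
      by field; rewrite !lt0r_neq0.
    have -> : 1 / 8 * pr P B / l = 1 / 8 * (pr P B / l) by rewrite mulrA.
    apply: ler_wpM2r; first by rewrite divr_ge0// ltW.
    rewrite ler_pdivrMr//; have := K1C; lra.
  have t2 : 4 * K ^+ 2 * B2 / l ^+ 2 * ((s k - s (k + i)%N) * pr P B) <= 1 / 8 * pr P B / l.
    apply: (@le_trans _ _ (4 * K ^+ 2 * B2 / l ^+ 2 * (s k * pr P B))).
      apply: ler_wpM2l; first by rewrite divr_ge0 ?sqr_ge0// !mulr_ge0// sqr_ge0.
      by apply: ler_wpM2r => //; have := s_gt0 (k + i); lra.
    have -> : 4 * K ^+ 2 * B2 / l ^+ 2 * (s k * pr P B) = (4 * K ^+ 2 * B2 / K1 ^+ 2) * (pr P B / l).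
      by rewrite lE; field; rewrite !lt0r_neq0.
    have -> : 1 / 8 * pr P B / l = 1 / 8 * (pr P B / l) by rewrite mulrA.
    apply: ler_wpM2r; first by rewrite divr_ge0// ltW.
    rewrite ler_pdivrMr ?exprn_gt0//; have := K1B; lra.
  have -> : 3 / 4 * pr P B / l = (2 * l)^-1 * pr P B + 1 / 8 * pr P B / l + 1 / 8 * pr P B / l.
    by field; exact: lt0r_neq0.
  by apply: lerD => //; apply: lerD.
apply/ler_addgt0Pr => e e0.
have [m hm] := bad_lim (mulr_gt0 l0 e0).
have := upper m; rewrite ler_pdivlMr// => up.
have mBb : measurable (B `&` bad) by exact: measurableI.
have kk : (k <= k + m)%N by exact: leq_addr.
have sub : B `&` bad `<=` Bj (k + m)%N.
  by move=> w [Bw [h _]]; split => // i /andP[ki _]; apply: h; exact: leq_trans ki.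
have mBj := Fsub hF (FBj _ kk).
have lo1 : ev P (B `&` bad) (fun w => (`|q (k + m)%N w| + l)^-1) <= ev P (Bj (k + m)%N) (fun w => (`|q (k + m)%N w| + l)^-1).
  apply: ev_sub => //; first exact: Iq.
  by move=> w _; case/andP: (inv0 (q (k + m)%N w)).
(* The inverse lies above its tangent at 0. As the mean of q over [bad] tends to 0, the bad part of
   [B] contributes asymptotically its full mass divided by l. *)
have lo2 : l^-1 * pr P (B `&` bad) - l^-1 ^+ 2 * ev P (B `&` bad) (q (k + m)%N) <=
    ev P (B `&` bad) (fun w => (`|q (k + m)%N w| + l)^-1).
  have Ic : itg P (B `&` bad) (fun _ => l^-1) by exact: itg_cst.
  have Iqq : itg P (B `&` bad) (fun w => l^-1 ^+ 2 * q (k + m)%N w) by apply: itgZ; exact: itg_q.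
  rewrite -ev_cst// -evZ; last exact: itg_q.
  rewrite -evB//; apply: ev_le => //; [exact: itgB|exact: Iq|].
  move=> w _; rewrite ger0_norm//; have y0 := q0 (k + m)%N w.
  rewrite -[X in _ <= X]mul1r ler_pdivlMr ?ltr_wpDl//.
  have -> : (l^-1 - l^-1 ^+ 2 * q (k + m)%N w) * (q (k + m)%N w + l) = 1 - (q (k + m)%N w / l) ^+ 2.
    by field; exact: lt0r_neq0.
  by rewrite gerBl sqr_ge0.
have eb : ev P (B `&` bad) (q (k + m)%N) <= l * e.
  apply: le_trans (hm (k + m)%N (leq_addl _ _)).
  by apply: ev_sub => //; exact: itg_q.
have := ler_wpM2l (ltW l0) (le_trans lo2 lo1).
rewrite mulrBr mulVKf ?gt_eqF//.
have -> : l * (l^-1 ^+ 2 * ev P (B `&` bad) (q (k + m)%N)) = ev P (B `&` bad) (q (k + m)%N) / l.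
  by field; exact: lt0r_neq0.
have : ev P (B `&` bad) (q (k + m)%N) / l <= e by rewrite ler_pdivrMr// mulrC.
move: up; set x := ev P (Bj _) _; set y := ev P _ _ / l; lra.
Qed.

Let LIP2 k w : (N <= k)%N -> Gd k w -> q' k.+1 w <= 2 * q k w + 2 * (K * c k.+1) ^+ 2 * U k.+1 w ^+ 2.
Proof.
move=> Nk Gw; have h := LIP Nk Gw.
have V0 : 0 <= K * c k.+1 * U k.+1 w by rewrite !mulr_ge0.
have -> : 2 * (K * c k.+1) ^+ 2 * U k.+1 w ^+ 2 = 2 * (K * c k.+1 * U k.+1 w) ^+ 2 by ring.
move: (K * c k.+1 * U k.+1 w) V0 h => V V0 h.
have := sqr_sqrtr (q0 k w); have := sqr_sqrtr (q'0 k.+1 w).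
have := sqrtr_ge0 (q k w); have := sqrtr_ge0 (q' k.+1 w).
have := le_trans (ler_norm _) h.
move: (q k w) (q' k.+1 w) (Num.sqrt (q k w)) (Num.sqrt (q' k.+1 w)) => y z u v uv v0 u0 vz uy.
have [vu|uv'] := leP v (u + V).
  have : v ^+ 2 <= (u + V) ^+ 2 by rewrite ler_sqr ?nnegrE// addr_ge0.
  have := sqr_ge0 (u - V); lra.
have uv0 : 0 < u + v by lra.
have : V * (u + v) < (v - u) * (u + v) by rewrite ltr_pM2r//; lra.
lra.
Qed.

(* Below the level [K1 ^+ 2 * s n] the drift of [q] dominates, so that either
   [q] reaches the level, where [escape_above] applies, or it does not tend
   to 0. *)
Lemma escape_from : exists2 C5 : R, 0 <= C5 & forall n A, (N <= n)%N -> F n A ->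
  kap / 8 * pr P A <= C5 * pr P (A `\` bad).
Proof.
have K10 : 0 < K1 by apply: lt_le_trans K11.
have kp := kap0; have Cp := Cc0; have mb := bad_measurable.
(* Truncation of U at level [Rr]: beyond it U^2 <= U^a / X, and X is such that the corresponding
   part of the overshoot is at most half of the drift. This is where a > 2 enters. *)
pose X := 4 * K ^+ 2 * Ba / kap + 1.
have X0 : 0 < X.
  by apply: ltr_wpDl => //; apply: divr_ge0; [apply: mulr_ge0 => //; apply: mulr_ge0 => //; exact: sqr_ge0|exact: ltW].
have am : 0 < a - 2 by have := a2; lra.
have [Rr [Rr0 RX]] : exists Rr : R, 0 < Rr /\ Rr `^ (a - 2) = X.
  exists (X `^ (a - 2)^-1); split; first exact: powR_gt0.
  by rewrite -powRrM mulVf ?gt_eqF// powRr1// ltW.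
have Ubound u : 0 <= u -> u ^+ 2 <= Rr ^+ 2 + X^-1 * u `^ a.
  move=> u0; have [uR|Ru] := leP u Rr.
    have : u ^+ 2 <= Rr ^+ 2 by rewrite ler_sqr ?nnegrE// ltW.
    have : 0 <= X^-1 * u `^ a by rewrite mulr_ge0 ?powR_ge0// invr_ge0 ltW.
    lra.
  have up : 0 < u by lra.
  have -> : u `^ a = u ^+ 2 * u `^ (a - 2).
    by rewrite -powR_mulrn// -powRD ?(gt_eqF up) ?implybT//; congr (_ `^ _); ring.
  have h : X <= u `^ (a - 2) by rewrite -RX; apply: ge0_ler_powR; rewrite ?nnegrE ?ltW.
  have : u ^+ 2 <= X^-1 * (u ^+ 2 * u `^ (a - 2)).
    rewrite mulrCA -[X in X <= _]mulr1; apply: ler_wpM2l; first exact: sqr_ge0.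
    by rewrite mulrC ler_pdivlMr// mul1r.
  have := sqr_ge0 Rr; lra.
have XB : 2 * K ^+ 2 * X^-1 * Ba <= kap / 2.
  have -> : 2 * K ^+ 2 * X^-1 * Ba = kap / 2 * ((4 * K ^+ 2 * Ba / kap) / X).
    by field; rewrite !lt0r_neq0.
  rewrite -[X in _ <= X]mulr1; apply: ler_wpM2l; first lra.
  by rewrite ler_pdivrMr// mul1r /X; lra.
pose C3 := 2 * K1 ^+ 2 + 2 * K ^+ 2 * Rr ^+ 2.
have C30 : 0 <= C3 by nonneg.
exists (K1 ^+ 2 + 4 * C3 + kap); first by have := sqr_ge0 K1; lra.
move=> n A Nn FA; have mA := Fsub hF FA.
have [l lE] : {l | l = K1 ^+ 2 * s n} by exists (K1 ^+ 2 * s n).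
have sn := s_gt0 n.
have l0 : 0 < l by rewrite lE mulr_gt0// exprn_gt0.
(* [D m] gathers the paths of [A] that stay good and below the level l at all times from n to m -
   1. *)
pose Gl i := Gd i `\` [set w | l <= q i w].
have GlF i : F i (Gl i) by apply: FD => //; exact: F_ge.
have Glq i w : Gl i w -> q i w < l by move=> [_ /negP]; rewrite -ltNge.
pose D m := A `&` trk Gl n m.
have DS m : (n <= m)%N -> D m.+1 = D m `&` Gl m by move=> nm; rewrite /D trk_recr// setIA.
have DF m : (n <= m)%N -> F m (D m).
  by move=> nm; apply: FI => //; [exact: Fle FA|exact: F_trk'].
have DSF m : (n <= m)%N -> F m (D m.+1) by move=> nm; rewrite DS//; apply: FI => //; exact: DF.
have mD m : (n <= m)%N -> measurable (D m) by move=> nm; exact: Fsub (DF m nm).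
have DA m : D m `<=` A by move=> w [].
have Dle m : (n <= m)%N -> pr P (D m.+1) <= pr P (D m).
  by move=> nm; apply: pr_le; [exact: mD (leqW nm)|exact: mD|rewrite DS//; exact: subIsetl].
have DG m : (n <= m)%N -> D m.+1 `<=` Gd m by move=> nm w; rewrite DS// => -[_ []].
have Dq m w : (n <= m)%N -> D m.+1 w -> q m w < l by move=> nm; rewrite DS// => -[_ /Glq].
have sl0 := sqrtr_ge0 l.
have step m : (n <= m)%N -> ev P (D m.+1) (q m) + kap / 2 * c m.+1 ^+ 2 * pr P (D m.+1) <=
    ev P (D m.+2) (q m.+1) + C3 * s n * (pr P (D m.+1) - pr P (D m.+2))
    + Cc * Num.sqrt l * (c m.+1 * ev P A (rho m.+1)).
  move=> nm; have Nm := leq_trans Nn nm; have nm1 := leqW nm.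
  have mD1 := mD _ nm1; have mD2 := mD _ (leqW nm1).
  have c0 := c_ge0 m.+1.
  have os := OS Nm (DSF m nm) (DG m nm).
  have I1 := itg_q' m.+1 mD1; have I2 := itg_q m mD1; have I3 := itg_sr Nm mD1.
  have I4 : itg P (D m.+1) (fun _ => kap * c m.+1 ^+ 2) by exact: itg_cst.
  rewrite evD in os; [|by apply: itgB => //; exact: itgB|exact: itgZ].
  rewrite evB// in os; last exact: itgB.
  rewrite evB// ev_cst// evZ// in os.
  have r1 : ev P (D m.+1) (fun w => Num.sqrt (q m w) * rho m.+1 w) <= Num.sqrt l * ev P A (rho m.+1).
    apply: (@le_trans _ _ (Num.sqrt l * ev P (D m.+1) (rho m.+1))).
      have Ir := itg_rho Nm mD1.
      rewrite -evZ//; apply: ev_le => //; first exact: itgZ.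
      move=> w Dw; apply: ler_wpM2r => //; apply: ler_wsqrtr; apply: ltW; exact: (Dq m).
    apply: ler_wpM2l => //; apply: ev_sub => //; exact: itg_rho.
  have r1' := ler_wpM2l (mulr_ge0 Cp c0) r1.
  have mGl := Fsub hF (GlF m.+1).
  have sp := ev_split I1 mGl; rewrite -DS// in sp.
  have D2G : D m.+2 `<=` Gd m `&` Gd m.+1.
    by move=> w; rewrite DS// => -[/(DG m nm) ? [? _]].
  have eq := EQ Nm mD2 D2G (@measurable_id _ _ setT); rewrite /= in eq.
  set ex := D m.+1 `\` Gl m.+1 in sp.
  have mex : measurable ex by exact: measurableD.
  have exD : ex `<=` D m.+1 by exact: subDsetl.
  have [IU eU] := Ua Nm (DSF m nm) (DG m nm).
  have IUe := itgS mex exD IU.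
  have cs : c m.+1 ^+ 2 <= s n.
    by have := s_le nm; rewrite (s_step m); have := s_gt0 m.+1; lra.
  (* Before leaving, q was below l, and the jump is governed by U. The mean value at exit is thus of
     order s_n times the mass that leaves, plus half of the drift for large U. *)
  have ex1 : ev P ex (q' m.+1) <= C3 * s n * pr P ex + kap / 2 * c m.+1 ^+ 2 * pr P (D m.+1).
    have Ib : itg P ex (fun w => C3 * s n + 2 * K ^+ 2 * c m.+1 ^+ 2 * X^-1 * U m.+1 w `^ a).
      by apply: itgD; [exact: itg_cst|exact: itgZ].
    apply: (@le_trans _ _ (ev P ex (fun w => C3 * s n + 2 * K ^+ 2 * c m.+1 ^+ 2 * X^-1 * U m.+1 w `^ a))).
      apply: ev_le => //; first exact: itg_q'.
      move=> w exw; apply: le_trans (LIP2 Nm (DG m nm w (exD w exw))) _.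
      have ql : q m w < l by exact: (Dq m _ nm (exD w exw)).
      have cK : 0 <= 2 * (K * c m.+1) ^+ 2 by rewrite mulr_ge0// sqr_ge0.
      have ub := ler_wpM2l cK (Ubound _ (U0 m.+1 w)).
      apply: (le_trans (lerD (ler_wpM2l (ler0n R 2) (ltW ql)) ub)).
      have KR : 2 * K ^+ 2 * Rr ^+ 2 * c m.+1 ^+ 2 <= 2 * K ^+ 2 * Rr ^+ 2 * s n.
        by apply: ler_wpM2l => //; nonneg.
      rewrite lE /C3; move: (U m.+1 w `^ a) => Y; lra.
    rewrite evD//; [|exact: itg_cst|exact: itgZ].
    rewrite ev_cst// evZ// lerD2l.
    have e1 : ev P ex (fun w => U m.+1 w `^ a) <= Ba * pr P (D m.+1).
      by apply: le_trans eU; apply: ev_sub => // w _; exact: powR_ge0.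
    have k0 : 0 <= 2 * K ^+ 2 * c m.+1 ^+ 2 * X^-1.
      by nonneg.
    apply: le_trans (ler_wpM2l k0 e1) _.
    have -> : 2 * K ^+ 2 * c m.+1 ^+ 2 * X^-1 * (Ba * pr P (D m.+1)) = (2 * K ^+ 2 * X^-1 * Ba) * (c m.+1 ^+ 2 * pr P (D m.+1)) by ring.
    have -> : kap / 2 * c m.+1 ^+ 2 * pr P (D m.+1) = kap / 2 * (c m.+1 ^+ 2 * pr P (D m.+1)) by ring.
    by apply: ler_wpM2r => //; apply: mulr_ge0; [exact: sqr_ge0|exact: pr_ge0].
  have prex : pr P ex = pr P (D m.+1) - pr P (D m.+2).
    by rewrite (pr_split P mD1 mGl) -DS// addrAC subrr add0r.
  rewrite prex in ex1.
  move: os r1' sp eq ex1.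
  have -> : Cc * c m.+1 * (Num.sqrt l * ev P A (rho m.+1)) = Cc * Num.sqrt l * (c m.+1 * ev P A (rho m.+1)) by ring.
  lra.
have inv m : (n <= m)%N -> kap / 2 * (s n - s m) * pr P (D m.+1) <=
    ev P (D m.+1) (q m) + C3 * s n * (pr P A - pr P (D m.+1))
    + Cc * Num.sqrt l * (\sum_(n <= j < m) c j.+1 * ev P A (rho j.+1)).
  elim: m => [|m ih].
    rewrite leqn0 => /eqP n0; rewrite n0 subrr mulr0 mul0r big_geq// mulr0 addr0.
    apply: addr_ge0; first by apply: ev_ge0 => w _.
    apply: mulr_ge0; first by rewrite -?n0; nonneg.
    by rewrite subr_ge0; apply: pr_le => //; apply: mD; rewrite n0.
  rewrite leq_eqVlt => /orP[/eqP nm|].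
    rewrite nm subrr mulr0 mul0r big_geq// mulr0 addr0.
    apply: addr_ge0; first by apply: ev_ge0 => w _.
    apply: mulr_ge0; first by rewrite -?nm; nonneg.
    by rewrite subr_ge0; apply: pr_le => //; apply: mD; rewrite nm.
  rewrite ltnS => nm; have := step m nm; have := ih nm.
  rewrite big_nat_recr//= mulrDr.
  have sE : s n - s m.+1 = (s n - s m) + c m.+1 ^+ 2 by rewrite (s_step m); ring.
  have sD : 0 <= s n - s m.+1 by rewrite subr_ge0; apply: s_le; exact: leqW.
  have h1 : kap / 2 * (s n - s m.+1) * pr P (D m.+2) <= kap / 2 * (s n - s m.+1) * pr P (D m.+1).
    by apply: ler_wpM2l; [apply: mulr_ge0 => //; lra|exact: Dle (leqW nm)].
  have h2 : kap / 2 * (s n - s m.+1) * pr P (D m.+1) = kap / 2 * (s n - s m) * pr P (D m.+1) + kap / 2 * c m.+1 ^+ 2 * pr P (D m.+1) by rewrite sE; ring.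
  have h3 : C3 * s n * (pr P A - pr P (D m.+2)) = C3 * s n * (pr P A - pr P (D m.+1)) + C3 * s n * (pr P (D m.+1) - pr P (D m.+2)) by ring.
  rewrite h3; move: h1; rewrite h2; lra.
(* A path leaves [D] either by quitting [Gd], and is then not in [bad], or upwards, and then
   [escape_above] applies because s decreases. At most 3/4 of the lost mass is therefore bad. *)
have lost m : (n <= m)%N -> pr P ((A `\` D m) `&` bad) <= 3 * pr P ((A `\` D m) `\` bad).
  have base : pr P ((A `\` D n) `&` bad) <= 3 * pr P ((A `\` D n) `\` bad).
    by rewrite /D trkn setIT setDv set0I set0D /pr measure0 mulr0.
  move=> nm0; rewrite -(subnKC nm0); elim: (m - n)%N => {m nm0} [|i]; first by rewrite addn0.
  rewrite addnS; move: (leq_addr i n); move: (n + i)%N => m nm ih.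
  have mDm := mD m nm; have mD1 := mD m.+1 (leqW nm).
  pose E := D m `&` (Gd m `&` [set w | l <= q m w]).
  have FE : F m E by apply: (FI hF); [exact: DF|apply: (FI hF) => //; exact: F_ge].
  have mE := Fsub hF FE.
  have hE : pr P (E `&` bad) <= 3 / 4 * pr P E.
    apply: escape_above FE _ _; first exact: leq_trans nm.
      by move=> w [_ []].
    move=> w [_ [_ /=]]; apply: le_trans; rewrite lE; apply: ler_wpM2l; first exact: sqr_ge0.
    exact: s_le.
  have hE' := pr_split P mE mb.
  have mAD : measurable (A `\` D m) by exact: measurableD.
  have mAD1 : measurable (A `\` D m.+1) by exact: measurableD.
  have u1 : pr P ((A `\` D m.+1) `&` bad) <= pr P ((A `\` D m) `&` bad) + pr P (E `&` bad).
    apply: pr_le_split; [exact: measurableI|exact: measurableI|exact: measurableI|].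
    move=> w [[Aw nD] bw]; have [Dw|Dw] := pselect (D m w); last by left.
    right; split => //; split => //; split; first by apply: bw.1; exact: leq_trans nm.
    by apply: contrapT => lq; apply: nD; rewrite DS//; split => //; split => //; apply: bw.1; exact: leq_trans nm.
  have u2 : pr P ((A `\` D m) `\` bad) + pr P (E `\` bad) <= pr P ((A `\` D m.+1) `\` bad).
    have mY : measurable ((A `\` D m.+1) `\` bad) by exact: measurableD.
    rewrite (pr_split P mY mDm) addrC; apply: lerD; apply: pr_le.
    - exact: measurableD.
    - exact: measurableI.
    - move=> w [[Dw [Gw lq]] bw]; split => //; split => //; split; first exact: DA Dw.
      by rewrite DS// => -[_ [_]]; exact.
    - exact: measurableD.
    - exact: measurableD.
    - move=> w [[Aw nD] bw]; split => //; split => //; split => //.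
      by rewrite DS// => -[].
  have := ih; lra.
have lostA m : (n <= m)%N -> pr P A - pr P (D m) <= 4 * pr P (A `\` bad).
  move=> nm; have mAD : measurable (A `\` D m) by apply: measurableD => //; exact: mD.
  rewrite -prD//; last exact: mD.
  have := pr_split P mAD mb; have := lost m nm.
  have : pr P ((A `\` D m) `\` bad) <= pr P (A `\` bad).
    apply: pr_le; [exact: measurableD|exact: measurableD|].
    by move=> w [[Aw _] bw].
  lra.
(* Take m so late that half of s_n has been spent and that the bad part of the mean of q_m is at
   most s_n e. Every term of [inv m] is then of order s_n, and s_n cancels. *)
have s2 : 0 < s n / 2 by rewrite divr_gt0.
have [m1 hm1] := s_lim s2.
apply/ler_addgt0Pr => e e0.
have [m2 hm2] := bad_lim (mulr_gt0 sn e0).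
pose m := (n + (m1 + m2))%N.
have nm : (n <= m)%N by exact: leq_addr.
have sm : s m <= s n / 2 by apply: hm1; rewrite /m addnCA leq_addr.
have qb : ev P bad (q m) <= s n * e by apply: hm2; rewrite /m addnA leq_addl.
have mD1 := mD _ (leqW nm).
have evq : ev P (D m.+1) (q m) <= s n * e + l * pr P (A `\` bad).
  rewrite (ev_split (itg_q m mD1) mb); apply: lerD.
    exact: le_trans (ev_sub (measurableI _ _ mD1 mb) (@subIsetr _ _ _) (itg_q m mb) (fun w _ => q0 m w)) qb.
  apply: (@le_trans _ _ (l * pr P (D m.+1 `\` bad))).
    apply: ev_le_cst; first by apply: itg_q; exact: measurableD.
    by move=> w [Dw _]; apply: ltW; exact: (Dq m).
  apply: ler_wpM2l; first exact: ltW.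
  apply: pr_le; [exact: measurableD|exact: measurableD|].
  by move=> w [Dw bw]; split => //; exact: DA Dw.
have rs := rho_sum m Nn mA.
have rs' : Cc * Num.sqrt l * (\sum_(n <= j < m) c j.+1 * ev P A (rho j.+1)) <= kap / 8 * s n * pr P A.
  apply: (le_trans (ler_wpM2l (mulr_ge0 Cp sl0) rs)).
  have -> : Num.sqrt l = K1 * Num.sqrt (s n).
    by rewrite lE sqrtrM ?sqr_ge0// sqrtr_sqr ger0_norm//; nonneg.
  have -> : Cc * (K1 * Num.sqrt (s n)) * (ep * Num.sqrt (s n) * pr P A) = (Cc * K1 * ep) * (Num.sqrt (s n) ^+ 2 * pr P A) by ring.
  rewrite (sqr_sqrtr (ltW sn)).
  have -> : kap / 8 * s n * pr P A = kap / 8 * (s n * pr P A) by ring.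
  apply: ler_wpM2r; first by rewrite mulr_ge0 ?pr_ge0// ltW.
  have := epC; lra.
have I := inv m nm.
have L := lostA m.+1 (leqW nm).
have pA := pr_ge0 P A; have pB := pr_ge0 P (A `\` bad); have pD := pr_ge0 P (D m.+1).
have i1 : kap / 2 * (s n / 2) * pr P (D m.+1) <= kap / 2 * (s n - s m) * pr P (D m.+1).
  by apply: ler_wpM2r => //; apply: ler_wpM2l; lra.
have C3s : 0 <= C3 * s n by rewrite mulr_ge0// ltW.
have i2 := ler_wpM2l C3s L.
have i3 : kap / 4 * s n * (pr P A - 4 * pr P (A `\` bad)) <= kap / 4 * s n * pr P (D m.+1).
  by apply: ler_wpM2l; [apply: mulr_ge0; lra|lra].
rewrite lE in evq.
have main : s n * (kap / 8 * pr P A) <= s n * ((K1 ^+ 2 + 4 * C3 + kap) * pr P (A `\` bad) + e).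
  lra.
by rewrite ler_pM2l in main.
Qed.

Theorem escape : P bad = 0%E.
Proof.
have mb := bad_measurable.
rewrite prE//; congr (_%:E); apply/eqP; rewrite eq_le pr_ge0 andbT.
have [C5 C50 h] := escape_from; have kp := kap0.
apply/ler_addgt0Pr => e e0; rewrite add0r.
pose e1 := e * kap / 8 / (C5 + kap / 8).
have d0 : 0 < C5 + kap / 8 by lra.
have e10 : 0 < e1 by rewrite /e1 !divr_gt0// mulr_gt0.
have [_ /(_ e1 e10)[n [A [Nn FA a1 a2']]]] := filtration_approx P hF N bad_sigma.
have := h n A Nn FA; have mA := Fsub hF FA.
have b1 := pr_split P mb mA.
have b2 : pr P (bad `&` A) <= pr P A by apply: pr_le => //; exact: measurableI.
have ea : C5 * pr P (A `\` bad) <= C5 * e1 by exact: ler_wpM2l.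
have ee : (C5 + kap / 8) * e1 = e * kap / 8 by rewrite mulrC divfK// gt_eqF.
move=> hh.
have : kap / 8 * pr P bad <= kap / 8 * e.
  have : kap / 8 * pr P bad <= kap / 8 * (pr P A + e1) by apply: ler_wpM2l; lra.
  lra.
by rewrite ler_pM2l//; lra.
Qed.

End Escape.

(** * The stochastic approximation process *)

Section VectorMeasurability.
Context {R : realType} {d : nat} {disp : measure_display} {T : measurableType disp}.
Local Notation V := 'rV[R]_d.
Implicit Types x y : T -> V.

Definition vmeas x := forall j, measurable_fun setT (fun w => x w 0 j).

(* [x] is a pointwise limit of countably valued functions: round every
   coordinate down to a multiple of [1 / n]. *)
Lemma vmeas_comp x (phi : V -> R) : vmeas x -> continuous phi -> measurable_fun setT (fun w => phi (x w)).
Proof.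
move=> mx cphi.
pose a (n : nat) (z : 'rV[int]_d) : V := \row_j ((z 0 j)%:~R / n.+1%:R).
pose fl (n : nat) w : 'rV[int]_d := \row_j Num.floor (n.+1%:R * x w 0 j).
have mfl n z : measurable [set w | fl n w = z].
  have -> : [set w | fl n w = z] = \bigcap_(j in [set: 'I_d]) [set w | Num.floor (n.+1%:R * x w 0 j) = z 0 j].
    apply/seteqP; split=> [w <- j _|w h]; first by rewrite /= mxE.
    by apply/rowP => j; rewrite mxE; exact: h.
  apply: fin_bigcap_measurable => [|j _]; first exact: finite_finset.
  have -> : [set w | Num.floor (n.+1%:R * x w 0 j) = z 0 j] =
      setT `&` (fun w => n.+1%:R * x w 0 j) @^-1` `[(z 0 j)%:~R, (z 0 j + 1)%:~R[.
    rewrite setTI; apply/seteqP; split=> w /=; rewrite in_itv/=; last exact: floor_def.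
    by move=> <-; exact: floor_itv.
  have m1 : measurable_fun setT (fun w => n.+1%:R * x w 0 j) by apply: measurable_funM => //; exact: mx.
  by apply: m1.
apply: (@measurable_fun_cvg _ _ _ _ (fun n w => phi (a n (fl n w)))) => [n|w _].
  move=> _ Y mY; rewrite setTI.
  have -> : (fun w => phi (a n (fl n w))) @^-1` Y =
     \bigcup_i (if unpickle i is Some z then (if `[< Y (phi (a n z)) >] then [set w | fl n w = z] else set0) else set0).
    apply/seteqP; split=> [w /= Yw|w [i _]].
      exists (pickle (fl n w)) => //=; rewrite pickleK.
      by case: asboolP.
    by case: unpickle => // z; case: asboolP => // Yz /= ->.
  apply: bigcupT_measurable => i; case: unpickle => [z|//].
  by case: asboolP.
apply/cvgrPdist_le => e e0.
have [r r0 hr] : exists2 r : R, 0 < r & forall y : V, `|y - x w| < r -> `|phi (x w) - phi y| <= e.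
  have /nbhs_ballP[r /= r0 hr] : \forall y \near x w, `|phi (x w) - phi y| <= e.
    by move/cvgrPdist_le : (cphi (x w)); exact.
  by exists r => // y yr; apply: hr; rewrite -ball_normE /= distrC.
exists (Num.truncn r^-1) => // n /= nr; apply: hr.
have n0 : 0 < n.+1%:R :> R by [].
apply: (@le_lt_trans _ _ n.+1%:R^-1).
  apply: rv_norm_le => [|j]; first by rewrite invr_ge0.
  rewrite !mxE; have := floor_itv (n.+1%:R * x w 0 j).
  set k := (Num.floor _)%:~R; rewrite intrD -/k => /andP[h1 h2].
  have -> : k / n.+1%:R - x w 0 j = (k - n.+1%:R * x w 0 j) / n.+1%:R.
    by field; exact: lt0r_neq0.
  rewrite normrM normfV (gtr0_norm n0) -[X in _ <= X]mul1r; apply: ler_wpM2r; first by rewrite invr_ge0.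
  by rewrite ler_norml; apply/andP; split; lra.
rewrite invf_plt ?posrE//; apply: lt_le_trans (truncnS_gt _) _.
by rewrite ler_nat ltnS.
Qed.

Lemma vmeasD x y : vmeas x -> vmeas y -> vmeas (fun w => x w + y w).
Proof.
move=> mx my j; have -> : (fun w => (x w + y w) 0 j) = (fun w => x w 0 j + y w 0 j).
  by apply/funext => w; rewrite mxE.
by apply: measurable_funD; [exact: mx|exact: my].
Qed.

Lemma vmeasZ (a : T -> R) x : measurable_fun setT a -> vmeas x -> vmeas (fun w => a w *: x w).
Proof.
move=> ma mx j; have -> : (fun w => (a w *: x w) 0 j) = (fun w => a w * x w 0 j).
  by apply/funext => w; rewrite mxE.
by apply: measurable_funM => //; exact: mx.
Qed.

End VectorMeasurability.

Lemma coord_continuous (R : realType) d (j : 'I_d) : continuous (fun x : 'rV[R]_d => x 0 j).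
Proof.
apply: (@holder_continuous R 'rV[R]_d R^o _ 1 1) => // x y; rewrite powRr1// mul1r.
by have := rv_coord_le (x - y) j; rewrite !mxE.
Qed.

Lemma ip_continuous (R : realType) d (ip : {dot 'rV[R]_d for idfun}) (v : 'rV[R]_d) :
  continuous (fun x => ip x v).
Proof.
have [i1 [i2 [i10 i20 h2 h1]]] := ip_norm_equiv ip.
apply: (@holder_continuous R 'rV[R]_d R^o _ (i2 * ip_norm ip v) 1) => // x y; rewrite powRr1//.
rewrite -linearBl; apply: le_trans (ip_cauchy_schwarz ip _ _) _.
by rewrite mulrAC; apply: ler_wpM2r => //; rewrite sqrtr_ge0.
Qed.

Lemma ip_norm_continuous (R : realType) d (ip : {dot 'rV[R]_d for idfun}) : continuous (ip_norm ip).
Proof.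
have [i1 [i2 [i10 i20 h2 h1]]] := ip_norm_equiv ip.
have tri (x y : 'rV[R]_d) : ip_norm ip (x + y) <= ip_norm ip x + ip_norm ip y.
  have n0 z : 0 <= ip_norm ip z by exact: sqrtr_ge0.
  have sq z : ip_norm ip z ^+ 2 = ip z z by rewrite sqr_sqrtr// ipxx_ge0.
  rewrite -ler_sqr ?nnegrE ?addr_ge0// sq linearDl !linearDr /= (ip_sym ip y x).
  have := ler_norm (ip x y); have := ip_cauchy_schwarz ip x y; rewrite -!sq; lra.
have sub (x y : 'rV[R]_d) : ip_norm ip x - ip_norm ip y <= i2 * `|x - y|.
  by have := tri (x - y) y; rewrite subrK; have := h2 (x - y); lra.
apply: (@holder_continuous R 'rV[R]_d R^o _ i2 1) => // x y; rewrite powRr1// ler_norml.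
by have := sub x y; have := sub y x; rewrite [`|y - x|]distrC => ? ?; apply/andP; split; lra.
Qed.

Section Adapted.
Context {R : realType} {d : nat} {disp : measure_display} {T : measurableType disp}.
Variables (P : probability T R) (F : nat -> set (set T)) (x : nat -> T -> 'rV[R]_d).
Hypothesis hF : filtration F.
Hypothesis hx : adapted F x.

Lemma adapted_comp k (phi : 'rV[R]_d -> R) : continuous phi -> fmeas F k (fun w => phi (x k w)).
Proof.
move=> cphi; have mphi : measurable_fun setT (phi : g_sigma_algebraType (@open 'rV[R]_d) -> R).
  apply: (measurability _ (RGenOpens.measurableE R)) => _ [_ [a [b ->] <-]].
  rewrite setTI; apply: sub_sigma_algebra; move/continuousP : cphi; apply; exact: interval_open.
exact: (measurableT_comp mphi (@hx k)).
Qed.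

Lemma adapted_vmeas k : vmeas (x k).
Proof. by move=> j; apply: (fmeas_sub hF (k := k)); exact: (@adapted_comp k _ (@coord_continuous R d j)). Qed.

Lemma adapted_open k (O : set 'rV[R]_d) : open O -> F k [set w | O (x k w)].
Proof.
move=> oO; rewrite (F_measurable hF).
have -> : [set w | O (x k w)] = setT `&` x k @^-1` O by rewrite setTI.
by apply: hx => //; exact: sub_sigma_algebra.
Qed.

End Adapted.

(** The tolerance [e] is fixed first, so that finitely many directions cover [S] with one constant
    [kap]. Sequences over all of nat replace families over the first n indices; hence the
    alternative n <= i. *)
Lemma lyapunov_cover (R : realType) (d : nat) (nu : R) (ip : {dot 'rV[R]_d for idfun}) f
    (S Nb : set 'rV[R]_d) Q L qd K b (e : R) :
  compact S -> lyapunov nu ip f S Nb Q L qd K b -> 0 < e ->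
  exists (n : nat) (v : nat -> 'rV[R]_d) (O : nat -> set 'rV[R]_d) (kap : R),
    [/\ 0 < kap, forall i, ip_norm ip (v i) = 1 \/ (n <= i)%N, forall i, open (O i),
        forall p, S p -> exists2 i, (i < n)%N & O i p &
        forall i x (u : 'rV[R]_d), (i < n)%N -> O i x -> kap * (ip u (v i) ^+ 2 - e * `|u| ^+ 2) <= qd x u].
Proof.
move=> cS HL e0.
have weaken (k1 k2 x y : R) : 0 < k1 -> k1 <= k2 -> 0 <= y -> k2 * x <= y -> k1 * x <= y.
  move=> k10 k12 y0 h; have [x0|x0] := leP x 0.
    by apply: le_trans y0; rewrite pmulr_rle0.
  by apply: le_trans h; rewrite ler_pM2r.
pose PP (A : set 'rV[R]_d) := exists (n : nat) (v : nat -> 'rV[R]_d) (O : nat -> set 'rV[R]_d) (kap : R),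
    [/\ 0 < kap, forall i, ip_norm ip (v i) = 1 \/ (n <= i)%N, forall i, open (O i),
        forall p, S p -> A p -> exists2 i, (i < n)%N & O i p &
        forall i x (u : 'rV[R]_d), (i < n)%N -> O i x -> kap * (ip u (v i) ^+ 2 - e * `|u| ^+ 2) <= qd x u].
suff [n [v [Os [kap [h1 h2 h3 h4 h5]]]]] : PP S by exists n, v, Os, kap; split => // p Sp; exact: h4.
apply: (@compact_induction 'rV[R]_d S PP cS).
- exists 0%N, (fun _ => 0), (fun _ => set0), 1; split => //; first by move=> i; right.
  by move=> i; exact: open0.
- move=> A B [n1 [v1 [U1 [k1 [k10 n11 o1 c1 q1]]]]] [n2 [v2 [U2 [k2 [k20 n12 o2 c2 q2]]]]].
  exists (n1 + n2)%N, (fun i => if (i < n1)%N then v1 i else v2 (i - n1)%N),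
    (fun i => if (i < n1)%N then U1 i else U2 (i - n1)%N), (Num.min k1 k2).
  have mi0 : 0 < Num.min k1 k2 by rewrite lt_min k10.
  split => //.
  + move=> i; case: (ltnP i n1) => h; first by have [|] := n11 i; [left|rewrite leqNgt h].
    by have [|] := n12 (i - n1)%N; [left|rewrite leq_subRL//; right].
  + by move=> i; case: ifP.
  + move=> p Sp [Ap|Bp].
      by have [i i1 Oi] := c1 p Sp Ap; exists i; [exact: ltn_addr|rewrite i1].
    have [i i1 Oi] := c2 p Sp Bp; exists (n1 + i)%N; first by rewrite ltn_add2l.
    by rewrite ltnNge leq_addr/= addKn.
  + move=> i x u; case: (ltnP i n1) => [i1 _ Ox|i1 i2 Ox].
      by apply: (weaken _ k1) => //; [rewrite ge_min lexx|exact: lyqd_ge0 HL _ _|exact: q1].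
    apply: (weaken _ k2) => //; [by rewrite ge_min lexx orbT|exact: lyqd_ge0 HL _ _|].
    by apply: q2 => //; rewrite ltn_subLR.
- move=> A B AB [n [v [Os [k [h1 h2 h3 h4 h5]]]]]; exists n, v, Os, k; split => // p Sp Ap.
  by apply: h4 => //; exact: AB.
move=> p Sp; have [v v1 hv] := lyqd_lower HL Sp.
have [kap kap0 [rad rad0 hr]] := hv e e0.
exists (ball p rad); first by split; [exact: ball_open|exact: ballxx].
exists 1%N, (fun _ => v), (fun _ => ball p rad), kap; split => //.
- by left.
- by move=> i; exact: ball_open.
- by move=> p' _ pp; exists 0%N.
move=> i x u _; rewrite -ball_normE /= distrC => xr; exact: hr.
Qed.

(** * Integrals deduced from conditional expectations *)

Section CondExp.
Context {R : realType} {disp : measure_display} {T : measurableType disp}.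
Variables (P : probability T R) (F : nat -> set (set T)).
Hypothesis hF : filtration F.

Lemma fmeas_mono m n (f : T -> R) : (m <= n)%N -> fmeas F m f -> fmeas F n f.
Proof.
move=> mn mf _ B mB; rewrite -(F_measurable hF); apply: (Fle hF mn).
by rewrite (F_measurable hF); exact: mf.
Qed.

Lemma cond_emeasurable k (Y : T -> \bar R) :
  measurable_fun [set: g_sigma_algebraType (F k)] (Y : g_sigma_algebraType (F k) -> \bar R) ->
  measurable_fun setT Y.
Proof.
move=> mY _ B mB; apply: (Fsub hF (k := k)); rewrite (F_measurable hF); exact: mY.
Qed.

(** Integrability is a conclusion: the conditional expectation is defined for any nonnegative
    variable, and a bound on it over [A] makes the variable integrable there. *)
Lemma cond_ge0_upper k A (g : T -> R) Y (B : R) :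
  is_cond_exp_ge0 P (F k) (EFin \o g) Y -> measurable_fun setT g -> (forall w, 0 <= g w) ->
  F k A -> (forall w, A w -> (Y w <= B%:E)%E) -> itg P A g /\ ev P A g <= B * pr P A.
Proof.
move=> [mY Y0 EY] mg g0 FA YB; have mA := Fsub hF FA.
have mgA : measurable_fun A (EFin \o g) by apply/measurable_EFinP; exact: measurable_funS mg.
have le : (\int[P]_(w in A) (g w)%:E <= (B * pr P A)%:E)%E.
  rewrite -(EY A FA) EFinM -prE// -integral_cst//; apply: ge0_le_integral => //.
  exact: measurable_funS (cond_emeasurable mY).
have fin : (\int[P]_(w in A) (g w)%:E)%E \is a fin_num.
  rewrite ge0_fin_numE; first exact: le_lt_trans le (ltry _).
  by apply: integral_ge0 => w _; rewrite lee_fin.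
split.
  split => //; apply/integrableP; split => //.
  under eq_integral do rewrite /= ger0_norm//.
  by rewrite -ge0_fin_numE// integral_ge0// => w _; rewrite lee_fin.
by rewrite /ev /Rintegral -lee_fin fineK.
Qed.

Lemma cond_ge0_lower k A (g : T -> R) Y (B : R) :
  is_cond_exp_ge0 P (F k) (EFin \o g) Y -> itg P A g -> 0 <= B ->
  F k A -> (forall w, A w -> (B%:E <= Y w)%E) -> B * pr P A <= ev P A g.
Proof.
move=> [mY Y0 EY] [mA Ig] B0 FA YB.
rewrite -lee_fin EFinM -prE// -integral_cst// /ev /Rintegral fineK; last exact: integrable_fin_num.
rewrite -[X in (_ <= X)%E](EY A FA); apply: ge0_le_integral => //.
exact: measurable_funS (cond_emeasurable mY).
Qed.

Lemma cond_zero k A (g : T -> R) : is_cond_exp P (F k) g (fun _ => 0) -> measurable_fun setT g ->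
  itg P A g -> F k A -> ev P A g = 0.
Proof.
move=> [_ [Yp [Ym [[mp p0 Ep] [mm m0 Em] hY]]]] mg Ig FA; have mA := Fsub hF FA.
have mgp : measurable_fun setT (fun w => Num.max (g w) 0) by exact: measurable_maxr.
have mgm : measurable_fun setT (fun w => Num.max (- g w) 0).
  by apply: measurable_maxr => //; exact: measurableT_comp.
have Ip : itg P A (fun w => Num.max (g w) 0).
  apply: (itg_le mgp (itg_norm Ig)) => w _.
  by rewrite ger0_norm ?le_max ?lexx ?orbT// ge_max ler_norm normr_ge0.
have Im : itg P A (fun w => Num.max (- g w) 0).
  apply: (itg_le mgm (itg_norm Ig)) => w _.
  by rewrite ger0_norm ?le_max ?lexx ?orbT// ge_max normr_ge0 -normrN ler_norm.
have -> : ev P A g = ev P A (fun w => Num.max (g w) 0 - Num.max (- g w) 0).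
  apply: eq_ev => w _; case: (leP (g w) 0) => h; case: leP => h'; lra.
rewrite evB//; apply/eqP; rewrite subr_eq0; apply/eqP; rewrite /ev /Rintegral; congr fine.
rewrite -(Ep A FA) -(Em A FA); apply: ge0_ae_eq_integral => //.
- exact: measurable_funS (cond_emeasurable mp).
- exact: measurable_funS (cond_emeasurable mm).
apply: filterS hY => w [p1 m1] /= e _.
have pf : Yp w \is a fin_num by rewrite ge0_fin_numE.
have mf : Ym w \is a fin_num by rewrite ge0_fin_numE.
move: e; rewrite -(fineK pf) -(fineK mf) -EFinB => -[e]; congr (_%:E).
by apply/eqP; rewrite -subr_eq0 -e.
Qed.

(** The weight is clipped and shifted to lie everywhere in [0, 2 M']; [ev_weight] applied to g and
    to - g, whose integrals over level sets vanish, then gives both inequalities. *)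
Lemma cond_zero_weight k A (g h : T -> R) (M : R) : is_cond_exp P (F k) g (fun _ => 0) ->
  measurable_fun setT g -> itg P A g -> F k A -> fmeas F k h -> (forall w, A w -> `|h w| <= M) ->
  itg P A (fun w => h w * g w) /\ ev P A (fun w => h w * g w) = 0.
Proof.
move=> hg mg Ig FA mh hM; have mA := Fsub hF FA; have mh' := fmeas_sub hF mh.
have Ihg := itgM mg mh' Ig hM; split => //.
have [M' M'E] : {M' | M' = `|M|} by exists `|M|.
have M'0 : 0 <= M' by rewrite M'E.
pose h' w := Num.max 0 (Num.min (h w + M') (2 * M')).
have mh1 : fmeas F k h'.
  apply: (@fmeas_comp _ _ _ F k h (fun x => Num.max 0 (Num.min (x + M') (2 * M')))) => //.
  apply: measurable_maxr => //; apply: measurable_minr => //; exact: measurable_funD.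
have h'01 w : 0 <= h' w <= 2 * M'.
  by rewrite /h' le_max lexx/= ge_max ge_min lexx orbT andbT; lra.
have h'E w : A w -> h' w = h w + M'.
  move=> Aw; have := hM w Aw; have := ler_norm M; rewrite -M'E => MM /ler_normlP[h1 h2].
  rewrite /h' min_l; last lra.
  by rewrite max_r//; lra.
have zero t : ev P (A `&` [set w | t <= h' w]) g = 0.
  have FAt : F k (A `&` [set w | t <= h' w]) by apply: (FI hF) => //; exact: (F_ge hF).
  exact: (cond_zero hg mg (itgS (Fsub hF FAt) (@subIsetl _ _ _) Ig) FAt).
have mN : measurable_fun setT (fun w => - g w) by exact: measurableT_comp.
have IN : itg P A (fun w => - g w).
  by have := itgZ (-1) Ig; congr (itg P A _); apply/funext => w; rewrite mulN1r.
have up : 0 <= ev P A (fun w => h' w * g w).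
  apply: (ev_weight (M := 2 * M')) => //; first exact: (fmeas_sub hF mh1).
  by move=> t; rewrite zero.
have dn : 0 <= ev P A (fun w => h' w * - g w).
  apply: (ev_weight (M := 2 * M')) => //; first exact: (fmeas_sub hF mh1).
  move=> t; have -> : ev P (A `&` [set w | t <= h' w]) (fun w => - g w) = 0; last by [].
  have -> : (fun w => - g w) = (fun w => (-1) * g w) by apply/funext => w; rewrite mulN1r.
  have FAt : F k (A `&` [set w | t <= h' w]) by apply: (FI hF) => //; exact: (F_ge hF).
  by rewrite (evZ _ (itgS (Fsub hF FAt) (@subIsetl _ _ _) Ig)) zero mulr0.
have Ih' : itg P A (fun w => h' w * g w).
  by apply: (itgM (M := 2 * M')) => //; [exact: (fmeas_sub hF mh1)|move=> w _; rewrite ger0_norm; case/andP: (h'01 w)].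
have e0 : ev P A (fun w => h' w * g w) = 0.
  apply/eqP; rewrite eq_le up andbT -oppr_ge0.
  move: dn; have -> : (fun w => h' w * - g w) = (fun w => (-1) * (h' w * g w)).
    by apply/funext => w; rewrite mulN1r mulrN.
  by rewrite evZ// mulN1r.
have -> : ev P A (fun w => h w * g w) = ev P A (fun w => h' w * g w - M' * g w).
  by apply: eq_ev => w Aw; rewrite h'E//; ring.
by rewrite evB// ?e0 ?evZ// ?(cond_zero hg mg Ig FA) ?mulr0 ?subr0//; exact: itgZ.
Qed.

End CondExp.

Lemma powR_le_1D (R : realType) (x p q : R) : 0 <= x -> 0 <= p -> p <= q -> x `^ p <= 1 + x `^ q.
Proof.
move=> x0 p0 pq; have [x1|x1] := leP x 1.
  have : x `^ p <= 1 `^ p by apply: ge0_ler_powR; rewrite ?nnegrE.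
  rewrite powR1.
  have := powR_ge0 x q; lra.
by have := ler_powR (ltW x1) pq; lra.
Qed.

(** The left side is z^(2+nu) near 0 and z^2 far away, hence below every power in between. Taking p
    = min(a, 2 + nu) needs only the moment of order a and still gives o(c^2). *)
Lemma mul_min_powR (R : realType) (z nu p : R) : 0 <= z -> 2 <= p -> p <= 2 + nu ->
  z * Num.min (z `^ (1 + nu)) z <= z `^ p.
Proof.
move=> z0 p2 pnu; have [->|zn] := eqVneq z 0; first by rewrite mul0r powR_ge0.
have zp : 0 < z by rewrite lt_def zn.
have [z1|z1] := leP z 1.
  apply: (@le_trans _ _ (z * z `^ (1 + nu))); first by apply: ler_wpM2l => //; rewrite ge_min lexx.
  rewrite -{1}(powRr1 z0) -powRD; last by rewrite zn implybT.
  by apply: ger_powR; [rewrite zp|lra].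
apply: (@le_trans _ _ (z * z)); first by apply: ler_wpM2l => //; rewrite ge_min lexx orbT.
by rewrite -expr2 -powR_mulrn//; apply: ler_powR => //; exact: ltW.
Qed.

Section OneStepPointwise.
Context {R : realType} {d : nat}.
Local Notation V := 'rV[R]_d.
Variables (nu : R) (ip : {dot V for idfun}) (f : V -> V) (S Nb : set V) (Q : V -> R)
  (L : V -> 'cV[R]_d) (qd : V -> V -> R) (K b : R).
Hypothesis HL : lyapunov nu ip f S Nb Q L qd K b.
Variables (a i2 ep kap e1 c : R) (v x g e rh : V).
Hypothesis nu01 : 0 < nu <= 1.
Hypothesis a2 : 2 < a.
Hypothesis hi2 : forall z, ip_norm ip z <= i2 * `|z|.
Hypothesis i20 : 0 <= i2.
Hypothesis ep0 : 0 <= ep.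
Hypothesis c0 : 0 <= c.
Hypothesis kap0 : 0 <= kap.
Hypothesis v1 : ip_norm ip v = 1.
Hypothesis hg : b * Q x <= (g *m L x) 0 0.
Hypothesis hq : forall u : V, kap * (ip u v ^+ 2 - e1 * `|u| ^+ 2) <= qd x u.
Hypothesis hrh : `|rh| <= ep.

Variable U : R.
Hypothesis UE : U = `|g + e + rh|.

(** With p and s the components along v of g + e and of rh, (p + s)^2 >= p^2 / 2 - s^2, and p^2 / 2
    contains half the squared noise plus a product linear in the noise, whose mean is 0. The
    first-order effect of the remainder stays on the right: it is summed over time, not absorbed at
    each step. *)
Lemma one_step_pointwise :
  c * b * Q x + c * (e *m L x) 0 0 + kap * c ^+ 2 * (1 / 2 * ip e v ^+ 2 + ip g v * ip e v)
  - kap * c ^+ 2 * (i2 * ep) ^+ 2 - kap * e1 * c ^+ 2 * U ^+ 2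
  - K * c `^ (1 + nu) * (Num.sqrt (Q x) * (1 + U ^+ 2))
  - K * c `^ (Num.min a (2 + nu)) * (1 + U `^ a)
  <= Q (x + c *: (g + e + rh)) - Q x + K * c * (Num.sqrt (Q x) * `|rh|).
Proof.
have ca := a2; case/andP: (nu01) => n0 n1; have K0 := lyK0 HL; have cc := c0.
have nU : `|c *: (g + e + rh)| = c * U by rewrite normrZ ger0_norm// UE.
have U0 : 0 <= U by rewrite UE.
have := lyQ_expand HL x (c *: (g + e + rh)).
have -> : (c *: (g + e + rh) *m L x) 0 0 = c * ((g *m L x) 0 0 + (e *m L x) 0 0 + (rh *m L x) 0 0).
  by rewrite -scalemxAl mxE !mulmxDl !mxE.
have lr : - (K * (Num.sqrt (Q x) * `|rh|)) <= (rh *m L x) 0 0.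
  by have := lyL_le HL x rh; rewrite ler_norml => /andP[].
have := hq (c *: (g + e + rh)); rewrite nU.
have -> : ip (c *: (g + e + rh)) v = c * (ip (g + e) v + ip rh v).
  by rewrite linearZl_LR /= linearDl.
set p := ip (g + e) v; set s := ip rh v.
have pE : p = ip g v + ip e v by rewrite /p linearDl.
have s2 : s ^+ 2 <= (i2 * ep) ^+ 2.
  rewrite -[X in X <= _]real_normK ?num_real// ler_sqr ?nnegrE//; last exact: mulr_ge0.
  apply: le_trans (ip_cauchy_schwarz ip rh v) _; rewrite v1 mulr1.
  by apply: le_trans (hi2 rh) _; apply: ler_wpM2l.
have ps : 1 / 2 * ip e v ^+ 2 + ip g v * ip e v - (i2 * ep) ^+ 2 <= (p + s) ^+ 2.
  have := sqr_ge0 (p + 2 * s); have := sqr_ge0 (ip g v); rewrite pE; lra.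
have kc : 0 <= kap * c ^+ 2 by rewrite mulr_ge0// sqr_ge0.
have ps' := ler_wpM2l kc ps.
have t1 : Num.sqrt (Q x) * (c * U) `^ (1 + nu) <= c `^ (1 + nu) * (Num.sqrt (Q x) * (1 + U ^+ 2)).
  rewrite powRM// mulrCA; apply: ler_wpM2l; first exact: powR_ge0.
  apply: ler_wpM2l; first exact: sqrtr_ge0.
  by rewrite -powR_mulrn//; apply: powR_le_1D => //; lra.
have t2 : c * U * Num.min ((c * U) `^ (1 + nu)) (c * U) <= c `^ (Num.min a (2 + nu)) * (1 + U `^ a).
  have m2 : 2 <= Num.min a (2 + nu) by rewrite le_min; apply/andP; split; lra.
  apply: (@le_trans _ _ ((c * U) `^ (Num.min a (2 + nu)))).
    by apply: mul_min_powR => //; [exact: mulr_ge0|rewrite ge_min lexx orbT].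
  rewrite powRM//; apply: ler_wpM2l; first exact: powR_ge0.
  by apply: powR_le_1D => //; [lra|rewrite ge_min lexx].
have t1' := ler_wpM2l K0 t1; have t2' := ler_wpM2l K0 t2.
have lg := ler_wpM2l cc hg; have lr' := ler_wpM2l cc lr.
lra.
Qed.

End OneStepPointwise.

Section Approach.
Context {R : realType} {d : nat}.
Local Notation V := 'rV[R]_d.
Variables (nu : R) (ip : {dot V for idfun}) (f : V -> V) (S Nb : set V) (Q : V -> R)
  (L : V -> 'cV[R]_d) (qd : V -> V -> R) (K b : R).
Hypothesis HL : lyapunov nu ip f S Nb Q L qd K b.
Context {disp : measure_display} {T : measurableType disp}.
Variables (P : probability T R) (F : nat -> set (set T)) (X G eps r : nat -> T -> V) (c s : nat -> R).
Hypothesis hnu : 1 / 2 < nu <= 1.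
Hypothesis hF : filtration F.
Hypothesis hX : adapted F X.
Hypothesis hG : adapted F G.
Hypothesis heps : adapted F eps.
Hypothesis hr : adapted F r.
Hypothesis c_ge0 : forall k, 0 <= c k.
Hypothesis s_step : forall k, s k = c k.+1 ^+ 2 + s k.+1.
Hypothesis s_gt0 : forall k, 0 < s k.
Hypothesis s_lim : forall e : R, 0 < e -> exists m, forall k, (m <= k)%N -> s k <= e.
Hypothesis hrec : {ae P, forall w, forall n, X n.+1 w = X n w + c n.+1 *: (G n w + eps n.+1 w + r n.+1 w)}.
Hypothesis heps1 : forall n, is_cond_exp_vec P (F n) (eps n.+1) (cst 0).
Variables (a sig : R) (Ya : nat -> T -> \bar R) (Yv : nat -> nat -> T -> \bar R).
Variables (nv : nat) (v : nat -> V) (O : nat -> set V) (i1 i2 kap1 e1 BB Kf ep K1 : R) (N : nat).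
Hypothesis a2 : 2 < a.
Hypothesis hYa : forall n, is_cond_exp_ge0 P (F n) (fun w => (ip_norm ip (eps n.+1 w) `^ a)%:E) (Ya n).
Hypothesis hYv : forall n i, (i < nv)%N ->
  is_cond_exp_ge0 P (F n) (fun w => (ip (eps n.+1 w) (v i) ^+ 2)%:E) (Yv n i).
Hypothesis v1 : forall i, (i < nv)%N -> ip_norm ip (v i) = 1.
Hypothesis oO : forall i, open (O i).
Hypothesis hO : forall i x (u : V), (i < nv)%N -> O i x -> kap1 * (ip u (v i) ^+ 2 - e1 * `|u| ^+ 2) <= qd x u.
Hypothesis hi1 : forall z, `|z| <= i1 * ip_norm ip z.
Hypothesis hi2 : forall z, ip_norm ip z <= i2 * `|z|.
Hypothesis i10 : 0 <= i1.
Hypothesis i20 : 0 <= i2.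
Hypothesis sig0 : 0 < sig.
Hypothesis kap10 : 0 < kap1.
Hypothesis e10 : 0 <= e1.
Hypothesis BB0 : 0 <= BB.
Hypothesis Kf0 : 0 <= Kf.
Hypothesis ep0 : 0 < ep.
Hypothesis ep1 : ep <= 1.

(** Bound for the conditional moment of order a of the increment: drift and cut remainder are at
    most Kf + 1, (x + y)^a <= 2^a (x^a + y^a), and i1 converts the inner-product norm into the sup
    norm. *)
Definition moment_a : R := 2 `^ a * ((Kf + 1) `^ a + i1 `^ a * BB).
Definition moment_2 : R := 1 + moment_a.

Hypothesis small_ep : (i2 * ep) ^+ 2 <= sig / 16.
Hypothesis small_e1 : e1 * moment_2 <= sig / 16.
Hypothesis small_c1 : forall k, (N <= k)%N ->
  c k.+1 `^ (2 * nu - 1) * ((K * (1 + moment_2)) ^+ 2 / (4 * b)) <= kap1 * sig / 16.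
Hypothesis small_c2 : forall k, (N <= k)%N ->
  K * c k.+1 `^ (Num.min a (2 + nu) - 2) * (1 + moment_a) <= kap1 * sig / 16.
Hypothesis K11 : 1 <= K1.
Hypothesis K1B : 32 * K ^+ 2 * moment_2 <= K1 ^+ 2.
Hypothesis K1C : 8 * K * ep <= K1.
Hypothesis epC : 8 * K * K1 * ep <= kap1 * sig / 8.

Definition cumul (j : nat) (w : T) : R := \sum_(N <= i < j) `|r i.+1 w| ^+ 2.
(* The remainder is cut as soon as its cumulated square exceeds [ep ^+ 2]: it
   is then bounded and still adapted, and unchanged on [good]. *)
Definition rhat (j : nat) (w : T) : V := \1_[set w | cumul j w <= ep ^+ 2] w *: r j w.
Definition incr (j : nat) (w : T) : V := G j.-1 w + eps j w + rhat j w.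
Definition zone : set V := Nb `&` \bigcup_(i in [set i | (i < nv)%N]) O i.
(** [Gam] and [T0] are not assumed measurable at time k. They are replaced by those of their
    consequences that time k can observe: position near [S], bounded and repelling drift, controlled
    conditional moments, small cumulated remainder. *)
Definition good (k : nat) : set T := [set w | [/\ zone (X k w), `|G k w| <= Kf,
  b * Q (X k w) <= (G k w *m L (X k w)) 0 0,
  (Ya k w <= BB%:E)%E /\ (forall i, (i < nv)%N -> (sig%:E <= Yv k i w)%E)
  & cumul k w <= ep ^+ 2]].

Let normc : continuous (fun x : V => `|x|).
Proof. exact: norm_continuous. Qed.

Lemma cumul_F k : fmeas F k (cumul k).
Proof.
apply: (@fmeas_mono _ _ _ _ hF k k) => //.
rewrite /fmeas /cumul.
have -> : (fun w => \sum_(N <= i < k) `|r i.+1 w| ^+ 2) =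
    (fun w => \sum_(i <- index_iota N k) (if (i < k)%N then `|r i.+1 w| ^+ 2 else 0)).
  apply/funext => w; apply: eq_big_seq => i; by rewrite mem_index_iota => /andP[_ ->].
apply: measurable_sum => i; case: ltnP => ik //.
apply: measurable_funX; apply: (fmeas_mono hF ik).
exact: (adapted_comp hr (k := i.+1) normc).
Qed.

Lemma rhat_norm j w : `|rhat j w| <= `|r j w|.
Proof.
rewrite /rhat normrZ -[X in _ <= X]mul1r; apply: ler_wpM2r => //.
by rewrite indicE; case: (_ \in _); rewrite ?normr1 ?normr0.
Qed.

(** [cumul j] includes the term of index j itself. If it is within the budget, the sum is bounded by
    it; otherwise the j-th cut remainder is 0 and earlier terms are bounded by induction. *)
Lemma rhat_sum n m w : (N <= n)%N -> \sum_(n <= j < m) `|rhat j.+1 w| ^+ 2 <= ep ^+ 2.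
Proof.
move=> Nn; have [nm|mn] := leqP n m; last by rewrite big_geq ?sqr_ge0// ltnW.
have [Nm h] : (N <= m)%N /\ \sum_(N <= j < m) `|rhat j.+1 w| ^+ 2 <= ep ^+ 2.
  have Nm := leq_trans Nn nm; split => //.
  rewrite -(subnKC Nm); elim: (m - N)%N => [|i ih]; first by rewrite addn0 big_geq// sqr_ge0.
  rewrite addnS big_nat_recr ?leq_addr//=.
  have [h|h] := leP (cumul (N + i).+1 w) (ep ^+ 2).
    have -> : \sum_(N <= j < N + i) `|rhat j.+1 w| ^+ 2 + `|rhat (N + i).+1 w| ^+ 2 =
        \sum_(N <= j < (N + i).+1) `|rhat j.+1 w| ^+ 2 by rewrite big_nat_recr ?leq_addr.
    apply: le_trans h.
    apply: ler_sum => j _; rewrite ler_sqr ?nnegrE//; exact: rhat_norm.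
  rewrite [`|rhat (N + i).+1 w|](_ : _ = 0) ?expr0n ?addr0//.
  rewrite /rhat indicE memNset ?scale0r ?normr0//=.
  by apply/negP; rewrite -ltNge.
apply: le_trans h; rewrite (big_cat_nat Nn nm)/= lerDr.
by apply: sumr_ge0 => j _; exact: sqr_ge0.
Qed.

Lemma rhat_le k w : (N <= k)%N -> `|rhat k.+1 w| <= ep.
Proof.
move=> Nk; have := rhat_sum k.+1 w Nk; rewrite big_nat1 ler_sqr ?nnegrE//; exact: ltW.
Qed.

Lemma good_F k : F k (good k).
Proof.
have oz : open zone by apply: openI; [exact: lyN_open HL|apply: bigcup_open => i _; exact: oO].
pose g1 w := (G k w *m L (X k w)) 0 0 - b * Q (X k w).
have m1 : fmeas F k g1.
  apply: measurable_funB.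
    have -> : (fun w => (G k w *m L (X k w)) 0 0) = (fun w => \sum_j G k w 0 j * L (X k w) j 0).
      by apply/funext => w; rewrite mxE.
    apply: measurable_sum => j; apply: measurable_funM.
      exact: (adapted_comp hG (k := k) (@coord_continuous R d j)).
    have cL : continuous (fun x => L x j 0) by exact: (lyL_continuous HL).
    exact: (adapted_comp hX (k := k) cL).
  apply: measurable_funM => //; exact: (adapted_comp hX (k := k) (lyQ_continuous HL)).
have [mYa _ _] := hYa k.
have FYa : F k [set w | (Ya k w <= BB%:E)%E].
  rewrite (F_measurable hF) -[X in measurable X]setTI; exact: emeasurable_fun_infty_c.
have FYv i : (i < nv)%N -> F k [set w | (sig%:E <= Yv k i w)%E].
  move=> inv; have [mYv _ _] := hYv k inv.
  rewrite (F_measurable hF) -[X in measurable X]setTI; exact: emeasurable_fun_c_infty.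
have -> : good k = [set w | zone (X k w)] `&` ([set w | `|G k w| <= Kf] `&` ([set w | 0 <= g1 w] `&`
   ([set w | (Ya k w <= BB%:E)%E] `&` ((\bigcap_(i in [set i | (i < nv)%N]) [set w | (sig%:E <= Yv k i w)%E])
   `&` [set w | cumul k w <= ep ^+ 2])))).
  apply/seteqP; split=> [w [h1 h2 h3 [h4 h5] h6]|w [h1 [h2 [h3 [h4 [h5 h6]]]]]].
    by do 5?split => //; rewrite /= subr_ge0.
  by split => //; rewrite -subr_ge0.
apply: (FI hF); first exact: (adapted_open hF hX).
apply: (FI hF); first exact: (F_le hF _ (adapted_comp hG (k := k) normc)).
apply: (FI hF); first exact: (F_ge hF _ m1).
apply: (FI hF) => //.
apply: (FI hF); last exact: (F_le hF _ (@cumul_F k)).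
rewrite (F_measurable hF); apply: bigcap_measurableType => i /= inv.
by have := FYv i inv; rewrite (F_measurable hF).
Qed.

Let Ba := moment_a.
Let B2 := moment_2.

Lemma moment_a_ge0 : 0 <= moment_a.
Proof. by rewrite /moment_a; have h := i10; have h' := BB0; nonneg. Qed.

Let B20 : 0 <= B2.
Proof. by rewrite /B2 /moment_2; have := moment_a_ge0; lra. Qed.

Let mX k : vmeas (X k). Proof. exact: (adapted_vmeas hF hX). Qed.
Let mG k : vmeas (G k). Proof. exact: (adapted_vmeas hF hG). Qed.
Let meps k : vmeas (eps k). Proof. exact: (adapted_vmeas hF heps). Qed.
Let mr k : vmeas (r k). Proof. exact: (adapted_vmeas hF hr). Qed.

Lemma rhat_measurable j : vmeas (rhat j).
Proof.
apply: vmeasZ; last exact: mr.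
apply: measurable_indic; apply: (Fsub hF (k := j)); exact: (F_le hF _ (@cumul_F j)).
Qed.

Lemma incr_measurable j : vmeas (incr j).
Proof. by apply: vmeasD; [apply: vmeasD; [exact: mG|exact: meps]|exact: rhat_measurable]. Qed.

Let incr_norm_measurable j : measurable_fun setT (fun w => `|incr j w|).
Proof. exact: (vmeas_comp (@incr_measurable j) normc). Qed.

Let eps_norm_measurable j : measurable_fun setT (fun w => `|eps j w|).
Proof. exact: (vmeas_comp (@meps j) normc). Qed.

Lemma powR_measurable (f0 : T -> R) (p : R) : measurable_fun setT f0 -> measurable_fun setT (fun w => f0 w `^ p).
Proof. by move=> mf; apply: (measurableT_comp (@measurable_powR R p)). Qed.

Lemma eps_moment k A : F k A -> A `<=` good k ->
  itg P A (fun w => `|eps k.+1 w| `^ a) /\ ev P A (fun w => `|eps k.+1 w| `^ a) <= i1 `^ a * BB * pr P A.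
Proof.
move=> FA AG; have mA := Fsub hF FA.
have min : measurable_fun setT (fun w => ip_norm ip (eps k.+1 w)).
  exact: (vmeas_comp (@meps k.+1) (@ip_norm_continuous R d ip)).
have mp := powR_measurable a min.
have [I1 E1] := cond_ge0_upper hF (hYa k) mp (fun w => powR_ge0 _ _) FA (fun w Aw => (let: And5 _ _ _ h _ := AG w Aw in h.1)).
have le w : `|eps k.+1 w| `^ a <= i1 `^ a * ip_norm ip (eps k.+1 w) `^ a.
  rewrite -powRM ?sqrtr_ge0//; apply: ge0_ler_powR; rewrite ?nnegrE ?mulr_ge0 ?sqrtr_ge0//.
  by have := a2; lra.
have I2 : itg P A (fun w => `|eps k.+1 w| `^ a).
  apply: (itg_le (powR_measurable a (@eps_norm_measurable k.+1)) (itgZ (i1 `^ a) I1)) => w _.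
  by rewrite ger0_norm ?powR_ge0.
split => //; apply: (@le_trans _ _ (ev P A (fun w => i1 `^ a * ip_norm ip (eps k.+1 w) `^ a))).
  by apply: ev_le => //; exact: itgZ.
by rewrite evZ// -mulrA; apply: ler_wpM2l => //; exact: powR_ge0.
Qed.

Lemma incr_moment_a k A : (N <= k)%N -> F k A -> A `<=` good k ->
  itg P A (fun w => `|incr k.+1 w| `^ a) /\ ev P A (fun w => `|incr k.+1 w| `^ a) <= Ba * pr P A.
Proof.
move=> Nk FA AG; have mA := Fsub hF FA; have [Ie Ee] := eps_moment FA AG.
have ca := a2; have k0 := Kf0.
pose g w := 2 `^ a * ((Kf + 1) `^ a + `|eps k.+1 w| `^ a).
have Ig : itg P A g by apply: itgZ; apply: itgD => //; exact: itg_cst.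
have le w : A w -> `|incr k.+1 w| `^ a <= g w.
  move=> Aw; have [_ Gw _ _ _] := AG w Aw.
  have Uw : `|incr k.+1 w| <= 2 * Num.max (Kf + 1) `|eps k.+1 w|.
    have h1 : Kf + 1 <= Num.max (Kf + 1) `|eps k.+1 w| by rewrite le_max lexx.
    have h2 : `|eps k.+1 w| <= Num.max (Kf + 1) `|eps k.+1 w| by rewrite le_max lexx orbT.
    have := ler_normD (G k w + eps k.+1 w) (rhat k.+1 w); have := ler_normD (G k w) (eps k.+1 w).
    have := rhat_le w Nk; have := ep1; rewrite /incr/= in Gw *; lra.
  apply: (@le_trans _ _ ((2 * Num.max (Kf + 1) `|eps k.+1 w|) `^ a)).
    by apply: ge0_ler_powR; rewrite ?nnegrE ?mulr_ge0 ?le_max ?normr_ge0 ?orbT//; lra.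
  rewrite powRM ?le_max ?normr_ge0 ?orbT// /g; apply: ler_wpM2l; first exact: powR_ge0.
  have h3 := powR_ge0 (Kf + 1) a; have h4 := powR_ge0 `|eps k.+1 w| a.
  by case: (leP (Kf + 1) `|eps k.+1 w|) => _; lra.
have I : itg P A (fun w => `|incr k.+1 w| `^ a).
  apply: (itg_le (powR_measurable a (@incr_norm_measurable k.+1)) Ig) => w Aw.
  by rewrite ger0_norm ?powR_ge0// le.
split => //; apply: (@le_trans _ _ (ev P A g)); first exact: ev_le.
rewrite evZ; last by apply: itgD => //; exact: itg_cst.
rewrite evD//; last exact: itg_cst.
rewrite ev_cst// /Ba /moment_a -mulrA; apply: ler_wpM2l; first exact: powR_ge0.
by rewrite mulrDl lerD2l.
Qed.

Lemma incr_moment_2 k A : (N <= k)%N -> F k A -> A `<=` good k ->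
  itg P A (fun w => `|incr k.+1 w| ^+ 2) /\ ev P A (fun w => `|incr k.+1 w| ^+ 2) <= B2 * pr P A.
Proof.
move=> Nk FA AG; have mA := Fsub hF FA; have [Ie Ee] := incr_moment_a Nk FA AG.
have le w : `|incr k.+1 w| ^+ 2 <= 1 + `|incr k.+1 w| `^ a.
  by rewrite -powR_mulrn//; apply: powR_le_1D => //; have := a2; lra.
have I1 : itg P A (fun w => 1 + `|incr k.+1 w| `^ a) by apply: itgD => //; exact: itg_cst.
have I2 : itg P A (fun w => `|incr k.+1 w| ^+ 2).
  apply: (itg_le _ I1) => [|w _]; first exact: measurable_funX.
  by rewrite ger0_norm ?sqr_ge0.
split => //; apply: le_trans (ev_le I2 I1 (fun w _ => le w)) _.
by rewrite evD//; [rewrite ev_cst// /B2 /moment_2 mulrDl lerD2l|exact: itg_cst].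
Qed.

Let itg_eps k A j : F k A -> A `<=` good k -> itg P A (fun w => eps k.+1 w 0 j).
Proof.
move=> FA AG; have mA := Fsub hF FA; have [Ie _] := eps_moment FA AG.
have I1 : itg P A (fun w => 1 + `|eps k.+1 w| `^ a) by apply: itgD => //; exact: itg_cst.
apply: (itg_le _ I1) => [|w _]; first exact: meps.
apply: le_trans (rv_coord_le _ _) _; rewrite -[X in X <= _]powRr1//.
by apply: powR_le_1D => //; have := a2; lra.
Qed.

Lemma noise_mean k A (h : 'I_d -> T -> R) (M : R) : F k A -> A `<=` good k ->
  (forall j, fmeas F k (h j)) -> (forall j w, A w -> `|h j w| <= M) ->
  itg P A (fun w => \sum_j h j w * eps k.+1 w 0 j) /\ ev P A (fun w => \sum_j h j w * eps k.+1 w 0 j) = 0.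
Proof.
move=> FA AG mh hM; have mA := Fsub hF FA.
have c0 j : is_cond_exp P (F k) (fun w => eps k.+1 w 0 j) (fun _ => 0).
  have := heps1 k j; congr (is_cond_exp P (F k) _ _).
  by apply/funext => w; rewrite /cst mxE.
have w0 j := cond_zero_weight hF (c0 j) (@meps k.+1 j) (itg_eps j FA AG) FA (@mh j) (hM j).
have [I E] := @ev_bigsum _ _ _ P _ (index_enum 'I_d) (fun j w => h j w * eps k.+1 w 0 j) A (fun j _ => (w0 j).1) mA.
split => //; rewrite E big1// => j _; exact: (w0 j).2.
Qed.

Let q k w := Q (X k w).
Let q' j w := Q (X j.-1 w + c j *: incr j w).
Let kap := kap1 * sig / 8.

Let itg_q k A : measurable A -> itg P A (q k).
Proof.
move=> mA; apply: (itg_bd P (M := K)) => // [|w _]; first exact: (vmeas_comp (@mX k) (lyQ_continuous HL)).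
by rewrite ger0_norm ?(lyQ_ge0 HL)// (lyQ_le HL).
Qed.

Let mq' j : measurable_fun setT (q' j).
Proof.
apply: (vmeas_comp (phi := Q) (x := fun w => X j.-1 w + c j *: incr j w)); last exact: (lyQ_continuous HL).
by apply: vmeasD; [exact: mX|apply: vmeasZ => //; exact: incr_measurable].
Qed.

Let itg_q' k A : measurable A -> itg P A (q' k).
Proof.
move=> mA; apply: (itg_bd P (M := K)) => // w _.
by rewrite ger0_norm ?(lyQ_ge0 HL)// (lyQ_le HL).
Qed.

Let sqrt_F k : fmeas F k (fun w => Num.sqrt (q k w)).
Proof.
apply: (@fmeas_comp _ _ _ F k (q k) (@Num.sqrt R)); last exact: (adapted_comp hX (k := k) (lyQ_continuous HL)).
by apply: continuous_measurable_fun; exact: sqrt_continuous.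
Qed.

Let sqrt_bd k w : 0 <= Num.sqrt (q k w) <= Num.sqrt K.
Proof. by rewrite sqrtr_ge0/=; apply: ler_wsqrtr; exact: (lyQ_le HL). Qed.

(** The pointwise bound is integrated while X_k stays in one piece [O i], so that a single direction
    of noise is used. Terms linear in the noise vanish, and its square contributes at least
    [sig]. *)
Lemma one_step_zone i k A : (i < nv)%N -> (N <= k)%N -> F k A -> A `<=` good k ->
  (forall w, A w -> O i (X k w)) ->
  0 <= ev P A (fun w => q' k.+1 w - q k w - kap * c k.+1 ^+ 2
                       + K * c k.+1 * (Num.sqrt (q k w) * `|rhat k.+1 w|)).
Proof.
move=> inv Nk FA AG AO; have mA := Fsub hF FA.
have K0 := lyK0 HL; have ca := a2; have ck := c_ge0 k.+1; have kp := kap10; have sp := sig0.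
have bp := lyb0 HL; have e0 := e10.
have nn : 0 < nu <= 1 by case/andP: hnu => h1 h2; apply/andP; split; lra.
have msq := fmeas_sub hF (@sqrt_F k).
have [Ia Ea] := incr_moment_a Nk FA AG; have [I2 E2] := incr_moment_2 Nk FA AG.
set x := c k.+1 in ck *.
have [f1I f1E] : itg P A (fun w => (eps k.+1 w *m L (X k w)) 0 0) /\
    ev P A (fun w => (eps k.+1 w *m L (X k w)) 0 0) = 0.
  have -> : (fun w => (eps k.+1 w *m L (X k w)) 0 0) = (fun w => \sum_j L (X k w) j 0 * eps k.+1 w 0 j).
    by apply/funext => w; rewrite mxE; apply: eq_bigr => j _; rewrite mulrC.
  apply: (noise_mean (h := fun j w => L (X k w) j 0) (M := K * (Num.sqrt K * \sum_j `|delta_mx 0 j : V|))) => // [j|j w _].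
    have cL : continuous (fun x => L x j 0) by exact: (lyL_continuous HL).
    exact: (adapted_comp hX (k := k) cL).
  have := lyL_le HL (X k w) (delta_mx 0 j); rewrite -rowE !mxE => /le_trans; apply.
  apply: ler_wpM2l => //; apply: ler_pM; rewrite ?sqrtr_ge0//; first by case/andP: (sqrt_bd k w).
  by rewrite (bigD1 j)//= lerDl; apply: sumr_ge0.
have ip_sum z : ip z (v i) = \sum_j ip (delta_mx 0 j) (v i) * z 0 j.
  rewrite {1}(row_sum_delta z) linear_sumlz /=; apply: eq_bigr => j _.
  by rewrite linearZl_LR /= mulrC.
have [f2I f2E] : itg P A (fun w => ip (G k w) (v i) * ip (eps k.+1 w) (v i)) /\
    ev P A (fun w => ip (G k w) (v i) * ip (eps k.+1 w) (v i)) = 0.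
  have -> : (fun w => ip (G k w) (v i) * ip (eps k.+1 w) (v i)) =
      (fun w => \sum_j ip (G k w) (v i) * ip (delta_mx 0 j) (v i) * eps k.+1 w 0 j).
    by apply/funext => w; rewrite (ip_sum (eps _ _)) mulr_sumr; apply: eq_bigr => j _; rewrite mulrA.
  apply: (noise_mean (h := fun j w => ip (G k w) (v i) * ip (delta_mx 0 j) (v i))
            (M := i2 * Kf * \sum_j `|ip (delta_mx 0 j) (v i)|)) => // [j|j w Aw].
    by apply: measurable_funM => //; exact: (adapted_comp hG (k := k) (@ip_continuous R d ip (v i))).
  rewrite normrM; apply: ler_pM => //; last by rewrite (bigD1 j)//= lerDl; apply: sumr_ge0.
  apply: le_trans (ip_cauchy_schwarz ip _ _) _; rewrite (v1 inv) mulr1.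
  by apply: le_trans (hi2 _) _; apply: ler_wpM2l => //; have [_ h _ _ _] := AG w Aw.
have mip : measurable_fun setT (fun w => ip (eps k.+1 w) (v i)).
  exact: (vmeas_comp (@meps k.+1) (@ip_continuous R d ip (v i))).
have f3I : itg P A (fun w => ip (eps k.+1 w) (v i) ^+ 2).
  have [Ie _] := eps_moment FA AG.
  have I1 : itg P A (fun w => i2 ^+ 2 * (1 + `|eps k.+1 w| `^ a)) by apply: itgZ; apply: itgD => //; exact: itg_cst.
  apply: (itg_le _ I1) => [|w _]; first exact: measurable_funX.
  rewrite ger0_norm ?sqr_ge0//.
  apply: (@le_trans _ _ ((i2 * `|eps k.+1 w|) ^+ 2)).
    rewrite -[X in X <= _]real_normK ?num_real// ler_sqr ?nnegrE ?mulr_ge0//.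
    by apply: le_trans (ip_cauchy_schwarz ip _ _) _; rewrite (v1 inv) mulr1.
  rewrite exprMn; apply: ler_wpM2l; first exact: sqr_ge0.
  by rewrite -powR_mulrn//; apply: powR_le_1D => //; lra.
have f3E : sig * pr P A <= ev P A (fun w => ip (eps k.+1 w) (v i) ^+ 2).
  apply: (cond_ge0_lower hF (hYv k inv) f3I (ltW sig0) FA) => w Aw.
  by have [_ _ _ [_ h] _] := AG w Aw; exact: h.
have sI : itg P A (fun w => Num.sqrt (q k w)).
  by apply: (itg_bd P (M := Num.sqrt K)) => // w _; rewrite ger0_norm; case/andP: (sqrt_bd k w).
have IBU : itg P A (fun w => B2 - `|incr k.+1 w| ^+ 2) by apply: itgB => //; exact: itg_cst.
have mU2 : measurable_fun setT (fun w => B2 - `|incr k.+1 w| ^+ 2).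
  by apply: measurable_funB => //; exact: measurable_funX.
have IsU : itg P A (fun w => Num.sqrt (q k w) * `|incr k.+1 w| ^+ 2).
  apply: (itgM (M := Num.sqrt K)) => //; first exact: measurable_funX.
  by move=> w _; rewrite ger0_norm; case/andP: (sqrt_bd k w).
have IsB : itg P A (fun w => Num.sqrt (q k w) * (B2 - `|incr k.+1 w| ^+ 2)).
  apply: (itgM (M := Num.sqrt K)) => //.
  by move=> w _; rewrite ger0_norm; case/andP: (sqrt_bd k w).
have f5E : ev P A (fun w => Num.sqrt (q k w) * `|incr k.+1 w| ^+ 2) <= B2 * ev P A (fun w => Num.sqrt (q k w)).
  have : 0 <= ev P A (fun w => Num.sqrt (q k w) * (B2 - `|incr k.+1 w| ^+ 2)).
    apply: (ev_weight (M := Num.sqrt K)) => // t.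
    have FAt : F k (A `&` [set w | t <= Num.sqrt (q k w)]).
      by apply: (FI hF) => //; exact: (F_ge hF _ (@sqrt_F k)).
    have mAt := Fsub hF FAt.
    have [J2 H2] := incr_moment_2 Nk FAt (subset_trans (@subIsetl _ _ _) AG).
    by rewrite evB//; [rewrite ev_cst// subr_ge0|exact: itg_cst].
  have -> : (fun w => Num.sqrt (q k w) * (B2 - `|incr k.+1 w| ^+ 2)) =
      (fun w => B2 * Num.sqrt (q k w) - Num.sqrt (q k w) * `|incr k.+1 w| ^+ 2).
    by apply/funext => w; ring.
  rewrite evB//; last exact: itgZ.
  by rewrite evZ// subr_ge0.
pose y := x `^ (1 + nu); pose z := x `^ Num.min a (2 + nu).
have y0 : 0 <= y by exact: powR_ge0.
have z0 : 0 <= z by exact: powR_ge0.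
pose t := x `^ (2 * nu - 1); pose t' := x `^ (Num.min a (2 + nu) - 2).
have [h1 h2] := andP hnu.
have zE : z = x ^+ 2 * t'.
  have [x00|xn] := eqVneq x 0.
    by rewrite /z x00 powR0 ?expr0n ?mul0r// gt_eqF// lt_min; apply/andP; split; lra.
  rewrite -powR_mulrn// -powRD; last by rewrite xn implybT.
  by congr (_ `^ _); ring.
pose M := K * (1 + B2).
(* Completing the square in sqrt Q: the loss M^2 y^2 / (4 x b) equals x^2 times x^(2 nu - 1) times a
   constant, and is small compared with x^2 because nu > 1/2. *)
have quadr w : - (x ^+ 2 * (t * (M ^+ 2 / (4 * b)))) <= x * b * q k w - M * y * Num.sqrt (q k w).
  have Q0 : 0 <= q k w by exact: (lyQ_ge0 HL).
  have [x00|xn] := eqVneq x 0.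
    rewrite /y x00 expr0n/= powR0 ?gt_eqF//; last lra.
    by rewrite !mul0r mulr0 mul0r subr0 oppr0.
  have xp : 0 < x by rewrite lt_def xn.
  have yt : y ^+ 2 = x ^+ 3 * t.
    rewrite /y /t -powR_mulrn ?powR_ge0// -powRrM -powR_mulrn// -powRD; last by rewrite xn implybT.
    by congr (_ `^ _); ring.
  have sq : Num.sqrt (q k w) ^+ 2 = q k w by rewrite sqr_sqrtr.
  have xb : 0 < x * b by exact: mulr_gt0.
  have : 0 <= (2 * (x * b) * Num.sqrt (q k w) - M * y) ^+ 2 / (4 * (x * b)).
    by rewrite divr_ge0 ?sqr_ge0// mulr_ge0// ltW.
  have -> : (2 * (x * b) * Num.sqrt (q k w) - M * y) ^+ 2 / (4 * (x * b)) =
     x * b * Num.sqrt (q k w) ^+ 2 - M * y * Num.sqrt (q k w) + M ^+ 2 * y ^+ 2 / (4 * (x * b)).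
    by field; rewrite !lt0r_neq0.
  rewrite sq yt.
  have -> : M ^+ 2 * (x ^+ 3 * t) / (4 * (x * b)) = x ^+ 2 * (t * (M ^+ 2 / (4 * b))).
    by field; rewrite !lt0r_neq0.
  lra.
have qI := itg_q k mA.
have IL : itg P A (fun w => x * b * q k w - M * y * Num.sqrt (q k w)) by apply: itgB; exact: itgZ.
have EL : - (x ^+ 2 * (t * (M ^+ 2 / (4 * b)))) * pr P A <= x * b * ev P A (q k) - M * y * ev P A (fun w => Num.sqrt (q k w)).
  rewrite -!evZ// -evB; [|exact: itgZ|exact: itgZ].
  by rewrite -ev_cst//; apply: ev_le => //; exact: itg_cst.
pose low w := x * b * q k w + x * (eps k.+1 w *m L (X k w)) 0 0
  + kap1 * x ^+ 2 * (1 / 2 * ip (eps k.+1 w) (v i) ^+ 2 + ip (G k w) (v i) * ip (eps k.+1 w) (v i))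
  - kap1 * x ^+ 2 * (i2 * ep) ^+ 2 - kap1 * e1 * x ^+ 2 * `|incr k.+1 w| ^+ 2
  - K * y * (Num.sqrt (q k w) * (1 + `|incr k.+1 w| ^+ 2)) - K * z * (1 + `|incr k.+1 w| `^ a).
have I3 : itg P A (fun w => 1 / 2 * ip (eps k.+1 w) (v i) ^+ 2 + ip (G k w) (v i) * ip (eps k.+1 w) (v i)).
  by apply: itgD => //; exact: itgZ.
have E3 : ev P A (fun w => 1 / 2 * ip (eps k.+1 w) (v i) ^+ 2 + ip (G k w) (v i) * ip (eps k.+1 w) (v i)) =
   1 / 2 * ev P A (fun w => ip (eps k.+1 w) (v i) ^+ 2).
  by rewrite evD//; [rewrite f2E addr0 evZ|exact: itgZ].
have I5 : itg P A (fun w => Num.sqrt (q k w) * (1 + `|incr k.+1 w| ^+ 2)).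
  by have := itgD sI IsU; congr (itg P A _); apply/funext => w; ring.
have E5 : ev P A (fun w => Num.sqrt (q k w) * (1 + `|incr k.+1 w| ^+ 2)) <= (1 + B2) * ev P A (fun w => Num.sqrt (q k w)).
  have -> : (fun w => Num.sqrt (q k w) * (1 + `|incr k.+1 w| ^+ 2)) =
    (fun w => Num.sqrt (q k w) + Num.sqrt (q k w) * `|incr k.+1 w| ^+ 2) by apply/funext => w; ring.
  rewrite evD//; lra.
have I6 : itg P A (fun w => 1 + `|incr k.+1 w| `^ a) by apply: itgD => //; exact: itg_cst.
have E6 : ev P A (fun w => 1 + `|incr k.+1 w| `^ a) <= (1 + Ba) * pr P A.
  rewrite evD//; last exact: itg_cst.
  rewrite ev_cst//; lra.
have J1 : itg P A (fun w => x * b * q k w) by exact: itgZ.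
have J2 := itgZ x f1I.
have J3 := itgZ (kap1 * x ^+ 2) I3.
have J4 : itg P A (fun _ => kap1 * x ^+ 2 * (i2 * ep) ^+ 2) by exact: itg_cst.
have J5 := itgZ (kap1 * e1 * x ^+ 2) I2.
have J6 := itgZ (K * y) I5.
have J7 := itgZ (K * z) I6.
have J12 := itgD J1 J2.
have J123 := itgD J12 J3.
have J1234 := itgB J123 J4.
have J12345 := itgB J1234 J5.
have J123456 := itgB J12345 J6.
have Ilow : itg P A low := itgB J123456 J7.
have Elow : ev P A low = x * b * ev P A (q k) + kap1 * x ^+ 2 * (1 / 2 * ev P A (fun w => ip (eps k.+1 w) (v i) ^+ 2))
   - kap1 * x ^+ 2 * (i2 * ep) ^+ 2 * pr P A - kap1 * e1 * x ^+ 2 * ev P A (fun w => `|incr k.+1 w| ^+ 2)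
   - K * y * ev P A (fun w => Num.sqrt (q k w) * (1 + `|incr k.+1 w| ^+ 2)) - K * z * ev P A (fun w => 1 + `|incr k.+1 w| `^ a).
  rewrite /low (evB J123456 J7) (evB J12345 J6) (evB J1234 J5) (evB J123 J4) (evD J12 J3) (evD J1 J2).
  rewrite (evZ _ qI) (evZ _ f1I) f1E (evZ _ I3) E3 (ev_cst _ _ mA) (evZ _ I2) (evZ _ I5) (evZ _ I6).
  by rewrite mulr0 addr0.
have Isr : itg P A (fun w => Num.sqrt (q k w) * `|rhat k.+1 w|).
  apply: (itgM (M := Num.sqrt K)) => //.
  - exact: (vmeas_comp (@rhat_measurable k.+1) normc).
  - apply: (itg_bd P (M := ep)) => // [|w _]; last by rewrite normr_id rhat_le.
    exact: (vmeas_comp (@rhat_measurable k.+1) normc).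
  by move=> w _; rewrite ger0_norm; case/andP: (sqrt_bd k w).
have qI' := itg_q' k.+1 mA.
have Iqq := itgB qI' qI.
have JK : itg P A (fun _ => kap * x ^+ 2) by exact: itg_cst.
have JR := itgZ (K * x) Isr.
rewrite (evD (itgB Iqq JK) JR) (evB Iqq JK) (ev_cst _ _ mA).
have main : ev P A low <= ev P A (fun w => q' k.+1 w - q k w + K * x * (Num.sqrt (q k w) * `|rhat k.+1 w|)).
  apply: ev_le => //; first exact: itgD.
  move=> w Aw; have [[zw _] gw hw _ _] := AG w Aw.
  have rw := rhat_le w Nk.
  exact: (@one_step_pointwise R d nu ip f S Nb Q L qd K b HL a i2 ep kap1 e1 x (v i) (X k w) (G k w) (eps k.+1 w) (rhat k.+1 w)
    nn a2 hi2 i20 (ltW ep0) ck (ltW kap10) (v1 inv) hw (fun u => hO u inv (AO w Aw)) rw `|incr k.+1 w| erefl).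
rewrite (evD Iqq JR) Elow in main.
have p0 := pr_ge0 P A.
have kx : 0 <= kap1 * x ^+ 2 by rewrite mulr_ge0 ?sqr_ge0// ltW.
have g3 := ler_wpM2l kx f3E.
have g2 : kap1 * e1 * x ^+ 2 * ev P A (fun w => `|incr k.+1 w| ^+ 2) <= kap1 * x ^+ 2 * (sig / 16 * pr P A).
  have -> : kap1 * e1 * x ^+ 2 * ev P A (fun w => `|incr k.+1 w| ^+ 2) = kap1 * x ^+ 2 * (e1 * ev P A (fun w => `|incr k.+1 w| ^+ 2)) by ring.
  apply: ler_wpM2l => //; apply: le_trans (ler_wpM2l e0 E2) _; rewrite mulrA.
  by apply: ler_wpM2r.
have g4 : kap1 * x ^+ 2 * (i2 * ep) ^+ 2 * pr P A <= kap1 * x ^+ 2 * (sig / 16 * pr P A).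
  by rewrite -mulrA; apply: ler_wpM2l => //; apply: ler_wpM2r.
have g5 := ler_wpM2l (mulr_ge0 K0 y0) E5.
have g6 : K * z * ev P A (fun w => 1 + `|incr k.+1 w| `^ a) <= kap1 * x ^+ 2 * (sig / 16 * pr P A).
  apply: le_trans (ler_wpM2l (mulr_ge0 K0 z0) E6) _.
  have -> : K * z * ((1 + Ba) * pr P A) = x ^+ 2 * ((K * t' * (1 + Ba)) * pr P A) by rewrite zE; ring.
  have -> : kap1 * x ^+ 2 * (sig / 16 * pr P A) = x ^+ 2 * (kap1 * sig / 16 * pr P A) by ring.
  apply: ler_wpM2l; first exact: sqr_ge0.
  apply: ler_wpM2r => //; exact: small_c2.
have g7 : x ^+ 2 * (t * (M ^+ 2 / (4 * b))) * pr P A <= kap1 * x ^+ 2 * (sig / 16 * pr P A).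
  have -> : kap1 * x ^+ 2 * (sig / 16 * pr P A) = x ^+ 2 * (kap1 * sig / 16) * pr P A by ring.
  apply: ler_wpM2r => //; apply: ler_wpM2l; first exact: sqr_ge0.
  exact: small_c1.
(* In units of kap1 x^2 sig pr A / 16 the noise brings 8, each of the four errors costs at most 1,
   and the announced drift is 2. *)
have g8 : kap * x ^+ 2 * pr P A = 2 * (kap1 * x ^+ 2 * (sig / 16 * pr P A)) by rewrite /kap; field.
have g9 : kap1 * x ^+ 2 * (1 / 2 * (sig * pr P A)) = 8 * (kap1 * x ^+ 2 * (sig / 16 * pr P A)) by field.
have g10 : 0 <= kap1 * x ^+ 2 * (sig / 16 * pr P A) by rewrite mulr_ge0// mulr_ge0// divr_ge0// ltW.
have g11 : K * y * ((1 + B2) * ev P A (fun w => Num.sqrt (q k w))) = M * y * ev P A (fun w => Num.sqrt (q k w)) by rewrite /M; ring.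
rewrite g8.
rewrite g11 in g5.
move: main g2 g3 g4 g5 g6 g7 g9 g10 EL.
move: (kap1 * x ^+ 2 * (sig / 16 * pr P A)) => W.
lra.
Qed.

(** Induction on the number of pieces: [A] is split according to whether X_k lies in the last one,
    the two integrals being added. *)
Lemma one_step k A : (N <= k)%N -> F k A -> A `<=` good k ->
  0 <= ev P A (fun w => q' k.+1 w - q k w - kap * c k.+1 ^+ 2
                       + K * c k.+1 * (Num.sqrt (q k w) * `|rhat k.+1 w|)).
Proof.
move=> Nk FA AG.
have IZ B : measurable B -> itg P B (fun w => q' k.+1 w - q k w - kap * c k.+1 ^+ 2
                       + K * c k.+1 * (Num.sqrt (q k w) * `|rhat k.+1 w|)).
  move=> mB; have msq := fmeas_sub hF (@sqrt_F k).
  have mrh := vmeas_comp (@rhat_measurable k.+1) normc.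
  apply: itgD; first by apply: itgB; [apply: itgB; [exact: itg_q'|exact: itg_q]|exact: itg_cst].
  apply: itgZ; apply: (itgM (M := Num.sqrt K)) => //.
    by apply: (itg_bd P (M := ep)) => // w _; rewrite normr_id rhat_le.
  by move=> w _; rewrite ger0_norm; case/andP: (sqrt_bd k w).
suff claim n : (n <= nv)%N -> forall B, F k B -> B `<=` good k ->
    (forall w, B w -> exists2 i, (i < n)%N & O i (X k w)) ->
    0 <= ev P B (fun w => q' k.+1 w - q k w - kap * c k.+1 ^+ 2
                       + K * c k.+1 * (Num.sqrt (q k w) * `|rhat k.+1 w|)).
  apply: (claim nv) => // w Aw; have [[_ [i inv Oi]] _ _ _ _] := AG w Aw; by exists i.
elim: n => [|n ih] nnv B FB BG BO.
  have -> : B = set0 by apply/seteqP; split=> // w /BO[].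
  by rewrite /ev Rintegral_set0.
have mB := Fsub hF FB; have FO : F k [set w | O n (X k w)] by exact: (adapted_open hF hX).
rewrite (ev_split (IZ _ mB) (Fsub hF FO)); apply: addr_ge0.
  apply: (one_step_zone nnv Nk); [exact: (FI hF)|by move=> w [/BG]|by move=> w []].
apply: ih; [exact: ltnW|exact: (FD hF)|by move=> w [/BG]|].
move=> w [Bw nO]; have [i] := BO w Bw; rewrite ltnS leq_eqVlt => /orP[/eqP->//|ii Oi]; by exists i.
Qed.

Theorem approach_null : P (bad N q good) = 0%E.
Proof.
have K0 := lyK0 HL; have kp := kap10; have sp := sig0.
apply: (@escape R disp T P F hF N q q' (fun j w => `|rhat j w|) (fun j w => `|incr j w|) good c s
  K kap K K K1 B2 Ba a ep) => //.
- by move=> k; exact: (adapted_comp hX (k := k) (lyQ_continuous HL)).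
- by move=> k w; rewrite (lyQ_ge0 HL) (lyQ_le HL).
- by move=> k w; rewrite (lyQ_ge0 HL) (lyQ_le HL).
- by move=> k; exact: (vmeas_comp (@rhat_measurable k) normc).
- by move=> n m w; exact: rhat_sum.
- exact: incr_moment_a.
- exact: incr_moment_2.
- exact: good_F.
- move=> k w Nk _; rewrite /q' /q /=.
  set y := X k w + _; have yx : `|y - X k w| = c k.+1 * `|incr k.+1 w|.
    by rewrite /y addrAC subrr add0r normrZ ger0_norm.
  have d1 := lyQ_diff HL (X k w) y; have d2 := lyQ_diff HL y (X k w).
  rewrite [`|X k w - y|]distrC in d2; rewrite yx in d1 d2.
  have cU : 0 <= c k.+1 * `|incr k.+1 w| by exact: mulr_ge0.
  have e1' := mulr_ge0 (mulr_ge0 K0 cU) (sqrtr_ge0 (Q y)).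
  have e2' := mulr_ge0 (mulr_ge0 K0 cU) (sqrtr_ge0 (Q (X k w))).
  rewrite ler_norml; apply/andP; split; lra.
(* On [good k.+1] the cumulated remainder is within the budget, so nothing was cut in this step and
   the recursion identifies the two processes almost surely. *)
- move=> k D phi Nk mD DG mphi; rewrite /ev /Rintegral; congr fine.
  have mq : measurable_fun setT (q k.+1) by exact: (vmeas_comp (@mX k.+1) (lyQ_continuous HL)).
  apply: ae_eq_integral => //.
  + apply/measurable_EFinP; apply: (measurable_funS measurableT) => //.
    exact: (measurableT_comp mphi (@mq' k.+1)).
  + apply/measurable_EFinP; apply: (measurable_funS measurableT) => //.
    exact: (measurableT_comp mphi mq).
  apply: filterS hrec => w hw Dw; congr (phi _)%:E.
  have [_ [_ _ _ _ cw]] := DG w Dw.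
  rewrite /q' /q /= hw /incr /rhat indicE mem_set//= scale1r//.
- exact: one_step.
- by rewrite /kap divr_gt0// mulr_gt0.
- exact: moment_a_ge0.
Qed.

End Approach.

(** The tail starts after k because the step from k to k + 1 uses the coefficient of index k + 1. *)
Lemma series_tail (R : realType) (u : nat -> R) : (forall n, 0 <= u n) ->
  (\sum_(0 <= n <oo) (u n)%:E < +oo)%E ->
  exists s : nat -> R, [/\ forall k, s k = u k.+1 + s k.+1, forall k, 0 <= s k,
    forall e, 0 < e -> exists m, forall k, (m <= k)%N -> s k <= e &
    forall m n, (m <= n)%N -> \sum_(m <= i < n) u i.+1 <= s m].
Proof.
move=> u0 su; pose p n := \sum_(0 <= i < n) u i.
have pb n : p n <= fine (\sum_(0 <= n <oo) (u n)%:E)%E.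
  rewrite -lee_fin fineK; last by rewrite ge0_fin_numE//; apply: nneseries_ge0 => i _ _; rewrite lee_fin.
  rewrite /p -sumEFin; apply: nneseries_lim_ge => i _ _; by rewrite lee_fin.
have nd : nondecreasing_seq p.
  apply/nondecreasing_seqP => n; by rewrite /p big_nat_recr//= lerDl.
have cp : cvgn p.
  apply: nondecreasing_is_cvgn => //.
  by exists (fine (\sum_(0 <= n <oo) (u n)%:E)%E) => _ [n _ <-]; exact: pb.
have ple n : p n <= limn p by exact: nondecreasing_cvgn_le.
have step k : limn p - p k.+1 = u k.+1 + (limn p - p k.+2).
  by rewrite /p [in RHS]big_nat_recr//=; ring.
exists (fun k => limn p - p k.+1); split.
- exact: step.
- by move=> k; rewrite subr_ge0.
- move=> e e0; move/cvgrPdist_le : (cp : p @ \oo --> limn p) => /(_ e e0)[m _ hm]; exists m => k mk.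
  have := hm k.+1 (leq_trans mk (leqnSn _)); rewrite /= ger0_norm ?subr_ge0//.
move=> m n mn; have -> : \sum_(m <= i < n) u i.+1 = p n.+1 - p m.+1.
  rewrite -(subnKC mn); elim: (n - m)%N => [|i ih]; first by rewrite addn0 big_geq// subrr.
  by rewrite addnS big_nat_recr ?leq_addr//= ih /p [in RHS]big_nat_recr//=; ring.
by rewrite lerD2r.
Qed.

Lemma dist_cvgP (R : realType) (d : nat) (ip : {dot 'rV[R]_d for idfun}) (S : set 'rV[R]_d) (x : nat -> 'rV[R]_d) :
  (fun n => ip_dist ip (x n) S) @ \oo --> 0%E <->
  forall m : nat, exists N : nat, forall n, (N <= n)%N -> exists2 p, S p & ip_norm ip (x n - p) < m.+1%:R^-1.
Proof.
have d0 n : (0 <= ip_dist ip (x n) S)%E.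
  by apply: le_ereal_inf_tmp => _ [p Sp <-]; rewrite lee_fin sqrtr_ge0.
split=> [/fine_cvgP[[N1 _ fin] /cvgrPdist_le cv] m|h].
  have m0 : 0 < m.+2%:R^-1 :> R by rewrite invr_gt0.
  have [N2 _ h2] := cv _ m0; exists (maxn N1 N2) => n; rewrite geq_max => /andP[n1 n2].
  have := h2 n n2; rewrite /= sub0r normrN ger0_norm ?fine_ge0// -lee_fin fineK; last exact: fin.
  move=> le; have lt : (ip_dist ip (x n) S < (m.+1%:R^-1)%:E)%E.
    by apply: le_lt_trans le _; rewrite lte_fin ltf_pV2 ?posrE// ltr_nat.
  by have [_ [p Sp <-]] := ereal_inf_lt lt; rewrite lte_fin => ?; exists p.
have up n (e : R) : (exists2 p, S p & ip_norm ip (x n - p) < e) -> (ip_dist ip (x n) S < e%:E)%E.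
  move=> [p Sp pe]; apply: (@le_lt_trans _ _ (ip_norm ip (x n - p))%:E); last by rewrite lte_fin.
  by apply: ereal_inf_lbound; exists p.
have fin n (e : R) : (exists2 p, S p & ip_norm ip (x n - p) < e) -> ip_dist ip (x n) S \is a fin_num.
  by move=> /up lt; rewrite ge0_fin_numE// (lt_trans lt)// ltry.
apply/fine_cvgP; split.
  by have [N hN] := h 0%N; exists N => // n /= Nn; exact: fin (hN n Nn).
apply/cvgrPdist_le => e e0; have [N hN] := h (Num.truncn e^-1).
exists N => // n /= Nn; have hn := hN n Nn.
rewrite sub0r normrN ger0_norm ?fine_ge0// -lee_fin fineK; last exact: fin hn.
apply: le_trans (ltW (up _ _ hn)) _; rewrite lee_fin invf_ple ?posrE//.
by apply: ltW; exact: truncnS_gt.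
Qed.

Lemma compact_tube (R : realType) (d : nat) (S W : set 'rV[R]_d) : compact S -> open W -> S `<=` W ->
  exists2 e : R, 0 < e & forall p, S p -> forall x, `|x - p| < e -> W x.
Proof.
move=> cS oW SW.
apply: (@compact_uniform R 'rV[R]_d S (fun e p => forall x, `|x - p| < e -> W x)) => //.
  by move=> c c' p c0 cc h x xp; apply: h; exact: lt_le_trans xp cc.
move=> p Sp.
have /nbhs_ballP[r /= r0 hr] : nbhs p W by apply: open_nbhs_nbhs; split => //; exact: SW.
exists (r / 2), (r / 2); split; rewrite ?divr_gt0// => p' _ pp x xp.
apply: hr; rewrite -ball_normE /= distrC.
have := ler_normD (x - p') (p' - p); rewrite addrA subrK; lra.
Qed.

(** * From the good events to the event Gamma *)

Section Final.
Context {R : realType} {d : nat}.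
Local Notation V := 'rV[R]_d.
Variables (nu : R) (ip : {dot V for idfun}) (f : V -> V) (S Nb N0 : set V) (Q : V -> R)
  (L : V -> 'cV[R]_d) (qd : V -> V -> R) (K b : R).
Hypothesis HL : lyapunov nu ip f S Nb Q L qd K b.
Hypothesis cS : compact S.
Hypothesis NbN0 : Nb `<=` N0.
Context {disp : measure_display} {T : measurableType disp}.
Variables (P : probability T R) (F : nat -> set (set T)) (X G eps r : nat -> T -> V) (c : nat -> R).
Hypothesis hnu : 1 / 2 < nu <= 1.
Hypothesis hF : filtration F.
Hypothesis hX : adapted F X.
Hypothesis hG : adapted F G.
Hypothesis heps : adapted F eps.
Hypothesis hr : adapted F r.
Hypothesis c_ge0 : forall k, 0 <= c k.
Hypothesis hcio : forall N, exists2 n, (N <= n)%N & c n != 0.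
Hypothesis hcsum : (\sum_(0 <= n <oo) (c n ^+ 2)%:E < +oo)%E.
Hypothesis hrec : {ae P, forall w, forall n, X n.+1 w = X n w + c n.+1 *: (G n w + eps n.+1 w + r n.+1 w)}.
Hypothesis heps1 : forall n, is_cond_exp_vec P (F n) (eps n.+1) (cst 0).
Variables (Gam : set T) (kappa a Kf : R) (T0 : T -> R) (Ya : nat -> T -> \bar R).
Hypothesis hkappa : 0 < kappa.
Hypothesis a2 : 2 < a.
Hypothesis Kf0 : 0 <= Kf.
Hypothesis hKf : forall x, N0 x -> `|f x| <= Kf.
Hypothesis hGf : {ae P, forall w, Gam w -> forall n, T0 w <= n%:R -> G n w = f (X n w)}.
Hypothesis hrsum : {ae P, forall w, Gam w -> (\sum_(0 <= n <oo) (ip_norm ip (r n w) ^+ 2)%:E < +oo)%E}.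
Hypothesis hYa : forall n, is_cond_exp_ge0 P (F n) (fun w => (ip_norm ip (eps n.+1 w) `^ a)%:E) (Ya n).
Hypothesis hnoise : forall n (v : V), ip_norm ip v = 1 ->
    exists2 Y : T -> \bar R,
      is_cond_exp_ge0 P (F n) (fun w => (ip (eps n.+1 w) v ^+ 2)%:E) Y
      & {ae P, forall w, Gam w -> T0 w <= n%:R -> ((kappa * \1_N0 (X n w))%:E <= Y w)%E}.

Let conv : set T := [set w | (fun n => ip_dist ip (X n w) S) @ \oo --> 0%E].

Lemma conv_measurable : measurable conv.
Proof.
pose Om (m : nat) : set V := \bigcup_(p in S) [set x | ip_norm ip (x - p) < m.+1%:R^-1].
have oO m : open (Om m).
  apply: bigcup_open => p _.
  have cn : continuous (fun x : V => ip_norm ip (x - p)).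
    move=> x; apply: (@continuous_comp _ _ _ (fun x : V => x - p) (ip_norm ip)); last exact: ip_norm_continuous.
    apply: (@holder_continuous R V V _ 1 1) => // y z; rewrite powRr1// mul1r.
    by rewrite opprB addrA subrK.
  have -> : [set x : V | ip_norm ip (x - p) < m.+1%:R^-1] = (fun x => ip_norm ip (x - p)) @^-1` [set y | y < m.+1%:R^-1] by [].
  by move/continuousP : cn; apply; exact: open_lt.
have -> : conv = \bigcap_m \bigcup_N \bigcap_(n in [set n | (N <= n)%N]) [set w | Om m (X n w)].
  apply/seteqP; split=> [w /dist_cvgP h m _|w h].
    by have [N hN] := h m; exists N.
  apply/dist_cvgP => m; case: (h m Logic.I) => N _ hN; exists N => n Nn.
  by case: (hN n Nn) => p Sp hp; exists p.
apply: bigcapT_measurable => m; apply: bigcupT_measurable => N.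
apply: bigcap_measurableType => n _; apply: (Fsub hF (k := n)); exact: (adapted_open hF hX).
Qed.

Lemma step_size_small (p M e : R) : 0 < p -> 0 <= M -> 0 < e ->
  exists m, forall k, (m <= k)%N -> c k.+1 `^ p * M <= e.
Proof.
move=> p0 M0 e0.
have [s [s_step s0 s_lim _]] := series_tail (fun n => sqr_ge0 (c n)) hcsum.
have M1 : 0 < M + 1 by lra.
have q0 : 0 < e / (M + 1) by rewrite divr_gt0.
pose x := (e / (M + 1)) `^ p^-1.
have x0 : 0 < x by exact: powR_gt0.
have [m hm] := s_lim _ (exprn_gt0 2 x0); exists m => k mk.
have cx : c k.+1 <= x.
  have x00 := ltW x0; rewrite -ler_sqr ?nnegrE//; apply: le_trans (hm k mk).
  by rewrite (s_step k) lerDl.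
have : c k.+1 `^ p <= e / (M + 1).
  have -> : e / (M + 1) = x `^ p by rewrite -powRrM mulVf ?gt_eqF// powRr1// ltW.
  by apply: ge0_ler_powR; rewrite ?nnegrE// ltW.
rewrite ler_pdivlMr// mulrDr mulr1; have := powR_ge0 (c k.+1) p; lra.
Qed.

(** The constants are fixed in a non-circular order: the moment bound, the tolerance [e1], the cover
    with its [kap1], then [K1], then [ep], and last the time from which the steps are small. A path
    of the event is good from some later time on and Q tends to 0 along it, so countably many [bad]
    events cover it. *)
Lemma approach_negligible (BB : R) : 0 <= BB ->
  P.-negligible (Gam `&` conv `&` [set w | exists N, forall n, (N <= n)%N -> (Ya n w <= BB%:E)%E]).
Proof.
move=> BB0.
have [s [s_step s0 s_lim s_sum]] := series_tail (fun n => sqr_ge0 (c n)) hcsum.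
have s_gt0 k : 0 < s k.
  have [n kn cn] := hcio k.+1; apply: lt_le_trans (s_sum k n _); last exact: ltnW.
  case: n kn cn => // n kn cn; rewrite big_nat_recr//= ltr_wpDl//; last by rewrite lt_def sqr_ge0 sqrf_eq0 cn.
  by apply: sumr_ge0 => i _; exact: sqr_ge0.
have [i1 [i2 [i10 i20 hi2 hi1]]] := ip_norm_equiv ip.
have K0 := lyK0 HL; have b0 := lyb0 HL; have hk := hkappa.
have [ma maE] : {ma | ma = moment_a a i1 BB Kf} by exists (moment_a a i1 BB Kf).
have [m2 m2E] : {m2 | m2 = moment_2 a i1 BB Kf} by exists (moment_2 a i1 BB Kf).
have ma0 : 0 <= ma by rewrite maE; exact: moment_a_ge0 (ltW i10) BB0.
have m21 : m2 = 1 + ma by rewrite m2E maE.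
have m20 : 0 < m2 by lra.
(* The loss e1 |u|^2 in the quadratic term costs, in mean, at most a sixteenth of the variance of
   the noise. *)
have [e1 e1E] : {e1 | e1 = kappa / 16 / m2} by exists (kappa / 16 / m2).
have e10 : 0 < e1 by rewrite e1E !divr_gt0.
have [nv [v [Os [kap1 [kap10 v1 oO cO hO]]]]] := lyapunov_cover cS HL e10.
(* [K1] is large with respect to the moments alone, a bound ep <= 1 sufficing for [K1C]; only then
   can [ep] be taken small with respect to [K1]. *)
have [K1 K1E] : {K1 | K1 = 1 + 32 * K ^+ 2 * m2 + 8 * K} by exists (1 + 32 * K ^+ 2 * m2 + 8 * K).
have K2m : 0 <= 32 * K ^+ 2 * m2 by have h := ltW m20; nonneg.
have K11 : 1 <= K1 by lra.
have K1B : 32 * K ^+ 2 * m2 <= K1 ^+ 2.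
  have : 1 * K1 <= K1 * K1 by apply: ler_pM => //; lra.
  rewrite -expr2; lra.
pose x1 := Num.sqrt (kappa / 16) / i2.
pose x2 := kap1 * kappa / 8 / (8 * K * K1 + 1).
have x10 : 0 < x1 by rewrite divr_gt0// sqrtr_gt0 divr_gt0.
have KK1 : 0 < 8 * K * K1 + 1.
  have : 0 <= K * K1 by apply: mulr_ge0 => //; lra.
  lra.
have x20 : 0 < x2 by rewrite divr_gt0// divr_gt0// mulr_gt0.
(* The budget of the remainder: [x1] keeps its component along the noise direction small, [x2] keeps
   its cumulated effect below the drift gained from the noise. *)
have [ep epE] : {ep | ep = Num.min 1 (Num.min x1 x2)} by exists (Num.min 1 (Num.min x1 x2)).
have ep0 : 0 < ep by rewrite epE !lt_min ltr01 x10.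
have ep1 : ep <= 1 by rewrite epE ge_min lexx.
have epx1 : ep <= x1 by rewrite epE !ge_min lexx !orbT.
have epx2 : ep <= x2 by rewrite epE !ge_min lexx !orbT.
have small_ep : (i2 * ep) ^+ 2 <= kappa / 16.
  have k16 : 0 <= kappa / 16 by rewrite divr_ge0// ltW.
  have i200 := ltW i20; have ep00 := ltW ep0.
  rewrite -[X in _ <= X](sqr_sqrtr k16) ler_sqr ?nnegrE ?sqrtr_ge0 ?mulr_ge0//.
  by rewrite mulrC -ler_pdivlMr.
have small_e1 : e1 * m2 <= kappa / 16 by rewrite e1E divfK ?gt_eqF.
have K1C : 8 * K * ep <= K1.
  have : K * ep <= K * 1 by exact: ler_wpM2l.
  lra.
have epC : 8 * K * K1 * ep <= kap1 * kappa / 8.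
  have : ep * (8 * K * K1 + 1) <= kap1 * kappa / 8 by rewrite -ler_pdivlMr.
  lra.
have kk0 : 0 < kap1 * kappa / 16 by rewrite divr_gt0// mulr_gt0.
have [h1 h2] := andP hnu.
have p1 : 0 < 2 * nu - 1 by lra.
have p2 : 0 < Num.min a (2 + nu) - 2 by rewrite subr_gt0 lt_min; apply/andP; split; [exact: a2|lra].
have M1 : 0 <= (K * (1 + m2)) ^+ 2 / (4 * b) by rewrite divr_ge0 ?sqr_ge0// mulr_ge0// ltW.
have M2 : 0 <= K * (1 + ma) by apply: mulr_ge0 => //; lra.
have [N1 small1] := step_size_small p1 M1 kk0.
have [N2 small2] := step_size_small p2 M2 kk0.
have choiceY n i : exists Y : T -> \bar R, (i < nv)%N ->
    is_cond_exp_ge0 P (F n) (fun w => (ip (eps n.+1 w) (v i) ^+ 2)%:E) Y /\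
    {ae P, forall w, Gam w -> T0 w <= n%:R -> ((kappa * \1_N0 (X n w))%:E <= Y w)%E}.
  have [vi|ni] := v1 i; last by exists (fun _ => 0%E); rewrite ltnNge ni.
  by have [Y hY1 hY2] := hnoise n vi; exists Y.
pose Yv n i := projT1 (cid (choiceY n i)).
have hYv n i : (i < nv)%N -> is_cond_exp_ge0 P (F n) (fun w => (ip (eps n.+1 w) (v i) ^+ 2)%:E) (Yv n i).
  by move=> inv; have [] := projT2 (cid (choiceY n i)) inv.
have aeY : {ae P, forall w, forall n i, (i < nv)%N -> Gam w -> T0 w <= n%:R -> ((kappa * \1_N0 (X n w))%:E <= Yv n i w)%E}.
  apply: ae_foralln => n; apply: ae_foralln => i.
  have [inv|ni] := ltnP i nv; last first.
    by apply: aeW => w.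
  have [_ h] := projT2 (cid (choiceY n i)) inv.
  by apply: filterS h => w h _; exact: h.
have v1' i : (i < nv)%N -> ip_norm ip (v i) = 1 by move=> inv; have [//|] := v1 i; rewrite leqNgt inv.
rewrite m2E in small_e1 K1B small1; rewrite maE in small2.
have null N : (N1 <= N)%N -> (N2 <= N)%N ->
    P (bad N (fun k w => Q (X k w)) (good Nb Q L b X G r kappa Ya Yv nv Os BB Kf ep N)) = 0%E.
  move=> n1 n2.
  have sc1 k (Nk : (N <= k)%N) := small1 k (leq_trans n1 Nk).
  have sc2 k : (N <= k)%N -> K * c k.+1 `^ (Num.min a (2 + nu) - 2) * (1 + moment_a a i1 BB Kf) <= kap1 * kappa / 16.
    by move=> Nk; have := small2 k (leq_trans n2 Nk); rewrite mulrCA mulrA.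
  exact: (approach_null HL hnu hF hX hG heps hr c_ge0 s_step s_gt0 s_lim hrec heps1 a2 hYa hYv v1' oO hO
    hi1 hi2 (ltW i10) (ltW i20) hk kap10 (ltW e10) BB0 Kf0 ep0 ep1 small_ep small_e1 sc1 sc2 K11 K1B K1C epC).
have [dl dl0 hdl] : exists2 e : R, 0 < e & forall p, S p -> forall x, `|x - p| < e -> zone Nb nv Os x.
  apply: compact_tube => //.
    by apply: openI; [exact: lyN_open HL|apply: bigcup_open => i _; exact: oO].
  move=> p Sp; split; first exact: lyS_sub HL _ Sp.
  by have [i inv Oi] := cO p Sp; exists i.
have negbad n : P.-negligible (bad (maxn (maxn N1 N2) n) (fun k w => Q (X k w))
    (good Nb Q L b X G r kappa Ya Yv nv Os BB Kf ep (maxn (maxn N1 N2) n))).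
  set N := maxn _ n; have n1 : (N1 <= N)%N by rewrite /N -maxnA leq_maxl.
  have n2 : (N2 <= N)%N by rewrite /N (maxnC N1) -maxnA leq_maxl.
  exists (bad N (fun k w => Q (X k w)) (good Nb Q L b X G r kappa Ya Yv nv Os BB Kf ep N)); split => //.
  - apply: (@bad_measurable R disp T P F hF N _ _ K) => [k|k w|k].
    + exact: (adapted_comp hX (k := k) (lyQ_continuous HL)).
    + by rewrite (lyQ_ge0 HL) (lyQ_le HL).
    + exact: (good_F HL hF hX hG hr kappa BB Kf ep N hYa hYv oO).
  - exact: null.
have [Z [mZ Z0 hZ]] : P.-negligible (~` [set w | [/\ (Gam w -> forall n, T0 w <= n%:R -> G n w = f (X n w)),
    (Gam w -> (\sum_(0 <= n <oo) (ip_norm ip (r n w) ^+ 2)%:E < +oo)%E) &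
    forall n i, (i < nv)%N -> Gam w -> T0 w <= n%:R -> ((kappa * \1_N0 (X n w))%:E <= Yv n i w)%E]]).
  by apply: filterS3 hGf hrsum aeY => w *.
apply: (@negligibleS _ _ _ P (Z `|` \bigcup_n bad (maxn (maxn N1 N2) n) (fun k w => Q (X k w))
    (good Nb Q L b X G r kappa Ya Yv nv Os BB Kf ep (maxn (maxn N1 N2) n))) _); last first.
  by apply: negligibleU; [by exists Z; split|exact: negligible_bigcup].
move=> w [[Gw Cw] [nY hY]]; have [Zw|nZ] := pselect (Z w); [by left|right].
have [hG' hr' hv'] : [/\ (Gam w -> forall n, T0 w <= n%:R -> G n w = f (X n w)),
    (Gam w -> (\sum_(0 <= n <oo) (ip_norm ip (r n w) ^+ 2)%:E < +oo)%E) &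
    forall n i, (i < nv)%N -> Gam w -> T0 w <= n%:R -> ((kappa * \1_N0 (X n w))%:E <= Yv n i w)%E].
  by apply: contrapT => h; apply: nZ; exact: hZ.
have near_S (e : R) : 0 < e -> exists m, forall n, (m <= n)%N -> exists2 p, S p & `|X n w - p| < e.
  move=> e0; have ie : 0 < e / i1 by rewrite divr_gt0.
  have [m hm] := (dist_cvgP ip S (fun n => X n w)).1 Cw (Num.truncn (e / i1)^-1).
  exists m => n mn; have [p Sp hp] := hm n mn; exists p => //.
  apply: le_lt_trans (hi1 _) _; rewrite mulrC -ltr_pdivlMr//.
  apply: lt_trans hp _; rewrite invf_plt ?posrE//; exact: truncnS_gt.
have [n1 hn1] := near_S dl dl0.
have [sr [_ _ sr_lim sr_sum]] := series_tail (fun n => sqr_ge0 (ip_norm ip (r n w))) (hr' Gw).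
have eri : 0 < (ep / i1) ^+ 2 by rewrite exprn_gt0// divr_gt0.
have [n2 hn2] := sr_lim _ eri.
pose nT := (Num.truncn (T0 w)).+1.
pose n := maxn (maxn nY nT) (maxn n1 n2).
exists n => //; set N := maxn _ n.
have nN : (n <= N)%N by exact: leq_maxr.
have N_Y : (nY <= N)%N by apply: leq_trans nN; rewrite /n -maxnA leq_maxl.
have N_T : (nT <= N)%N by apply: leq_trans nN; rewrite /n (maxnC nY) -maxnA leq_maxl.
have N_1 : (n1 <= N)%N by apply: leq_trans nN; rewrite /n (maxnC n1) maxnCA maxnC -maxnA leq_max (maxnC n1) leq_maxr orbT.
have N_2 : (n2 <= N)%N by apply: leq_trans nN; rewrite /n maxnA leq_maxr.
split=> [k Nk|].
  have [p Sp xp] := hn1 k (leq_trans N_1 Nk).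
  have zk := hdl p Sp _ xp.
  have Nbk : Nb (X k w) by case: zk.
  have N0k : N0 (X k w) by exact: NbN0.
  have Tk : T0 w <= k%:R.
    apply: le_trans (ltW (truncnS_gt _)) _; rewrite ler_nat; exact: leq_trans Nk.
  have Gk : G k w = f (X k w) by exact: hG'.
  split => //.
  - by rewrite Gk; exact: hKf.
  - by rewrite Gk; exact: lyf_ge HL _ Nbk.
  - split; first by apply: hY; exact: leq_trans Nk.
    move=> i inv; have := hv' k i inv Gw Tk.
    by rewrite indicE mem_set// mulr1.
  - have le : cumul r N k w <= i1 ^+ 2 * \sum_(N <= i < k) ip_norm ip (r i.+1 w) ^+ 2.
      rewrite /cumul mulr_sumr; apply: ler_sum => i _; rewrite -exprMn ler_sqr ?nnegrE ?mulr_ge0 ?sqrtr_ge0//.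
      exact: ltW.
    apply: le_trans le _.
    have -> : ep ^+ 2 = i1 ^+ 2 * (ep / i1) ^+ 2 by field; exact: lt0r_neq0.
    apply: ler_wpM2l; first exact: sqr_ge0.
    by apply: le_trans (sr_sum _ _ Nk) _; exact: hn2.
apply/cvgrPdist_le => e e0.
have K10' : 0 < K + 1 by lra.
have e20 : 0 < Num.sqrt e / (K + 1) by rewrite divr_gt0// sqrtr_gt0.
have [m hm] := near_S _ e20.
exists m => // k /= mk; have [p Sp xp] := hm k mk.
have Q0 := lyQ_ge0 HL (X k w).
rewrite sub0r normrN ger0_norm//.
(* With p in [S] near X_k this reads Q <= K sqrt(Q) |X_k - p|; dividing, sqrt Q is at most K times
   the distance. *)
have := lyQ_diff HL p (X k w); rewrite (lyQ_S HL Sp) subr0.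
have sQ := sqr_sqrtr Q0; have sQ0 := sqrtr_ge0 (Q (X k w)).
set u := Num.sqrt (Q (X k w)) in sQ sQ0 *.
have [u0|un] := eqVneq u 0; first by move=> _; rewrite -sQ u0 expr0n ltW.
have up : 0 < u by rewrite lt_def un.
rewrite -{1}sQ expr2 mulrCA ler_pM2l// => uK.
have ue : u <= Num.sqrt e.
  apply: le_trans uK _; apply: (@le_trans _ _ ((K + 1) * (Num.sqrt e / (K + 1)))).
    by apply: ler_pM => //; [lra|exact: ltW].
  by rewrite mulrC divfK// gt_eqF.
rewrite -sQ -(sqr_sqrtr (ltW e0)) ler_sqr ?nnegrE ?sqrtr_ge0//.
Qed.

Theorem convergence_null : measurable Gam ->
  {ae P, forall w, Gam w -> (limn_esup (fun n => Ya n w) < +oo)%E} ->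
  P (Gam `&` conv) = 0%E.
Proof.
move=> mGam hY; have mC := conv_measurable.
apply: measure_negligible; first exact: measurableI.
have [Z [mZ Z0 hZ]] := hY.
(* The limit superior is finite but random: the event is the union, over integers BB, of those where
   the conditional moments are eventually at most BB. *)
apply: (@negligibleS _ _ _ P (Z `|` \bigcup_(BB : nat) (Gam `&` conv `&`
    [set w | exists N, forall n, (N <= n)%N -> (Ya n w <= BB%:R%:E)%E])) _); last first.
  apply: negligibleU; first by exists Z; split.
  by apply: negligible_bigcup => BB; apply: approach_negligible.
move=> w [Gw Cw]; have [Zw|nZ] := pselect (Z w); [by left|right].
have fin : (limn_esup (fun n => Ya n w) < +oo)%E.
  by apply: contrapT => h; apply: nZ; apply: hZ => /= /(_ Gw).
have [_ [V [N _ NV] <-] lt] := ereal_inf_lt fin.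
have [BB hBB] : exists BB : nat, (ereal_sup ((fun n => Ya n w) @` V) <= BB%:R%:E)%E.
  case: (ereal_sup _) lt => [x _||_] //; last by exists 0%N; rewrite leNye.
  by exists (Num.truncn x).+1; rewrite lee_fin ltW// truncnS_gt.
exists BB => //; split => //; exists N => n Nn; apply: le_trans hBB.
by apply: ereal_sup_ubound; exists n => //; exact: NV.
Qed.

End Final.

Theorem theorem2p3p1 (R : realType) (d delta : nat)
  (ip : {dot 'rV[R]_d for idfun})
  (nu : R) (f : 'rV[R]_d -> 'rV[R]_d) (Phi : R -> 'rV[R]_d -> 'rV[R]_d)
  (S M : set 'rV[R]_d) (E : 'rV[R]_d -> {vspace 'rV[R]_d}) (lambda C : R)
  (hnu : 1 / 2 < nu <= 1)
  (hf : C1_holder nu setT f)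
  (hPhi : is_flow f Phi)
  (hScompact : compact S)
  (hSinv : flow_invariant f Phi S)
  (hSM : S `<=` M)
  (hdelta : (1 <= delta <= d)%N)
  (hM : is_submanifold nu (d - delta) M)
  (hMinv : locally_invariant f Phi S M)
  (hsplit : forall p, S p -> direct_sum (tangent_space M p) [set` E p])
  (hEcont : grassmann_continuous ip delta S E)
  (hEinv : forall (t : R) p, S p ->
    'd (Phi t) p @` [set` E p] = [set` E (Phi t p)])
  (hlambda : 0 < lambda) (hC : 0 < C)
  (hexp : forall p w (t : R), S p -> w \in E p -> 0 <= t ->
    C * expR (lambda * t) * ip_norm ip w <= ip_norm ip ('d (Phi t) p w))
  (disp : measure_display) (T : measurableType disp) (P : probability T R)
  (F : nat -> set (set T))
  (X G eps r : nat -> T -> 'rV[R]_d) (gamma c : nat -> R)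
  (hF : filtration F)
  (hX : adapted F X) (hG : adapted F G) (heps : adapted F eps)
  (hr : adapted F r)
  (hgamma0 : forall n, 0 <= gamma n) (hc0 : forall n, 0 <= c n)
  (hcio : forall N, exists2 n, (N <= n)%N & c n != 0)
  (hcsum : (\sum_(0 <= n <oo) (c n ^+ 2)%:E < +oo)%E)
  (hgammac : forall n, gamma n = c n)
  (hrec : {ae P, forall w, forall n,
    X n.+1 w - X n w =
      gamma n.+1 *: G n w + c n.+1 *: (eps n.+1 w + r n.+1 w)})
  (heps1 : forall n, is_cond_exp_vec P (F n) (eps n.+1) (cst 0))
  (heps2 : forall n, exists2 Y : T -> \bar R,
    is_cond_exp_ge0 P (F n) (fun w => (ip_norm ip (eps n.+1 w) ^+ 2)%:E) Y
    & {ae P, forall w, (Y w < +oo)%E})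
  (Gam : set T) (hGam : measurable Gam)
  (N0 : set 'rV[R]_d) (kappa a : R) (T0 : {RV P >-> R})
  (hN0compact : compact N0) (hN0nbhs : S `<=` N0°)
  (hkappa : 0 < kappa) (ha : 2 < a)
  (hGf : {ae P, forall w, Gam w -> forall n, T0 w <= n%:R ->
    G n w = f (X n w)})
  (hepsbnd : {ae P, forall w, Gam w ->
    exists B : R, forall n, ip_norm ip (eps n w) <= B})
  (hrsum : {ae P, forall w, Gam w ->
    (\sum_(0 <= n <oo) (ip_norm ip (r n w) ^+ 2)%:E < +oo)%E})
  (hepsa : exists2 Y : nat -> T -> \bar R,
    forall n, is_cond_exp_ge0 P (F n)
      (fun w => (ip_norm ip (eps n.+1 w) `^ a)%:E) (Y n)
    & {ae P, forall w, Gam w -> (limn_esup (fun n => Y n w) < +oo)%E})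
  (hnoise : forall n (v : 'rV[R]_d), ip_norm ip v = 1 ->
    exists2 Y : T -> \bar R,
      is_cond_exp_ge0 P (F n) (fun w => (ip (eps n.+1 w) v ^+ 2)%:E) Y
      & {ae P, forall w, Gam w -> T0 w <= n%:R ->
          ((kappa * \1_N0 (X n w))%:E <= Y w)%E}) :
  P (Gam `&` [set w | (fun n => ip_dist ip (X n w) S) @ \oo --> 0%E]) = 0%E.
Proof.
have nu01 : 0 < nu <= 1 by have [h1 h2] := andP hnu; apply/andP; split; lra.
have [Nb [Q [L [qd [K [b [HL NbN0]]]]]]] := lyapunov_exists nu01 hf hPhi hScompact hSinv hSM hdelta hM hMinv
  hsplit hEcont hEinv hlambda hC hexp hN0nbhs.
(* Compactness of the neighbourhood bounds f there, hence the drift on the good events. *)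
have [Kf Kf0 hKf] : exists2 Kf : R, 0 < Kf & forall y, (f @` N0) y -> `|y| <= Kf.
  apply: compact_norm_bound; apply: continuous_compact hN0compact.
  by apply: continuous_subspaceT => x; apply: differentiable_continuous; exact: hf.1.
have hrec' : {ae P, forall w, forall n,
    X n.+1 w = X n w + c n.+1 *: (G n w + eps n.+1 w + r n.+1 w)}.
  apply: filterS hrec => w h n; apply/eqP; rewrite addrC -subr_eq (h n) hgammac.
  by rewrite -addrA [in X in _ == X]scalerDr.
have [Ya hYa hYlim] := hepsa.
have hKf' x (N0x : N0 x) : `|f x| <= Kf by apply: hKf; exists x.
exact: (convergence_null HL hScompact NbN0 hnu hF hX hG heps hr hc0 hcio hcsum hrec' heps1 hkappa ha (ltW Kf0)
  hKf' hGf hrsum hYa hnoise hGam hYlim).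
Qed.
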